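(* Let $\mathcal{K}^i$ be a path component of $\mathcal{K}=\mathcal{C}\cap\mathcal{N}$, let $\mathcal{U}^i=\pi^{-1}(\mathcal{K}^i)$ and let $\pi^i=\pi|_{\mathcal{U}^i}:\mathcal{U}^i\to\mathcal{K}^i$, a proper Fredholm map of index $0$. Then, up to a fixed sign determined by orientation, $$\deg\pi^i=\sum_{u_j\in(\pi^i)^{-1}(K)}(-1)^{\mathrm{ind}(u_j)},$$ where $K\in\mathcal{K}^i$ is any regular value of $\pi^i$ and $\mathrm{ind}(u_j)$ is the dimension of the negative eigenspace of the Hessian $D^2J_K$ at $u_j$.
   Context: Let $m\ge 4$, $\alpha\in(0,1)$. $g_{+1}$ is the round metric of radius 1 on $S^2$; $\nabla,\Delta$ are its gradient and Laplacian (sign convention: $\Delta$ is the trace of the Hessian). $C_+^{m-2,\alpha}$ is the set of $C^{m-2,\alpha}$ functions on $S^2$ that are positive somewhere. The curvature map $\pi:C^{m,\alpha}\to C_+^{m-2,\alpha}$ sends $u$ to the Gauss curvature $K$ of $e^{2u}g_{+1}$, i.e. $e^{2u}K=1-\Delta u$. $\mathcal{C}$ is the set of $K\in C_+^{m-2,\alpha}$ such that: whenever $K(q)=0$ and near $q$ one has $K=\chi r^{2a}$ with $r(x)=\mathrm{dist}_{g_{+1}}(x,q)$, $a\ge1$ and $\chi$ continuous near $q$, then $\Delta K(q)>0$. $\mathcal{N}$ is the set of $K\in C_+^{m-2,\alpha}$ such that $|\nabla K|(p)+|\Delta K|(p)>0$ for all $p$ with $K(p)>0$. For $K\in C_+^{m-2,\alpha}$,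 $$J_K(u)=\int_{S^2}(|du|^2+2u)\,dv_0-\log\Big(\int_{S^2}Ke^{2u}\,dv_0\Big),$$ where $dv_0$ is the round area form normalized to unit total area. Solutions $u$ of $e^{2u}K=1-\Delta u$ are critical points of $J_K$ (with $\int Ke^{2u}dv_0=1$). Degree: for a proper Fredholm map $F:X\to Y$ of index $0$ between oriented Banach manifolds (here open subsets of Banach spaces) with $Y$ connected, $\deg F=\sum_{x\in F^{-1}(y)}\mathrm{sign}(DF_x)\in\mathbb{Z}$, where $y$ is any regular value of $F$ and $\mathrm{sign}(DF_x)=\pm1$ according to whether $DF_x$ preserves or reverses orientation at $x$. *)

(* Defs.v *)
From HB Require Import structures.
From mathcomp Require Import all_boot all_order all_algebra.
From mathcomp Require Import all_classical all_reals all_analysis.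

Set Implicit Arguments.
Unset Strict Implicit.
Unset Printing Implicit Defensive.

Import Order.TTheory GRing.Theory Num.Theory.
Import numFieldNormedType.Exports.

Local Open Scope classical_set_scope.
Local Open Scope ring_scope.

Definition dot (R : realType) (x y : 'rV[R]_3) : R :=
  \sum_(i < 3) x 0 i * y 0 i.

Definition unit_sphere (R : realType) : set 'rV[R]_3 := [set x | dot x x = 1].

Notation S2 R := (set_type (@unit_sphere R)).

Section Sphere.
Variable R : realType.
Local Notation S2 := (S2 R).
Local Notation unit_sphere := (@unit_sphere R).

Lemma dot_delta i : dot 'e_i 'e_i = 1 :> R.
Proof.
rewrite /dot (bigD1 i)//= big1 => [|j /negPf ji]; rewrite !mxE ?eqxx ?ji ?mulr0//.
by rewrite mulr1 addr0.
Qed.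

Definition north : S2 := exist _ 'e_ord_max (mem_set (dot_delta ord_max)).

(* Radial projection; the value at the origin is irrelevant. *)
Definition radial (x : 'rV[R]_3) : S2 :=
  insubd north ((Num.sqrt (dot x x))^-1 *: x).

Lemma radial_val (p : S2) : radial (val p) = p.
Proof.
have pp : dot (val p) (val p) = 1 by case: p => x /= /set_mem.
by apply: val_inj; rewrite /radial pp sqrtr1 invr1 scale1r val_insubd (valP p).
Qed.

(* Distance of the round metric of radius 1. *)
Definition sdist (p q : S2) : R := acos (dot (val p) (val q)).

(* The i-th Cartesian component of the gradient of f for the round metric is
   the i-th partial derivative of the extension of f to R^3 minus the origin
   that is homogeneous of degree 0. *)
Definition tder (i : 'I_3) (f : S2 -> R) (p : S2) : R :=
  'D_('e_i) (f \o radial) (val p).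

Definition tderivable (f : S2 -> R) : Prop :=
  forall i (p : S2), derivable (f \o radial) (val p) 'e_i.

Definition grad_norm (f : S2 -> R) (p : S2) : R :=
  Num.sqrt (\sum_(i < 3) tder i f p ^+ 2).

(* Divergence of the gradient = trace of the Hessian for the round metric.
   It is also the Euclidean Laplacian, on the sphere, of the extension of f of
   degree 0, because the gradient is tangent to the sphere. *)
Definition laplacian (f : S2 -> R) (p : S2) : R :=
  \sum_(i < 3) tder i (tder i f) p.

(* Area form of the round metric in spherical coordinates, normalized to unit
   total area. *)
Definition sph (t s : R) : S2 :=
  radial (\row_(i < 3) [:: sin t * cos s; sin t * sin s; cos t]`_i).

Definition mean (f : S2 -> R) : R :=
  (4 * pi)^-1 *
  \int[lebesgue_measure]_(t in `[0, pi])
    (\int[lebesgue_measure]_(s in `[0, 2 * pi]) (f (sph t s) * sin t)).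

Section Holder.
Variable a : R.

Definition holder_at (f : S2 -> R) : Prop := exists C : R,
  forall p q, `|f p - f q| <= C * sdist p q `^ a.

Fixpoint is_holder (k : nat) (f : S2 -> R) : Prop :=
  continuous f /\
  match k with
  | 0 => holder_at f
  | k.+1 => tderivable f /\ forall i, is_holder k (tder i f)
  end.

Definition sup_norm (f : S2 -> R) : R := sup (range (fun p => `|f p|)).

Definition holder_seminorm (f : S2 -> R) : R :=
  sup (range (fun pq : S2 * S2 =>
    `|f pq.1 - f pq.2| / sdist pq.1 pq.2 `^ a)).

Fixpoint holder_norm (k : nat) (f : S2 -> R) : R :=
  sup_norm f +
  match k with
  | 0 => holder_seminorm f
  | k.+1 => \sum_(i < 3) holder_norm k (tder i f)
  end.
End Holder.

Lemma tderD f g i : tderivable f -> tderivable g ->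
  tder i (f + g) = tder i f + tder i g.
Proof. by move=> df dg; apply/funext => p; rewrite /tder [LHS]deriveD. Qed.

Lemma tderZ (c : R) f i : tderivable f -> tder i (c *: f) = c *: tder i f.
Proof. by move=> df; apply/funext => p; rewrite /tder [LHS]deriveZ. Qed.

Lemma tderivableD f g : tderivable f -> tderivable g -> tderivable (f + g).
Proof. by move=> df dg i p; exact: derivableD. Qed.

Lemma tderivableZ (c : R) f : tderivable f -> tderivable (c *: f).
Proof. by move=> df i p; exact: derivableZ. Qed.

Lemma coord_le1 (p : S2) i : `|val p 0 i| <= 1.
Proof.
have pp : dot (val p) (val p) = 1 by case: p => x /= /set_mem.
rewrite -(@ler_sqr _ `|_|) ?nnegrE// expr1n real_normK ?num_real// -pp.
rewrite /dot (bigD1 i)//= expr2 lerDl sumr_ge0// => j _.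
by rewrite -expr2 sqr_ge0.
Qed.

Lemma continuous_dot : continuous (fun x : 'rV[R]_3 => dot x x).
Proof.
apply: continuous_big; first exact: add_continuous.
move=> i _ x.
by apply: (@continuousM _ _ (fun y : 'rV[R]_3 => y 0 i) (fun y => y 0 i));
  exact: coord_continuous.
Qed.

Lemma compact_sphere : compact unit_sphere.
Proof.
apply: bounded_closed_compact.
  exists 1; split; first exact: num_real.
  move=> M M1 x Sx; rewrite /Num.Def.normr/= mx_normrE.
  apply/bigmax_leP; split; first by rewrite (le_trans _ (ltW M1)).
  move=> [i j] _ /=; rewrite ord1.
  exact: le_trans (coord_le1 (exist _ x (mem_set Sx)) j) (ltW M1).
rewrite (_ : unit_sphere = (fun x => dot x x) @^-1` [set 1])//.
by apply: preimage_closed; [move=> x _; exact: continuous_dot|exact: closed_eq].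
Qed.

Lemma continuous_bounded (f : S2 -> R) : continuous f ->
  exists M, forall p, `|f p| <= M.
Proof.
move=> /(@subspace_valL_continuousP' _ _ _ (0 : R)) cf.
have /compact_bounded[M [_ /(_ (M + 1))]] := continuous_compact cf compact_sphere.
rewrite ltrDl ltr01 => /(_ isT) fM; exists (M + 1) => p; apply: fM.
exists (val p); first by case: p => x /= /set_mem.
have -> : val p = set_val p by [].
by rewrite -[LHS]/((valL_ 0 f \o set_val) p) [_ \o _]valLK.
Qed.


Section Sup.
Variables (T : Type) (t0 : T).
Implicit Types F G H : T -> R.

Lemma le_sup_range F M t : (forall t, F t <= M) -> F t <= sup (range F).
Proof.
move=> FM; apply: ub_le_sup; last by exists t.
by exists M => _ [u _ <-].
Qed.

Lemma sup_range_le F M : (forall t, F t <= M) -> sup (range F) <= M.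
Proof. by move=> FM; apply: ge_sup; [exists (F t0), t0|move=> _ [u _ <-]]. Qed.

Lemma sup_range_ge0 F : (forall t, 0 <= F t) -> 0 <= sup (range F).
Proof.
move=> F0; have [hs|/sup_out->//] := pselect (has_sup (range F)).
by rewrite (le_trans (F0 t0))//; apply: ub_le_sup; [case: hs|exists t0].
Qed.

Lemma sup_rangeZ (c : R) F M : 0 <= c -> (forall t, F t <= M) ->
  sup (range (fun t => c * F t)) = c * sup (range F).
Proof.
move=> c0 FM; apply/eqP; rewrite eq_le; apply/andP; split.
  by apply: sup_range_le => t; rewrite ler_wpM2l// (le_sup_range _ FM).
have [->|cN0] := eqVneq c 0.
  by rewrite mul0r; apply: sup_range_ge0 => t; rewrite mul0r.
have {cN0}c0 : 0 < c by rewrite lt_neqAle eq_sym cN0.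
rewrite -ler_pdivlMl//; apply: sup_range_le => t; rewrite ler_pdivlMl//.
by apply: (@le_sup_range (fun t => c * F t) (c * M)) => u; rewrite ler_wpM2l// ltW.
Qed.
End Sup.

Section HolderNormed.
Variable a : R.

Lemma sup_normD f g : continuous f -> continuous g ->
  sup_norm (f + g) <= sup_norm f + sup_norm g.
Proof.
move=> /continuous_bounded[M fM] /continuous_bounded[N gN].
apply: (sup_range_le north) => p.
by rewrite (le_trans (ler_normD _ _))// lerD// (le_sup_range _ fM, le_sup_range _ gN).
Qed.

Lemma sup_normZ c f : continuous f -> sup_norm (c *: f) = `|c| * sup_norm f.
Proof.
move=> /continuous_bounded[M fM]; rewrite /sup_norm.
rewrite -(sup_rangeZ north (normr_ge0 c) fM).
by congr (sup (_ @` _)); apply/funext => p; rewrite -normrM.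
Qed.

Lemma holder_atP f : holder_at a f -> exists M, forall pq : S2 * S2,
  `|f pq.1 - f pq.2| / sdist pq.1 pq.2 `^ a <= M.
Proof.
move=> [C fC]; exists (Num.max C 0) => -[p q]/=.
have := powR_ge0 (sdist p q) a; rewrite le_eqVlt => /orP[/eqP<-|d0].
  by rewrite invr0 mulr0 le_max lexx orbT.
by rewrite ler_pdivrMr// (le_trans (fC p q))// ler_wpM2r ?(ltW d0)// le_max lexx.
Qed.

Lemma holder_seminormD f g : holder_at a f -> holder_at a g ->
  holder_seminorm a (f + g) <= holder_seminorm a f + holder_seminorm a g.
Proof.
move=> /holder_atP[M fM] /holder_atP[N gN].
apply: (sup_range_le (north, north)) => pq.
apply: le_trans (lerD (le_sup_range pq fM) (le_sup_range pq gN)).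
rewrite -mulrDl ler_wpM2r ?invr_ge0 ?powR_ge0//.
by rewrite (le_trans _ (ler_normD _ _))// addrACA -opprD.
Qed.

Lemma holder_seminormZ c f : holder_at a f ->
  holder_seminorm a (c *: f) = `|c| * holder_seminorm a f.
Proof.
move=> /holder_atP[M fM]; rewrite /holder_seminorm.
rewrite -(sup_rangeZ (north, north) (normr_ge0 c) fM).
congr (sup (_ @` _)); apply/funext => pq.
by rewrite mulrA -normrM mulrBr.
Qed.

Lemma is_holder_continuous k f : is_holder a k f -> continuous f.
Proof. by case: k => [|k] []. Qed.

Lemma is_holder0 k : is_holder a k 0.
Proof.
elim: k => [|k IH]; (split; first exact: cst_continuous).
  by exists 0 => p q; rewrite subrr normr0 mul0r.
have d0 i (p : S2) : is_derive (val p) 'e_i ((0 : S2 -> R) \o radial) 0.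
  by rewrite (_ : _ \o _ = cst 0)//; exact: is_derive_cst.
split=> [i p|i]; first by have [] := d0 i p.
by rewrite (_ : tder i 0 = 0)//; apply/funext => p; have [] := d0 i p.
Qed.

Lemma is_holderD k f g : is_holder a k f -> is_holder a k g ->
  is_holder a k (f + g).
Proof.
elim: k f g => [|k IH] f g [cf hf] [cg hg];
    (split; first by move=> x; exact: (continuousD (cf x) (cg x))).
  have [[C fC] [D gD]] := (hf, hg); exists (C + D) => p q.
  by rewrite mulrDl (le_trans _ (lerD (fC p q) (gD p q)))//
    (le_trans _ (ler_normD _ _))// addrACA -opprD.
have [[df hdf] [dg hdg]] := (hf, hg).
split; first exact: tderivableD.
by move=> i; rewrite tderD//; exact: (IH _ _ (hdf i) (hdg i)).
Qed.

Lemma is_holderZ k c f : is_holder a k f -> is_holder a k (c *: f).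
Proof.
elim: k f => [|k IH] f [cf hf];
    (split; first by move=> x; exact: (continuousZl_tmp (cf x))).
  have [C fC] := hf; exists (`|c| * C) => p q.
  by rewrite -mulrBr normrM -mulrA ler_wpM2l.
have [df hdf] := hf; split; first exact: tderivableZ.
by move=> i; rewrite tderZ//; exact: (IH _ (hdf i)).
Qed.

Lemma holder_normD k f g : is_holder a k f -> is_holder a k g ->
  holder_norm a k (f + g) <= holder_norm a k f + holder_norm a k g.
Proof.
elim: k f g => [|k IH] f g [cf hf] [cg hg] /=; rewrite addrACA.
  by rewrite lerD ?sup_normD ?holder_seminormD.
have [[df hdf] [dg hdg]] := (hf, hg).
rewrite lerD ?sup_normD// -big_split/= ler_sum// => i _.
by rewrite tderD//; exact: (IH _ _ (hdf i) (hdg i)).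
Qed.

Lemma holder_normZ k c f : is_holder a k f ->
  holder_norm a k (c *: f) = `|c| * holder_norm a k f.
Proof.
elim: k f => [|k IH] f [cf hf] /=; rewrite mulrDr sup_normZ//.
  by rewrite holder_seminormZ.
have [df hdf] := hf; rewrite mulr_sumr; congr (_ + _); apply: eq_bigr => i _.
by rewrite tderZ//; exact: (IH _ (hdf i)).
Qed.

Lemma sup_norm_ge0 f : 0 <= sup_norm f.
Proof. exact: (sup_range_ge0 north). Qed.

Lemma holder_seminorm_ge0 f : 0 <= holder_seminorm a f.
Proof.
apply: (sup_range_ge0 (north, north)) => pq.
by rewrite divr_ge0// powR_ge0.
Qed.

Lemma holder_norm_ge0 k f : 0 <= holder_norm a k f.
Proof.
elim: k f => [|k IH] f; rewrite /= addr_ge0 ?sup_norm_ge0 ?holder_seminorm_ge0//.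
by rewrite sumr_ge0.
Qed.

Lemma holder_norm_eq0 k f : is_holder a k f -> holder_norm a k f = 0 -> f = 0.
Proof.
move=> /is_holder_continuous/continuous_bounded[M fM] f0.
have sf0 : sup_norm f <= 0.
  rewrite -f0; case: k {f0} => [|k]; rewrite lerDl ?holder_seminorm_ge0//.
  by rewrite sumr_ge0// => i _; exact: holder_norm_ge0.
apply/funext => p; apply/eqP; rewrite -normr_le0.
exact: le_trans (le_sup_range p fM) sf0.
Qed.

End HolderNormed.
End Sphere.

Section HolderSpace.
Variables (R : realType) (a : R) (k : nat).

Definition holder_pred : {pred S2 R -> R} := fun f => `[< is_holder a k f >].

Record holder := Holder {
  holder_fun :> S2 R -> R;
  _ : holder_fun \in holder_pred }.

HB.instance Definition _ := [isSub for holder_fun].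
HB.instance Definition _ := [Choice of holder by <:].

Lemma holder_submod_closed : submod_closed holder_pred.
Proof.
split; first by apply/asboolP; exact: is_holder0.
move=> c f g /asboolP hf /asboolP hg; apply/asboolP.
by apply: is_holderD => //; exact: is_holderZ.
Qed.

HB.instance Definition _ :=
  GRing.isSubmodClosed.Build _ _ holder_pred holder_submod_closed.
HB.instance Definition _ := [SubChoice_isSubLmodule of holder by <:].

Lemma holderP (f : holder) : is_holder a k f.
Proof. by case: f => f /= /asboolP. Qed.

Lemma holder_space_normD (f g : holder) :
  holder_norm a k (f + g) <= holder_norm a k f + holder_norm a k g.
Proof. by apply: holder_normD; exact: holderP. Qed.

Lemma holder_space_normZ (c : R) (f : holder) :
  holder_norm a k (c *: f) = `|c| * holder_norm a k f.
Proof. by apply: holder_normZ; exact: holderP. Qed.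

Lemma holder_space_norm_eq0 (f : holder) : holder_norm a k f = 0 -> f = 0.
Proof. by move=> f0; apply: val_inj; exact: holder_norm_eq0 (holderP f) f0. Qed.

HB.instance Definition _ := Lmodule_isNormed.Build R holder
  holder_space_normD holder_space_normZ holder_space_norm_eq0.

End HolderSpace.

Section Degree.
Variables (R : realType) (E F : normedModType R).

Definition has_dim (V : lmodType R) (A : set V) (n : nat) : Prop :=
  exists b : 'I_n -> V,
    (forall c : 'I_n -> R, \sum_i c i *: b i = 0 -> forall i, c i = 0) /\
    A = [set v | exists c : 'I_n -> R, v = \sum_i c i *: b i].

(* Codimension, through an algebraic complement W of A. *)
Definition has_codim (V : lmodType R) (A : set V) (n : nat) : Prop :=
  exists W : set V, [/\ has_dim W n, A `&` W = [set 0] &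
    forall v, exists x y, [/\ A x, W y & v = x + y]].

Definition fredholm0 (L : E -> F) : Prop :=
  [/\ linear L, continuous L, closed (range L) &
    exists n, has_dim [set x | L x = 0] n /\ has_codim (range L) n].

(* The last clause: f is C^1, for the operator norm. *)
Definition fredholm0_map (X : set E) (f : E -> F) : Prop :=
  forall x, X x ->
    [/\ differentiable f x, fredholm0 ('d f x) &
      forall e : R, 0 < e -> \forall y \near x, X y ->
        forall h, `|'d f y h - 'd f x h| <= e * `|h| ].

Definition proper_map (X : set E) (Y : set F) (f : E -> F) : Prop :=
  forall C, C `<=` Y -> compact C -> compact (X `&` f @^-1` C).

Definition regular_value (X : set E) (Y : set F) (f : E -> F) (y : F) : Prop :=
  Y y /\ forall x, X x -> f x = y -> range ('d f x) = setT.

(* Orientations of Fredholm operators of index 0 after Benevieri and Furi.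
   A corrector of L is a finite-rank operator A such that L + A is invertible;
   two correctors A and B are equivalent when the automorphism
   (L + B)^-1 (L + A), a finite-rank perturbation of the identity, has positive
   determinant. There are two classes, and an orientation of L is one of them. *)
Definition corrector (L A : E -> F) : Prop :=
  [/\ linear A, continuous A, exists n, has_dim (range A) n &
    bijective (fun x => L x + A x)].

(* d is the determinant of T, where T - id has finite rank: the determinant of
   the restriction of T to a finite-dimensional subspace containing the range
   of T - id. *)
Definition has_det (T : E -> E) (d : R) : Prop :=
  exists (n : nat) (b : 'I_n -> E) (M : 'M[R]_n),
    [/\ forall c : 'I_n -> R, \sum_i c i *: b i = 0 -> forall i, c i = 0,
        forall x, exists c : 'I_n -> R, T x - x = \sum_i c i *: b i,
        forall i, T (b i) = \sum_j M i j *: b j &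
        d = \det M].

Definition corrector_equiv (L A B : E -> F) : Prop :=
  exists T : E -> E, (forall x, L (T x) + B (T x) = L x + A x) /\
    exists d, 0 < d /\ has_det T d.

Definition operator_orientation (L : E -> F) (o : set (E -> F)) : Prop :=
  exists2 A, corrector L A &
    o = [set B | corrector L B /\ corrector_equiv L A B].

(* A continuous choice of orientations of the differentials of f. *)
Definition orientation (f : E -> F) (o : E -> set (E -> F)) : Prop :=
  (forall x, operator_orientation ('d f x) (o x)) /\
  (forall x A, o x A -> \forall y \near x, o y A).

(* For 'd f x invertible: 'd f x preserves orientation when the trivial
   corrector 0 is positive. *)
Definition sign (o : E -> set (E -> F)) (x : E) : int :=
  if `[< o x (cst 0) >] then 1 else -1.

(* The sum is taken over the fibre of a chosen regular value. *)
Definition degree (o : E -> set (E -> F)) (X : set E) (Y : set F)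
    (f : E -> F) : int :=
  let y := xget 0 [set y | regular_value X Y f y] in
  \sum_(x \in X `&` f @^-1` [set y]) sign o x.

Definition path_component (A : set F) (x : F) : set F :=
  [set y | exists g : R -> F, [/\ {within `[0, 1], continuous g},
    g 0 = x, g 1 = y & forall t, 0 <= t <= 1 -> A (g t)]].

Definition is_path_component (A P : set F) : Prop :=
  exists2 x, A x & P = path_component A x.

End Degree.

Section Nirenberg.
Variable R : realType.

(* The curvature of a C^{m,a} metric is of class C^{m-2,a} for m >= 2 and
   0 < a < 1, so the default value 0 is never used in that range. *)
Definition curvature (m : nat) (a : R) (u : holder a m) : holder a (m - 2) :=
  insubd 0 (fun p => expR (- (2 * u p)) * (1 - laplacian u p)).

Definition Cplus (k : nat) (a : R) : set (holder a k) :=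
  [set K | exists p, 0 < K p].

Definition calC (k : nat) (a : R) : set (holder a k) :=
  [set K | Cplus K /\
    forall q, K q = 0 -> forall (b : R) (chi : S2 R -> R), 1 <= b ->
      (\forall x \near q, {for x, continuous chi}) ->
      (\forall x \near q, K x = chi x * sdist x q `^ (2 * b)) ->
      0 < laplacian K q].

Definition calN (k : nat) (a : R) : set (holder a k) :=
  [set K | Cplus K /\
    forall p, 0 < K p -> 0 < grad_norm K p + `|laplacian K p| ].

Definition calK (k : nat) (a : R) : set (holder a k) := @calC k a `&` @calN k a.

Definition J (K : S2 R -> R) (m : nat) (a : R) (u : holder a m) : R :=
  mean (fun p => grad_norm u p ^+ 2 + 2 * u p) -
  ln (mean (fun p => K p * expR (2 * u p))).

Definition hessian (K : S2 R -> R) (m : nat) (a : R) (u h k : holder a m) : R :=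
  'D_h ('D_k (J K (m := m) (a := a))) u.

(* Span of the eigenvectors with negative eigenvalue, the Hessian being
   represented by an operator through the inner product of L^2(dv_0). *)
Definition neg_eigenspace (K : S2 R -> R) (m : nat) (a : R) (u : holder a m) :
    set (holder a m) :=
  [set v | exists (n : nat) (h : 'I_n -> holder a m),
    (forall i, exists2 l : R, l < 0 & forall k : holder a m,
       hessian K u (h i) k = l * mean (fun p => h i p * k p)) /\
    v = \sum_i h i].

Definition morse_index (K : S2 R -> R) (m : nat) (a : R) (u : holder a m) : nat :=
  xget 0%N [set n | has_dim (neg_eigenspace K u) n].

End Nirenberg.

(* Main.v *)
(* The linearization of the curvature map at [u] is [e^{-2u} (- Delta - 2 f)],
   where [f = 1 - Delta u = K e^{2u}], and the Hessian of [J_K] at a solution is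
   twice the form of [- Delta - 2 f] plus a rank one form in the direction [f].  It
   annihilates the constants, on which the form of [- Delta - 2 f] is negative, and
   agrees with that form on functions orthogonal to [f]; so [ind] is one less than
   the number of negative eigenvalues of [- Delta - 2 f].
   An orientation is compared at each [u] with the finite rank correctors [A] for
   which [e^{2u} ('d pi_u + A)] is positive for the L^2 product: these form a convex
   family depending continuously on [u], hence carry one coherent choice, and the
   sign of [det ((L + A)^-1 L)] with respect to such a corrector is the parity of
   the negative eigenvalues of the symmetric operator [- Delta - 2 f].  So the
   given orientation agrees or disagrees with the Morse parity at all [u] at once.
   That the signed count does not depend on the regular value follows by inverting
   the positive operator [- Delta + c]: solutions become fixed points of a compact map
   whose Leray-Schauder index, built from a combinatorial degree on grids, is the
   Morse parity; along a path in the component properness confines the fixed points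
   to a compact set and homotopy invariance applies. *)

From HB Require Import structures.
Require Import Defs.
From mathcomp Require Import all_boot all_order all_algebra all_fingroup.
From mathcomp Require Import all_classical all_reals all_analysis.
From mathcomp Require Import zify ring lra.

Set Implicit Arguments.
Unset Strict Implicit.
Unset Printing Implicit Defensive.

Import Order.TTheory GRing.Theory Num.Theory.
Import numFieldNormedType.Exports.

Local Open Scope classical_set_scope.
Local Open Scope ring_scope.

(** * A combinatorial degree on grids *)

(** A path joining two regular values may cross critical values of the curvature map. A
    transversality argument would then require a Sard-Smale theorem, while the Leray-Schauder index
    asks only for compactness of the fixed points along the path. Its finite-dimensional degree
    lives on a discrete torus, where a cochain identity replaces Stokes' formula, so no genericity
    enters there either. Ellipticity enters through a single fact: the differential at [u = 0] is
    [- Delta - 2], and the orientation given there contains a finite-rank corrector that makes it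
    invertible. The operators [- Delta + c] differ from this one by compact terms, so Riesz theory
    yields the Fredholm alternative. Of the spectrum only the finitely many eigenvalues of one sign
    are used. Continuity of an orientation concerns one fixed operator [A] while [u] varies, whereas
    the positive correctors carry the moving factor [e^{-2u}]. A fixed operator is therefore
    compared with the moving ones by a small perturbation, and a reflection supplies a fixed
    operator of the opposite class. *)

Section Cochain.
Variable G : Type.
Implicit Types (w : nat -> G) (a b : (nat -> G) -> int) (t : G -> int).

(** A simplex is an infinite sequence of vertices of which a [p]-cochain reads only the first
    [p + 1]; composing with [bump k] deletes the vertex [k]. This is the simplicial coboundary,
    without types depending on the dimension. *)
Definition cobd p b w : int := \sum_(k < p.+2) (-1) ^+ k * b (w \o bump k).

Definition cochain p b :=
  forall w w', (forall i, (i <= p)%N -> w i = w' i) -> b w = b w'.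

Definition cup p a b w : int := a w * b (fun i => w (p + i)%N).

(** Leibniz rule. Deleting a vertex of index at most [p] touches only [a], deleting a later one only
    [b]. The two products on the right contain one extra face each, the last of [a] and the first of
    [b], and these cancel. *)
Lemma cobd_cup p q a b w : cochain p a -> cochain q b ->
  cobd (p + q) (cup p a b) w =
  cup p.+1 (cobd p a) b w + (-1) ^+ p * cup p a (cobd q b) w.
Proof.
move=> la lb; rewrite /cobd /cup.
have -> : (p + q).+2 = (p.+1 + q.+1)%N by rewrite addnS addSn.
rewrite big_split_ord /= [\sum_(k < p.+2) _]big_ord_recr /=.
rewrite mulrDl mulr_suml mulrA mulr_sumr -addrA; congr (_ + _).
  apply: eq_bigr => i _; rewrite -mulrA; congr (_ * (_ * _)).
  apply: lb => j _ /=; congr (w _); rewrite /bump; have := ltn_ord i; lia.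
rewrite [X in _ = _ + X]big_ord_recl /=.
have -> : a (w \o bump p.+1) = a w.
  by apply: la => i ip /=; congr (w _); rewrite /bump; lia.
rewrite addrA (_ : (-1) ^+ p.+1 * a w * _ + _ = 0) ?add0r; last first.
  rewrite exprS expr0 mul1r.
  have -> : b ((fun i => w (p + i)%N) \o bump 0) = b (fun i => w (p.+1 + i)%N).
    by apply: lb => i _ /=; congr (w _); rewrite /bump; lia.
  by ring.
apply: eq_bigr => i _ /=.
have -> : a (w \o bump (p.+1 + i)) = a w.
  by apply: la => j jp /=; congr (w _); rewrite /bump; lia.
have -> : b (fun i0 => (w \o bump (p.+1 + i)) (p + i0)%N) =
    b ((fun i0 => w (p + i0)%N) \o bump (bump 0 i)).
  by apply: lb => j _ /=; congr (w _); rewrite /bump /=; lia.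
rewrite /bump leq0n /= add1n exprD !exprS; ring.
Qed.

(** The cup product of the coboundaries of the functions in [s]: the [i]-th function is differenced
    along the [i]-th edge. For sign functions the product is nonzero only if every one of them jumps
    on its own edge. *)
Fixpoint cupd (s : seq (G -> int)) w : int :=
  if s is t :: s' then (t (w 1%N) - t (w 0%N)) * cupd s' (w \o succn) else 1.

Lemma cochain_cupd s : cochain (size s) (cupd s).
Proof.
elim: s => [|t s IH] w w' ww' //=.
by rewrite !ww'//; congr (_ * _); apply: IH => i ip /=; rewrite ww'.
Qed.

Lemma cupd_cat s1 s2 w :
  cupd (s1 ++ s2) w = cup (size s1) (cupd s1) (cupd s2) w.
Proof.
elim: s1 w => [|t s IH] w /=; first by rewrite /cup mul1r.
by rewrite IH /cup mulrA.
Qed.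

Definition pt t w := t (w 0%N).

Lemma cupd_cons t s w : cupd (t :: s) w = cup 1 (cobd 0 (pt t)) (cupd s) w.
Proof.
rewrite /cup /cobd !big_ord_recl big_ord0 /= /pt /=; congr (_ * _).
by rewrite /bump/= expr0 expr1; ring.
Qed.

Lemma cobd_ext p b b' w : (forall w, b w = b' w) -> cobd p b w = cobd p b' w.
Proof. by move=> bb'; apply: eq_bigr => k _; rewrite bb'. Qed.

(** By the Leibniz rule and [d d = 0], a product of coboundaries is closed. *)
Lemma cobd_cupd s w : cobd (size s) (cupd s) w = 0.
Proof.
elim: s w => [|t s IH] w; first by rewrite /cobd/= !big_ord_recl big_ord0 /=; ring.
rewrite (cobd_ext _ _ (cupd_cons t s)) /= -add1n cobd_cup; last 2 first.
- move=> w1 w2 ww; apply: eq_bigr => -[[|[|k]] ki] _ //=; congr (_ * _).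
  + by rewrite /pt /= ww.
  + by rewrite /pt /= ww.
- exact: cochain_cupd.
rewrite /cup IH mulr0 mulr0 addr0 (_ : cobd _ _ _ = 0) ?mul0r//.
rewrite /cobd !big_ord_recl !big_ord0 /= /pt /bump /=; ring.
Qed.

(* [chi d(s1) t d(s2)], whose coboundary moves the difference operator
   between [t] and [chi]. *)
Definition mixed chi s1 t s2 w : int :=
  pt chi w * cupd s1 w * t (w (size s1)) * cupd s2 (fun i => w (size s1 + i)%N).

(** The cochain is the cup product of [chi d(s1)] and [t d(s2)]; products of coboundaries being
    closed, the Leibniz rule differentiates only [chi] and [t]. *)
Lemma cobd_mixed (chi : G -> int) s1 t s2 w :
  cobd (size s1 + size s2) (mixed chi s1 t s2) w =
  (chi (w 1%N) - chi (w 0%N)) * cupd s1 (w \o succn) * t (w (size s1).+1) *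
    cupd s2 (fun i => w ((size s1).+1 + i)%N)
  + (-1) ^+ (size s1) * chi (w 0%N) * cupd (s1 ++ t :: s2) w.
Proof.
pose m1 := cup 0 (pt chi) (cupd s1).
pose m2 := cup 0 (pt t) (cupd s2).
rewrite (@cobd_ext _ _ (cup (size s1) m1 m2)); last first.
  by move=> w'; rewrite /mixed /cup /m1 /m2 /cup /pt /= addn0 mulrA.
have cpt t' : cochain 0 (pt t') by move=> w1 w2 ww; rewrite /pt ww.
have cm t' s' : cochain (size s') (cup 0 (pt t') (cupd s')).
  move=> w1 w2 ww; rewrite /cup (cpt t' w1 w2) => [|[]// _]; last exact: ww.
  by congr (_ * _); apply: cochain_cupd => i ip; rewrite add0n ww.
have dm t' s' w' : cobd (size s') (cup 0 (pt t') (cupd s')) w' =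
    cupd (t' :: s') w'.
  rewrite -[X in cobd X]add0n cobd_cup//; last exact: cochain_cupd.
  by rewrite cupd_cons {2}/cup cobd_cupd !mulr0 addr0.
rewrite cobd_cup//; [|exact: cm|exact: cm].
rewrite /cup !dm cupd_cat /cup /m1 /m2 /cup /= /pt addn0.
by rewrite -!mulrA.
Qed.

End Cochain.

Section GridSum.
Variables (n : nat) (G : finZmodType) (e : 'I_n.+1 -> G).
Implicit Types (z : G) (chi t : G -> int).

(** The Freudenthal-Kuhn simplex: starting from [z], the steps [e] are added in the order [s]. As
    [G] is a finite group, the grid is a discrete torus and has no boundary. *)
Definition vtx z (s : {perm 'I_n.+1}) (i : nat) : G :=
  z + \sum_(k < n.+1 | (k < i)%N) e (s k).

Lemma vtx0 z s : vtx z s 0 = z.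
Proof. by rewrite /vtx big_pred0 ?addr0. Qed.

Lemma vtxS z s (i : 'I_n.+1) : vtx z s i.+1 = vtx z s i + e (s i).
Proof.
rewrite /vtx (bigD1 i)//= -!addrA [X in z + X]addrC; congr (z + (_ + _)).
by apply: eq_bigl => k; rewrite ltnS ltn_neqAle andbC.
Qed.

Definition grid_sum (b : (nat -> G) -> int) : int :=
  \sum_z \sum_s (-1) ^+ odd_perm s * b (vtx z s).


(** The face opposite to the first vertex of the simplex [(z, s)] is the face opposite to the last
    vertex of the simplex based at [z + e (s ord0)] with the order rotated by [c]; the rotation has
    sign [(-1)^n]. *)
Lemma grid_sum_face0 b : cochain n b ->
  grid_sum (fun w => b (w \o succn)) = (-1) ^+ n * grid_sum b.
Proof.
move=> lb; pose c : 'S_n.+1 := lift_perm ord_max ord0 1%g.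
have ci (i : 'I_n.+1) (ni : (i < n)%N) : c i = i.+1 :> nat.
  have -> : i = lift ord_max (Ordinal ni).
    by apply: val_inj; rewrite /= /bump leqNgt ni.
  by rewrite lift_perm_lift perm1 /= /bump leq0n leqNgt ni.
have vc z s i : (i <= n)%N -> vtx z s i.+1 = vtx (z + e (s ord0)) (c * s)%g i.
  elim: i => [_|i IH ni]; first by rewrite (vtxS z s ord0) !vtx0.
  have ni1 : (i.+1 < n.+1)%N by [].
  have ni0 : (i < n.+1)%N by exact: ltnW.
  rewrite (vtxS z s (Ordinal ni1)) (vtxS _ (c * s)%g (Ordinal ni0)) /= IH ?(ltnW ni)//.
  by congr (_ + e _); rewrite permM; congr (s _); apply: val_inj; exact/esym/ci.
rewrite /grid_sum exchange_big /= [in RHS]exchange_big /=.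
rewrite [in RHS](reindex_inj (mulgI c)) /= mulr_sumr; apply: eq_bigr => s _.
rewrite [in RHS](reindex_inj (addIr (e (s ord0)))) /= mulr_sumr.
apply: eq_bigr => z _; rewrite mulrA; congr (_ * _).
  by rewrite odd_permM odd_lift_perm /= odd_perm1 !addbF signr_addb signr_odd mulrA
    -signr_odd -expr2 sqrr_sign mul1r.
by apply: lb => i ni /=; rewrite vc.
Qed.

(** Exchanging the two steps around the deleted vertex gives the other simplex with the same face,
    with the opposite sign. *)
Lemma grid_sum_face b k : cochain n b -> (k < n)%N ->
  grid_sum (fun w => b (w \o bump k.+1)) = 0.
Proof.
move=> lb kn; rewrite /grid_sum big1 // => z _.
pose k0 : 'I_n.+1 := Ordinal (ltnW kn : (k < n.+1)%N).
pose k1 : 'I_n.+1 := Ordinal (kn : (k.+1 < n.+1)%N).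
have kk : k0 != k1 by rewrite -val_eqE /= neq_ltn ltnSn.
have vt s i : i != k.+1 -> vtx z (tperm k0 k1 * s)%g i = vtx z s i.
  move=> ik; rewrite /vtx; congr (_ + _).
  rewrite (reindex_inj (@perm_inj _ (tperm k0 k1))) /=.
  apply: eq_big => [l|l _]; last by rewrite permM tpermK.
  case: tpermP => [->|->|] //=; move: ik; lia.
set S := (LHS); have : S = - S.
  rewrite {1}/S (reindex_inj (mulgI (tperm k0 k1))) /= -sumrN.
  apply: eq_bigr => s _; rewrite odd_mul_tperm kk signr_addb expr1 mulN1r mulNr.
  congr (- (_ * _)); apply: lb => i ni /=; apply: vt.
  by rewrite /bump; case: leqP; lia.
by lia.
Qed.

(** Stokes' formula on the torus: inner faces cancel in pairs, and first and last faces cancel after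
    a translation. *)
Lemma grid_sum_cobd b : cochain n b -> grid_sum (cobd n b) = 0.
Proof.
move=> lb.
have -> : grid_sum (cobd n b) =
    \sum_(k < n.+2) (-1) ^+ k * grid_sum (fun w => b (w \o bump k)).
  rewrite /grid_sum; under [RHS]eq_bigr do rewrite mulr_sumr.
  rewrite [RHS]exchange_big /=; apply: eq_bigr => z _.
  under [RHS]eq_bigr do rewrite mulr_sumr.
  rewrite [RHS]exchange_big /=; apply: eq_bigr => s _.
  by rewrite /cobd mulr_sumr; apply: eq_bigr => k _; rewrite mulrCA.
rewrite big_ord_recl big_ord_recr /= big1 ?add0r => [|i _]; last first.
  by rewrite grid_sum_face ?mulr0.
rewrite expr0 mul1r.
have -> : grid_sum (fun w => b (w \o bump 0)) = (-1) ^+ n * grid_sum b.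
  by rewrite -grid_sum_face0.
have -> : grid_sum (fun w => b (w \o bump (bump 0 n))) = grid_sum b.
  apply: eq_bigr => z _; apply: eq_bigr => s _.
  by congr (_ * _); apply: lb => i ni /=; congr (vtx z s _); rewrite /bump; lia.
by rewrite /bump leq0n add1n exprS mulN1r mulNr subrr.
Qed.

(** With [chi] the indicator of a region and [s] sign functions, this counts with sign the simplices
    based in the region on which the signs change one after the other along the edges: a
    combinatorial count of zeros. *)
Definition grid_deg chi (s : seq (G -> int)) : int :=
  \sum_z chi z * \sum_p (-1) ^+ odd_perm p * cupd s (vtx z p).

(** Summation by parts: Stokes' formula for [mixed] transfers the difference from [t] to [chi], so
    the degree vanishes once the remaining integrand does on the simplices whose first edge enters
    or leaves the region. *)
Lemma grid_deg_vary chi (s1 : seq (G -> int)) t (s2 : seq (G -> int)) : (size s1 + size s2 = n)%N ->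
  (forall z p, chi (vtx z p 1) != chi (vtx z p 0) ->
    cupd s1 (vtx z p \o succn) * t (vtx z p (size s1).+1) *
    cupd s2 (fun i => vtx z p ((size s1).+1 + i)%N) = 0) ->
  grid_deg chi (s1 ++ t :: s2) = 0.
Proof.
move=> ns H.
have lm : cochain n (mixed chi s1 t s2).
  move=> w w' ww; rewrite /mixed /pt !ww//; last by rewrite -ns leq_addr.
  rewrite (cochain_cupd (w' := w')); last first.
    by move=> i ip; rewrite ww// (leq_trans ip)// -ns leq_addr.
  congr (_ * _); apply: cochain_cupd => i ip; apply: ww.
  by rewrite -ns leq_add2l.
have := grid_sum_cobd lm; rewrite /grid_sum => /(congr1 (fun x => (-1) ^+ size s1 * x)).
rewrite mulr0 => E; rewrite -[RHS]E /grid_deg mulr_sumr; apply: eq_bigr => z _.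
rewrite !mulr_sumr; apply: eq_bigr => p _; have := cobd_mixed chi s1 t s2 (vtx z p); rewrite ns => ->.
set A := (X in X + _); have -> : A = 0.
  rewrite /A; have [->|/H] := eqVneq (chi (vtx z p 1)) (chi (vtx z p 0)).
    by rewrite subrr !mul0r.
  by rewrite -!mulrA => ->; rewrite mulr0.
rewrite add0r vtx0; have : (-1) ^+ size s1 * (-1) ^+ size s1 = 1%R :> int.
  by rewrite -expr2 sqrr_sign.
move: ((-1) ^+ size s1) ((-1) ^+ p) (cupd _ _) (chi z) => q q' C x q2.
by rewrite [RHS]mulrCA -(mulrA q x) (mulrA q q) q2 mul1r mulrCA.
Qed.

Lemma cupd_eq0 (s : seq (G -> int)) w i : (i < size s)%N ->
  nth (fun=> 0) s i (w i) = nth (fun=> 0) s i (w i.+1) -> cupd s w = 0.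
Proof.
elim: s w i => [|t s IH] w [|i] //= si; first by move=> ->; rewrite subrr mul0r.
by move=> H; rewrite (IH (w \o succn) i) ?mulr0.
Qed.

Lemma cupdB s1 t t' s2 (w : nat -> G) :
  cupd (s1 ++ (fun x => t x - t' x) :: s2) w =
  cupd (s1 ++ t :: s2) w - cupd (s1 ++ t' :: s2) w.
Proof. by rewrite !cupd_cat /cup /=; ring. Qed.

Lemma grid_degB chi s1 t t' s2 :
  grid_deg chi (s1 ++ (fun x => t x - t' x) :: s2) =
  grid_deg chi (s1 ++ t :: s2) - grid_deg chi (s1 ++ t' :: s2).
Proof.
rewrite /grid_deg -sumrB; apply: eq_bigr => z _; rewrite -mulrBr; congr (_ * _).
by rewrite -sumrB; apply: eq_bigr => p _; rewrite -mulrBr cupdB.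
Qed.

(** The sign functions are exchanged one at a time, [S m] having its first [m] entries from [s'].
    Each exchange changes the degree by that of a tuple containing a difference [t - t'], to which
    [grid_deg_vary] applies. *)
Lemma grid_deg_homotopy chi (s s' : seq (G -> int)) :
  size s = n.+1 -> size s' = n.+1 ->
  (forall z p, chi (vtx z p 1) != chi (vtx z p 0) ->
    exists2 i, (i < n.+1)%N & exists c, forall j, (0 < j <= n.+1)%N ->
      nth (fun=> 0) s i (vtx z p j) = c /\ nth (fun=> 0) s' i (vtx z p j) = c) ->
  grid_deg chi s = grid_deg chi s'.
Proof.
move=> ss ss' H.
pose S m := take m s' ++ drop m s.
have -> : s = S 0%N by rewrite /S take0 drop0.
have -> : s' = S n.+1 by rewrite /S -{1}ss' -ss take_size drop_size cats0.
suff : forall m, (m <= n.+1)%N -> grid_deg chi (S 0%N) = grid_deg chi (S m) by apply.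
elim=> // m IH mn; rewrite {}IH 1?ltnW//; apply/eqP; rewrite -subr_eq0; apply/eqP.
have -> : S m = take m s' ++ nth (fun=> 0) s m :: drop m.+1 s.
  by rewrite /S (drop_nth (fun=> 0)) ?ss.
have -> : S m.+1 = take m s' ++ nth (fun=> 0) s' m :: drop m.+1 s.
  by rewrite /S (take_nth (fun=> 0)) ?ss'// cat_rcons.
have st : size (take m s') = m by rewrite size_takel// ss' ltnW.
rewrite -grid_degB; apply: grid_deg_vary.
  by rewrite st size_drop ss; lia.
move=> z p /H[i ni [c Hc]]; rewrite st.
(* A coordinate [i] on which both families are constant kills the integrand: through its own factor
   if [i] lies before or after position [m], through the difference [t - t'] itself if [i = m]. *)
have [im|mi|<-] := ltngtP i m.
- rewrite (@cupd_eq0 _ _ i) ?mul0r ?st//= nth_take//.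
  by rewrite !(proj2 (Hc _ _))//; lia.
- rewrite [X in _ * X](@cupd_eq0 _ _ (i - m.+1)) ?mulr0//.
    by rewrite size_drop ss; lia.
  rewrite nth_drop subnKC// ; have -> : (m.+1 + (i - m.+1).+1 = i.+1)%N by lia.
  by rewrite !(proj1 (Hc _ _))//; lia.
- by have [-> ->] := Hc i.+1 ltac:(lia); rewrite subrr mulr0 mul0r.
Qed.

Lemma grid_deg_sum (I : finType) (chi : I -> G -> int) s :
  grid_deg (fun z => \sum_i chi i z) s = \sum_i grid_deg (chi i) s.
Proof.
rewrite /grid_deg exchange_big /=; apply: eq_bigr => z _.
by rewrite mulr_suml.
Qed.

Lemma eq_grid_deg chi chi' s :
  (forall z p, chi z != chi' z -> cupd s (vtx z p) = 0) ->
  grid_deg chi s = grid_deg chi' s.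
Proof.
move=> H; apply: eq_bigr => z _; have [->//|zz] := eqVneq (chi z) (chi' z).
by rewrite big1 ?mulr0 // => p _; rewrite H ?mulr0.
Qed.

End GridSum.

(** Only the first point has to lie in [K]: grid neighbours of a point of a bounded region may leave
    it. *)
Lemma compact_unif_cont (R : realType) (X Y : normedModType R) (K : set X)
    (F : X -> Y) : compact K -> (forall x, K x -> {for x, continuous F}) ->
  forall e, 0 < e -> exists2 d, 0 < d &
    forall x y, K x -> `|x - y| < d -> `|F x - F y| < e.
Proof.
move=> /compact_near_coveringP cK cF e e0.
have H : forall x, K x -> \forall x' \near x & d \near 0^'+,
    forall y, `|x' - y| < d -> `|F x' - F y| < e.
  move=> x Kx; have e20 : 0 < e / 2 by rewrite divr_gt0.
  have /cvgrPdist_lt/(_ _ e20)/nbhs_normP[d /= d0 Hd] := cF x Kx.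
  exists (ball x (d / 2), [set d' | d' < d / 2]) => /=.
    split; first by apply: nbhsx_ballx; rewrite divr_gt0.
    by apply: nbhs_right_lt; rewrite divr_gt0.
  move=> [x' d'] /= []; rewrite -ball_normE /= => xx' dd' y x'y.
  have -> : F x' - F y = (F x - F y) - (F x - F x') by rewrite opprB [RHS]addrC addrA subrK.
  rewrite (le_lt_trans (ler_normB _ _))// (splitr e) ltrD//.
    apply: Hd; rewrite /ball_ /= (splitr d) -(subrK x' x) -addrA.
    by rewrite (le_lt_trans (ler_normD _ _))// ltrD// (lt_trans x'y).
  by apply: Hd; rewrite /ball_ /= (lt_trans xx')// ltr_pdivrMr// ltr_pMr// ltr1n.
have FF : Filter (0^'+ : set_system R) by exact: _.
have [d /= d0 Hd] := cK R (0^'+)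
  (fun d x => forall y, `|x - y| < d -> `|F x - F y| < e) FF H.
exists (d / 2); first by rewrite divr_gt0.
move=> x y Kx xy; apply: (Hd (d / 2)) => //=; last by rewrite divr_gt0.
by rewrite sub0r normrN gtr0_norm ?divr_gt0// ltr_pdivrMr// ltr_pMr// ltr1n.
Qed.

Section RowNorm.
Variables (R : realType) (n : nat).
Implicit Types x y : 'rV[R]_n.

Lemma row_norm_le x (c : R) : 0 <= c -> (forall i, `|x 0 i| <= c) -> `|x| <= c.
Proof.
move=> c0 xc; rewrite /Num.Def.normr /= mx_normrE; apply/bigmax_leP; split=> //.
by move=> [i j] _ /=; rewrite ord1.
Qed.

Lemma coord_le_norm x i : `|x 0 i| <= `|x|.
Proof.
by rewrite [leRHS]/Num.Def.normr /= mx_normrE; exact: (le_bigmax _ _ (ord0, i)).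
Qed.

Lemma row_norm_ge x (c : R) : 0 < c -> c <= `|x| -> exists i, c <= `|x 0 i|.
Proof.
move=> c0; apply: contraPP => /forallNP H; apply/negP; rewrite -ltNge.
have : `|x| <= \big[Num.max/0]_i `|x 0 i|.
  apply: row_norm_le => [|i]; last exact: le_bigmax.
  by elim/big_ind : _ => // a b; rewrite le_max => ->.
move=> /le_lt_trans; apply; apply/bigmax_ltP; split=> // i _.
by rewrite ltNge; apply/negP/H.
Qed.
End RowNorm.

(** * Degree of maps of Euclidean space, computed on grids *)

Section Grid.
Variables (R : realType) (n : nat).
Local Notation rV := ('rV[R]_n.+1).
Implicit Types (U V : set rV) (f g : rV -> rV) (N : nat).

(** The mesh is [1 / (N + 1)] and the grid covers the cube of half-width [N + 1], so both improve
    with [N]. Coordinates are added modulo [grid_size N + 1], which makes the grid a torus. *)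
Definition grid_size N := (2 * N.+1 ^ 2)%N.
Definition grid N := {ffun 'I_n.+1 -> 'I_(grid_size N).+1}.
HB.instance Definition _ N := Finite.on (grid N).
HB.instance Definition _ N := GRing.Zmodule.on (grid N).

Definition grid_unit N (j : 'I_n.+1) : grid N :=
  [ffun i => if i == j then inZp 1 else 0].

Definition grid_pt N (z : grid N) : rV :=
  \row_i ((z i)%:R / N.+1%:R - N.+1%:R).

Lemma grid_vtx N (z : grid N) p b i :
  vtx (@grid_unit N) z p b i =
  z i + (if ((p^-1)%g i < b)%N then inZp 1 else 0).
Proof.
rewrite /vtx ffunE; congr (_ + _); rewrite sum_ffunE.
have [ib|ib] := ltnP.
  rewrite (bigD1 ((p^-1)%g i))//= big1 ?addr0 ?ffunE ?permKV ?eqxx// => k /andP[_ ki].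
  by rewrite ffunE; have [ik|//] := eqVneq i (p k); move: ki; rewrite ik permK eqxx.
rewrite big1// => k kb; rewrite ffunE; case: eqP => // ki.
by move: ib kb; rewrite ki permK; lia.
Qed.

Lemma grid_pt_vtx N (z : grid N) p b i : (z i < grid_size N)%N ->
  grid_pt (vtx (@grid_unit N) z p b) 0 i =
  grid_pt z 0 i + ((p^-1)%g i < b)%N%:R / N.+1%:R.
Proof.
move=> zi; rewrite !mxE grid_vtx addrAC -mulrDl -natrD; congr (_%:R / _ - _).
case: ltnP => _; last by rewrite addr0 addn0.
have L1 : (1 %% (grid_size N).+1 = 1)%N.
  by rewrite modn_small// ltnS; apply: leq_trans zi.
by rewrite /= L1 modn_small // addn1 ltnS.
Qed.

(** Only a cell that starts at the last grid value wraps around, and its vertices then have a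
    coordinate equal to plus or minus [N + 1]; a vertex of smaller norm excludes this. *)
Lemma grid_vtx_lt N (z : grid N) p a : `|grid_pt (vtx (@grid_unit N) z p a)| < N.+1%:R ->
  forall i, (z i < grid_size N)%N.
Proof.
move=> H i; rewrite ltn_neqAle -ltnS ltn_ord andbT; apply/eqP => zi.
have := le_lt_trans (coord_le_norm _ i) H; apply/negP; rewrite -leNgt.
have N0 : N.+1%:R != 0 :> R by rewrite pnatr_eq0.
have e2 : (2 * N.+1 ^ 2)%N%:R / N.+1%:R = 2 * N.+1%:R :> R.
  by rewrite natrM natrX; field.
rewrite mxE grid_vtx; case: ltnP => _.
  have -> : nat_of_ord (z i + inZp 1) = 0%N.
    rewrite /= zi modnDmr addn1.
    by rewrite modnn.
  by rewrite mul0r sub0r normrN ger0_norm.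
rewrite addr0 zi e2 ger0_norm; last by rewrite mulr_natl mulr2n addrK.
by rewrite mulr_natl mulr2n addrK.
Qed.

Lemma grid_vtx_dist N (z : grid N) p a b :
  `|grid_pt (vtx (@grid_unit N) z p a)| < N.+1%:R ->
  `|grid_pt (vtx (@grid_unit N) z p b) - grid_pt (vtx (@grid_unit N) z p a)|
    <= N.+1%:R^-1.
Proof.
move=> /grid_vtx_lt zL; apply: row_norm_le => [|i]; first by rewrite invr_ge0.
rewrite [X in `|X|]mxE [X in _ + X]mxE !grid_pt_vtx// opprD addrACA subrr add0r -mulrBl.
rewrite normrM [`|_^-1|]ger0_norm ?invr_ge0// -[leRHS]mul1r ler_wpM2r ?invr_ge0//.
by do 2 case: ltnP => _ /=; rewrite ?subrr ?normr0 ?subr0 ?sub0r ?normrN ?normr1.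
Qed.

Definition grid_sign N f (i : 'I_n.+1) (z : grid N) : int :=
  ((0 < f (grid_pt z) 0 i)%R : nat)%:Z.

Definition deg_approx N U f : int :=
  grid_deg (@grid_unit N) (fun z => (`[< U (grid_pt z) >] : nat)%:Z)
    [seq grid_sign f i | i <- enum 'I_n.+1].

Lemma nth_grid_sign N f (i : 'I_n.+1) :
  nth (fun=> 0) [seq @grid_sign N f i | i <- enum 'I_n.+1] i = grid_sign f i.
Proof. by rewrite (nth_map i) ?size_enum_ord// nth_ord_enum. Qed.

Lemma grid_sign_stable N f g (x : rV) (i : 'I_n.+1) (r : R) (z : grid N) :
  r <= `|f x 0 i| -> `|g (grid_pt z) - f x| < r ->
  grid_sign g i z = ((0 < f x 0 i)%R : nat)%:Z.
Proof.
move=> rf gf; rewrite /grid_sign; congr ((nat_of_bool _)%:Z).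
have : `|g (grid_pt z) 0 i - f x 0 i| < r.
  by have := coord_le_norm (g (grid_pt z) - f x) i; rewrite !mxE => /le_lt_trans; apply.
move: rf; rewrite ltr_norml => rf /andP[g1 g2].
have [f0|f0|f0] := ltgtP 0 (f x 0 i).
- by move: rf; rewrite gtr0_norm// => rf; apply/idP; lra.
- by move: rf; rewrite ltr0_norm// => rf; apply/negP/negP; rewrite -leNgt; lra.
- by move: rf; rewrite -f0 normr0 => rf; lra.
Qed.

(** A cell crossing the boundary of [U] has a vertex [x] in [U] where some coordinate of [f x] is at
    least [r] in absolute value. At the other vertices [f] and [g] differ from [f x] by less than
    [r], so this coordinate has one constant sign on the cell for both maps. *)
Lemma deg_approx_step N U f g (r B : R) : 0 < r -> B < N.+1%:R ->
  (forall x, U x -> `|x| <= B) ->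
  (forall x y, U x -> ~ U y -> `|y - x| <= N.+1%:R^-1 -> r <= `|f x|) ->
  (forall x y, U x -> `|y - x| <= N.+1%:R^-1 ->
     `|f y - f x| < r /\ `|g y - f x| < r) ->
  deg_approx N U f = deg_approx N U g.
Proof.
move=> r0 BN UB Ur fg; apply: grid_deg_homotopy.
- by rewrite size_map size_enum_ord.
- by rewrite size_map size_enum_ord.
move=> z p zp.
have [a Ua [b nUb]] : exists2 a, U (grid_pt (vtx (@grid_unit N) z p a)) &
    exists b, ~ U (grid_pt (vtx (@grid_unit N) z p b)).
  have [U1|nU1] := pselect (U (grid_pt (vtx (@grid_unit N) z p 1))).
    exists 1%N => //; exists 0%N => U0.
    by move: zp; rewrite !(asboolT (P := U _))// eqxx.
  have [U0|nU0] := pselect (U (grid_pt (vtx (@grid_unit N) z p 0))).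
    by exists 0%N => //; exists 1%N.
  by move: zp; rewrite !(asboolF (P := U _))// eqxx.
set x := grid_pt _ in Ua.
have xN : `|x| < N.+1%:R by rewrite (le_lt_trans (UB _ Ua)).
have [i ri] : exists i, r <= `|f x 0 i|.
  by apply: row_norm_ge => //; apply: (Ur _ _ Ua nUb); exact: grid_vtx_dist.
exists i => //; exists ((0 < f x 0 i)%R : nat)%:Z => j _.
have [f1 g1] := fg x _ Ua (grid_vtx_dist j xN).
by rewrite !nth_grid_sign; split; apply: (grid_sign_stable ri).
Qed.

End Grid.

Lemma compact_pos_lb (R : realType) (X : topologicalType) (K : set X)
    (F : X -> R) : compact K -> (forall x, K x -> {for x, continuous F}) ->
  (forall x, K x -> 0 < F x) -> exists2 c, 0 < c & forall x, K x -> c <= F x.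
Proof.
move=> /compact_near_coveringP cK cF F0.
have FF : Filter (0^'+ : set_system R) by exact: _.
have H : forall x, K x -> \forall x' \near x & c \near 0^'+, c <= F x'.
  move=> x Kx; have F20 : 0 < F x / 2 by rewrite divr_gt0// F0.
  exists ([set y | `|F x - F y| < F x / 2], [set c | c < F x / 2]) => /=.
    split; last by apply: nbhs_right_lt.
    by have /cvgrPdist_lt/(_ _ F20) := cF x Kx.
  move=> [y c] /= [] ; rewrite ltr_norml => /andP[_ Fy] cF2; lra.
have [d /= d0 Hd] := cK R (0^'+) (fun c x => c <= F x) FF H.
exists (d / 2); first by rewrite divr_gt0.
apply: (Hd (d / 2)) => //=; last by rewrite divr_gt0.
by rewrite sub0r normrN gtr0_norm ?divr_gt0// ltr_pdivrMr// ltr_pMr// ltr1n.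
Qed.

Lemma compact_row_ball (R : realType) n (B : R) :
  compact [set x : 'rV[R]_n | `|x| <= B].
Proof.
apply: bounded_closed_compact; first by exists B; split; [exact: num_real|] => M BM x /le_trans; apply; exact: ltW.
have -> : [set x : 'rV[R]_n | `|x| <= B] = Num.norm @^-1` [set y | y <= B] by [].
by apply: preimage_closed => [x _|]; [exact: norm_continuous|exact: closed_le].
Qed.

Lemma cupd_prod (G : Type) m (t : 'I_m -> G -> int) (w : nat -> G) :
  cupd [seq t i | i <- enum 'I_m] w = \prod_(i < m) (t i (w i.+1) - t i (w i)).
Proof.
elim: m t w => [|m IH] t w; first by rewrite big_ord0 enum_ord0.
rewrite enum_ordSl /= big_ord_recl /= -map_comp; congr (_ * _).
by rewrite IH; apply: eq_bigr => i _.
Qed.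

Lemma pred_jump (P : pred nat) : (forall k, P k -> P k.+1) -> ~~ P 0%N ->
  (exists k, P k) -> exists2 k, (~~ P k && P k.+1) &
    forall k', (P k'.+1 : nat)%:Z - (P k' : nat)%:Z = (k' == k)%:R.
Proof.
move=> Pup P0 exP; case: (ex_minnP exP) => -[|k] Pk kmin; first by rewrite Pk in P0.
have up j i : (i <= j)%N -> P i -> P j.
  elim: j => [|j IH]; first by rewrite leqn0 => /eqP ->.
  by rewrite leq_eqVlt => /orP[/eqP->//|/IH H /H /Pup].
have Pkn : ~~ P k by apply/negP => /kmin; rewrite ltnn.
exists k; first by rewrite Pkn.
move=> k'; have [kk|kk|->] := ltngtP k' k; last by rewrite Pk (negPf Pkn).
  have /negPf-> : ~~ P k'.+1 by apply/negP => /kmin; lia.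
  by have /negPf-> : ~~ P k' by apply/negP => /kmin; lia.
by rewrite (up k'.+1 _ _ Pk) 1?(up k' _ _ Pk)//; lia.
Qed.

Section GridDegree.
Variables (R : realType) (n : nat).
Local Notation rV := ('rV[R]_n.+1).
Implicit Types (U V : set rV) (f g : rV -> rV) (N : nat).

Lemma near_grid (B d : R) : 0 < d ->
  \forall N \near \oo, B < N.+1%:R /\ N.+1%:R^-1 < d.
Proof.
move=> d0; near=> N; split.
  by apply: (@lt_trans _ _ N%:R); [near: N; exact: nbhs_infty_gtr|rewrite ltr_nat].
rewrite -(invrK d) ltf_pV2 ?posrE ?invr_gt0//.
by apply: (@lt_trans _ _ N%:R); [near: N; exact: nbhs_infty_gtr|rewrite ltr_nat].
Unshelve. all: by end_near. Qed.

(** The number [M] of intermediate times is fixed by the modulus of continuity alone, before [N]; a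
    single fine grid then serves all the steps. *)
Lemma deg_homotopy U (H : R -> rV -> rV) (r d B : R) : 0 < r -> 0 < d ->
  (forall x, U x -> `|x| <= B) ->
  continuous (fun p : R * rV => H p.1 p.2) ->
  (forall s x y, 0 <= s <= 1 -> U x -> ~ U y -> `|y - x| < d -> r <= `|H s x|) ->
  \forall N \near \oo, deg_approx N U (H 0) = deg_approx N U (H 1).
Proof.
move=> r0 d0 UB cH Hr.
have cK : compact ([set s : R | 0 <= s <= 1] `*` [set x : rV | `|x| <= B]).
  apply: compact_setX; last exact: compact_row_ball.
  rewrite (_ : mkset _ = `[0, 1]%classic); first exact: segment_compact.
  by apply/seteqP; split=> s /=; rewrite in_itv.
have [d' d'0 Hd'] := compact_unif_cont cK (fun p _ => cH p) r0.
have dd0 : 0 < Num.min d d' by rewrite lt_min d0.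
have [M M0 Md] : exists2 M, (0 < M)%N & M%:R^-1 < d'.
  by have [N _ /(_ N (leqnn N)) []] := near_grid 0 d'0; exists N.+1.
apply: filterS (near_grid B dd0) => N [BN]; rewrite lt_min => /andP[Nd Nd'].
suff E j : (j <= M)%N -> deg_approx N U (H 0) = deg_approx N U (H (j%:R / M%:R)).
  by rewrite (E M)// divff// pnatr_eq0 -lt0n.
elim: j => [|j IH] jM; first by rewrite mul0r.
have M0' : 0 < M%:R :> R by rewrite ltr0n.
have jb k : (k <= M)%N -> 0 <= (k%:R / M%:R : R) <= 1.
  by move=> kM; rewrite divr_ge0//= ler_pdivrMr// mul1r ler_nat.
rewrite IH 1?ltnW//; apply: (deg_approx_step (r := r) (B := B)) => //.
- move=> x y Ux Uy xy; apply: (Hr _ x y) => //; first exact/jb/ltnW.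
  exact: le_lt_trans xy Nd.
- move=> x y Ux xy.
  have P s' : `|j%:R / M%:R - s'| < d' -> `|H s' y - H (j%:R / M%:R) x| < r.
    move=> ss; rewrite distrC.
    apply: (Hd' (j%:R / M%:R, x) (s', y)) => /=.
      by split; [exact/jb/ltnW|exact: UB].
    by rewrite prod_normE /= gt_max ss distrC (le_lt_trans xy).
  split; apply: P; first by rewrite subrr normr0.
  rewrite -mulrBl -natr1 opprD addrA subrr sub0r mulN1r normrN.
  by rewrite ger0_norm// invr_ge0.
Qed.

(** Off the pieces [V i] one coordinate of [f] keeps its sign on each cell, so the cells based there
    contribute nothing. *)
Lemma deg_additive (I : finType) U (V : I -> set rV) f (r B : R) : 0 < r ->
  (forall x, U x -> `|x| <= B) -> continuous f ->
  (forall i, V i `<=` U) -> (forall i j x, V i x -> V j x -> i = j) ->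
  (forall x, U x -> (exists i, V i x) \/ r <= `|f x|) ->
  \forall N \near \oo, deg_approx N U f = \sum_i deg_approx N (V i) f.
Proof.
move=> r0 UB cf VU Vd UV.
have [d d0 Hd] := compact_unif_cont (compact_row_ball (B := B)) (fun p _ => cf p) r0.
apply: filterS (near_grid B d0) => N [BN Nd].
rewrite /deg_approx -grid_deg_sum; apply: eq_grid_deg => z p.
have [Uz|nUz] := pselect (U (grid_pt R z)); last first.
  rewrite asboolF// big1 ?eqxx// => i _; rewrite asboolF// => /VU//.
rewrite asboolT//; have [[i Vi]|rf _] := UV _ Uz.
  rewrite (bigD1 i)//= asboolT// big1 ?addr0 ?eqxx// => j ji.
  by rewrite asboolF// => /Vd/(_ Vi) /eqP; rewrite (negPf ji).
have [i ri] := row_norm_ge r0 rf.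
have zN a : `|grid_pt R (vtx (@grid_unit n N) z p a) - grid_pt R z| <= N.+1%:R^-1.
  have := @grid_vtx_dist R n N z p 0 a; rewrite vtx0; apply.
  exact: le_lt_trans (UB _ Uz) BN.
have S a : grid_sign f i (vtx (@grid_unit n N) z p a) =
    ((0 < f (grid_pt R z) 0 i)%R : nat)%:Z.
  apply: (grid_sign_stable ri); rewrite distrC; apply: Hd => /=; first exact: UB.
  by rewrite distrC (le_lt_trans (zN a)).
apply: (@cupd_eq0 _ _ _ i); first by rewrite size_map size_enum_ord.
by rewrite nth_grid_sign !S.
Qed.

(** Normalization. Only the simplex based just before [x0] with its steps in the order [tau]
    contributes: the [i]-th sign depends on the coordinate [tau i] alone, which must therefore move
    along the [i]-th edge. *)
Lemma deg_signed_perm U (x0 : rV) (tau : 'S_n.+1) (eps : 'I_n.+1 -> bool) (d B : R) :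
  0 < d -> (forall x, U x -> `|x| <= B) -> (forall x, `|x - x0| < d -> U x) ->
  \forall N \near \oo, deg_approx N U
     (fun x => \row_i ((-1) ^+ eps i * (x - x0) 0 (tau i))) =
     (-1) ^+ tau * \prod_i (-1) ^+ eps i.
Proof.
move=> d0 UB dU; apply: filterS (near_grid (Num.max B `|x0|) d0) => N [].
rewrite gt_max => /andP[BN x0N] Nd.
set f := (fun x : rV => _).
have N0 : 0 < N.+1%:R :> R by [].
have N0' : 0 < N.+1%:R^-1 :> R by rewrite invr_gt0.
pose pos k : R := k%:R / N.+1%:R - N.+1%:R.
have posS k : pos k.+1 = pos k + N.+1%:R^-1.
  by rewrite /pos -natr1 mulrDl mul1r addrAC.
(* the coordinate [tau i] crosses [x0] exactly once *)
have step i : exists2 k, (k < grid_size N)%N /\ `|pos k - x0 0 (tau i)| <= N.+1%:R^-1 &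
    forall k', ((0 < (-1) ^+ eps i * (pos k'.+1 - x0 0 (tau i)))%R : nat)%:Z
      - ((0 < (-1) ^+ eps i * (pos k' - x0 0 (tau i)))%R : nat)%:Z
      = (-1) ^+ eps i * (k' == k)%:R :> int.
  pose c : R := x0 0 (tau i); rewrite -/c.
  have /ltr_normlP [c1 c2] : `|c| < N.+1%:R.
    exact: le_lt_trans (coord_le_norm _ _) x0N.
  have posL : pos (grid_size N) = N.+1%:R.
    have N1 : N.+1%:R != 0 :> R by rewrite pnatr_eq0.
    by rewrite /pos /grid_size natrM natrX; field.
  have pos0 : pos 0 = - N.+1%:R by rewrite /pos mul0r sub0r.
  have key (P : pred nat) : (forall k, P k -> c <= pos k) ->
      (forall k, ~~ P k -> pos k <= c) -> (forall k, P k -> P k.+1) ->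
      ~~ P 0%N -> P (grid_size N) ->
    exists2 k, (k < grid_size N)%N /\ `|pos k - c| <= N.+1%:R^-1 &
      forall k', (P k'.+1 : nat)%:Z - (P k' : nat)%:Z = (k' == k)%:R.
    move=> Pc Pc' Pup P0 PL.
    have [k /andP[Pk PSk] H] := pred_jump Pup P0 (ex_intro (fun k => is_true (P k)) _ PL).
    exists k => //; split.
      rewrite ltnNge; apply/negP => Lk; move: Pk; apply/negP/negPn.
      elim: k Lk {PSk H} => [|k IH]; first by rewrite leqn0.
      by rewrite leq_eqVlt => /orP[/eqP<-//|/IH/Pup].
    have := Pc _ PSk; have := Pc' _ Pk; rewrite posS => h1 h2.
    move: N0' h1 h2; rewrite ler_norml; move: (pos k) (N.+1%:R^-1) (c) => a b c' b0 h1 h2.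
    by apply/andP; split; lra.
  (* A reversed sign turns the strict inequality of [grid_sign] into the negation of [c <= pos k];
     hence the monotone predicate is non-strict or strict according to [eps i]. *)
  case: (eps i).
  - have [] := key (fun k => c <= pos k).
    + by [].
    + by move=> k; rewrite -ltNge => /ltW.
    + by move=> k /le_trans; apply; rewrite posS lerDl ltW.
    + by rewrite pos0 -ltNge; lra.
    + by rewrite posL; lra.
    + move=> k kL H; exists k => // k'; rewrite expr1 mulN1r -H !mulN1r !oppr_gt0.
      by rewrite !subr_lt0 2!ltNge; do 2 case: (c <= _).
  - have [] := key (fun k => c < pos k).
    + by move=> k /ltW.
    + by move=> k; rewrite -leNgt.
    + by move=> k /lt_le_trans; apply; rewrite posS lerDl ltW.
    + by rewrite pos0 -leNgt; lra.
    + by rewrite posL; lra.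
    + move=> k kL H; exists k => // k'; rewrite expr0 mul1r -H !mul1r.
      by rewrite !subr_gt0.
have [kk kk1 kk2] : exists2 kk : 'I_n.+1 -> nat,
    (forall i, (kk i < grid_size N)%N /\ `|pos (kk i) - x0 0 (tau i)| <= N.+1%:R^-1) &
    forall i k', ((0 < (-1) ^+ eps i * (pos k'.+1 - x0 0 (tau i)))%R : nat)%:Z
      - ((0 < (-1) ^+ eps i * (pos k' - x0 0 (tau i)))%R : nat)%:Z
      = (-1) ^+ eps i * (k' == kk i)%:R :> int.
  exists (fun i => s2val (cid2 (step i))) => i; first exact: (s2valP (cid2 (step i))).
  exact: (s2valP' (cid2 (step i))).
pose K j : nat := kk ((tau^-1)%g j).
have KL j : (K j < (grid_size N).+1)%N.
  by rewrite ltnW// ltnS; have [] := kk1 ((tau^-1)%g j).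
pose zs : grid n N := [ffun j => Ordinal (KL j)].
have zsx0 : `|grid_pt R zs - x0| < d.
  apply: le_lt_trans Nd; apply: row_norm_le => [|j]; first exact: ltW.
  have [_] := kk1 ((tau^-1)%g j); rewrite permKV.
  by rewrite !mxE ffunE.
have sz (z : grid n N) p : U (grid_pt R z) ->
    cupd [seq grid_sign f i | i <- enum 'I_n.+1] (vtx (@grid_unit n N) z p) =
    if (z == zs) && (p == tau) then \prod_i (-1) ^+ eps i else 0.
  move=> Uz; rewrite cupd_prod.
  have zL i : (z i < grid_size N)%N.
    apply: (@grid_vtx_lt R n N z p 0); rewrite vtx0.
    exact: le_lt_trans (UB _ Uz) BN.
  have E i b : grid_sign f i (vtx (@grid_unit n N) z p b) =
    ((0 < (-1) ^+ eps i * (pos (z (tau i) + ((p^-1)%g (tau i) < b))%N - x0 0 (tau i)))%R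
       : nat)%:Z.
    rewrite /grid_sign /f mxE [X in _ * X]mxE [in X in _ + X]mxE grid_pt_vtx// mxE.
    suff -> : pos (z (tau i) + ((p^-1)%g (tau i) < b))%N = (z (tau i))%:R / N.+1%:R
        - N.+1%:R + ((p^-1)%g (tau i) < b)%N%:R / N.+1%:R by [].
    by rewrite /pos natrD mulrDl addrAC.
  have [pt|pt] := eqVneq p tau; last first.
    rewrite andbF; have [i pi] : exists i, p i != tau i.
      apply/existsP; rewrite -negb_forall; apply: contra pt => /forallP H.
      by apply/eqP/permP => i; apply/eqP.
    rewrite (bigD1 i)//= !E.
    suff -> : ((p^-1)%g (tau i) < i.+1)%N = ((p^-1)%g (tau i) < i)%N by rewrite subrr mul0r.
    rewrite ltnS leq_eqVlt; case: eqP => // /val_inj pi'.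
    by move: pi; rewrite -{1}pi' permKV eqxx.
  rewrite andbT.
  have E' i : grid_sign f i (vtx (@grid_unit n N) z p i.+1) -
      grid_sign f i (vtx (@grid_unit n N) z p i) =
      (-1) ^+ eps i * (z (tau i) == K (tau i) :> nat)%:R.
    rewrite !E pt permK ltnSn ltnn addn1 addn0.
    by rewrite kk2 /K permK.
  rewrite (eq_bigr _ (fun i _ => E' i)).
  have [->|/eqP zzs] := eqVneq z zs.
    by apply: eq_bigr => i _; rewrite ffunE /= eqxx mulr1.
  have [j zj] : exists j, z j != zs j.
    apply/existsP; rewrite -negb_forall; apply/negP => /forallP H; apply: zzs.
    by apply/ffunP => j; apply/eqP.
  rewrite (bigD1 ((tau^-1)%g j))//= permKV.
  suff /negPf-> : nat_of_ord (z j) != K j by rewrite mulr0 mul0r.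
  by apply: contra zj => /eqP zj; apply/eqP/val_inj; rewrite ffunE.
rewrite /deg_approx /grid_deg (bigD1 zs)//= asboolT; last exact: dU.
rewrite mul1r (bigD1 tau)//= sz ?eqxx; last exact: dU.
rewrite -[RHS]addr0 -[RHS]addr0; congr (_ + _ + _).
  rewrite big1 // => p pt.
  by rewrite sz ?(negPf pt) ?andbF ?mulr0//; exact: dU.
rewrite big1 // => z zz.
have [Uz|nUz] := pselect (U (grid_pt R z)); last by rewrite asboolF// mul0r.
by rewrite big1 ?mulr0// => p _; rewrite sz// (negPf zz) mulr0.
Qed.

Lemma continuous_row_mx (T : topologicalType) m (F : T -> 'rV[R]_m) :
  (forall i, continuous (fun x => F x 0 i)) -> continuous F.
Proof.
move=> cF x; apply/cvgrPdist_le => e e0.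
have : forall i, \forall y \near x, `|F x 0 i - F y 0 i| <= e.
  by move=> i; move/cvgrPdist_le : (cF i x); apply.
move=> /filter_forall; apply: filterS => y H.
by apply: row_norm_le => [|i]; [exact: ltW|rewrite !mxE].
Qed.

Lemma continuous_mulmx_path (P : R -> 'M[R]_n.+1) (x0 : rV) :
  (forall i j, continuous (fun s => P s i j)) ->
  continuous (fun p : R * rV => (p.2 - x0) *m P p.1).
Proof.
move=> cP; apply: continuous_row_mx => i.
have -> : (fun p : R * rV => ((p.2 - x0) *m P p.1) 0 i) =
    (fun p => \sum_j (p.2 0 j - x0 0 j) * P p.1 j i).
  by apply/funext => p; rewrite mxE; apply: eq_bigr => j _; rewrite !mxE.
apply: continuous_big; first exact: add_continuous.
move=> j _ p.
apply: (@continuousM _ _ (fun p : R * rV => p.2 0 j - x0 0 j) (fun p => P p.1 j i)).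
  apply: (@continuousB _ _ _ (fun p : R * rV => p.2 0 j) (fun=> x0 0 j));
    last exact: cst_continuous.
  apply: (@continuous_comp _ _ _ snd (fun y : rV => y 0 j)); first exact: cvg_snd.
  exact: coord_continuous.
by apply: (@continuous_comp _ _ _ fst (fun s => P s j i)); [exact: cvg_fst|exact: cP].
Qed.

Lemma mulmx_unit_lb (P : R -> 'M[R]_n.+1) : (forall i j, continuous (fun s => P s i j)) ->
  (forall s, 0 <= s <= 1 -> \det (P s) != 0) ->
  exists2 c, 0 < c & forall s (v : rV), 0 <= s <= 1 -> c * `|v| <= `|v *m P s|.
Proof.
move=> cP dP.
have cF : continuous (fun p : R * rV => p.2 *m P p.1).
  have := continuous_mulmx_path (x0 := 0) cP.
  by rewrite (_ : (fun _ => _) = fun p : R * rV => p.2 *m P p.1)//; apply/funext => p; rewrite subr0.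
have cK : compact ([set s : R | 0 <= s <= 1] `*` [set x : rV | `|x| = 1]).
  apply: compact_setX.
    rewrite (_ : mkset _ = `[0, 1]%classic); first exact: segment_compact.
    by apply/seteqP; split=> s /=; rewrite in_itv.
  apply: (subclosed_compact _ (compact_row_ball (B := 1))); last by move=> x /= ->.
  have -> : [set x : rV | `|x| = 1] = Num.norm @^-1` [set 1] by [].
  by apply: preimage_closed => [x _|]; [exact: norm_continuous|exact: closed_eq].
have [] := compact_pos_lb cK (F := fun p : R * rV => `|p.2 *m P p.1|).
- by move=> p _; apply: continuous_comp; [exact: cF|exact: norm_continuous].
- move=> [s v] /= [s01 v1]; rewrite normr_gt0; apply/negP => /eqP vP.
  have PU : P s \in unitmx by rewrite unitmxE unitfE dP.
  by move: v1; rewrite -(mulmxK PU v) vP mul0mx normr0 => /eqP; rewrite eq_sym oner_eq0.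
move=> c c0 Hc; exists c => // s v s01.
have [->|v0] := eqVneq v 0; first by rewrite mul0mx !normr0 mulr0.
have nv : 0 < `|v| by rewrite normr_gt0.
have := Hc (s, `|v|^-1 *: v); rewrite /= -scalemxAl !normrZ normfV normr_id mulVf ?gt_eqF//.
by rewrite ler_pdivlMl// mulrC; apply.
Qed.

Lemma deg_linear_path U (x0 : rV) (P : R -> 'M[R]_n.+1) (d B : R) :
  0 < d -> (forall x, U x -> `|x| <= B) -> (forall x, `|x - x0| < d -> U x) ->
  (forall i j, continuous (fun s => P s i j)) ->
  (forall s, 0 <= s <= 1 -> \det (P s) != 0) ->
  \forall N \near \oo, deg_approx N U (fun x => (x - x0) *m P 0) =
    deg_approx N U (fun x => (x - x0) *m P 1).
Proof.
move=> d0 UB dU cP dP; have [c c0 Hc] := mulmx_unit_lb cP dP.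
apply: (deg_homotopy (H := fun s x => (x - x0) *m P s) (r := c * (d / 2))
  (d := d / 2) (B := B)) => //; first by rewrite mulr_gt0// divr_gt0.
- by rewrite divr_gt0.
- exact: continuous_mulmx_path.
move=> s x y s01 Ux Uy xy; apply: le_trans (Hc _ _ s01); rewrite ler_pM2l// leNgt.
apply/negP => xx0; apply/Uy/dU; rewrite -(subrK x y) -addrA (le_lt_trans (ler_normD _ _))//.
by rewrite (splitr d) ltrD.
Qed.

(** The factors of an LUP decomposition are deformed through invertible matrices: the unit
    triangular one to the identity, the other to its diagonal, the diagonal to its signs. A signed
    permutation remains, whose determinant has the same sign. *)
Lemma deg_linear U (x0 : rV) (M : 'M[R]_n.+1) (d B : R) :
  0 < d -> (forall x, U x -> `|x| <= B) -> (forall x, `|x - x0| < d -> U x) ->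
  \det M != 0 ->
  \forall N \near \oo, deg_approx N U (fun x => (x - x0) *m M) = sgz (\det M).
Proof.
move=> d0 UB dU dM.
have aff (A A' : 'M[R]_n.+1) : (forall s, 0 <= s <= 1 -> \det (A + s *: (A' - A)) != 0) ->
    \forall N \near \oo, deg_approx N U (fun x => (x - x0) *m A) =
      deg_approx N U (fun x => (x - x0) *m A').
  move=> H; have := deg_linear_path (P := fun s => A + s *: (A' - A)) d0 UB dU.
  rewrite scale0r addr0 scale1r [A + _]addrC subrK; apply => // i j s.
  rewrite (_ : (fun _ => _) = (fun t : R => A i j + t * (A' i j - A i j))); last first.
    by apply/funext => t; rewrite !mxE.
  apply: (@continuousD _ _ _ (fun=> A i j) (fun t : R => t * (A' i j - A i j)));
    first exact: cst_continuous.
  by apply: (@continuousM _ _ id (fun=> _)); [exact: cvg_id|exact: cst_continuous].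
have := cormen_lup_correct M; have := cormen_lup_perm M.
have := @cormen_lup_lower _ _ M; have := @cormen_lup_upper _ _ M.
case: (cormen_lup M) => [[Q L] V] /= Vu Ll /is_perm_mxP[s ->] QM.
have {QM} EM : M = perm_mx s^-1 *m L *m V.
  by rewrite -mulmxA (_ : L *m V = L * V)// -QM mulmxA -perm_mxM mulVg perm_mx1 mul1mx.
have detL t : \det (L + t *: (1%:M - L)) = 1.
  rewrite det_trig; last first.
    apply/is_trig_mxP => i j ij; have ne : (i == j) = false.
      by rewrite -val_eqE; exact: ltn_eqF.
    by rewrite !mxE (Ll _ _ (ltnW ij)) ne mulr0n subrr mulr0 addr0.
  by rewrite big1// => i _; rewrite !mxE Ll// eqxx subrr mulr0 addr0.
pose D := diag_mx (\row_i V i i).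
have detV t : \det (V + t *: (D - V)) = \prod_i V i i.
  rewrite -det_tr det_trig; last first.
    apply/is_trig_mxP => i j ij; have ne : (j == i) = false.
      by rewrite -val_eqE; exact: gtn_eqF.
    by rewrite !mxE (Vu _ _ ij) ne mulr0n subrr mulr0 addr0.
  by apply: eq_bigr => i _; rewrite !mxE eqxx mulr1n subrr mulr0 addr0.
have det0 : \det V = \prod_i V i i by rewrite -(detV 0) scale0r addr0.
have det1 : \det L = 1 by rewrite -(detL 0) scale0r addr0.
have detM : \det M = (-1) ^+ s * \prod_i V i i.
  by rewrite EM !det_mulmx det_perm odd_permV det1 mulr1 det0.
have V0 : \prod_i V i i != 0 by apply: contraNneq dM => V0; rewrite detM V0 mulr0.
have V0i i : V i i != 0 by move/prodf_neq0 : V0; apply.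
pose eps i := V i i < 0.
pose D' : 'M[R]_n.+1 := diag_mx (\row_i (-1) ^+ eps i).
have s0 (b : bool) : (-1) ^+ b != 0 :> R by rewrite signr_eq0.
have H1 : \forall N \near \oo, deg_approx N U (fun x => (x - x0) *m M) =
    deg_approx N U (fun x => (x - x0) *m (perm_mx s^-1 *m V)).
  apply: aff => t _; rewrite EM.
  have -> : perm_mx s^-1 *m L *m V + t *: (perm_mx s^-1 *m V - perm_mx s^-1 *m L *m V) =
      perm_mx s^-1 *m (L + t *: (1%:M - L)) *m V.
    by rewrite mulmxDr mulmxDl -scalemxAr -scalemxAl mulmxBr mulmxBl mulmx1.
  by rewrite !det_mulmx det_perm detL mulr1 mulf_neq0// det0.
have H2 : \forall N \near \oo, deg_approx N U (fun x => (x - x0) *m (perm_mx s^-1 *m V)) =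
    deg_approx N U (fun x => (x - x0) *m (perm_mx s^-1 *m D)).
  apply: aff => t _.
  by rewrite -mulmxBr scalemxAr -mulmxDr det_mulmx det_perm detV mulf_neq0.
have H3 : \forall N \near \oo, deg_approx N U (fun x => (x - x0) *m (perm_mx s^-1 *m D)) =
    deg_approx N U (fun x => (x - x0) *m (perm_mx s^-1 *m D')).
  apply: aff => t /andP[t0 t1].
  rewrite -mulmxBr scalemxAr -mulmxDr det_mulmx det_perm mulf_neq0//.
  have -> : D + t *: (D' - D) = diag_mx (\row_i (V i i + t * ((-1) ^+ eps i - V i i))).
    by apply/matrixP => i j; rewrite !mxE; case: eqP => // _; rewrite ?mulr1n// !mulr0n subrr mulr0 addr0.
  rewrite det_diag; apply/prodf_neq0 => i _; rewrite mxE /eps.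
  have cp (b : R) : 0 < b -> 0 < b + t * (1 - b).
    move=> b0; have -> : b + t * (1 - b) = (1 - t) * b + t by ring.
    have [t1'|t1'] := ltP t 1; last first.
      by apply: ltr_wpDl; [rewrite mulr_ge0 ?subr_ge0// ltW|exact: lt_le_trans ltr01 t1'].
    by rewrite ltr_pwDl// mulr_gt0// subr_gt0.
  have := V0i i; case: ltgtP => // Vi _.
    rewrite expr1 lt_eqF// -oppr_gt0.
    have -> : - (V i i + t * (-1 - V i i)) = - V i i + t * (1 - - V i i) by ring.
    by rewrite cp// oppr_gt0.
  by rewrite expr0 gt_eqF// cp.
have H4 := deg_signed_perm s eps d0 UB dU.
have sgzP : sgz (\det M) = (-1) ^+ s * \prod_i (-1) ^+ eps i.
  rewrite detM sgzM sgzX sgzN1; congr (_ * _).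
  rewrite (big_morph (@sgz R) (@sgzM R) (@sgz1 R)); apply: eq_bigr => i _.
  by rewrite /eps; have := V0i i; case: ltgtP => // Vi _; [rewrite ltr0_sgz|rewrite gtr0_sgz].
near=> N.
rewrite (near H1 N)// (near H2 N)// (near H3 N)//.
have -> : (fun x => (x - x0) *m (perm_mx s^-1 *m D')) =
    (fun x => \row_i ((-1) ^+ eps i * (x - x0) 0 (s i))).
  apply/funext => x; apply/rowP => i; rewrite mulmxA !mxE (bigD1 i)//= big1 ?addr0.
    rewrite !mxE eqxx mulr1n mulrC; congr (_ * _).
    rewrite (bigD1 (s i))//= big1 ?addr0 => [|j ji].
      by rewrite !mxE permK eqxx mulr1.
    by rewrite !mxE (can2_eq (permKV s) (permK s)) (negPf ji) mulr0.
  by move=> j ji; rewrite !mxE (negPf ji) mulr0n mulr0.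
by rewrite (near H4 N)// sgzP.
Unshelve. all: by end_near. Qed.

End GridDegree.

(** * The Leray-Schauder degree *)

(** Sylvester's identity, from two block triangular factorizations of one matrix. It makes
    determinants insensitive to the number of coordinates used. *)
Lemma det_1BmulC (R : comNzRingType) m k (A : 'M[R]_(m, k)) (B : 'M[R]_(k, m)) :
  \det (1%:M - A *m B) = \det (1%:M - B *m A).
Proof.
have E1 : block_mx 1%:M A B 1%:M =
    block_mx 1%:M 0 B 1%:M *m block_mx 1%:M A 0 (1%:M - B *m A).
  by rewrite mulmx_block !(mul1mx, mulmx1, mul0mx, mulmx0, addr0) addrC subrK.
have E2 : block_mx 1%:M A B 1%:M =
    block_mx 1%:M A 0 1%:M *m block_mx (1%:M - A *m B) 0 B 1%:M.
  by rewrite mulmx_block !(mul1mx, mulmx1, mul0mx, mulmx0, add0r) subrK.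
have := congr1 determinant E1; rewrite E2 !det_mulmx !det_ublock !det_lblock !det1.
by rewrite !mul1r mulr1.
Qed.

Section Nets.
Variables (R : realType) (E : normedModType R).
Implicit Types (A B : set E) (s : seq E).

(** Total boundedness, with centres anywhere in [E] so that it passes to subsets. In a complete
    space it stands for relative compactness, and it hands over the finite lists on which the
    Schauder projection is built. *)
Definition has_nets A := forall e : R, 0 < e ->
  exists s, forall x, A x -> exists2 v, v \in s & `|x - v| < e.

Lemma has_netsS A B : A `<=` B -> has_nets B -> has_nets A.
Proof. by move=> AB nB e /nB[s H]; exists s => x /AB/H. Qed.

Lemma has_nets_bigU (I : finType) (A : I -> set E) :
  (forall i, has_nets (A i)) -> has_nets [set x | exists i, A i x].
Proof.
move=> nA e e0; have [s H] := choice (fun i => nA i e e0).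
exists (flatten [seq s i | i : I]) => x [i /H[v vs xv]]; exists v => //.
by apply/flattenP; exists (s i) => //; apply/mapP; exists i => //; rewrite mem_enum.
Qed.

Lemma ultra_cover (T : Type) (G : set_system T) (I : finType) (P : I -> set T) :
  UltraFilter G -> (\forall x \near G, exists i, P i x) -> exists i, G (P i).
Proof.
move=> UG cov; apply: contrapT => /forallNP nP.
have /filter_forall H : forall i, \forall x \near G, ~ P i x.
  by move=> i; have [/nP//|] := in_ultra_setVsetC (P i) UG.
by have [x [[i Pi] nPi]] := filter_ex (filterI cov H); exact: nPi Pi.
Qed.

Lemma fmap_ultra (T T' : Type) (G : set_system T) (f : T -> T') :
  UltraFilter G -> UltraFilter (f @ G).
Proof.
move=> UG; split; first exact: fmap_proper_filter.
move=> G' PG' GG'; apply/seteqP; split=> // A G'A.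
have [//|H] := in_ultra_setVsetC (f @^-1` A) UG.
have /GG' nA : (f @ G) (~` A) by [].
by have [x []] := filter_ex (filterI G'A nA).
Qed.

End Nets.

(** An ultrafilter contains one ball of every finite cover, hence the image is Cauchy. In the
    compactness arguments below this replaces the extraction of subsequences. *)
Lemma has_nets_ultra (R : realType) (E : completeNormedModType R) (A : set E)
    (T : Type) (G : set_system T) (c : T -> E) :
  has_nets A -> UltraFilter G -> (\forall t \near G, A (c t)) ->
  exists x : E, c @ G --> x.
Proof.
move=> nA UG Gc; suff : cvg (c @ G) by move=> H; exists (lim (c @ G)).
apply/cauchy_cvgP; apply/cauchy_exP => e e0; have [s Hs] := nA e e0.
have [|i Gi] := @ultra_cover T G 'I_(size s) (fun i t => `|c t - s`_i| < e) UG.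
  apply: filterS Gc => t /Hs[v vs cv]; have vi : (index v s < size s)%N by rewrite index_mem.
  by exists (Ordinal vi); rewrite nth_index.
exists s`_i; change (G (fun t => ball s`_i e (c t))).
by apply: filterS Gi => t /=; rewrite -ball_normE /ball_/= distrC.
Qed.

Section FixedPointFree.
Variables (R : realType) (E : completeNormedModType R).

(** Otherwise some points have displacement tending to 0. Along an ultrafilter the times converge,
    the images converge by total boundedness, hence so do the points, and the limit is a fixed point
    in [Z]. *)
Lemma compact_homotopy_lb (C : R -> E -> E) (Z : set E) :
  closed Z -> continuous (fun p : R * E => C p.1 p.2) ->
  has_nets [set C s u | s in [set s | 0 <= s <= 1] & u in Z] ->
  (forall s u, 0 <= s <= 1 -> Z u -> C s u <> u) ->
  exists2 e, 0 < e & forall s u, 0 <= s <= 1 -> Z u -> e <= `|u - C s u|.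
Proof.
move=> cZ cC nC nz; apply: contrapT => H.
have {}H (n : nat) : exists p : R * E, [/\ 0 <= p.1 <= 1, Z p.2 &
    `|p.2 - C p.1 p.2| < n.+1%:R^-1].
  apply: contrapT => nH; apply: H; exists n.+1%:R^-1; first by rewrite invr_gt0.
  by move=> s u s01 Zu; rewrite leNgt; apply/negP => su; apply: nH; exists (s, u).
have [w Hw] := choice H.
have [G [UG oG]] := @ultraFilterLemma nat eventually _.
have cI : compact [set s : R | 0 <= s <= 1].
  rewrite (_ : mkset _ = `[0, 1]%classic); first exact: segment_compact.
  by apply/seteqP; split=> s /=; rewrite in_itv.
pose s n := (w n).1; pose u n := (w n).2.
have [s0 [s01 ss0]] : [set s : R | 0 <= s <= 1] `&` [set s0 | s @ G --> s0] !=set0.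
  move: cI; rewrite compact_ultra => /(_ (s @ G) (fmap_ultra s UG)); apply.
  by apply: nearW => n; have [] := Hw n.
have [x cx] : exists x : E, (fun n => C (s n) (u n)) @ G --> x.
  apply: (has_nets_ultra nC UG); apply: nearW => n.
  by have [s1 Zu _] := Hw n; exists (s n) => //; exists (u n).
have ux : u @ G --> x.
  apply/cvgrPdist_lt => e e0; have e20 : 0 < e / 2 by rewrite divr_gt0.
  move/cvgrPdist_lt : cx => /(_ _ e20) c1.
  have c2 : \forall n \near G, `|u n - C (s n) (u n)| < e / 2.
    apply: oG; apply: filterS (near_grid 0 e20) => n [_ ne].
    by have [_ _ h] := Hw n; exact: lt_trans h ne.
  apply: filterS2 c1 c2 => n h1 h2; rewrite (splitr e).
  have -> : x - u n = (x - C (s n) (u n)) - (u n - C (s n) (u n)).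
    by rewrite opprB addrA subrK.
  by rewrite (le_lt_trans (ler_normB _ _))// ltrD.
have Zx : Z x.
  by apply: (closed_cvg _ cZ _ x ux); apply: nearW => n; have [] := Hw n.
apply: (nz s0 x s01 Zx).
have su : (fun n => (s n, u n)) @ G --> (s0, x) by exact: (cvg_pair ss0 ux).
have cx' : (fun n => C (s n) (u n)) @ G --> C s0 x.
  exact: (@cvg_comp _ _ _ (fun n => (s n, u n)) (fun p : R * E => C p.1 p.2)
    G _ _ su (cC (s0, x))).
by rewrite -[RHS](cvg_lim (@norm_hausdorff _ E) cx) (cvg_lim (@norm_hausdorff _ E) cx').
Qed.

End FixedPointFree.

Section Schauder.
Variables (R : realType) (E : normedModType R) (N : nat) (v : 'I_N.+1 -> E).
Local Notation rV := ('rV[R]_N.+1).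

Definition comb (x : rV) : E := \sum_i x 0 i *: v i.

Lemma combB x y : comb (x - y) = comb x - comb y.
Proof.
by rewrite /comb -sumrB; apply: eq_bigr => i _; rewrite !mxE scalerBl.
Qed.

Lemma combD x y : comb (x + y) = comb x + comb y.
Proof.
by rewrite /comb -big_split; apply: eq_bigr => i _; rewrite !mxE scalerDl.
Qed.

Lemma combZ c x : comb (c *: x) = c *: comb x.
Proof.
by rewrite /comb scaler_sumr; apply: eq_bigr => i _; rewrite !mxE scalerA.
Qed.

Lemma comb_delta i : comb (delta_mx 0 i) = v i.
Proof.
rewrite /comb (bigD1 i)//= big1 ?addr0 => [|j ji]; first by rewrite mxE !eqxx scale1r.
by rewrite mxE (negPf ji) andbF scale0r.
Qed.

Lemma comb_le : exists2 k, 0 < k & forall x, `|comb x| <= k * `|x|.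
Proof.
exists (1 + \sum_i `|v i|); first by rewrite ltr_pwDl// sumr_ge0.
move=> x; rewrite mulrDl mul1r (le_trans (ler_norm_sum _ _ _))//.
rewrite mulr_suml (le_trans (ler_sum _ _ : _ <= \sum_i `|v i| * `|x|)) ?lerDr//.
by move=> i _; rewrite normrZ mulrC ler_wpM2l// coord_le_norm.
Qed.

Lemma continuous_comb : continuous comb.
Proof.
have [k k0 kx] := comb_le; move=> x.
apply/(@cvgrPdist_lt _ _ _ (nbhs x)) => e e0.
apply/(@nbhs_normP _ rV); exists (e / k); first by rewrite /= divr_gt0.
by move=> y /= xy; rewrite -combB (le_lt_trans (kx _))// -ltr_pdivlMl// mulrC.
Qed.

Variable e : R.
Hypothesis e0 : 0 < e.

(** The support radius is [2 * e] for a net of fineness [e]: within [e] of a centre the bumps add up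
    to at least [e], so the [Num.max] in [schauder] is inactive there. Elsewhere it keeps the map
    continuous. *)
Definition bump_at i (u : E) : R := Num.max 0 (2 * e - `|u - v i|).
Definition schauder (u : E) : rV :=
  \row_i (bump_at i u / Num.max e (\sum_j bump_at j u)).

Lemma bump_at_ge0 i u : 0 <= bump_at i u.
Proof. by rewrite le_max lexx. Qed.

Lemma schauder_den u : 0 < Num.max e (\sum_j bump_at j u).
Proof. by rewrite lt_max e0. Qed.

Lemma schauder_le1 u : `|schauder u| <= 1.
Proof.
apply: row_norm_le => // i; rewrite mxE normrM normfV.
rewrite !ger0_norm ?bump_at_ge0 ?(ltW (schauder_den u))//.
rewrite ler_pdivrMr ?schauder_den// mul1r le_max (bigD1 i)//= lerDl.
by rewrite sumr_ge0 ?orbT// => j _; exact: bump_at_ge0.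
Qed.

Lemma continuous_schauder : continuous schauder.
Proof.
have cb i : continuous (bump_at i).
  move=> u; apply: (@continuous_max _ _ (fun=> 0) (fun u => 2 * e - `|u - v i|)).
    exact: cst_continuous.
  apply: (@continuousB _ _ _ (fun=> 2 * e) (fun u => `|u - v i|)); first exact: cst_continuous.
  apply: (@continuous_comp _ _ _ (fun u => u - v i) Num.norm); last exact: norm_continuous.
  by apply: (@continuousB _ _ _ id (fun=> v i)); [exact: cvg_id|exact: cst_continuous].
apply: continuous_row_mx => i u; rewrite (_ : (fun _ => _) =
    (fun u => bump_at i u * (Num.max e (\sum_j bump_at j u))^-1)); last first.
  by apply/funext => w; rewrite mxE.
apply: (@continuousM _ _ (bump_at i) (fun u => (Num.max e (\sum_j bump_at j u))^-1)).
  exact: cb.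
apply: (@continuousV _ _ (fun u => Num.max e (\sum_j bump_at j u))).
  by rewrite gt_eqF// schauder_den.
apply: (@continuous_max _ _ (fun=> e) (fun u => \sum_j bump_at j u)).
  exact: cst_continuous.
by apply: continuous_big => [|j _]; [exact: add_continuous|exact: cb].
Qed.

Lemma schauder_approx u : (exists i, `|u - v i| < e) ->
  `|comb (schauder u) - u| <= 2 * e.
Proof.
move=> [i0 ui].
have S : e <= \sum_j bump_at j u.
  rewrite (bigD1 i0)//= -[leLHS]addr0 lerD//; last first.
    by apply: sumr_ge0 => j _; exact: bump_at_ge0.
  by rewrite le_max; apply/orP; right; lra.
have den : Num.max e (\sum_j bump_at j u) = \sum_j bump_at j u.
  by apply/max_idPr.
have s0 : 0 < \sum_j bump_at j u by rewrite (lt_le_trans e0).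
have sum1 : \sum_i schauder u 0 i = 1.
  under eq_bigr do rewrite mxE den.
  by rewrite -mulr_suml divff// gt_eqF.
have -> : comb (schauder u) - u = \sum_i schauder u 0 i *: (v i - u).
  under [RHS]eq_bigr do rewrite scalerBr.
  by rewrite sumrB -scaler_suml sum1 scale1r.
rewrite (le_trans (ler_norm_sum _ _ _))//.
rewrite -[leRHS]mulr1 -[X in _ <= _ * X]sum1 mulr_sumr ler_sum// => i _.
rewrite normrZ mxE den ger0_norm; last by rewrite divr_ge0 ?bump_at_ge0// ltW.
rewrite [leLHS]mulrC; have [b|b] := ltP (2 * e) `|u - v i|.
  by rewrite /bump_at max_l ?mul0r ?mulr0//; lra.
by apply: ler_wpM2r; [rewrite divr_ge0 ?bump_at_ge0// ltW|rewrite distrC].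
Qed.

End Schauder.

Lemma fin_pos_lb (R : realType) (I : finType) (f : I -> R) :
  (forall i, 0 < f i) -> exists2 c, 0 < c & forall i, c <= f i.
Proof.
move=> f0; exists (\big[Num.min/1]_i f i); last by move=> i; exact: bigmin_le_cond.
by elim/big_ind : _ => // x y x0 y0; rewrite lt_min x0.
Qed.

Section LeraySchauder.
Variables (R : realType) (E : completeNormedModType R).
Local Notation I01 := ([set s : R | 0 <= s <= 1]).

Section FixedCenters.
Variables (N : nat) (v : 'I_N.+1 -> E) (eps : R).
Hypothesis eps0 : 0 < eps.
Local Notation rV := ('rV[R]_N.+1).

(** The degree is taken in the coordinate space of the centres and not in their span, so dependent
    centres are allowed. The cutoff [|x| < M] bounds the set in the directions where [comb] has a
    kernel. *)
Definition ls_set (M : R) (U : set E) : set rV := [set x | U (comb v x) /\ `|x| < M].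

Lemma ls_homotopy (M eta : R) (U : set E) (q : R -> E -> rV) (C : R -> E -> E) :
  0 < eta -> continuous (fun p : R * E => q p.1 p.2) ->
  (forall s u, 0 <= s <= 1 -> U u -> `|comb v (q s u) - C s u| <= eps) ->
  (forall s u, 0 <= s <= 1 -> U u -> `|q s u| <= M - 2) ->
  (forall s u w, 0 <= s <= 1 -> U u -> ~ U w -> `|w - u| < eta ->
    2 * eps <= `|u - C s u|) ->
  \forall K \near \oo,
    deg_approx K (ls_set M U) (fun x => x - q 0 (comb v x)) =
    deg_approx K (ls_set M U) (fun x => x - q 1 (comb v x)).
Proof.
move=> eta0 cq qC qM UC; have [k k0 kx] := comb_le v.
apply: (@deg_homotopy _ _ _ (fun s x => x - q s (comb v x)) (Num.min (eps / k) 1)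
  (Num.min (eta / k) 1) M).
- by rewrite lt_min divr_gt0//=.
- by rewrite lt_min divr_gt0//=.
- by move=> x [_ /ltW].
- move=> p; apply: (@continuousB _ _ _ (fun p : R * rV => p.2)
    (fun p => q p.1 (comb v p.2))); first exact: cvg_snd.
  apply: (@continuous_comp _ _ _ (fun p : R * rV => (p.1, comb v p.2))
    (fun p : R * E => q p.1 p.2)); last exact: cq.
  have h1 : (fun p : R * rV => p.1) @ p --> p.1 by exact: cvg_fst.
  have h2 : (fun p : R * rV => comb v p.2) @ p --> comb v p.2.
    by apply: (@continuous_comp _ _ _ snd (comb v)); [exact: cvg_snd|exact: continuous_comb].
  exact: (cvg_pair h1 h2).
move=> s x y s01 [Ux xM] nUy; rewrite lt_min => /andP[yx yx1].
(* Two ways of leaving the set. Through the cutoff: [y] is within 1 of [x] and [q] has norm at most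
   [M - 2], so [x - q] has norm at least 1. Through [U]: the lower bound on the displacement passes
   to coordinates with the factor [k]. *)
rewrite ge_min; have [Uy|nUy'] := pselect (U (comb v y)).
  apply/orP; right; have yM : M <= `|y| by rewrite leNgt; apply/negP => yM; exact: nUy.
  have := qM s _ s01 Ux.
  have := lerB_dist x (q s (comb v x)); move: yx1 yM.
  have := lerB_dist y x; lra.
apply/orP; left; rewrite ler_pdivrMr// mulrC (le_trans _ (kx _))//.
rewrite combB.
have := UC s (comb v x) (comb v y) s01 Ux nUy'.
have -> : `|comb v y - comb v x| < eta.
  by rewrite -combB (le_lt_trans (kx _))// -ltr_pdivlMl// mulrC.
move=> /(_ isT) h1; have h2 := qC s _ s01 Ux.
have -> : comb v x - comb v (q s (comb v x)) =
    (comb v x - C s (comb v x)) - (comb v (q s (comb v x)) - C s (comb v x)).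
  by rewrite opprB addrA subrK.
by have := lerB_dist (comb v x - C s (comb v x))
  (comb v (q s (comb v x)) - C s (comb v x)); lra.
Qed.

Lemma ls_additive (I : finType) (M : R) (U : set E) (V : I -> set E)
    (q : E -> rV) (C : E -> E) :
  continuous q -> (forall u, U u -> `|comb v (q u) - C u| <= eps) ->
  (forall i, V i `<=` U) -> (forall i j u, V i u -> V j u -> i = j) ->
  (forall u, U u -> (exists i, V i u) \/ 2 * eps <= `|u - C u|) ->
  \forall K \near \oo,
    deg_approx K (ls_set M U) (fun x => x - q (comb v x)) =
    \sum_i deg_approx K (ls_set M (V i)) (fun x => x - q (comb v x)).
Proof.
move=> cq qC VU Vd UC; have [k k0 kx] := comb_le v.
apply: (@deg_additive _ _ I _ _ _ (eps / k) M).
- by rewrite divr_gt0.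
- by move=> x [_ /ltW].
- move=> x; apply: (@continuousB _ _ _ id (fun x => q (comb v x))); first exact: cvg_id.
  by apply: (@continuous_comp _ _ _ (comb v) q); [exact: continuous_comb|exact: cq].
- by move=> i x [/VU].
- by move=> i j x [Vi _] [Vj _]; exact: Vd Vi Vj.
move=> x [Ux xM]; have [[i Vi]|h1] := UC _ Ux; first by left; exists i.
right; rewrite ler_pdivrMr// mulrC (le_trans _ (kx _))// combB.
have h2 := qC _ Ux.
have -> : comb v x - comb v (q (comb v x)) =
    (comb v x - C (comb v x)) - (comb v (q (comb v x)) - C (comb v x)).
  by rewrite opprB addrA subrK.
by have := lerB_dist (comb v x - C (comb v x))
  (comb v (q (comb v x)) - C (comb v x)); lra.
Qed.

Variable p : E -> rV.
Hypotheses (cp : continuous p) (p1 : forall u, `|p u| <= 1).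

(* At an affine finite-rank map the Schauder coordinates can be replaced by
   the exact ones. *)
Lemma ls_affine (M delta : R) n (phi : 'I_n -> E -> R) (b : 'I_n -> E) (z : E)
    (iz : 'I_N.+1) (ib : 'I_n -> 'I_N.+1) (L : E -> E) :
  0 < delta -> (forall u, L u = z + \sum_i phi i (u - z) *: b i) ->
  (forall i c u w, phi i (c *: u + w) = c * phi i u + phi i w) ->
  (forall i, exists k, forall u, `|phi i u| <= k * `|u|) ->
  v iz = z -> (forall i, v (ib i) = b i) ->
  (forall u, `|u - z| < delta -> `|comb v (p (L u)) - L u| <= eps) ->
  (forall u, `|u - z| < delta -> 1 + \sum_i `|phi i (u - z)| <= M - 2) ->
  3 <= M -> (forall u, delta / 2 <= `|u - z| <= delta -> 2 * eps <= `|u - L u|) ->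
  \det (1%:M - \matrix_(i, j) phi j (b i)) != 0 ->
  \forall K \near \oo,
    deg_approx K (ls_set M [set u | `|u - z| < delta]) (fun x => x - p (L (comb v x))) =
    sgz (\det (1%:M - \matrix_(i, j) phi j (b i))).
Proof.
move=> delta0 Lz philin phib viz vib pL phiM M3 annulus detn.
(* Exact coordinates of [L u], available because [z] and the vectors [b i] are themselves
   centres. *)
pose a u : rV := delta_mx 0 iz + \sum_i phi i (u - z) *: delta_mx 0 (ib i).
have phi0 i : phi i 0 = 0.
  by have := philin i (-1) 0 0; rewrite scaler0 addr0 mulN1r addNr.
have phiD i u w : phi i (u + w) = phi i u + phi i w.
  by have := philin i 1 u w; rewrite scale1r mul1r.
have phiZ i c u : phi i (c *: u) = c * phi i u.
  by have := philin i c u 0; rewrite !addr0 phi0 addr0.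
have phiN i u : phi i (- u) = - phi i u by rewrite -scaleN1r phiZ mulN1r.
have combs m (F : 'I_m -> rV) : comb v (\sum_i F i) = \sum_i comb v (F i).
  elim: m F => [|m IH] F; last by rewrite !big_ord_recr combD IH.
  by rewrite !big_ord0 /comb big1// => i _; rewrite mxE scale0r.
have ca u : comb v (a u) = L u.
  rewrite combD comb_delta viz combs Lz; congr (_ + _).
  by apply: eq_bigr => i _; rewrite combZ comb_delta vib.
have nd i : `|delta_mx 0 i : rV| <= 1.
  by apply: row_norm_le => // j; rewrite mxE; case: (_ && _); rewrite ?normr1 ?normr0.
have aM u : `|u - z| < delta -> `|a u| <= M - 2.
  move=> uz; apply: le_trans (phiM u uz); rewrite (le_trans (ler_normD _ _))// lerD//.
  rewrite (le_trans (ler_norm_sum _ _ _))// ler_sum// => i _.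
  by rewrite normrZ ler_piMr.
have cphi i : continuous (phi i).
  have [k kP] := phib i; move=> u; apply/cvgrPdist_lt => e e0.
  have k1 : 0 < `|k| + 1 by rewrite ltr_wpDl.
  apply/nbhs_normP; exists (e / (`|k| + 1)); first by rewrite /= divr_gt0.
  move=> w /= uw; rewrite -phiN -phiD (le_lt_trans (kP _))//.
  rewrite (@le_lt_trans _ _ ((`|k| + 1) * `|u - w|))//.
    by rewrite ler_wpM2r// (le_trans (ler_norm k))// lerDl.
  by rewrite -ltr_pdivlMl// mulrC.
have ctr : continuous (fun u : E => u - z).
  by move=> u; apply: (@continuousB _ _ _ id (fun=> z)); [exact: cvg_id|exact: cst_continuous].
have caC : continuous a.
  apply: continuous_row_mx => j u.
  rewrite (_ : (fun _ => _) = fun u => (delta_mx 0 iz : rV) 0 j +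
      \sum_i phi i (u - z) * (delta_mx 0 (ib i) : rV) 0 j); last first.
    by apply/funext => w; rewrite mxE summxE; congr (_ + _); apply: eq_bigr => i _; rewrite mxE.
  apply: (@continuousD _ _ _ (fun=> (delta_mx 0 iz : rV) 0 j)
    (fun u => \sum_i phi i (u - z) * (delta_mx 0 (ib i) : rV) 0 j)).
    exact: cst_continuous.
  move: u; apply: continuous_big; first exact: add_continuous.
  move=> i _ u; apply: (@continuousM _ _ (fun u => phi i (u - z)) (fun=> _)).
    by apply: (@continuous_comp _ _ _ (fun u => u - z) (phi i)); [exact: ctr|exact: cphi].
  exact: cst_continuous.
have cL : continuous L.
  have -> : L = comb v \o a by apply/funext => u; rewrite /= ca.
  by move=> u; apply: continuous_comp; [exact: caC|exact: continuous_comb].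
have H1 : \forall K \near \oo,
    deg_approx K (ls_set M [set u | `|u - z| < delta]) (fun x => x - p (L (comb v x))) =
    deg_approx K (ls_set M [set u | `|u - z| < delta]) (fun x => x - a (comb v x)).
  have H : \forall K \near \oo,
      deg_approx K (ls_set M [set u | `|u - z| < delta])
        (fun x => x - ((1 - 0) *: p (L (comb v x)) + 0 *: a (comb v x))) =
      deg_approx K (ls_set M [set u | `|u - z| < delta])
        (fun x => x - ((1 - 1) *: p (L (comb v x)) + 1 *: a (comb v x))).
    apply: (ls_homotopy (q := fun s u => (1 - s) *: p (L u) + s *: a u)
      (C := fun _ => L) (eta := delta / 2)).
    - by rewrite divr_gt0.
    - have cs : continuous (fun p : R * E => p.1) by move=> w; exact: cvg_fst.
      have cu (F : E -> rV) : continuous F -> continuous (fun p : R * E => F p.2).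
        by move=> cF w; apply: (@continuous_comp _ _ _ snd F); [exact: cvg_snd|exact: cF].
      have cpL : continuous (p \o L).
        by move=> u; apply: continuous_comp; [exact: cL|exact: cp].
      have c1 := cu _ cpL; have c2 := cu _ caC.
      move=> w; apply: (@continuousD _ _ _ (fun p0 : R * E => (1 - p0.1) *: p (L p0.2))
        (fun p0 => p0.1 *: a p0.2)).
        apply: (@cvgZ _ _ _ _ _ (fun p0 : R * E => 1 - p0.1) (fun p0 => p (L p0.2))
          (1 - w.1) (p (L w.2))); last exact: c1.
        by apply: cvgB; [exact: cvg_cst|exact: cvg_fst].
      by apply: (@cvgZ _ _ _ _ _ (fun p0 : R * E => p0.1) (fun p0 => a p0.2) w.1 (a w.2));
        [exact: cs|exact: c2].
    - move=> s u /andP[s0 s1] uz; rewrite combD !combZ ca.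
      rewrite (_ : _ - L u = (1 - s) *: (comb v (p (L u)) - L u)); last first.
        by rewrite scalerBr -addrA; congr (_ + _); rewrite scalerBl scale1r opprB.
      rewrite normrZ ger0_norm ?subr_ge0// (le_trans _ (pL u uz))//.
      by rewrite ler_piMl// gerBl.
    - move=> s u /andP[s0 s1] uz; rewrite (le_trans (ler_normD _ _))// !normrZ.
      rewrite !ger0_norm ?subr_ge0//; have := aM u uz; have := p1 (L u) => h1 h2.
      have h3 : (1 - s) * `|p (L u)| <= (1 - s) * 1 by rewrite ler_wpM2l ?subr_ge0.
      have h4 : s * `|a u| <= s * (M - 2) by rewrite ler_wpM2l.
      have h5 : 0 <= (1 - s) * (M - 3) by rewrite mulr_ge0 ?subr_ge0.
      by move: h3 h4 h5; rewrite !mulrBr !mulrBl; lra.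
    - move=> s u w _ uz /negP; rewrite -leNgt => wz wu; apply: annulus.
      rewrite (ltW uz) andbT leNgt; apply/negP => uz2.
      have : `|w - z| < delta.
        rewrite -(subrK u w) -addrA (le_lt_trans (ler_normD _ _))// (splitr delta).
        by rewrite ltrD.
      by rewrite ltNge wz.
  apply: filterS H => K.
  rewrite (_ : (fun x => x - (_ + 0 *: _)) = fun x => x - p (L (comb v x))); last first.
    by apply/funext => x; rewrite subr0 scale1r scale0r addr0.
  move=> ->; congr (deg_approx _ _ _); apply/funext => x.
  by rewrite subrr scale0r scale1r add0r.
(* In coordinates the map has matrix [1 - A B], of the size of the net; its determinant equals that
   of [1 - B A], of the size of the rank. *)
pose A : 'M[R]_(N.+1, n) := \matrix_(k, i) phi i (v k).
pose B : 'M[R]_(n, N.+1) := \matrix_(i, l) (l == ib i)%:R.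
pose x1 : rV := delta_mx 0 iz.
have BA : B *m A = \matrix_(i, j) phi j (b i).
  apply/matrixP => i j; rewrite !mxE (bigD1 (ib i))//= big1 ?addr0 => [|k ki].
    by rewrite !mxE eqxx mul1r vib.
  by rewrite !mxE (negPf ki) mul0r.
have phic i y : phi i (comb v y) = (y *m A) 0 i.
  rewrite /comb (big_morph (phi i) (phiD i) (phi0 i)) mxE.
  by apply: eq_bigr => k _; rewrite phiZ mxE.
have EH x : x - a (comb v x) = (x - x1) *m (1%:M - A *m B).
  rewrite mulmxBr mulmx1 /a opprD addrA; congr (_ - _).
  rewrite mulmxA; apply/rowP => l; rewrite summxE mxE; apply: eq_bigr => i _.
  by rewrite -viz -(comb_delta v iz) -combB phic !mxE eq_sym.
have [k k0 kx] := comb_le v.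
have H2 := @deg_linear R N (ls_set M [set u | `|u - z| < delta]) x1
  (1%:M - A *m B) (Num.min (delta / k) 1) M.
have {}H2 : \forall K \near \oo,
    deg_approx K (ls_set M [set u | `|u - z| < delta])
      (fun x => (x - x1) *m (1%:M - A *m B)) = sgz (\det (1%:M - \matrix_(i, j) phi j (b i))).
  rewrite -BA -det_1BmulC; apply: H2; first by rewrite lt_min divr_gt0//=.
  - by move=> x [_ /ltW].
  - move=> x; rewrite lt_min => /andP[xd xx]; split.
      rewrite /= -viz -(comb_delta v iz) -combB (le_lt_trans (kx _))//.
      by rewrite -ltr_pdivlMl// mulrC.
    have := nd iz; have := ler_normD (x - x1) x1; rewrite subrK -/x1; lra.
  - by rewrite det_1BmulC BA.
apply: filterS2 H1 H2 => K -> <-.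
by rewrite (_ : (fun x => _) = (fun x => (x - x1) *m (1%:M - A *m B)))//; apply/funext.
Qed.

End FixedCenters.

(* Local data at a fixed point [z] of [C]: a compact homotopy, with [z] as its
   only fixed point near [z], to an affine map of finite rank. *)
Record ls_datum := LsDatum {
  ls_rank : nat;
  ls_form : 'I_ls_rank -> E -> R;
  ls_vec : 'I_ls_rank -> E;
  ls_path : R -> E -> E;
  ls_radius : R }.

Definition ls_mx (D : ls_datum) : 'M[R]_(ls_rank D) :=
  1%:M - \matrix_(i, j) ls_form j (ls_vec i).

Definition ls_datum_at (C : E -> E) (z : E) (D : ls_datum) : Prop :=
  [/\ 0 < ls_radius D, continuous (fun p : R * E => ls_path D p.1 p.2),
      has_nets [set ls_path D s u | s in I01 & u in [set u | `|u - z| <= ls_radius D]],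
      (forall s u, 0 <= s <= 1 -> `|u - z| <= ls_radius D ->
         ls_path D s u = u -> u = z) &
      [/\ forall u, ls_path D 0 u = C u,
          forall u, ls_path D 1 u = z + \sum_i @ls_form D i (u - z) *: @ls_vec D i,
          forall i c u w, @ls_form D i (c *: u + w) = c * ls_form i u + ls_form i w,
          forall i, exists k, forall u, `|@ls_form D i u| <= k * `|u| &
          \det (ls_mx D) != 0]].

Definition ls_index (C : E -> E) (z : E) (d : int) : Prop :=
  exists D, ls_datum_at C z D /\ d = sgz (\det (ls_mx D)).

Lemma closed_annulus (z : E) (a b : R) : closed [set u : E | a <= `|u - z| <= b].
Proof.
have cn : continuous (fun u : E => `|u - z|).
  move=> u; apply: (@continuous_comp _ _ _ (fun u => u - z) Num.norm).
    by apply: (@continuousB _ _ _ id (fun=> z)); [exact: cvg_id|exact: cst_continuous].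
  exact: norm_continuous.
have -> : [set u : E | a <= `|u - z| <= b] =
    (fun u => `|u - z|) @^-1` [set x | a <= x] `&` (fun u => `|u - z|) @^-1` [set x | x <= b].
  by apply/seteqP; split=> u /=; [move=> /andP[]|move=> [-> ->]].
apply: closedI; apply: preimage_closed => [u _|]; [exact: cn|exact: closed_ge|exact: cn|exact: closed_le].
Qed.

(** One finite set of centres, fine enough for the global homotopy and for all local ones and
    containing the fixed points and the vectors of the data, turns every index into a degree in the
    same coordinate space. There, additivity and homotopy invariance of the grid degree give the
    equality. *)
Theorem ls_invariance (C : R -> E -> E) (rho : R) (I : bool -> finType)
    (z : forall t, I t -> E) (d : forall t, I t -> int) :
  continuous (fun p : R * E => C p.1 p.2) ->
  has_nets [set C s u | s in I01 & u in [set u | `|u| <= rho + 1]] ->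
  (forall s u, 0 <= s <= 1 -> C s u = u -> `|u| < rho) ->
  (forall t, injective (z t)) ->
  (forall (t : bool) u, C (t : nat)%:R u = u <-> exists i, u = z t i) ->
  (forall (t : bool) i, ls_index (C (t : nat)%:R) (z t i) (d t i)) ->
  \sum_i d false i = \sum_i d true i.
Proof.
move=> cC nC bC zinj zC zd.
have t01 (t : bool) : 0 <= ((t : nat)%:R : R) <= 1 by case: t => /=; rewrite lexx ler01.
pose J := {t : bool & I t}.
pose zJ (j : J) := z (tag j) (tagged j).
have [D HD] := choice (fun j : J => zd (tag j) (tagged j)).
have DC (j : J) : ls_datum_at (C (tag j : nat)%:R) (zJ j) (D j) by have [] := HD j.
have dD (j : J) : d (tag j) (tagged j) = sgz (\det (ls_mx (D j))) by have [] := HD j.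
have zrho (j : J) : `|zJ j| < rho.
  by apply: (bC (tag j : nat)%:R) => //; apply/zC; exists (tagged j).
have [dl1 dl10 Hdl1] : exists2 c : R, 0 < c & forall j, c <= ls_radius (D j).
  by apply: fin_pos_lb => j; have [] := DC j.
have [dl2 dl20 Hdl2] : exists2 c : R, 0 < c & forall jj : J * J,
    c <= if zJ jj.1 == zJ jj.2 then 1 else `|zJ jj.1 - zJ jj.2| / 2.
  apply: fin_pos_lb => -[j j'] /=; case: eqVneq => // zz.
  by rewrite divr_gt0// normr_gt0 subr_eq0.
(* A common radius: at most the radii of the data, at most half the distances between fixed points,
   and at most 1 so that the balls stay in [|u| < rho + 1]. *)
pose dl := Num.min dl1 (Num.min dl2 1).
have dl0 : 0 < dl by rewrite !lt_min dl10 dl20 ltr01.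
have dlr (j : J) : dl <= ls_radius (D j) by rewrite ge_min Hdl1.
have dl_1 : dl <= 1 by rewrite !ge_min lexx !orbT.
have dlz t (i i' : I t) u : `|u - z t i| < dl -> `|u - z t i'| < dl -> i = i'.
  move=> ui ui'; apply: zinj; apply/eqP; apply: contraT => zz.
  have := Hdl2 (Tagged I i, Tagged I i'); rewrite /zJ /= (negPf zz).
  rewrite ler_pdivlMr// => h; have : dl <= dl2 by rewrite !ge_min lexx orbT.
  have := ler_distD u (z t i) (z t i'); rewrite (distrC (z t i) u); lra.
have mem01 s : 0 <= s <= 1 -> I01 s by [].
have [e1 e10 He1] : exists2 e, 0 < e & forall s u, 0 <= s <= 1 ->
    rho <= `|u - 0| <= rho + 1 -> e <= `|u - C s u|.
  apply: compact_homotopy_lb => //; first exact: closed_annulus.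
    apply: has_netsS nC => _ [s s01 [u /= /andP[_ u1] <-]]; exists s => //; exists u => //.
    by rewrite /= -(subr0 u).
  move=> s u s01 /= /andP[ru _] /(bC s u s01); rewrite subr0 in ru.
  by rewrite ltNge ru.
have [e2 e20 He2] : exists2 e, 0 < e & forall (t : bool) u, `|u| <= rho + 1 ->
    (forall i, dl <= `|u - z t i|) -> e <= `|u - C (t : nat)%:R u|.
  have He (t : bool) : exists2 e, 0 < e & forall (s : R) u, 0 <= s <= 1 ->
      [set u | `|u - 0| <= rho + 1 /\ forall i, dl <= `|u - z t i|] u ->
      e <= `|u - C (t : nat)%:R u|.
    apply: (compact_homotopy_lb (C := fun _ => C (t : nat)%:R)).
    - have -> : [set u | `|u - 0| <= rho + 1 /\ forall i, dl <= `|u - z t i|] =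
          [set u | 0 <= `|u - 0| <= rho + 1] `&`
          \bigcap_(i in [set: I t]) [set u | dl <= `|u - z t i|].
        apply/seteqP; split=> u /=; first by move=> [-> H]; rewrite normr_ge0; split=> // i _ /=.
        by move=> [/andP[_ ->] H]; split=> // i; exact: H.
      apply: closedI; first exact: closed_annulus.
      apply: closed_bigI => i _.
      have cn : continuous (fun u : E => `|u - z t i|).
        move=> u; apply: (@continuous_comp _ _ _ (fun u => u - z t i) Num.norm).
          by apply: (@continuousB _ _ _ id (fun=> z t i)); [exact: cvg_id|exact: cst_continuous].
        exact: norm_continuous.
      have -> : [set u | dl <= `|u - z t i|] = (fun u => `|u - z t i|) @^-1` [set x | dl <= x] by [].
      by apply: preimage_closed => [u _|]; [exact: cn|exact: closed_ge].
    - move=> p; apply: (@continuous_comp _ _ _ (fun p : R * E => ((t : nat)%:R : R, p.2))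
        (fun p : R * E => C p.1 p.2) p); last exact: cC.
      have h1 : (fun p : R * E => ((t : nat)%:R : R)) @ p --> ((t : nat)%:R : R) by exact: cvg_cst.
      have h2 : (fun p : R * E => p.2) @ p --> p.2 by exact: cvg_snd.
      exact: (cvg_pair h1 h2).
    - apply: has_netsS nC => _ [s s01 [u /= [u1 _] <-]].
      by exists (t : nat)%:R => //; exists u => //; rewrite /= -(subr0 u).
    - move=> s u _ /= [_ ud] /zC[i ui]; have := ud i.
      by rewrite ui subrr normr0 leNgt dl0.
  have [e He'] := choice (fun t => let: ex_intro2 e h1 h2 := He t in ex_intro
    (fun e => 0 < e /\ forall s u, 0 <= s <= 1 -> _ -> e <= `|u - C (t : nat)%:R u|) e (conj h1 h2)).
  exists (Num.min (e false) (e true)); first by rewrite lt_min !(proj1 (He' _)).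
  move=> t u u1 uz; have := proj2 (He' t) 0 u; rewrite /= lexx ler01 subr0.
  move=> /(_ isT (conj u1 uz)); apply: le_trans.
  by case: t {uz}; rewrite ge_min lexx ?orbT.
have [e3 e30 He3] : exists2 e, 0 < e & forall j s u, 0 <= s <= 1 ->
    dl / 2 <= `|u - zJ j| <= dl -> e <= `|u - ls_path (D j) s u|.
  have He j : exists e, 0 < e /\ forall s u, 0 <= s <= 1 ->
      dl / 2 <= `|u - zJ j| <= dl -> e <= `|u - ls_path (D j) s u|.
    have [r0 cQ nQ zQ _] := DC j.
    have [] := @compact_homotopy_lb _ _ (ls_path (D j)) [set u | dl / 2 <= `|u - zJ j| <= dl].
    - exact: closed_annulus.
    - exact: cQ.
    - apply: has_netsS nQ => _ [s s01 [u /= /andP[_ u1] <-]]; exists s => //; exists u => //=.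
      exact: le_trans u1 (dlr j).
    - move=> s u s01 /= /andP[du ud] /(zQ s u s01 (le_trans ud (dlr j))) uz.
      by move: du; rewrite uz subrr normr0 leNgt divr_gt0.
    - by move=> e e0 H; exists e.
  have [e He'] := choice He.
  have [c c0 ce] := fin_pos_lb (fun j => proj1 (He' j)).
  by exists c => // j s u s01 uj; exact: le_trans (ce j) (proj2 (He' j) s u s01 uj).
(* The displacement is at least [e1] near the outer sphere, [e2] off the fixed points at the two
   ends, [e3] on the annuli of the local homotopies. Half of the least bound is the error allowed to
   the Schauder projection. *)
pose eps := Num.min e1 (Num.min e2 e3) / 2.
have eps0 : 0 < eps by rewrite divr_gt0// !lt_min e10 e20.
have eps1 : 2 * eps <= e1 by rewrite /eps mulrC divfK// ge_min lexx.
have eps2 : 2 * eps <= e2 by rewrite /eps mulrC divfK// !ge_min lexx orbT.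
have eps3 : 2 * eps <= e3 by rewrite /eps mulrC divfK// !ge_min lexx !orbT.
pose A : set E := [set w | exists o : option J,
  (if o is Some j then [set ls_path (D j) s u | s in I01 & u in [set u | `|u - zJ j| <= dl]]
   else [set C s u | s in I01 & u in [set u | `|u| <= rho + 1]]) w].
have nA : has_nets A.
  apply: has_nets_bigU => -[j|] //; have [_ _ nQ _ _] := DC j.
  apply: has_netsS nQ => _ [s s01 [u /= u1 <-]]; exists s => //; exists u => //=.
  exact: le_trans u1 (dlr j).
have eps20 : 0 < eps / 2 by rewrite divr_gt0.
have [net Hnet] := nA _ eps20.
pose cs : seq E := net ++ [seq zJ j | j : J] ++ flatten [seq codom (@ls_vec (D j)) | j : J].
pose v (i : 'I_(size cs).+1) : E := nth 0 cs i.
have vP w : w \in cs -> exists i, v i = w.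
  move=> wcs; have wi : (index w cs < (size cs).+1)%N by rewrite ltnS index_size.
  by exists (Ordinal wi); rewrite /v /= nth_index.
pose p := schauder v (eps / 2).
have cp : continuous p by exact: continuous_schauder.
have p1 u : `|p u| <= 1 by exact: schauder_le1.
have pA u : A u -> `|comb v (p u) - u| <= eps.
  move=> /Hnet[w wn uw]; have [|i vi] := vP w; first by rewrite mem_cat wn.
  have -> : eps = 2 * (eps / 2) by rewrite mulrC divfK.
  by apply: schauder_approx => //; exists i; rewrite vi.
have Hz (j : J) : exists k, v k = zJ j.
  apply: vP; rewrite !mem_cat; apply/orP; right; apply/orP; left.
  by apply/mapP; exists j => //; rewrite mem_enum.
have [iz Hiz] := choice Hz.
have Hb (j : J) (i : 'I_(ls_rank (D j))) : exists k, v k = @ls_vec (D j) i.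
  apply: vP; rewrite !mem_cat; apply/orP; right; apply/orP; right.
  apply/flattenP; exists (codom (@ls_vec (D j))); last exact: codom_f.
  by apply/mapP; exists j => //; rewrite mem_enum.
have HM (j : J) : exists c, 0 <= c /\ forall u, `|u - zJ j| < dl ->
    1 + \sum_i `|@ls_form (D j) i (u - zJ j)| <= c.
  have [_ _ _ _ [_ _ _ fb _]] := DC j; have [k Hk] := choice fb.
  exists (1 + \sum_i `|k i| * dl); split.
    by rewrite addr_ge0// sumr_ge0// => i _; rewrite mulr_ge0// ltW.
  move=> u uz; rewrite lerD2l ler_sum// => i _; rewrite (le_trans (Hk i _))//.
  rewrite (@le_trans _ _ (`|k i| * `|u - zJ j|))//; first by rewrite ler_wpM2r// ler_norm.
  by rewrite ler_wpM2l// ltW.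
have [M0 HM0] := choice HM.
(* [M - 2] bounds the exact coordinates of the affine end maps, and also the Schauder coordinates,
   whose norm is at most 1. *)
pose M := 3 + \sum_j M0 j.
have M3 : 3 <= M by rewrite lerDl sumr_ge0// => j _; exact: (proj1 (HM0 j)).
have M0M j : M0 j <= M - 2.
  rewrite /M (bigD1 j)//= [leRHS](_ : _ = M0 j + (1 + \sum_(i | i != j) M0 i)); last by ring.
  by rewrite lerDl addr_ge0// sumr_ge0// => i _; exact: (proj1 (HM0 i)).
pose U := [set u : E | `|u| < rho + 1].
pose deg K (V : set E) (Q : E -> E) := deg_approx K (ls_set v M V) (fun x => x - p (Q (comb v x))).
have Hglob : \forall K \near \oo, deg K U (C 0) = deg K U (C 1).
  apply: (ls_homotopy eps0 (q := fun s u => p (C s u)) (C := C) (eta := 1)) => //.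
  - by move=> w; apply: (@continuous_comp _ _ _ (fun p : R * E => C p.1 p.2) p);
      [exact: cC|exact: cp].
  - move=> s u s01 Uu; apply: pA; exists None; exists s => //; exists u => //=; exact: ltW.
  - by move=> s u s01 Uu; rewrite (le_trans (p1 _))//; lra.
  - move=> s u w s01 Uu /negP; rewrite -leNgt => nUw wu.
    rewrite (le_trans eps1)// He1// subr0 (ltW Uu) andbT.
    by have := lerB_dist w u; lra.
have Hsum (t : bool) : \forall K \near \oo, deg K U (C (t : nat)%:R) =
    \sum_i deg K [set u | `|u - z t i| < dl] (C (t : nat)%:R).
  apply: (@ls_additive _ v eps eps0 (I t) M U (fun i => [set u | `|u - z t i| < dl])
    (fun u => p (C (t : nat)%:R u)) (C (t : nat)%:R)).
  - move=> u; apply: (@continuous_comp _ _ _ (C (t : nat)%:R) p); last exact: cp.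
    apply: (@continuous_comp _ _ _ (fun u => ((t : nat)%:R : R, u)) (fun p : R * E => C p.1 p.2) u);
      last exact: cC.
    have h1 : (fun u : E => ((t : nat)%:R : R)) @ u --> ((t : nat)%:R : R) by exact: cvg_cst.
    exact: (cvg_pair h1 (@cvg_id _ (nbhs u))).
  - move=> u Uu; apply: pA; exists None; exists (t : nat)%:R; first exact: t01.
    by exists u => //=; exact: ltW.
  - move=> i u /= ui; rewrite /U /= -[u](subrK (z t i)) (le_lt_trans (ler_normD _ _))//.
    by rewrite addrC ltr_leD ?(zrho (Tagged I i))// (le_trans (ltW ui)).
  - by move=> i j u; exact: dlz.
  - move=> u Uu; have [[i ui]|/forallNP H] := pselect (exists i, `|u - z t i| < dl).
      by left; exists i.
    right; rewrite (le_trans eps2)// He2 ?(ltW Uu)// => i; rewrite leNgt; exact/negP/H.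
have Hloc (j : J) : \forall K \near \oo, deg K [set u | `|u - zJ j| < dl] (C (tag j : nat)%:R) =
    d (tag j) (tagged j).
  have [r0 cQ nQ zQ [Q0 Q1 flin fb dt]] := DC j.
  have Hpath : \forall K \near \oo, deg K [set u | `|u - zJ j| < dl] (ls_path (D j) 0) =
      deg K [set u | `|u - zJ j| < dl] (ls_path (D j) 1).
    apply: (ls_homotopy eps0 (q := fun s u => p (ls_path (D j) s u)) (C := ls_path (D j))
      (eta := dl / 2)) => //.
    - by rewrite divr_gt0.
    - by move=> w; apply: (@continuous_comp _ _ _ (fun p : R * E => ls_path (D j) p.1 p.2) p);
        [exact: cQ|exact: cp].
    - move=> s u s01 uz; apply: pA; exists (Some j); exists s => //; exists u => //=; exact: ltW.
    - by move=> s u s01 _; rewrite (le_trans (p1 _))//; lra.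
    - move=> s u w s01 uz /negP; rewrite -leNgt => wz wu.
      rewrite (le_trans eps3)// He3// (ltW uz) andbT leNgt; apply/negP => uz2.
      have : `|w - zJ j| < dl.
        rewrite -(subrK u w) -addrA (le_lt_trans (ler_normD _ _))// (splitr dl).
        by rewrite ltrD.
      by rewrite ltNge wz.
  have [ib Hib'] := choice (Hb j).
  have Hend : \forall K \near \oo, deg K [set u | `|u - zJ j| < dl] (ls_path (D j) 1) =
      sgz (\det (ls_mx (D j))).
    apply: (ls_affine eps0 cp p1 (iz := iz j) (ib := ib)) => //.
    - move=> u uz; apply: pA; exists (Some j); exists 1; first by rewrite /= ler01 lexx.
      by exists u => //=; exact: ltW.
    - by move=> u uz; exact: le_trans (proj2 (HM0 j) u uz) (M0M j).
    - by move=> u uz; rewrite (le_trans eps3)// He3// ler01 lexx.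
  apply: filterS2 Hpath Hend => K h1 h2; rewrite dD -h2 -h1; congr deg_approx.
  by apply/funext => x; rewrite Q0.
have Hall (t : bool) : \forall K \near \oo, deg K U (C (t : nat)%:R) = \sum_i d t i.
  have H : \forall K \near \oo, forall i : I t,
      deg K [set u | `|u - z t i| < dl] (C (t : nat)%:R) = d t i.
    by apply: filter_forall => i; exact: (Hloc (Tagged I i)).
  by apply: filterS2 (Hsum t) H => K -> h; apply: eq_bigr => i _; exact: h.
have [K [[h0 h1] h]] := filter_ex (filterI (filterI (Hall false) (Hall true)) Hglob).
by rewrite -h0 -h1.
Qed.

End LeraySchauder.

Section LinearMaps.
Variables (R : realType) (E F : normedModType R).
Implicit Types f : E -> F.

Lemma linear_fun0 (f : E -> F) : linear f -> f 0 = 0.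
Proof. by move=> lf; have := lf (-1) 0 0; rewrite scaler0 addr0 scaleN1r addNr. Qed.

Lemma linear_funD (f : E -> F) : linear f -> {morph f : u w / u + w}.
Proof. by move=> lf u w; have := lf 1 u w; rewrite !scale1r. Qed.

Lemma linear_funZ (f : E -> F) : linear f -> forall c, {morph f : u / c *: u}.
Proof.
by move=> lf c u; have := lf c u 0; rewrite !addr0 (linear_fun0 lf) addr0.
Qed.

Lemma linear_funN (f : E -> F) : linear f -> {morph f : u / - u}.
Proof. by move=> lf u; rewrite -scaleN1r (linear_funZ lf) scaleN1r. Qed.

Lemma linear_funB (f : E -> F) : linear f -> {morph f : u w / u - w}.
Proof. by move=> lf u w; rewrite (linear_funD lf) (linear_funN lf). Qed.

Lemma linear_fun_sum (f : E -> F) : linear f ->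
  forall I (r : seq I) (P : pred I) (G : I -> E),
  f (\sum_(i <- r | P i) G i) = \sum_(i <- r | P i) f (G i).
Proof. by move=> lf I r P G; rewrite (big_morph f (linear_funD lf) (linear_fun0 lf)). Qed.

Lemma linear_continuous_bounded (f : E -> F) : linear f -> continuous f ->
  exists2 k, 0 < k & forall u, `|f u| <= k * `|u|.
Proof.
move=> lf cf; have /cvgrPdist_lt/(_ 1 ltr01)/nbhs_normP[d /= d0 Hd] := cf 0.
exists (2 / d); first by rewrite divr_gt0.
move=> u; have [->|u0] := eqVneq u 0; first by rewrite linear_fun0// !normr0 mulr0.
have nu : 0 < `|u| by rewrite normr_gt0.
have c0 : 0 < d / 2 / `|u| by rewrite !divr_gt0.
have := Hd ((d / 2 / `|u|) *: u); rewrite /= sub0r normrN normrZ gtr0_norm//.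
rewrite divfK ?gt_eqF// linear_fun0// sub0r normrN linear_funZ// normrZ gtr0_norm//.
rewrite ltr_pdivrMr// ltr_pMr// ltr1n => /(_ isT) /ltW h.
rewrite -(ler_pM2l c0) (le_trans h)// [leRHS](_ : _ = 1)//.
by field; rewrite !gt_eqF.
Qed.

Lemma bounded_linear_continuous (f : E -> F) k : linear f ->
  (forall u, `|f u| <= k * `|u|) -> continuous f.
Proof.
move=> lf fk u; apply/cvgrPdist_lt => e e0.
have k1 : 0 < `|k| + 1 by rewrite ltr_wpDl.
apply/nbhs_normP; exists (e / (`|k| + 1)); first by rewrite /= divr_gt0.
move=> w /= uw; rewrite -linear_funB// (le_lt_trans (fk _))//.
rewrite (@le_lt_trans _ _ ((`|k| + 1) * `|u - w|))//.
  by rewrite ler_wpM2r// (le_trans (ler_norm k))// lerDl.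
by rewrite -ltr_pdivlMl// mulrC.
Qed.

End LinearMaps.

(** * Compact operators: open mapping theorem and Riesz theory *)

Section CompactMaps.
Variables (R : realType) (E F : completeNormedModType R).

Lemma compact_has_nets (G : normedModType R) (A : set G) : compact A -> has_nets A.
Proof.
move=> cA e e0; move: cA; rewrite compact_cover => /(_ G A (fun x => ball x e)) [].
- by move=> x _; exact: ball_open.
- by move=> x Ax; exists x => //; exact: ballxx.
move=> D' _ AD; exists (finmap.enum_fset D') => x /AD[v /= vD]; rewrite -ball_normE /= => vx.
by exists v => //; rewrite distrC.
Qed.

Definition compact_map (K : E -> F) :=
  forall r, has_nets [set K u | u in [set u | `|u| <= r]].

Lemma has_netsD (A B : set F) : has_nets A -> has_nets B ->
  has_nets [set x + y | x in A & y in B].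
Proof.
move=> nA nB e e0; have e20 : 0 < e / 2 by rewrite divr_gt0.
have [s Hs] := nA _ e20; have [t Ht] := nB _ e20.
exists [seq x + y | x <- s, y <- t] => _ [x /Hs[v vs xv] [y /Ht[w wt yw] <-]].
exists (v + w); first by apply/allpairsP; exists (v, w).
by rewrite opprD addrACA (splitr e) (le_lt_trans (ler_normD _ _))// ltrD.
Qed.

Lemma compact_mapD (K L : E -> F) : compact_map K -> compact_map L ->
  compact_map (fun u => K u + L u).
Proof.
move=> cK cL r; apply: has_netsS (has_netsD (cK r) (cL r)) => _ [u ur <-].
by exists (K u); [exists u|exists (L u) => //; exists u].
Qed.

(** For independent vectors the norm of a combination controls its coefficients, by compactness of
    the unit sphere of coefficients; so bounded sets go into the image of a compact ball. *)
Lemma finite_rank_compact (A : E -> F) n : linear A -> continuous A ->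
  has_dim (range A) n -> compact_map A.
Proof.
move=> lA cA [b [fb Ab]] r; have [k k0 kA] := linear_continuous_bounded lA cA.
case: n b fb Ab => [|n] b fb Ab.
  move=> e e0; exists [:: 0] => _ [u _ <-].
  have : range A (A u) by exists u.
  rewrite Ab => -[c ->]; exists 0; first by rewrite mem_seq1.
  by rewrite big_ord0 subrr normr0.
have [c c0 Hc] : exists2 c, 0 < c & forall x : 'rV[R]_n.+1, c * `|x| <= `|comb b x|.
  have [] := @compact_pos_lb R _ [set x : 'rV[R]_n.+1 | `|x| = 1] (fun x => `|comb b x|).
  - apply: (subclosed_compact _ (compact_row_ball (B := 1))); last by move=> x /= ->.
    have -> : [set x : 'rV[R]_n.+1 | `|x| = 1] = Num.norm @^-1` [set 1] by [].
    by apply: preimage_closed => [x _|]; [exact: norm_continuous|exact: closed_eq].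
  - by move=> x _; apply: continuous_comp; [exact: continuous_comb|exact: norm_continuous].
  - move=> x /= x1; rewrite normr_gt0; apply/negP => /eqP bx.
    have x0 : x = 0 by apply/rowP => i; rewrite mxE; exact: (fb (fun i => x 0 i)).
    by move: x1; rewrite x0 normr0 => /eqP; rewrite eq_sym oner_eq0.
  move=> c c0 Hc; exists c => // x; have [->|x0] := eqVneq x 0.
    by rewrite normr0 mulr0.
  have nx : 0 < `|x| by rewrite normr_gt0.
  have := Hc (`|x|^-1 *: x); rewrite /= combZ !normrZ normfV normr_id mulVf ?gt_eqF//.
  by rewrite ler_pdivlMl// mulrC; apply.
have nets : has_nets [set comb b x | x in [set x | `|x| <= k * r / c]].
  apply: compact_has_nets; apply: continuous_compact; last exact: compact_row_ball.
  by apply: continuous_subspaceT; exact: continuous_comb.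
apply: has_netsS nets => _ [u ur <-].
have : range A (A u) by exists u.
rewrite Ab => -[x Ax]; exists (\row_i x i); last first.
  by rewrite Ax; apply: eq_bigr => i _; rewrite mxE.
have Au : A u = comb b (\row_i x i) by rewrite Ax; apply: eq_bigr => i _; rewrite mxE.
rewrite /= ler_pdivlMr// mulrC (le_trans (Hc _))// -Au (le_trans (kA u))//.
by rewrite ler_pM2l.
Qed.

(** Baire's theorem gives a set [B n] with an interior point [y]. Differences of approximations of
    [y + f] and of [y] approximate small [f], and halving the error repeatedly sums to a
    preimage. *)
Lemma open_mapping (S : E -> F) : linear S -> continuous S ->
  (forall f, exists u, S u = f) ->
  exists2 k, 0 < k & forall f, exists2 u, S u = f & `|u| <= k * `|f|.
Proof.
move=> lS cS surjS.
pose B n : set F := closure [set S u | u in [set u : E | `|u| <= n%:R]].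
have [n nD] : exists n, ~ dense (~` B n).
  apply: contrapT => /forallNP H.
  have : dense (\bigcap_n (~` B n)).
    apply: Baire => n; split; last by apply: contrapT; exact: H.
    by apply: closed_openC; exact: closed_closure.
  move=> /(_ setT) [|//|y [_ yB]]; [by exists 0|exact: openT|].
  have [u uy] := surjS y; have [n un] : exists n : nat, `|u| <= n%:R.
    by exists (Num.truncn `|u|).+1; rewrite ltW// truncnS_gt.
  by apply: (yB n I); apply: subset_closure; exists u.
have [y [r r0 yr]] : exists y, exists2 r, 0 < r & forall f, `|f| < r -> B n (y + f).
  move: nD => /existsNP[D]; move=> /not_implyP[[y Dy] /not_implyP[oD H]].
  have /nbhs_normP[r /= r0 Hr] : nbhs y D by exact: open_nbhs_nbhs.
  exists y, r => // f fr; apply: contrapT => nB; apply: H; exists (y + f); split=> //.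
  by apply: Hr; rewrite /= opprD addrA subrr sub0r normrN.
(* [f] is rescaled to norm [r / 2]. The approximate preimage is a difference of two vectors of norm
   at most [n], whence the factor [4 * n / r]; two errors below [r / 8] scale back to at most half
   of [|f|]. *)
have half f : exists u, `|u| <= (4 * n%:R / r) * `|f| /\ `|f - S u| <= `|f| / 2.
  have [->|f0] := eqVneq f 0.
    by exists 0; rewrite (linear_fun0 lS) subrr !normr0 mulr0 mul0r.
  have nf : 0 < `|f| by rewrite normr_gt0.
  pose c := r / 2 / `|f|; have c0 : 0 < c by rewrite !divr_gt0.
  have cf : `|c *: f| < r.
    by rewrite normrZ gtr0_norm// /c divfK ?gt_eqF// ltr_pdivrMr// ltr_pMr// ltr1n.
  have app g : B n g -> exists2 u, `|u| <= n%:R & `|g - S u| < r / 8.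
    move=> /(_ (ball g (r / 8))) []; first by apply: nbhsx_ballx; rewrite divr_gt0.
    by move=> _ [[u un <-]]; rewrite -ball_normE /= => gu; exists u.
  have [u1 u1n h1] := app _ (yr _ cf).
  have [u2 u2n h2] := app y ltac:(by rewrite -[y]addr0; apply: yr; rewrite normr0).
  exists (c^-1 *: (u1 - u2)); split.
    rewrite normrZ gtr0_norm ?invr_gt0//.
    have -> : 4 * n%:R / r * `|f| = c^-1 * (n%:R + n%:R).
      by rewrite /c; field; rewrite !gt_eqF.
    by rewrite ler_pM2l ?invr_gt0// (le_trans (ler_normB _ _))// lerD.
  rewrite (linear_funZ lS) (linear_funB lS).
  have -> : f - c^-1 *: (S u1 - S u2) = c^-1 *: ((y + c *: f - S u1) - (y - S u2)).
    have -> : (y + c *: f - S u1) - (y - S u2) = c *: f - (S u1 - S u2).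
      by rewrite -[y + c *: f - S u1]addrA opprD addrACA subrr add0r opprK opprB -addrA [- _ + _]addrC.
    by rewrite [RHS]scalerBr scalerA mulVf ?gt_eqF// scale1r.
  rewrite normrZ gtr0_norm ?invr_gt0//.
  have h : `|y + c *: f - S u1 - (y - S u2)| <= r / 4.
    by rewrite (le_trans (ler_normB _ _))//; move: h1 h2; lra.
  rewrite (@le_trans _ _ (c^-1 * (r / 4)))//; first by rewrite ler_pM2l ?invr_gt0.
  by rewrite le_eqVlt; apply/orP; left; apply/eqP; rewrite /c; field; rewrite !gt_eqF.
have [g Hg] := choice half.
pose k := 4 * n%:R / r; have k0 : 0 <= k by rewrite divr_ge0 ?mulr_ge0// ltW.
exists (2 * k + 1); first by rewrite ltr_wpDl// mulr_ge0.
move=> f; pose fs := fix fs m := if m is m'.+1 then fs m' - S (g (fs m')) else f.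
have fsn m : `|fs m| <= `|f| / 2 ^+ m.
  elim: m => [|m IH]; first by rewrite expr0 divr1.
  have [_ h] := Hg (fs m); rewrite (le_trans h)// ler_pdivrMr//.
  by rewrite exprS invfM mulrA [_ / 2 / _]mulrAC divfK.
have gn m : `|g (fs m)| <= k * `|f| / 2 ^+ m.
  by have [h _] := Hg (fs m); rewrite (le_trans h)// -/k -[leRHS]mulrA ler_wpM2l.
have cvs : cvgn (series (fun m => g (fs m))).
  apply: normed_cvg; apply: (@series_le_cvg _ _ (fun m => k * `|f| / 2 ^+ m)).
  - by move=> m; exact: normr_ge0.
  - by move=> m; apply: divr_ge0; [apply: mulr_ge0|apply: exprn_ge0].
  - exact: gn.
  rewrite (_ : (fun m => _) = geometric (k * `|f|) 2^-1); last first.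
    by apply/funext => m; rewrite /geometric /= exprVn.
  by apply: is_cvg_geometric_series; rewrite ger0_norm ?invr_ge0// invf_lt1// ltr1n.
pose u := limn (series (fun m => g (fs m))).
have part m : S (series (fun m => g (fs m)) m) = f - fs m.
  elim: m => [|m IH]; first by rewrite /series /= big_geq// (linear_fun0 lS) subrr.
  by rewrite seriesSr (linear_funD lS) IH /= opprB addrA [LHS]addrAC.
exists u.
  have h1 : (fun m => S (series (fun m => g (fs m)) m)) @ \oo --> S u.
    by apply: (cvg_comp _ S cvs); exact: cS.
  have h2 : (fun m => S (series (fun m => g (fs m)) m)) @ \oo --> f.
    apply/cvgrPdist_lt => e e0.
    have f1 : 0 < `|f| + 1 by rewrite ltr_wpDl.
    have : \forall m \near \oo, `|(2^-1 : R) ^+ m| < e / (`|f| + 1).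
      have : (fun m => (2^-1 : R) ^+ m) @ \oo --> (0 : R).
        by apply: cvg_expr; rewrite ger0_norm ?invr_ge0// invf_lt1// ltr1n.
      move=> /cvgrPdist_lt/(_ _ (divr_gt0 e0 f1)); apply: filterS => m.
      by rewrite sub0r normrN.
    apply: filterS => m; rewrite part subKr ger0_norm ?exprn_ge0 ?invr_ge0// => hm.
    rewrite (le_lt_trans (fsn m))// -exprVn (@le_lt_trans _ _ ((`|f| + 1) * 2^-1 ^+ m))//.
      by rewrite ler_wpM2r ?exprn_ge0 ?invr_ge0// lerDl.
    by rewrite -ltr_pdivlMl// mulrC.
  by rewrite -(cvg_lim (@norm_hausdorff _ F) h1) (cvg_lim (@norm_hausdorff _ F) h2).
have sn m : `|series (fun m => g (fs m)) m| <= (2 * k) * `|f| - 2 * (k * `|f| / 2 ^+ m).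
  elim: m => [|m IH]; first by rewrite /series /= big_geq// normr0 expr0 divr1 mulrA subrr.
  rewrite seriesSr /= (le_trans (ler_normD _ _))// (le_trans (lerD IH (gn m)))//.
  rewrite le_eqVlt; apply/orP; left; apply/eqP; rewrite exprS; field.
  by rewrite expf_neq0.
have cb : closed [set w : E | `|w| <= (2 * k + 1) * `|f|].
  have -> : [set w : E | `|w| <= (2 * k + 1) * `|f|] =
    Num.norm @^-1` [set y | y <= (2 * k + 1) * `|f|] by [].
  by apply: preimage_closed => [w _|]; [exact: norm_continuous|exact: closed_le].
apply: (closed_cvg _ cb _ u cvs).
apply: nearW => m /=; rewrite (le_trans (sn m))//.
have : 0 <= k * `|f| / 2 ^+ m.
  by apply: divr_ge0; [apply: mulr_ge0|apply: exprn_ge0].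
have := normr_ge0 f; lra.
Qed.

Section Riesz.
Variables (S0 K : E -> F) (k0 : R).
Hypotheses (lS0 : linear S0) (cS0 : continuous S0) (lK : linear K).
Hypotheses (cK : compact_map K) (K_cont : continuous K).
Hypothesis S0_lb : forall u, `|u| <= k0 * `|S0 u|.
Hypothesis S0_surj : forall f, exists u, S0 u = f.

(** Properness of [S0 + K] on bounded sets: [K u] converges by compactness, hence [S0 u] does, hence
    [u], because [S0] is bounded below. *)
Lemma riesz_cvg (T : Type) (G : set_system T) (u : T -> E) (r : R) (f : F) :
  UltraFilter G -> (forall t, `|u t| <= r) ->
  (fun t => S0 (u t) + K (u t)) @ G --> f -> exists x : E, u @ G --> x.
Proof.
move=> UG ur Suf.
have [y Kuy] : exists y : F, (K \o u) @ G --> y.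
  by apply: (has_nets_ultra (cK r) UG); apply: nearW => t; exists (u t) => //=; exact: ur.
have [x Sx] := S0_surj (f - y); exists x.
have S0u : (fun t => S0 (u t)) @ G --> f - y.
  have -> : (fun t => S0 (u t)) = (fun t => S0 (u t) + K (u t) - (K \o u) t).
    by apply/funext => t; rewrite addrK.
  exact: cvgB.
apply/cvgrPdist_lt => e e0; have k1 : 0 < `|k0| + 1 by rewrite ltr_wpDl.
move/cvgrPdist_lt : S0u => /(_ _ (divr_gt0 e0 k1)); apply: filterS => t.
rewrite -Sx -(linear_funB lS0) => h; rewrite (le_lt_trans (S0_lb _))//.
rewrite (@le_lt_trans _ _ ((`|k0| + 1) * `|S0 (x - u t)|))//.
  by rewrite ler_wpM2r// (le_trans (ler_norm k0))// lerDl.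
by rewrite -ltr_pdivlMl// mulrC.
Qed.

Hypothesis S_inj : forall u, S0 u + K u = 0 -> u = 0.

(** Unit vectors with images tending to 0 would converge to a unit vector of the kernel. *)
Lemma riesz_lb : exists2 k, 0 < k & forall u, `|u| <= k * `|S0 u + K u|.
Proof.
apply: contrapT => H.
have {}H (n : nat) : exists u, `|u| = 1 /\ `|S0 u + K u| < n.+1%:R^-1.
  apply: contrapT => /forallNP nH; apply: H; exists n.+1%:R => // u.
  have [->|u0] := eqVneq u 0; first by rewrite normr0 mulr_ge0.
  have nu : 0 < `|u| by rewrite normr_gt0.
  rewrite leNgt; apply/negP => h; apply: (nH (`|u|^-1 *: u)).
  rewrite (linear_funZ lS0) (linear_funZ lK) -scalerDr !normrZ normfV normr_id.
  by rewrite mulVf ?gt_eqF//; split=> //; rewrite ltr_pdivrMl// ltr_pdivlMr// mulrC.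
have [u Hu] := choice H.
have [G [UG oG]] := @ultraFilterLemma nat eventually _.
have Su0 : (fun n => S0 (u n) + K (u n)) @ G --> (0 : F).
  apply/cvgrPdist_lt => e e0; apply: oG; apply: filterS (near_grid 0 e0) => n [_ ne].
  by rewrite sub0r normrN (lt_trans (proj2 (Hu n))).
have [x ux] : exists x : E, u @ G --> x.
  by apply: (riesz_cvg UG (r := 1) _ Su0) => t; rewrite (proj1 (Hu t)).
have Sx : (fun n => S0 (u n) + K (u n)) @ G --> S0 x + K x.
  by apply: cvgD; [apply: (cvg_comp _ S0 ux); exact: cS0|apply: (cvg_comp _ K ux); exact: K_cont].
have x0 : x = 0.
  apply: S_inj.
  by rewrite -(cvg_lim (@norm_hausdorff _ F) Sx) (cvg_lim (@norm_hausdorff _ F) Su0).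
have : (fun n => `|u n|) @ G --> `|x| by exact: cvg_norm.
have -> : (fun n => `|u n|) = fun=> 1 by apply/funext => n; rewrite (proj1 (Hu n)).
move=> h1; have h2 : (fun _ : nat => (1 : R)) @ G --> (1 : R) by exact: cvg_cst.
have : `|x| = 1.
  by rewrite -(cvg_lim (@norm_hausdorff _ R^o) h1) (cvg_lim (@norm_hausdorff _ R^o) h2).
by rewrite x0 normr0 => /eqP; rewrite eq_sym oner_eq0.
Qed.

(* Otherwise the images of the iterates of [S0^-1 (S0 + K)] would strictly
   decrease, and Riesz's almost orthogonal vectors contradict compactness. *)
Lemma riesz_surj : forall f, exists u, S0 u + K u = f.
Proof.
have [k k_gt0 Sk] := riesz_lb; pose S u := S0 u + K u.
have lS : linear S.
  by move=> c u w; rewrite /S lS0 lK scalerDr addrACA.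
have [iS0 HiS0] := choice S0_surj.
pose T u := iS0 (S u).
have S0T u : S0 (T u) = S u by rewrite /T HiS0.
have S0inj u w : S0 u = S0 w -> u = w.
  move=> uw; apply/eqP; rewrite -subr_eq0 -normr_le0 (le_trans (S0_lb _))//.
  by rewrite (linear_funB lS0) uw subrr normr0 mulr0.
have lT : linear T.
  by move=> c u w; apply: S0inj; rewrite lS0 !S0T lS.
have [k1 k10 HS0] := linear_continuous_bounded lS0 cS0.
pose c := (k * k1)^-1; have c0 : 0 < c by rewrite invr_gt0 mulr_gt0.
have Tlb u : c * `|u| <= `|T u|.
  rewrite /c ler_pdivrMl ?mulr_gt0// (le_trans (Sk u))// -/(S u) -S0T -mulrA.
  by rewrite ler_pM2l.
pose V n := range (iter n T).
have lTn n : linear (iter n T).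
  by elim: n => [|n IH] d u w //=; rewrite IH lT.
suff TV x : exists u, T u = x.
  by move=> f; have [u Tu] := TV (iS0 f); exists u; rewrite -/(S u) -S0T Tu HiS0.
apply: contrapT => nx.
(* The range of [T] is closed, so a vector outside it is at positive distance from it. *)
have [d d0 xd] : exists2 d, 0 < d & forall u, d <= `|x - T u|.
  apply: contrapT => H.
  have {}H (n : nat) : exists u, `|x - T u| < n.+1%:R^-1.
    apply: contrapT => /forallNP nH; apply: H; exists n.+1%:R^-1; first by rewrite invr_gt0.
    by move=> u; rewrite leNgt; apply/negP/nH.
  have [u Hu] := choice H.
  have [G [UG oG]] := @ultraFilterLemma nat eventually _.
  have Tux : (T \o u) @ G --> x.
    apply/cvgrPdist_lt => e e0; apply: oG; apply: filterS (near_grid 0 e0) => n [_ ne].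
    exact: lt_trans (Hu n) ne.
  have [w uw] : exists w : E, u @ G --> w.
    apply: (@riesz_cvg _ G u (c^-1 * (`|x| + 1)) (S0 x)) => //.
      move=> n; rewrite ler_pdivlMl// (le_trans (Tlb _))//.
      have := lerB_dist (T (u n)) x; rewrite (distrC (T (u n)) x); have := Hu n.
      have : n.+1%:R^-1 <= 1 :> R by rewrite invf_le1// ler1n.
      move: (`|T (u n)|) (`|x|) (`|_ - _|) (_^-1) => a1 a2 a3 a4; lra.
    have -> : (fun t => S0 (u t) + K (u t)) = S0 \o (T \o u).
      by apply/funext => t; rewrite /= S0T.
    by apply: (cvg_comp _ S0 Tux); exact: cS0.
  apply: nx; exists w; apply: S0inj; rewrite S0T.
  have h1 : (fun n => S0 (u n) + K (u n)) @ G --> S w.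
    by apply: cvgD; [apply: (cvg_comp _ S0 uw); exact: cS0|apply: (cvg_comp _ K uw); exact: K_cont].
  have h2 : (fun n => S0 (u n) + K (u n)) @ G --> S0 x.
    have -> : (fun t => S0 (u t) + K (u t)) = S0 \o (T \o u).
      by apply/funext => t; rewrite /= S0T.
    by apply: (cvg_comp _ S0 Tux); exact: cS0.
  by rewrite -(cvg_lim (@norm_hausdorff _ F) h1) (cvg_lim (@norm_hausdorff _ F) h2).
have Tnlb n u : c ^+ n * `|u| <= `|iter n T u|.
  elim: n => [|n IH]; first by rewrite expr0 mul1r.
  by rewrite exprS -mulrA (le_trans _ (Tlb _))// ler_pM2l.
(* Riesz's lemma for [V n.+1] inside [V n]: the vector [iter n T x] is at distance at least
   [c ^+ n * d] from [V n.+1], and a nearly optimal difference is normalized. *)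
have ortho n : exists y, [/\ V n y, `|y| = 1 & forall z, V n.+1 z -> 2^-1 <= `|y - z|].
  pose D := [set r | exists2 z, V n.+1 z & r = `|iter n T x - z|].
  have D0 : D !=set0 by exists `|iter n T x - 0|, 0 => //; exists 0 => //; rewrite (linear_fun0 (lTn n.+1)).
  have Dlb r : D r -> c ^+ n * d <= r.
    move=> [_ [u _ <-] ->]; rewrite iterSr -(linear_funB (lTn n)) (le_trans _ (Tnlb _ _))//.
    by rewrite ler_pM2l ?exprn_gt0.
  have cd0 : 0 < c ^+ n * d by rewrite mulr_gt0 ?exprn_gt0.
  have hD : has_inf D by split=> //; exists (c ^+ n * d) => r /Dlb.
  have infD : c ^+ n * d <= inf D by apply: lb_le_inf => // r /Dlb.
  have infD0 : 0 < inf D by exact: lt_le_trans infD.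
  have [_ [z Vz ->] rz] : exists2 r, D r & r < 2 * inf D.
    have := inf_adherent infD0 hD; move=> [r Dr rD]; exists r => //.
    by move: rD; rewrite mulr_natl mulr2n.
  set y := iter n T x - z in rz; have y0 : 0 < `|y|.
    by apply: lt_le_trans cd0 _; apply: Dlb; exists z.
  have Vy : V n y.
    have [u _ zu] := Vz; exists (x - T u) => //.
    by rewrite (linear_funB (lTn n)) /y -zu -iterSr.
  exists (`|y|^-1 *: y); split.
  - by have [u _ uy] := Vy; exists (`|y|^-1 *: u) => //; rewrite (linear_funZ (lTn n)) uy.
  - by rewrite normrZ normfV normr_id mulVf// gt_eqF.
  - move=> w Vw; have -> : `|y|^-1 *: y - w = `|y|^-1 *: (y - `|y| *: w).
      by rewrite [RHS]scalerBr scalerA mulVf ?gt_eqF// scale1r.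
    rewrite normrZ normfV normr_id ler_pdivlMl//.
    have h : inf D <= `|y - `|y| *: w|.
      apply: inf_lbound; first by exists (c ^+ n * d) => r /Dlb.
      exists (z + `|y| *: w); last by rewrite /y opprD addrA.
      have [u1 _ <-] := Vz; have [u2 _ <-] := Vw; exists (u1 + `|y| *: u2) => //.
      by rewrite (linear_funD (lTn n.+1)) (linear_funZ (lTn n.+1)).
    by move: rz h; lra.
have [y Hy] := choice ortho.
have VS m n z : (m <= n)%N -> V n z -> V m z.
  move=> mn [u _ <-]; exists (iter (n - m) T u) => //.
  by rewrite -iterD subnKC.
(* Since [K u = S0 (T u - u)] and [T] maps [V m] into [V m.+1], the vector [K (y n) - K (y m)] is
   the image under [S0] of [y m] minus an element of [V m.+1]. *)
have sep m n : (m < n)%N -> 2^-1 <= (`|k0| + 1) * `|K (y m) - K (y n)|.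
  move=> mn; have [Vm ym1 Hm] := Hy m; have [Vn yn1 _] := Hy n.
  have Vz : V m.+1 (T (y m) - (T (y n) - y n)).
    have [u1 _ e1] := Vm; have [u2 _ e2] := VS m.+1 n _ mn Vn.
    exists (u1 - (T u2 - u2)) => //.
    by rewrite !(linear_funB (lTn m.+1)) -[iter _ _ (T u2)]iterSr [iter m.+2 _ _]iterS e2 iterS e1.
  have KS u : K u = S0 (T u - u) by rewrite (linear_funB lS0) S0T /S addrC addKr.
  rewrite (le_trans (Hm _ Vz))// (le_trans (S0_lb _))//.
  rewrite (_ : S0 _ = - (K (y m) - K (y n))); last first.
    rewrite !KS -(linear_funB lS0) -(linear_funN lS0); congr S0.
    by rewrite !opprB addrA addrAC [in RHS]addrC; congr (_ + _); rewrite addrC.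
  by rewrite normrN ler_wpM2r// (le_trans (ler_norm k0))// lerDl.
have k1' : 0 < `|k0| + 1 by rewrite ltr_wpDl.
have e0 : 0 < (4 * (`|k0| + 1))^-1 by rewrite invr_gt0 mulr_gt0.
have [s Hs] := cK 1 e0.
have Hcl (i : 'I_(size s).+1) : exists k : 'I_(size s),
    `|K (y i) - s`_k| < (4 * (`|k0| + 1))^-1.
  have [_ yi1 _] := Hy i.
  have [|v vs Kv] := Hs (K (y i)); first by exists (y i) => //=; rewrite yi1.
  have vi : (index v s < size s)%N by rewrite index_mem.
  by exists (Ordinal vi); rewrite /= nth_index.
have {Hcl} [cl Hcl] := choice Hcl.
have /injectivePn[i [i' ii' cii]] : ~~ injectiveb cl.
  by apply/negP => /injectiveP /leq_card; rewrite !card_ord ltnn.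
wlog lt_ii : i i' ii' cii / (i < i')%N => [H|].
  have [|] := ltnP i i'; first exact: H ii' cii.
  rewrite leq_eqVlt => /orP[/eqP/val_inj e|]; first by move: ii'; rewrite e eqxx.
  by apply: H => //; rewrite eq_sym.
have := sep _ _ lt_ii; apply/negP; rewrite -ltNge.
have h : `|K (y i) - K (y i')| < 2 * (4 * (`|k0| + 1))^-1.
  rewrite -(subrK s`_(cl i) (K (y i))) -addrA (le_lt_trans (ler_normD _ _))//.
  by rewrite mulr_natl mulr2n ltrD// cii distrC.
rewrite (@lt_le_trans _ _ ((`|k0| + 1) * (2 * (4 * (`|k0| + 1))^-1)))//.
  by rewrite ltr_pM2l.
rewrite le_eqVlt; apply/orP; left; apply/eqP; field; rewrite gt_eqF//.
Qed.

End Riesz.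
End CompactMaps.

(** * Elliptic operators with a potential *)

Module EllipticPair.

(* The structure of the pair [C^{m,a}], [C^{m-2,a}] that the proof uses: [ip] is
   the inner product of [L^2] and [ex f] is [e^{2f}]. The last clause is the
   ellipticity of [lap], in the form in which an orientation provides it. *)
Record elliptic (R : realType) (E F : completeNormedModType R) := Elliptic {
  emb : E -> F;
  lap : E -> F;
  ip : F -> F -> R;
  mul : F -> F -> F;
  ex : F -> F;
  one : F;
  cst1 : E;
  emb_lin : linear emb;
  emb_inj : forall u, emb u = 0 -> u = 0;
  emb_cont : continuous emb;
  emb_cpt : compact_map emb;
  lap_lin : linear lap;
  lap_cont : continuous lap;
  ip_lin : forall g c f f', ip (c *: f + f') g = c * ip f g + ip f' g;
  ip_sym : forall f g, ip f g = ip g f;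
  ip_ge0 : forall f, 0 <= ip f f;
  ip_eq0 : forall f, ip f f = 0 -> f = 0;
  ip_bnd : exists2 k, 0 < k & forall f g, `|ip f g| <= k * (`|f| * `|g|);
  lap_sym : forall u w, ip (lap u) (emb w) = ip (emb u) (lap w);
  lap_neg : forall u, ip (lap u) (emb u) <= 0;
  mul_lin : forall f, linear (mul f);
  mulC : forall f g, mul f g = mul g f;
  mulA : forall f g h, mul f (mul g h) = mul (mul f g) h;
  mul1 : forall f, mul one f = f;
  mul_bnd : exists2 k, 0 < k & forall f g, `|mul f g| <= k * (`|f| * `|g|);
  ip_mul : forall f g h, ip (mul f g) h = ip g (mul f h);
  ip_mul_bnd : exists2 k, 0 < k & forall f g, `|ip (mul f g) g| <= k * `|f| * ip g g;
  emb_cst1 : emb cst1 = one;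
  lap_cst1 : lap cst1 = 0;
  ip_one : ip one one = 1;
  exN : forall f, mul (ex (- f)) (ex f) = one;
  ex_diff : forall f e, 0 < e -> \forall g \near (0 : F),
    `|ex (f + g) - ex f - 2 *: mul (ex f) g| <= e * `|g|;
  ell : exists A, [/\ linear A, continuous A, exists n, has_dim (range A) n &
    bijective (fun u => - lap u - 2 *: emb u + A u)] }.

Section Symmetric.
Variables (R : realType) (E F : completeNormedModType R) (X : elliptic E F).
Local Notation emb := (emb X).
Local Notation lap := (lap X).
Local Notation ip := (ip X).
Local Notation mul := (mul X).
Local Notation one := (one X).
Implicit Types (f g h : F) (u w : E) (c : F -> F).

Lemma ip0l g : ip 0 g = 0.
Proof. by have := ip_lin X g (-1) 0 0; rewrite scaler0 addr0 mulN1r addNr. Qed.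

Lemma ipDl f f' g : ip (f + f') g = ip f g + ip f' g.
Proof. by have := ip_lin X g 1 f f'; rewrite scale1r mul1r. Qed.

Lemma ipZl (a : R) f g : ip (a *: f) g = a * ip f g.
Proof. by have := ip_lin X g a f 0; rewrite !addr0 ip0l addr0. Qed.

Lemma ipNl f g : ip (- f) g = - ip f g.
Proof. by rewrite -scaleN1r ipZl mulN1r. Qed.

Lemma ipBl f f' g : ip (f - f') g = ip f g - ip f' g.
Proof. by rewrite ipDl ipNl. Qed.

Lemma ip0r g : ip g 0 = 0. Proof. by rewrite ip_sym ip0l. Qed.
Lemma ipDr f f' g : ip g (f + f') = ip g f + ip g f'.
Proof. by rewrite ip_sym ipDl !(ip_sym X _ g). Qed.
Lemma ipZr (a : R) f g : ip g (a *: f) = a * ip g f.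
Proof. by rewrite ip_sym ipZl (ip_sym X _ g). Qed.
Lemma ipNr f g : ip g (- f) = - ip g f.
Proof. by rewrite ip_sym ipNl (ip_sym X _ g). Qed.
Lemma ipBr f f' g : ip g (f - f') = ip g f - ip g f'.
Proof. by rewrite ipDr ipNr. Qed.

Lemma ip_suml I (r : seq I) (P : pred I) (G : I -> F) g :
  ip (\sum_(i <- r | P i) G i) g = \sum_(i <- r | P i) ip (G i) g.
Proof. by rewrite (big_morph (ip^~ g) (fun f f' => ipDl f f' g) (ip0l g)). Qed.

Lemma ip_sumr I (r : seq I) (P : pred I) (G : I -> F) g :
  ip g (\sum_(i <- r | P i) G i) = \sum_(i <- r | P i) ip g (G i).
Proof. by rewrite ip_sym ip_suml; apply: eq_bigr => i _; rewrite ip_sym. Qed.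

Lemma quad_ge0_disc (a b d : R) : 0 <= a -> 0 <= d ->
  (forall t, 0 <= a + 2 * t * b + t ^+ 2 * d) -> b ^+ 2 <= a * d.
Proof.
move=> a0 d0 H; have [d_eq|dn] := eqVneq d 0.
  have [->|bn] := eqVneq b 0; first by rewrite d_eq mulr0 expr0n.
  have := H (- (a + 1) / (2 * b)); rewrite d_eq mulr0 addr0.
  have -> : a + 2 * (- (a + 1) / (2 * b)) * b = -1 by field.
  by rewrite oppr_ge0 ler10.
have dp : 0 < d by rewrite lt_neqAle eq_sym dn.
have := H (- b / d).
have -> : a + 2 * (- b / d) * b + (- b / d) ^+ 2 * d = (a * d - b ^+ 2) / d by field.
by rewrite pmulr_lge0 ?invr_gt0// subr_ge0.
Qed.

Lemma ip_CS f g : ip f g ^+ 2 <= ip f f * ip g g.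
Proof.
apply: quad_ge0_disc => [||t]; try exact: ip_ge0.
have := ip_ge0 X (f + t *: g); rewrite ipDl !ipDr !ipZl !ipZr (ip_sym X g f).
by congr (0 <= _); ring.
Qed.

Lemma ip_cont f : continuous (ip f).
Proof.
have [k k0 kip] := ip_bnd X.
have lf : linear (ip f : F -> R^o) by move=> a g g'; rewrite ipDr ipZr.
apply: (bounded_linear_continuous (k := k * `|f|) lf) => g.
by rewrite (le_trans (kip _ _))// mulrA.
Qed.

(** Zero-order symmetric operators bounded below in [L^2]: a class closed under sums that contains
    both the multiplications and the finite-rank terms [proj e]. *)
Definition potential c :=
  [/\ linear c, exists2 k, 0 < k & forall f, `|c f| <= k * `|f|,
      forall f g, ip (c f) g = ip f (c g) &
      exists2 C, 0 <= C & forall f, - (C * ip f f) <= ip (c f) f].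

Definition opr c u := - lap u + c (emb u).

Lemma potentialD c c' : potential c -> potential c' ->
  potential (fun f => c f + c' f).
Proof.
move=> [lc [k k0 kc] sc [C C0 Cc]] [lc' [k' k0' kc'] sc' [C' C0' Cc']]; split.
- by move=> a f g; rewrite lc lc' scalerDr addrACA.
- exists (k + k'); first by rewrite addr_gt0.
  by move=> f; rewrite mulrDl (le_trans (ler_normD _ _))// lerD.
- by move=> f g; rewrite ipDl ipDr sc sc'.
- exists (C + C'); first by rewrite addr_ge0.
  by move=> f; rewrite ipDl mulrDl opprD lerD.
Qed.

Lemma potentialZ (a : R) : potential (fun f => a *: f).
Proof.
split.
- by move=> b f g; rewrite scalerDr !scalerA mulrC.
- exists (`|a| + 1); first by rewrite ltr_wpDl.
  by move=> f; rewrite normrZ ler_wpM2r// lerDl.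
- by move=> f g; rewrite ipZl ipZr.
- by exists `|a| => // f; rewrite ipZl -mulNr ler_wpM2r ?ip_ge0// lerNnormlW.
Qed.

Lemma potential_mul (a : R) f : potential (fun g => a *: mul f g).
Proof.
have [k k0 km] := mul_bnd X; have [C C0 Cm] := ip_mul_bnd X; split.
- by move=> b g h; rewrite (mul_lin X) scalerDr !scalerA mulrC.
- exists (`|a| * (k * `|f|) + 1); first by rewrite ltr_wpDl// !mulr_ge0// ltW.
  move=> g; rewrite normrZ mulrDl mul1r.
  rewrite (le_trans (ler_wpM2l (normr_ge0 a) (km f g)))// !mulrA lerDl//.
- by move=> g h; rewrite ipZl ipZr ip_mul.
- exists (`|a| * (C * `|f|)); first by rewrite !mulr_ge0// ltW.
  move=> g; rewrite ipZl lerNl (le_trans (ler_norm _))// normrN normrM -mulrA.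
  by rewrite ler_wpM2l.
Qed.

(** Not a projection in general: the vectors are not normalized, and their lengths carry the weights
    by which eigenvalues are lifted. *)
Definition proj n (e : 'I_n -> F) f : F := \sum_i ip (e i) f *: e i.

Lemma ip_proj n (e : 'I_n -> F) f g : ip (proj e f) g = \sum_i ip (e i) f * ip (e i) g.
Proof. by rewrite ip_suml; apply: eq_bigr => i _; rewrite ipZl. Qed.

Lemma ip_proj_ge0 n (e : 'I_n -> F) f : 0 <= ip (proj e f) f.
Proof. by rewrite ip_proj sumr_ge0// => i _; rewrite -expr2 sqr_ge0. Qed.

Lemma potential_proj n (e : 'I_n -> F) : potential (proj e).
Proof.
have [k k0 kip] := ip_bnd X; split.
- move=> a f g; rewrite /proj scaler_sumr -big_split; apply: eq_bigr => i _ /=.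
  by rewrite ipDr ipZr scalerDl scalerA.
- exists (\sum_i k * `|e i| * `|e i| + 1).
    by rewrite ltr_wpDl// sumr_ge0// => i _; rewrite !mulr_ge0// ltW.
  move=> f; rewrite (le_trans (ler_norm_sum _ _ _))// mulrDl mul1r ler_wpDr//.
  rewrite mulr_suml ler_sum// => i _; rewrite normrZ.
  rewrite (le_trans (ler_wpM2r (normr_ge0 _) (kip _ _)))//.
  by rewrite [leLHS](_ : _ = k * `|e i| * `|e i| * `|f|)//; ring.
- move=> f g; rewrite ip_proj ip_sym ip_proj.
  by apply: eq_bigr => i _; rewrite mulrC.
- by exists 0 => // f; rewrite mul0r oppr0 ip_proj_ge0.
Qed.

Lemma opr_lin c : linear c -> linear (opr c).
Proof.
move=> lc a u w; rewrite /opr (lap_lin X) (emb_lin X) lc opprD -scalerN scalerDr.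
by rewrite addrACA.
Qed.

Lemma opr_sym c u w : potential c -> ip (opr c u) (emb w) = ip (emb u) (opr c w).
Proof. by move=> [_ _ sc _]; rewrite /opr ipDl ipDr ipNl ipNr lap_sym sc. Qed.

Lemma opr_cont c : potential c -> continuous (opr c).
Proof.
move=> [lc [k _ kc] _ _]; have cc := bounded_linear_continuous lc kc.
move=> u; apply: (@continuousD _ _ _ (fun u => - lap u) (fun u => c (emb u))).
  by apply: (@continuousN _ _ _ lap); exact: lap_cont.
by apply: (@continuous_comp _ _ _ emb c); [exact: emb_cont|exact: cc].
Qed.

(** The invertible operator given by [ell] differs from [opr c] by the compact operator [K], so
    Riesz theory derives surjectivity and the bound from injectivity. *)
Lemma opr_alternative c : potential c -> (forall u, opr c u = 0 -> u = 0) ->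
  (exists2 k, 0 < k & forall u, `|u| <= k * `|opr c u|) /\
  (forall f, exists u, opr c u = f).
Proof.
move=> pc inj; have [lc [k k0 kc] _ _] := pc.
have [A [lA cA [n dA] [G GK KG]]] := ell X.
pose S0 u := - lap u - 2 *: emb u + A u.
pose K u := (c (emb u) + 2 *: emb u) - A u.
have SK u : S0 u + K u = opr c u.
  by rewrite /S0 /K /opr addrACA subrr addr0 addrACA addNr addr0.
have lin_add (G1 : E -> F) G2 : linear G1 -> linear G2 -> linear (fun u => G1 u + G2 u).
  by move=> l1 l2 a u w; rewrite l1 l2 scalerDr addrACA.
have lin_opp (G1 : E -> F) : linear G1 -> linear (fun u => - G1 u).
  by move=> l1 a u w; rewrite l1 opprD scalerN.
have l2 : linear (fun u => 2 *: emb u).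
  by move=> a u w; rewrite (emb_lin X) scalerDr !scalerA mulrC.
have lS0 : linear S0.
  exact: (lin_add _ _ (lin_add _ _ (lin_opp _ (lap_lin X)) (lin_opp _ l2)) lA).
have cS0 : continuous S0.
  have cl : continuous (fun u => - lap u) by move=> u; apply: (@continuousN _ _ _ lap); exact: lap_cont.
  have ce : continuous (fun u => 2 *: emb u) by move=> u; apply: (@continuousZl_tmp _ _ _ emb); exact: emb_cont.
  have clm : continuous (fun u => - lap u - 2 *: emb u).
    by move=> u; apply: (@continuousB _ _ _ (fun u => - lap u) (fun u => 2 *: emb u)); [exact: cl|exact: ce].
  by move=> u; apply: (@continuousD _ _ _ (fun u => - lap u - 2 *: emb u) A); [exact: clm|exact: cA].
have S0s f : exists u, S0 u = f by exists (G f); exact: KG.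
have [k0' k0'0 S0k] := open_mapping lS0 cS0 S0s.
have S0lb u : `|u| <= k0' * `|S0 u|.
  have [w Sw wk] := S0k (S0 u).
  have -> : u = w by rewrite -(GK u) -(GK w); congr G; exact/esym.
  by rewrite Sw.
have cc := bounded_linear_continuous lc kc.
have lce : linear (fun u => c (emb u)) by move=> a u w; rewrite (emb_lin X) lc.
have lK : linear K.
  exact: (lin_add _ _ (lin_add _ _ lce l2) (lin_opp _ lA)).
have cceK : compact_map (fun u => c (emb u) + 2 *: emb u).
  have ccomp (d : F -> F) : potential d -> compact_map (fun u => d (emb u)).
    move=> [ld [kd kd0 kdd] _ _] r e e0; have [s Hs] := emb_cpt X r (divr_gt0 e0 kd0).
    exists [seq d v | v <- s] => _ [u ur <-].
    have [|v vs uv] := Hs (emb u); first by exists u.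
    exists (d v); first exact: map_f.
    by rewrite -(linear_funB ld) (le_lt_trans (kdd _))// mulrC -ltr_pdivlMr.
  by apply: compact_mapD; [exact: ccomp|apply: (ccomp (fun f => 2 *: f)); exact: potentialZ].
have cKm : compact_map K.
  apply: compact_mapD => // r e e0; have [s Hs] := finite_rank_compact lA cA dA r e0.
  exists [seq - v | v <- s] => _ [u ur <-]; have [|v vs uv] := Hs (A u); first by exists u.
  by exists (- v); [exact: map_f|rewrite -opprD normrN].
have Kc : continuous K.
  move=> u; apply: (@continuousB _ _ _ (fun u => c (emb u) + 2 *: emb u) A); last exact: cA.
  apply: (@continuousD _ _ _ (fun u => c (emb u)) (fun u => 2 *: emb u)).
    by apply: (@continuous_comp _ _ _ emb c); [exact: emb_cont|exact: cc].
  by apply: (@continuousZl_tmp _ _ _ emb); exact: emb_cont.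
have SKinj u : S0 u + K u = 0 -> u = 0 by rewrite SK; exact: inj.
split.
  have [k1 k10 H] := riesz_lb lS0 cS0 lK cKm Kc S0lb S0s SKinj.
  by exists k1 => // u; rewrite -SK.
by move=> f; have [u Hu] := riesz_surj lS0 cS0 lK cKm Kc S0lb S0s SKinj f; exists u; rewrite -SK.
Qed.

Lemma opr_inverse c : potential c -> (forall u, opr c u = 0 -> u = 0) ->
  exists G : F -> E, [/\ linear G, cancel G (opr c), cancel (opr c) G &
    exists2 k, 0 < k & forall f, `|G f| <= k * `|f|].
Proof.
move=> pc inj; have [lc _ _ _] := pc.
have [[k k0 Hk] /choice[G HG]] := opr_alternative pc inj.
have injS u w : opr c u = opr c w -> u = w.
  move=> uw; apply/eqP; rewrite -subr_eq0; apply/eqP/inj.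
  by rewrite (linear_funB (opr_lin lc)) uw subrr.
exists G; split=> //.
- by move=> a f g; apply: injS; rewrite (opr_lin lc) !HG.
- by move=> u; apply: injS.
- by exists k => // f; rewrite (le_trans (Hk _))// HG.
Qed.

(** Coercivity in the norm of [L^2], not of [E]; bounds in [E] are recovered from injectivity by the
    alternative. *)
Definition positive c (kappa : R) :=
  0 < kappa /\ forall u, kappa * ip (emb u) (emb u) <= ip (opr c u) (emb u).

Lemma emb_ip_gt0 u : u != 0 -> 0 < ip (emb u) (emb u).
Proof.
move=> u0; rewrite lt_neqAle ip_ge0 andbT eq_sym; apply: contraNneq u0.
by move=> /(ip_eq0)/(emb_inj) ->.
Qed.

Lemma positive_inj c kappa : positive c kappa -> forall u, opr c u = 0 -> u = 0.
Proof.
move=> [k0 pos] u u0; apply/eqP; apply: contraT => /emb_ip_gt0 h.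
by have := pos u; rewrite u0 ip0l leNgt mulr_gt0.
Qed.

Lemma positive_id : positive id 1.
Proof.
by split=> // u; rewrite mul1r /opr ipDl ipNl lerDr oppr_ge0 lap_neg.
Qed.

End Symmetric.

End EllipticPair.
Import EllipticPair.

Lemma le_of_sqr (R : realDomainType) (x y : R) : 0 <= y -> x ^+ 2 <= y ^+ 2 -> x <= y.
Proof.
move=> y0; rewrite leNgt => h; rewrite leNgt; apply: contra h => yx.
by rewrite ltr_pXn2r// nnegrE// ltW// (le_lt_trans y0).
Qed.

(** * Positivity and the finite part of the spectrum *)

Section Spectrum.
Variables (R : realType) (E F : completeNormedModType R) (X : elliptic E F).
Local Notation emb := (emb X).
Local Notation lap := (lap X).
Local Notation ip := (ip X).
Local Notation opr := (opr X).
Local Notation potential := (potential X).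
Implicit Types (f g h : F) (u w : E) (c : F -> F).

Lemma potential_id : potential id.
Proof.
have := potentialZ X 1; rewrite (_ : (fun f => 1 *: f) = id)//.
by apply/funext => f; rewrite scale1r.
Qed.

(* Lax: a symmetric operator that is bounded for the norm is bounded for the
   weaker norm of the inner product, with the same constant. *)
Lemma lax_bound (K : F -> F) (k : R) : linear K -> 0 < k ->
  (forall f g, ip (K f) g = ip f (K g)) -> (forall f, `|K f| <= k * `|f|) ->
  forall f, ip (K f) (K f) <= k ^+ 2 * ip f f.
Proof.
move=> lK k0 sK Kk f; pose a n := ip (iter n K f) (iter n K f).
have [ki ki0 Hki] := ip_bnd X.
have a_ge0 n : 0 <= a n by exact: ip_ge0.
have [a0|a0n] := eqVneq (a 0%N) 0.
  have f0 : f = 0 by exact: ip_eq0 a0.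
  by rewrite f0 (linear_fun0 lK) ip0l mulr0.
have a0p : 0 < a 0%N by rewrite lt_neqAle eq_sym a0n a_ge0.
have [a1|a1n] := eqVneq (a 1%N) 0.
  by rewrite -[leLHS]/(a 1%N) a1 mulr_ge0 ?exprn_ge0 ?(ltW k0)// ltW.
have a1p : 0 < a 1%N by rewrite lt_neqAle eq_sym a1n a_ge0.
(* The squares [a n] of the [L^2] norms of the iterates are log-convex, by symmetry and
   Cauchy-Schwarz, so they grow at least like [r ^+ n]. The norm bound lets them grow at most like
   [k ^+ 2] to the power [n], whence [r <= k ^+ 2]. *)
have logc n : a n.+1 ^+ 2 <= a n * a n.+2.
  by rewrite /a {1}iterS sK -iterS; exact: ip_CS.
pose r := a 1%N / a 0%N; have r0 : 0 < r by rewrite divr_gt0.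
have step n : 0 < a n /\ r * a n <= a n.+1.
  elim: n => [|n [an IH]]; first by rewrite /r divfK ?gt_eqF.
  have an1 : 0 < a n.+1 by apply: lt_le_trans IH; rewrite mulr_gt0.
  split=> //; rewrite -(ler_pM2l an) (le_trans _ (logc n))// expr2.
  by rewrite mulrA (mulrC (a n)) ler_pM2r.
have low n : r ^+ n * a 0%N <= a n.
  elim: n => [|n IH]; first by rewrite expr0 mul1r.
  by rewrite exprS -mulrA (le_trans _ (proj2 (step n)))// ler_pM2l.
have up n : a n <= (k ^+ 2) ^+ n * (ki * (`|f| * `|f|)).
  have Kn : `|iter n K f| <= k ^+ n * `|f|.
    elim: n => [|n IH]; first by rewrite expr0 mul1r.
    by rewrite iterS exprS -mulrA (le_trans (Kk _))// ler_pM2l.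
  rewrite (le_trans (ler_norm _))// (le_trans (Hki _ _))// [leRHS]mulrCA ler_pM2l//.
  rewrite (le_trans (ler_pM _ _ Kn Kn))// -exprM mulnC exprM expr2.
  by rewrite mulrACA.
rewrite -[leLHS]/(a 1%N) -ler_pdivrMr// -/r leNgt; apply/negP => kr.
pose q := k ^+ 2 / r; have q0 : 0 <= q by rewrite divr_ge0 ?exprn_ge0// ltW.
have q1 : `|q| < 1 by rewrite ger0_norm// ltr_pdivrMr// mul1r.
pose C := ki * (`|f| * `|f|) + 1.
have C0 : 0 < C by rewrite ltr_wpDl// !mulr_ge0// ltW.
have := cvg_expr q1; move=> /cvgrPdist_lt/(_ _ (divr_gt0 a0p C0))[n _ /(_ n (leqnn n))].
rewrite /= sub0r normrN ger0_norm ?exprn_ge0// ltr_pdivlMr// => h.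
have := le_trans (low n) (up n); apply/negP; rewrite -ltNge.
rewrite [ltRHS]mulrC -ltr_pdivrMr ?exprn_gt0//; apply: le_lt_trans h.
have -> : q ^+ n = (k ^+ 2) ^+ n / r ^+ n by exact: expr_div_n.
rewrite [leRHS]mulrAC; apply: ler_wpM2r; first by rewrite invr_ge0 exprn_ge0// ltW.
by apply: ler_wpM2l; [rewrite !exprn_ge0// ltW|rewrite /C lerDl].
Qed.

(** Let [q] be the form and [K] the inverse of [opr c] seen in [L^2]. Cauchy-Schwarz for [q] gives
    [<u, u>^2 <= q(u) <u, K u>], and Lax's bound on [K] turns this into a lower bound for [q]. *)
Lemma positive_improve c : potential c -> (forall u, opr c u = 0 -> u = 0) ->
  (forall u, 0 <= ip (opr c u) (emb u)) -> exists kappa, positive X c kappa.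
Proof.
move=> pc inj q0; have [lc _ _ _] := pc.
have [G [lG GK KG [k k0 Gk]]] := opr_inverse pc inj.
have [ke ke0 Hke] := linear_continuous_bounded (emb_lin X) (@emb_cont _ _ _ X).
pose K f := emb (G f).
have lK : linear K by move=> a f g; rewrite /K lG (emb_lin X).
have sK f g : ip (K f) g = ip f (K g).
  by rewrite /K -{1}(GK g) -opr_sym// GK.
have Kk f : `|K f| <= (ke * k) * `|f|.
  by rewrite (le_trans (Hke _))// -mulrA ler_pM2l.
have kk0 : 0 < ke * k by rewrite mulr_gt0.
have lax := lax_bound lK kk0 sK Kk.
have ipK f : ip f (K f) <= ke * k * ip f f.
  have ff := ip_ge0 X f.
  apply: le_of_sqr; first by rewrite mulr_ge0// ltW.
  rewrite (le_trans (ip_CS _ _ _))// exprMn expr2 mulrA [leRHS]mulrC.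
  by rewrite [ke * k * _]mulrC -expr2 ler_wpM2l.
exists (ke * k)^-1; split; first by rewrite invr_gt0.
move=> u; have [->|u0] := eqVneq u 0.
  by rewrite (linear_fun0 (emb_lin X)) !ip0r mulr0.
have iu := emb_ip_gt0 X u0.
have CS : ip (emb u) (emb u) ^+ 2 <= ip (opr c u) (emb u) * ip (emb u) (K (emb u)).
  apply: quad_ge0_disc => [||t]; first exact: q0.
    by rewrite -{1}(GK (emb u)); exact: q0.
  have := q0 (u + t *: G (emb u)).
  rewrite (linear_funD (opr_lin X lc)) (linear_funZ (opr_lin X lc)) GK.
  rewrite (linear_funD (emb_lin X)) (linear_funZ (emb_lin X)).
  rewrite ipDl !ipDr !ipZl !ipZr (opr_sym u (G (emb u)) pc) GK /K.
  by congr (0 <= _); ring.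
rewrite mulrC ler_pdivrMr// -(ler_pM2r iu) -expr2 (le_trans CS)//.
rewrite -mulrA ler_wpM2l//.
Qed.

Lemma opr_shift c (l : R) u : opr (fun f => c f + l *: f) u = opr c u + l *: emb u.
Proof. by rewrite /opr addrA. Qed.

(** The least shift [l >= 0] making the form nonnegative is attained. There the form is strictly
    positive by [positive_improve], the hypothesis excluding a kernel for every such [l]; a nonzero
    least shift could therefore be decreased. *)
Lemma positive_of_spectrum c : potential c ->
  (forall l u, 0 <= l -> opr c u = - l *: emb u -> u = 0) ->
  exists kappa, positive X c kappa.
Proof.
move=> pc spec; have [lc _ _ [C C0 HC]] := pc.
have inj l : 0 <= l -> forall u, opr (fun f => c f + l *: f) u = 0 -> u = 0.
  move=> l0 u; rewrite opr_shift => /eqP; rewrite addr_eq0 -scaleNr => /eqP.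
  exact: spec.
have pl l : potential (fun f => c f + l *: f).
  by apply: potentialD => //; exact: potentialZ.
have improve l : 0 <= l ->
    (forall u, 0 <= ip (opr c u) (emb u) + l * ip (emb u) (emb u)) ->
    exists2 k, 0 < k & forall u, k * ip (emb u) (emb u) <=
      ip (opr c u) (emb u) + l * ip (emb u) (emb u).
  move=> l0 H; have [] := positive_improve (pl l) (inj l l0).
    by move=> u; rewrite opr_shift ipDl ipZl.
  by move=> k [k0 Hk]; exists k => // u; have := Hk u; rewrite opr_shift ipDl ipZl.
pose B := [set l | 0 <= l /\ forall u, 0 <= ip (opr c u) (emb u) + l * ip (emb u) (emb u)].
have B0 : B !=set0.
  exists C; split=> // u; rewrite /opr ipDl ipNl -addrA addr_ge0//.
    by rewrite oppr_ge0 lap_neg.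
  by rewrite -lerBlDr sub0r.
have hB : has_inf B by split=> //; exists 0 => l [].
have inf0 : 0 <= inf B by apply: lb_le_inf => // l [].
have Binf u : 0 <= ip (opr c u) (emb u) + inf B * ip (emb u) (emb u).
  have [->|u0] := eqVneq u 0.
    by rewrite (linear_fun0 (emb_lin X)) !ip0r mulr0 addr0.
  have iu := emb_ip_gt0 X u0.
  rewrite -lerBlDr sub0r lerNl -ler_pdivrMr//; apply: lb_le_inf => // l [_ /(_ u)].
  by rewrite ler_pdivrMr// lerNl -sub0r lerBlDr.
have [k k0 Hk] := improve _ inf0 Binf.
have inf_eq0 : inf B = 0.
  apply/eqP; rewrite eq_le inf0 andbT leNgt; apply/negP => infp.
  pose l := Num.max 0 (inf B - k).
  have Bl : B l.
    split; first by rewrite le_max lexx.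
    move=> u; have := Hk u; rewrite -subr_ge0 => /le_trans; apply.
    rewrite -addrA lerD2l -mulrBl ler_wpM2r ?ip_ge0// le_max lexx orbT//.
  have := inf_lbound (proj2 hB) Bl; apply/negP; rewrite -ltNge gt_max infp /=.
  by rewrite ltrBlDr ltrDl.
by exists k; split=> // u; have := Hk u; rewrite inf_eq0 mul0r addr0.
Qed.

(** The eigenvalue is [- l i]: nonnegative or positive [l] selects the nonpositive or the negative
    part of the spectrum. *)
Definition eigen_family c (P : R -> Prop) n (e : 'I_n -> E) (l : 'I_n -> R) :=
  (forall i j, ip (emb (e i)) (emb (e j)) = (i == j)%:R) /\
  (forall i, P (l i) /\ opr c (e i) = - l i *: emb (e i)).

Lemma eigen_bound c C l u : (forall f, - (C * ip f f) <= ip (c f) f) ->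
  u != 0 -> opr c u = - l *: emb u -> l <= C.
Proof.
move=> HC u0 ul; have iu := emb_ip_gt0 X u0.
have := HC (emb u); have : ip (opr c u) (emb u) = - l * ip (emb u) (emb u).
  by rewrite ul ipZl.
rewrite /opr ipDl ipNl => h1 h2; rewrite -(ler_pM2r iu) -lerN2 -[- (l * _)]mulNr -h1.
by rewrite (le_trans h2)// lerDr oppr_ge0 lap_neg.
Qed.

(** Two norms are played against each other: the unit ball of [E] is totally bounded in [F], so it
    cannot contain many uniformly separated eigenvectors, and the lower bound of [c] keeps their [l]
    in a bounded interval. *)
Lemma eigen_family_bound c (P : R -> Prop) : potential c ->
  (forall l, P l -> 0 <= l) ->
  exists N, forall n (e : 'I_n -> E) l, eigen_family c P e l -> (n <= N)%N.
Proof.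
move=> pc P0; have [lc [kc kc0 Hkc] _ [C C0 HC]] := pc.
have [ki ki0 Hki] := ip_bnd X.
have posid := positive_id X.
have [G [lG GK KG [kG kG0 HG]]] := opr_inverse potential_id (positive_inj posid).
(* eigenvectors of unit norm in E are not small for the inner product *)
have [d d0 Hd] : exists2 d, 0 < d & forall u l, `|u| = 1 -> P l ->
    opr c u = - l *: emb u -> d <= ip (emb u) (emb u).
  apply: contrapT => H.
  have {}H (n : nat) : exists p : E * R, [/\ `|p.1| = 1, P p.2,
      opr c p.1 = - p.2 *: emb p.1 & ip (emb p.1) (emb p.1) < n.+1%:R^-1].
    apply: contrapT => /forallNP nH; apply: H; exists n.+1%:R^-1; first by rewrite invr_gt0.
    move=> u l u1 Pl ul; rewrite leNgt; apply/negP => h.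
    by apply: (nH (u, l)).
  have [p Hp] := choice H; pose u n := (p n).1; pose l n := (p n).2.
  have [GG [UG oG]] := @ultraFilterLemma nat eventually _.
  have [y uy] : exists y : F, (fun n => emb (u n)) @ GG --> y.
    apply: (has_nets_ultra (emb_cpt X 1) UG); apply: nearW => n.
    by exists (u n) => //=; have [-> _ _ _] := Hp n.
  have [l0 [_ ll0]] : [set s : R | 0 <= s <= C] `&` [set s0 | l @ GG --> s0] !=set0.
    have cI : compact [set s : R | 0 <= s <= C].
      rewrite (_ : mkset _ = `[0, C]%classic); first exact: segment_compact.
      by apply/seteqP; split=> s /=; rewrite in_itv.
    move: cI; rewrite compact_ultra => /(_ (l @ GG) (fmap_ultra l UG)); apply.
    apply: nearW => n /=; have [u1 Pl ul _] := Hp n; rewrite P0//=.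
    apply: (eigen_bound HC _ ul); apply/negP => /eqP u0.
    by move: u1; rewrite u0 normr0 => /eqP; rewrite eq_sym oner_eq0.
  (* The eigenvalue equation solved for [u] through the inverse [G] of [- lap + 1]: convergence in
     [F] improves to convergence in [E]. *)
  have uE n : u n = G ((1 - l n) *: emb (u n) - c (emb (u n))).
    rewrite -[LHS](KG (u n)); congr G; have [_ _ ul _] := Hp n.
    have hl : - lap (u n) = - l n *: emb (u n) - c (emb (u n)).
      by rewrite -ul /opr addrK.
    by rewrite /EllipticPair.opr hl addrAC [_ + emb _]addrC scaleNr scalerBl scale1r.
  have cc := bounded_linear_continuous lc Hkc.
  have cG := bounded_linear_continuous lG HG.
  have [x ux] : exists x : E, u @ GG --> x.
    exists (G ((1 - l0) *: y - c y)).
    rewrite (_ : u = fun n => G ((1 - l n) *: emb (u n) - c (emb (u n)))); last exact/funext.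
    apply: (cvg_comp _ G) => [|]; last exact: cG.
    apply: cvgB; last by apply: (cvg_comp _ c uy); exact: cc.
    by apply: cvgZ => //; apply: cvgB => //; exact: cvg_cst.
  have xy : emb x = y.
    have h1 : (fun n => emb (u n)) @ GG --> emb x.
      by apply: (cvg_comp _ emb ux); exact: emb_cont.
    by rewrite -(cvg_lim (@norm_hausdorff _ F) h1) (cvg_lim (@norm_hausdorff _ F) uy).
  have x0 : x = 0.
    apply: (@emb_inj _ _ _ X); rewrite xy; apply: (@ip_eq0 _ _ _ X); apply/eqP; apply: contraT => yy.
    have yp : 0 < ip y y by rewrite lt_neqAle eq_sym yy ip_ge0.
    have h1 : (fun n => ip y (emb (u n))) @ GG --> ip y y.
      by apply: (cvg_comp _ (ip y) uy); exact: ip_cont.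
    have y20 : 0 < ip y y / 2 by rewrite divr_gt0.
    have y40 : 0 < ip y y / 4 by rewrite divr_gt0.
    move/cvgrPdist_lt : h1 => /(_ _ y20) h1.
    have h2 := oG _ (near_grid 0 y40).
    have [n [hn [_ ny]]] := filter_ex (filterI h1 h2).
    have [_ _ _ small] := Hp n.
    have CS := ip_CS X y (emb (u n)).
    have h3 : ip y y / 2 < ip y (emb (u n)).
      by move: hn; rewrite ltr_norml => /andP[_]; lra.
    have h4 : (ip y y / 2) ^+ 2 < ip y (emb (u n)) ^+ 2.
      by rewrite ltr_pXn2r// nnegrE ltW// (lt_trans y20).
    have h5 : ip y y * ip (emb (u n)) (emb (u n)) < ip y y * (ip y y / 4).
      by rewrite ltr_pM2l// (lt_trans small).
    have : (ip y y / 2) ^+ 2 < ip y y * (ip y y / 4).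
      by apply: lt_le_trans h4 _; exact: le_trans CS (ltW h5).
    have -> : (ip y y / 2) ^+ 2 = ip y y * (ip y y / 4) by field.
    by rewrite ltxx.
  have h1 : (fun n => `|u n|) @ GG --> `|x| by exact: cvg_norm.
  have h2 : (fun n => `|u n|) @ GG --> (1 : R).
    have -> : (fun n => `|u n|) = fun=> 1 by apply/funext => n; have [] := Hp n.
    exact: cvg_cst.
  have : `|x| = 1.
    by rewrite -(cvg_lim (@norm_hausdorff _ R^o) h1) (cvg_lim (@norm_hausdorff _ R^o) h2).
  by rewrite x0 normr0 => /eqP; rewrite eq_sym oner_eq0.
(* hence orthogonal ones are uniformly apart in F *)
pose eps := Num.sqrt (d / ki) / 2.
have dk0 : 0 < d / ki by rewrite divr_gt0.
have eps0 : 0 < eps by rewrite divr_gt0// sqrtr_gt0.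
have [s Hs] := emb_cpt X 1 eps0; exists (size s) => n e l [on eig].
have en i : 0 < `|e i|.
  rewrite normr_gt0; apply/negP => /eqP e0.
  by have := on i i; rewrite e0 (linear_fun0 (emb_lin X)) ip0l eqxx => /eqP; rewrite eq_sym oner_eq0.
pose x i := `|e i|^-1 *: e i.
have x1 i : `|x i| = 1 by rewrite normrZ normfV normr_id mulVf// gt_eqF.
have Hcl (i : 'I_n) : exists k : 'I_(size s), `|emb (x i) - s`_k| < eps.
  have [|v vs Kv] := Hs (emb (x i)); first by exists (x i) => //=; rewrite x1.
  have vi : (index v s < size s)%N by rewrite index_mem.
  by exists (Ordinal vi); rewrite /= nth_index.
have {Hcl} [cl Hcl] := choice Hcl.
suff /leq_card : injective cl by rewrite !card_ord.
move=> i j cij; apply/eqP; apply: contraT => ij.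
have xd k : d <= ip (emb (x k)) (emb (x k)).
  have [Pk ek] := eig k; apply: (Hd _ (l k)) => //.
  by rewrite (linear_funZ (opr_lin X lc)) ek (linear_funZ (emb_lin X)) !scalerA mulrC.
have orth : ip (emb (x i)) (emb (x j)) = 0.
  by rewrite !(linear_funZ (emb_lin X)) ipZl ipZr on (negPf ij) !mulr0.
have dist : `|emb (x i) - emb (x j)| < 2 * eps.
  rewrite -(subrK s`_(cl i) (emb (x i))) -addrA (le_lt_trans (ler_normD _ _))//.
  by rewrite mulr_natl mulr2n ltrD// cij distrC.
have low : 2 * d <= ki * (`|emb (x i) - emb (x j)| ^+ 2).
  have := Hki (emb (x i) - emb (x j)) (emb (x i) - emb (x j)).
  move=> /(le_trans (ler_norm _)); rewrite -expr2; apply: le_trans.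
  rewrite ipBl !ipBr (ip_sym X (emb (x j))) orth subr0 sub0r opprK.
  by rewrite mulr_natl mulr2n lerD.
have : ki * (`|emb (x i) - emb (x j)| ^+ 2) < ki * (2 * eps) ^+ 2.
  by rewrite ltr_pM2l// ltr_pXn2r// nnegrE// mulr_ge0// ltW.
have -> : 2 * eps = Num.sqrt (d / ki) by rewrite /eps mulrC divfK.
rewrite sqr_sqrtr ?(ltW dk0)// [ki * (d / ki)]mulrC divfK ?gt_eqF// => h.
by have := le_lt_trans low h; move: d0; lra.
Qed.

(** A family of maximal length exists by the bound. The component of an eigenvector orthogonal to it
    is, by symmetry, an eigenvector for the same value, and would extend the family if it were
    nonzero. *)
Lemma eigen_family_span c (P : R -> Prop) : potential c ->
  (forall l, P l -> 0 <= l) ->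
  exists n (e : 'I_n -> E) (l : 'I_n -> R), eigen_family c P e l /\
    forall m u, P m -> opr c u = - m *: emb u ->
      u = \sum_i ip (emb (e i)) (emb u) *: e i.
Proof.
move=> pc P0; have [lc _ _ _] := pc; have [N HN] := eigen_family_bound pc P0.
pose fam n := `[< exists (e : 'I_n -> E) (l : 'I_n -> R), eigen_family c P e l >].
have ex0 : exists n, fam n.
  exists 0%N; apply/asboolP.
  by exists (fun=> 0), (fun=> 0); split=> [[]|[]].
have famN n : fam n -> (n <= N)%N by move=> /asboolP[e [l /HN]].
case: (ex_maxnP ex0 famN) => n /asboolP[e [l [on eig]]] maxn.
exists n, e, l; split=> // m u Pm um.
pose w := u - \sum_i ip (emb (e i)) (emb u) *: e i.
suff w0 : w = 0 by apply/eqP; rewrite -subr_eq0 -/w w0.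
have orth i : ip (emb (e i)) (emb w) = 0.
  rewrite (linear_funB (emb_lin X)) (linear_fun_sum (emb_lin X)) ipBr ip_sumr.
  rewrite (bigD1 i)//= big1 => [|j ji]; last first.
    by rewrite (linear_funZ (emb_lin X)) ipZr on eq_sym (negPf ji) mulr0.
  by rewrite (linear_funZ (emb_lin X)) ipZr on eqxx mulr1 addr0 subrr.
have wm : opr c w = - m *: emb w.
  rewrite (linear_funB (opr_lin X lc)) (linear_funB (emb_lin X)) um scalerBr; congr (_ - _).
  rewrite (linear_fun_sum (opr_lin X lc)) (linear_fun_sum (emb_lin X)) scaler_sumr.
  apply: eq_bigr => i _; have [_ ei] := eig i.
  rewrite (linear_funZ (opr_lin X lc)) (linear_funZ (emb_lin X)) ei !scalerA; congr (_ *: _).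
  have := opr_sym (e i) u pc; rewrite ei um ipZl ipZr => h.
  by rewrite mulrC h mulrC.
apply/eqP; apply: contraT => w0; have iw := emb_ip_gt0 X w0.
pose e' (i : 'I_n.+1) := if unlift ord_max i is Some k then e k
  else (Num.sqrt (ip (emb w) (emb w)))^-1 *: w.
pose l' (i : 'I_n.+1) := if unlift ord_max i is Some k then l k else m.
suff /maxn : fam n.+1 by rewrite ltnn.
apply/asboolP; exists e', l'; split.
- move=> i j; rewrite /e'; case: unliftP => [i'|] ->; case: unliftP => [j'|] ->.
  + by rewrite on (inj_eq (@lift_inj _ _)).
  + by rewrite (linear_funZ (emb_lin X)) ipZr orth mulr0 eq_sym (negPf (neq_lift _ _)).
  + by rewrite (linear_funZ (emb_lin X)) ipZl ip_sym orth mulr0 (negPf (neq_lift _ _)).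
  + rewrite (linear_funZ (emb_lin X)) ipZl ipZr eqxx mulrA -expr2 exprVn.
    by rewrite sqr_sqrtr ?(ltW iw)// mulVf// gt_eqF.
- move=> i; rewrite /e' /l'; case: unliftP => [i'|] _; first exact: eig.
  split=> //; rewrite (linear_funZ (opr_lin X lc)) (linear_funZ (emb_lin X)) wm.
  by rewrite !scalerA mulrC.
Qed.

End Spectrum.

(** * Determinants of finite-rank perturbations of the identity *)

Section FiniteDim.
Variables (R : realType) (V : lmodType R).

Definition free n (b : 'I_n -> V) :=
  forall c : 'I_n -> R, \sum_i c i *: b i = 0 -> forall i, c i = 0.

Definition spanned n (b : 'I_n -> V) (v : V) :=
  exists c : 'I_n -> R, v = \sum_i c i *: b i.

Lemma spanned_sum n (b : 'I_n -> V) m (v : 'I_m -> V) (a : 'I_m -> R) :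
  (forall i, spanned b (v i)) -> spanned b (\sum_i a i *: v i).
Proof.
move=> /choice[c Hc]; exists (fun j => \sum_i a i * c i j).
under eq_bigr do rewrite Hc scaler_sumr; rewrite exchange_big /=.
by apply: eq_bigr => j _; rewrite scaler_suml; apply: eq_bigr => i _; rewrite scalerA.
Qed.

Lemma free_spanned_leq n (b : 'I_n -> V) m (v : 'I_m -> V) :
  free v -> (forall i, spanned b (v i)) -> (m <= n)%N.
Proof.
move=> fv /choice[c Hc]; pose M : 'M[R]_(m, n) := \matrix_(i, j) c i j.
suff : row_free M by move=> /eqP <-; exact: rank_leq_col.
rewrite -kermx_eq0; apply/eqP/row_matrixP => k; rewrite row0.
apply/rowP => i; rewrite [RHS]mxE.
have xM : row k (kermx M) *m M = 0 by rewrite -row_mul mulmx_ker row0.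
apply: (fv (fun i => row k (kermx M) 0 i)).
under eq_bigr do rewrite Hc scaler_sumr; rewrite exchange_big /= big1// => j _.
transitivity ((row k (kermx M) *m M) 0 j *: b j); last by rewrite xM mxE scale0r.
rewrite [in RHS]mxE scaler_suml; apply: eq_bigr => l _; rewrite scalerA.
by congr ((_ * _) *: _); rewrite mxE.
Qed.

Lemma spanned_base n (b : 'I_n -> V) i : spanned b (b i).
Proof.
exists (fun j => (i == j)%:R); rewrite (bigD1 i)//= eqxx scale1r big1 ?addr0// => j ji.
by rewrite eq_sym (negPf ji) scale0r.
Qed.


Lemma has_dim_subspace n (b : 'I_n -> V) (A : set V) :
  A 0 -> (forall c u w, A u -> A w -> A (c *: u + w)) ->
  (forall v, A v -> spanned b v) -> exists m, has_dim A m.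
Proof.
move=> A0 Alin Ab.
pose fam m := `[< exists w : 'I_m -> V, free w /\ forall i, A (w i) >].
have ex0 : exists m, fam m by exists 0%N; apply/asboolP; exists (fun=> 0); split=> [c _ []|[]].
have famn m : fam m -> (m <= n)%N.
  by move=> /asboolP[w [fw Aw]]; apply: (free_spanned_leq fw) => i; exact/Ab/Aw.
case: (ex_maxnP ex0 famn) => m /asboolP[w [fw Aw]] mx; exists m, w; split=> //.
apply/seteqP; split=> [v Av|v [c ->]]; last first.
  by elim/big_ind : _ => [//|x y Ax Ay|i _]; [rewrite -[x]scale1r; exact: Alin|
    rewrite -[_ *: _]addr0; exact: Alin].
apply: contrapT => nv.
pose w' (i : 'I_m.+1) := if unlift ord_max i is Some k then w k else v.
have w'l k : w' (lift ord_max k) = w k by rewrite /w' liftK.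
have w'm : w' ord_max = v by rewrite /w' unlift_none.
have lw (k : 'I_m) : widen_ord (leqnSn m) k = lift ord_max k.
  by apply: val_inj; rewrite /= /bump leqNgt ltn_ord.
suff /mx : fam m.+1 by rewrite ltnn.
apply/asboolP; exists w'; split; last first.
  by move=> i; rewrite /w'; case: unliftP => [k|] _.
move=> c; rewrite big_ord_recr /= w'm.
under eq_bigr do rewrite lw w'l.
move=> h; have cm : c ord_max = 0.
  apply/eqP; apply: contraT => cm; exfalso; apply: nv.
  exists (fun k => - (c ord_max)^-1 * c (lift ord_max k)).
  move: h => /eqP; rewrite addrC addr_eq0 => /eqP h.
  rewrite -[LHS]scale1r -(mulVf cm) -scalerA h scalerN scaler_sumr -sumrN.
  by apply: eq_bigr => k _; rewrite scalerA mulNr scaleNr.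
rewrite cm scale0r addr0 in h => i.
have := fw _ h; case: (unliftP ord_max i) => [k|] -> //; exact.
Qed.

Lemma has_dim_uniq (A : set V) m n : has_dim A m -> has_dim A n -> m = n.
Proof.
move=> [b [fb Ab]] [b' [fb' Ab']]; apply/eqP; rewrite eqn_leq; apply/andP; split.
  apply: (free_spanned_leq fb) => i.
  have h : A (b i) by rewrite Ab; exact: spanned_base.
  by rewrite Ab' in h; exact: h.
apply: (free_spanned_leq fb') => i.
have h : A (b' i) by rewrite Ab'; exact: spanned_base.
by rewrite Ab in h; exact: h.
Qed.

Lemma free_subfamily n (b : 'I_n -> V) :
  exists m (w : 'I_m -> V), free w /\ forall i, spanned w (b i).
Proof.
have [|||m [w [fw Aw]]] := @has_dim_subspace n b (spanned b).
- by exists (fun=> 0); rewrite big1// => i _; rewrite scale0r.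
- move=> c u w [x ->] [y ->]; exists (fun i => c * x i + y i).
  by rewrite scaler_sumr -big_split; apply: eq_bigr => i _; rewrite scalerDl scalerA.
- by [].
by exists m, w; split=> // i; have := spanned_base b i; rewrite Aw; exact.
Qed.

End FiniteDim.

Definition functional (R : realType) (V : lmodType R) (phi : V -> R) :=
  forall c u w, phi (c *: u + w) = c * phi u + phi w.

Lemma functional_sum (R : realType) (V : lmodType R) (phi : V -> R) n
    (a : 'I_n -> R) (v : 'I_n -> V) :
  functional phi -> phi (\sum_i a i *: v i) = \sum_i a i * phi (v i).
Proof.
move=> lp; have p0 : phi 0 = 0.
  by have := lp (-1) 0 0; rewrite scaler0 addr0 mulN1r addNr.
elim: n a v => [|n IH] a v; first by rewrite !big_ord0.
by rewrite big_ord_recl [in RHS]big_ord_recl lp IH.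
Qed.

Lemma finite_rank_form (R : realType) (V W : lmodType R) (A : V -> W) n (b : 'I_n -> W) :
  linear A -> free b -> (forall x, spanned b (A x)) ->
  exists phi : 'I_n -> V -> R, (forall i, functional (phi i)) /\
    forall x, A x = \sum_i phi i x *: b i.
Proof.
move=> lA fb /choice[c Hc]; exists (fun i x => c x i); split=> // i a u w.
apply/eqP; rewrite -subr_eq0; apply/eqP.
apply: (fb (fun i => c (a *: u + w) i - (a * c u i + c w i))).
under eq_bigr do rewrite scalerBl scalerDl -scalerA.
by rewrite sumrB big_split /= -scaler_sumr -!Hc lA subrr.
Qed.

Section Det.
Variables (R : realType) (V : normedModType R).

(** The vectors [b i] may be dependent, unlike those in [has_det], so that two representations can
    be concatenated freely. *)
Definition pert n (phi : 'I_n -> V -> R) (b : 'I_n -> V) (x : V) : V :=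
  x + \sum_i phi i x *: b i.

Definition pert_mx n (phi : 'I_n -> V -> R) (b : 'I_n -> V) : 'M[R]_n :=
  1%:M + \matrix_(i, j) phi j (b i).

Lemma det_1DmulC m k (A : 'M[R]_(m, k)) (B : 'M[R]_(k, m)) :
  \det (1%:M + A *m B) = \det (1%:M + B *m A).
Proof.
by have := det_1BmulC (- A) B; rewrite mulNmx mulmxN !opprK.
Qed.

(** Sylvester's identity rewrites both determinants on a common free family [w], where the two
    finite-rank parts have the same matrix. *)
Lemma det_pert_uniq n (phi : 'I_n -> V -> R) b n' (psi : 'I_n' -> V -> R) b' :
  (forall i, functional (phi i)) -> (forall i, functional (psi i)) ->
  (forall x, pert phi b x = pert psi b' x) ->
  \det (pert_mx phi b) = \det (pert_mx psi b').
Proof.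
move=> lphi lpsi eqp.
pose bb (i : 'I_(n + n')) := match fintype.split i with inl i => b i | inr i => b' i end.
have [m [w [fw Hw]]] := free_subfamily bb.
have red k (f : 'I_k -> V -> R) (c : 'I_k -> V) (cw : 'I_k -> 'I_m -> R) :
    (forall i, functional (f i)) -> (forall i, c i = \sum_l cw i l *: w l) ->
    \det (pert_mx f c) =
    \det (1%:M + \matrix_(l, l') \sum_j f j (w l) * cw j l').
  move=> lf Hc; pose be : 'M[R]_(k, m) := \matrix_(i, l) cw i l.
  pose Ph : 'M[R]_(m, k) := \matrix_(l, j) f j (w l).
  rewrite /pert_mx (_ : \matrix_(i, j) f j (c i) = be *m Ph); last first.
    apply/matrixP => i j; rewrite !mxE Hc functional_sum//.
    by apply: eq_bigr => l _; rewrite !mxE.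
  rewrite det_1DmulC; congr (\det (_ + _)); apply/matrixP => l l'; rewrite !mxE.
  by apply: eq_bigr => j _; rewrite !mxE.
have Hb i : spanned w (b i).
  by have := Hw (lshift n' i); rewrite /bb; case: split_ordP => j /eqP;
    rewrite ?eq_shift// => /eqP ->.
have Hb' i : spanned w (b' i).
  by have := Hw (rshift n i); rewrite /bb; case: split_ordP => j /eqP;
    rewrite ?eq_shift// => /eqP ->.
have [cb Hcb] := choice Hb; have [cb' Hcb'] := choice Hb'.
rewrite (red _ _ _ _ lphi Hcb) (red _ _ _ _ lpsi Hcb'); congr (\det (_ + _)).
apply/matrixP => l l'; rewrite !mxE; apply/eqP; rewrite -subr_eq0; apply/eqP.
apply: (fw (fun l' => \sum_j phi j (w l) * cb j l' - \sum_j psi j (w l) * cb' j l')).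
have expand k (f : 'I_k -> V -> R) (c : 'I_k -> V) (cw : 'I_k -> 'I_m -> R) :
    (forall i, c i = \sum_l cw i l *: w l) ->
    \sum_(i < m) (\sum_j f j (w l) * cw j i) *: w i = \sum_j f j (w l) *: c j.
  move=> Hc; under [RHS]eq_bigr do rewrite Hc scaler_sumr.
  rewrite exchange_big /=; apply: eq_bigr => i _; rewrite scaler_suml.
  by apply: eq_bigr => j _; rewrite scalerA.
under eq_bigr do rewrite scalerBl.
rewrite sumrB (expand _ _ _ _ Hcb) (expand _ _ _ _ Hcb').
by have /addrI -> := eqp (w l); rewrite subrr.
Qed.

Lemma linear_pert (T : V -> V) n (phi : 'I_n -> V -> R) b :
  (forall i, functional (phi i)) -> (forall x, T x = pert phi b x) -> linear T.
Proof.
move=> lphi HT a u w; rewrite !HT /pert scalerDr addrACA; congr (_ + _).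
rewrite scaler_sumr -big_split; apply: eq_bigr => i _ /=.
by rewrite lphi scalerDl scalerA.
Qed.

Lemma has_det_pert (T : V -> V) d : linear T -> has_det T d ->
  exists n (phi : 'I_n -> V -> R) b, [/\ forall i, functional (phi i),
    forall x, T x = pert phi b x & d = \det (pert_mx phi b)].
Proof.
move=> lT [n [b [M [fb Tb MT ->]]]].
have lT1 : linear (fun x => T x - x).
  by move=> a u w; rewrite lT opprD addrACA -scalerBr.
have [phi [lphi Hphi]] := finite_rank_form lT1 fb Tb.
exists n, phi, b; split=> //; first by move=> x; rewrite /pert -Hphi addrC subrK.
congr (\det _); apply/matrixP => i j; rewrite !mxE; apply/eqP; rewrite -subr_eq0; apply/eqP.
apply: (fb (fun j => M i j - ((i == j)%:R + phi j (b i)))).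
under eq_bigr do rewrite scalerBl scalerDl.
rewrite sumrB big_split /= -MT -Hphi (bigD1 i)//= eqxx scale1r big1 ?addr0 => [|k ki].
  by rewrite [b i + _]addrC subrK subrr.
by rewrite eq_sym (negPf ki) scale0r.
Qed.

Lemma has_det_uniq (T : V -> V) d n (phi : 'I_n -> V -> R) b :
  (forall i, functional (phi i)) -> (forall x, T x = pert phi b x) ->
  has_det T d -> d = \det (pert_mx phi b).
Proof.
move=> lphi HT hd; have lT := linear_pert lphi HT.
have [m [psi [c [lpsi HT' ->]]]] := has_det_pert lT hd.
by apply: det_pert_uniq => // x; rewrite -HT -HT'.
Qed.

Lemma pert_has_det (T : V -> V) n (phi : 'I_n -> V -> R) b :
  (forall i, functional (phi i)) -> (forall x, T x = pert phi b x) ->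
  has_det T (\det (pert_mx phi b)).
Proof.
move=> lphi HT; have [m [w [fw /choice[c Hc]]]] := free_subfamily b.
pose psi l x := \sum_j phi j x * c j l.
have lpsi l : functional (psi l).
  move=> a u v; rewrite /psi mulr_sumr -big_split; apply: eq_bigr => j _ /=.
  by rewrite lphi mulrDl mulrA.
have E x : \sum_j phi j x *: b j = \sum_l psi l x *: w l.
  under eq_bigr do rewrite Hc scaler_sumr; rewrite exchange_big /=.
  by apply: eq_bigr => l _; rewrite /psi scaler_suml; apply: eq_bigr => j _; rewrite scalerA.
have HT' x : T x = pert psi w x by rewrite HT /pert E.
exists m, w, (pert_mx psi w); split=> //.
- by move=> x; exists (psi^~ x); rewrite HT' /pert addrAC subrr add0r.
- move=> i; rewrite HT' /pert; under [RHS]eq_bigr do rewrite !mxE scalerDl.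
  rewrite [in RHS]big_split /= [in RHS](bigD1 i)//= eqxx scale1r; congr (_ + _); rewrite [X in _ + X]big1 ?addr0// => k ki.
  by rewrite eq_sym (negPf ki) scale0r.
- by apply: det_pert_uniq => // x; rewrite -HT -HT'.
Qed.

(** A vector [c] in the left kernel of the matrix gives [x = \sum_i c i *: b i] with
    [phi j x = - c j], which the perturbation kills; then [x = 0] forces [c = 0]. *)
Lemma det_pert_neq0 n (phi : 'I_n -> V -> R) b : (forall i, functional (phi i)) ->
  (forall x, pert phi b x = 0 -> x = 0) -> \det (pert_mx phi b) != 0.
Proof.
move=> lphi inj; apply/negP => /eqP/eqP/det0P[c c0 cM].
pose x := \sum_i c 0 i *: b i.
have phx j : phi j x = - c 0 j.
  rewrite functional_sum//; have := congr1 (fun v : 'rV[R]_n => v 0 j) cM.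
  rewrite mulmxDr mulmx1 !mxE => /eqP; rewrite addrC addr_eq0 => /eqP <-.
  by apply: eq_bigr => i _; rewrite !mxE.
have x0 : x = 0.
  apply: inj; rewrite /pert /x; under [X in _ + X]eq_bigr do rewrite phx scaleNr.
  by rewrite sumrN subrr.
move/eqP: c0; apply; apply/rowP => j; rewrite mxE -[LHS]opprK -phx x0.
have p0 : phi j 0 = 0 by have := lphi j (-1) 0 0; rewrite scaler0 addr0 mulN1r addNr.
by rewrite p0 oppr0.
Qed.

(** On the concatenated family [b] the composite has the forms [q2 + q1 \o T2], and its matrix
    factors as the product of the two matrices. *)
Lemma has_det_comp (T1 T2 : V -> V) d1 d2 : linear T1 -> linear T2 ->
  has_det T1 d1 -> has_det T2 d2 -> has_det (T1 \o T2) (d1 * d2).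
Proof.
move=> l1 l2 /(has_det_pert l1)[n1 [p1 [b1 [lp1 H1 d1E]]]].
move=> /(has_det_pert l2)[n2 [p2 [b2 [lp2 H2 d2E]]]].
pose b (i : 'I_(n1 + n2)) := match fintype.split i with inl i => b1 i | inr i => b2 i end.
pose q1 (i : 'I_(n1 + n2)) x := match fintype.split i with inl i => p1 i x | inr i => 0 end.
pose q2 (i : 'I_(n1 + n2)) x := match fintype.split i with inl i => 0 | inr i => p2 i x end.
have lq1 i : functional (q1 i).
  by move=> a u w; rewrite /q1; case: (fintype.split i) => k; rewrite ?lp1// mulr0 addr0.
have lq2 i : functional (q2 i).
  by move=> a u w; rewrite /q2; case: (fintype.split i) => k; rewrite ?lp2// mulr0 addr0.
have sl i : fintype.split (lshift n2 i) = inl i :> 'I_n1 + 'I_n2.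
  by case: split_ordP => k /eqP; rewrite ?eq_shift// => /eqP ->.
have sr i : fintype.split (rshift n1 i) = inr i :> 'I_n1 + 'I_n2.
  by case: split_ordP => k /eqP; rewrite ?eq_shift// => /eqP ->.
have H1' x : T1 x = pert q1 b x.
  rewrite H1 /pert big_split_ord /= [X in _ = _ + (_ + X)]big1 ?addr0 => [|i _].
    by congr (_ + _); apply: eq_bigr => i _; rewrite /q1 /b sl.
  by rewrite /q1 sr scale0r.
have H2' x : T2 x = pert q2 b x.
  rewrite H2 /pert big_split_ord /= [X in _ = _ + (X + _)]big1 ?add0r => [|i _].
    by congr (_ + _); apply: eq_bigr => i _; rewrite /q2 /b sr.
  by rewrite /q2 sl scale0r.
pose q i x := q2 i x + q1 i (T2 x).
have lq i : functional (q i).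
  by move=> a u w; rewrite /q lq2 l2 lq1 mulrDr addrACA.
have H x : (T1 \o T2) x = pert q b x.
  rewrite /= H1' {1}/pert {1}H2' /pert -addrA; congr (_ + _).
  by rewrite -big_split; apply: eq_bigr => i _ /=; rewrite -scalerDl.
have -> : d1 * d2 = \det (pert_mx q b); last exact: pert_has_det.
have -> : d1 = \det (pert_mx q1 b).
  by rewrite d1E; apply: det_pert_uniq => // x; rewrite -H1 -H1'.
have -> : d2 = \det (pert_mx q2 b).
  by rewrite d2E; apply: det_pert_uniq => // x; rewrite -H2 -H2'.
rewrite mulrC -det_mulmx; congr (\det _).
rewrite /pert_mx mulmxDl mul1mx mulmxDr mulmx1 -addrA; congr (_ + _).
apply/matrixP => i j; rewrite !mxE /q addrC -addrA; congr (_ + _).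
rewrite (H2' (b i)) /pert -[in RHS](scale1r (b i)) lq1 mul1r addrC; congr (_ + _).
by rewrite scale1r functional_sum//; apply: eq_bigr => k _; rewrite !mxE.
Qed.

End Det.

(** The determinant is a polynomial in [s], so a change of sign would produce a root in [[0, 1]]. *)
Lemma det_affine_sign (R : realType) n (M0 M1 : 'M[R]_n) :
  (forall s, 0 <= s <= 1 -> \det (M0 + s *: M1) != 0) ->
  0 < \det M0 * \det (M0 + M1).
Proof.
move=> H; pose P : {poly R} := \det (map_mx polyC M0 + 'X *: map_mx polyC M1).
have PE s : P.[s] = \det (M0 + s *: M1).
  rewrite -horner_evalE /P -det_map_mx; congr (\det _).
  by apply/matrixP => i j; rewrite !mxE /= horner_evalE !hornerE.
have P0 : P.[0] = \det M0 by rewrite PE scale0r addr0.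
have P1 : P.[1] = \det (M0 + M1) by rewrite PE scale1r.
rewrite -P0 -P1 ltNge; apply/negP => Ple.
have [x /H + /rootP Px] : exists2 x, 0 <= x <= 1 & root P x.
  have [p0|p0] := leP P.[0] 0.
    have [p1|p1] := leP 0 P.[1]; first by apply: poly_ivt; rewrite ?ler01// p0.
    have p0' : P.[0] = 0.
      apply/eqP; rewrite eq_le p0 leNgt /=; apply/negP => h; move: Ple.
      by rewrite leNgt => /negP; apply; rewrite nmulr_rgt0.
    by exists 0; [rewrite lexx ler01|apply/rootP].
  have p1 : P.[1] <= 0 by move: Ple; rewrite pmulr_rle0.
  have [|x x01 Px] := @poly_ivt R (- P) 0 1 ler01; first by rewrite !hornerN oppr_le0 oppr_ge0 (ltW p0).
  by exists x => //; move: Px; rewrite rootN.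
by rewrite -PE Px eqxx.
Qed.

(** * Correctors and the two classes of orientation *)

Module Corrector.

Section Correctors.
Variables (R : realType) (E F : normedModType R).
Implicit Types (L A B C : E -> F).

(* [d] is the determinant of [(L + B)^-1 (L + A)]. *)
Definition rel_det L A B (d : R) :=
  exists T : E -> E, (forall x, L (T x) + B (T x) = L x + A x) /\ has_det T d.

Lemma corrector_linear L A : linear L -> corrector L A -> linear (fun x => L x + A x).
Proof. by move=> lL [lA _ _ _] a u w; rewrite lL lA scalerDr addrACA. Qed.

Lemma corrector_inj L A x y : corrector L A -> L x + A x = L y + A y -> x = y.
Proof. by move=> [_ _ _ [g gK _]] xy; rewrite -(gK x) -(gK y) xy. Qed.

Lemma rel_transfer_linear L A B (T : E -> E) : linear L -> corrector L A -> corrector L B ->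
  (forall x, L (T x) + B (T x) = L x + A x) -> linear T.
Proof.
move=> lL cA cB HT a u w; apply: (corrector_inj cB).
by rewrite HT (corrector_linear lL cA) -!HT (corrector_linear lL cB).
Qed.

Lemma corrector_form L A : corrector L A ->
  exists n (phi : 'I_n -> E -> R) (b : 'I_n -> F), (forall i, functional (phi i)) /\
    forall x, A x = \sum_i phi i x *: b i.
Proof.
move=> [lA _ [n [b [fb Ab]]] _].
have [|phi Hphi] := finite_rank_form lA fb; last by exists n, phi, b.
move=> x; have h : range A (A x) by exists x.
by rewrite Ab in h; exact: h.
Qed.

(** [(L + B)^-1 (L + A)] is the identity plus [(L + B)^-1 (A - B)], which has finite rank. *)
Lemma rel_det_ex L A B : linear L -> corrector L A -> corrector L B ->
  exists2 d, d != 0 & rel_det L A B d.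
Proof.
move=> lL cA cB; have [n [phi [b [lphi Aphi]]]] := corrector_form cA.
have [m [psi [c [lpsi Bpsi]]]] := corrector_form cB.
have [_ _ _ [G GK KG]] := cB; pose S x := L x + B x.
have lS := corrector_linear lL cB.
pose T x := G (L x + A x).
have HT x : L (T x) + B (T x) = L x + A x by exact: KG.
have lG : linear G.
  by move=> a f g; apply: (corrector_inj cB); rewrite KG lS !KG.
pose ph (i : 'I_(n + m)) x := match fintype.split i with inl i => phi i x | inr i => - psi i x end.
pose v (i : 'I_(n + m)) := G (match fintype.split i with inl i => b i | inr i => c i end).
have lph i : functional (ph i).
  move=> a u w; rewrite /ph; case: (fintype.split i) => k; first exact: lphi.
  by rewrite lpsi opprD mulrN.
have sl i : fintype.split (lshift m i) = inl i :> 'I_n + 'I_m.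
  by case: split_ordP => k /eqP; rewrite ?eq_shift// => /eqP ->.
have sr i : fintype.split (rshift n i) = inr i :> 'I_n + 'I_m.
  by case: split_ordP => k /eqP; rewrite ?eq_shift// => /eqP ->.
have TE x : T x = pert ph v x.
  apply: (corrector_inj cB); rewrite HT /pert (linear_funD lS) (linear_fun_sum lS).
  under eq_bigr do rewrite (linear_funZ lS) KG.
  rewrite big_split_ord /=; under eq_bigr do rewrite /ph sl.
  under [X in _ + (_ + X)]eq_bigr do rewrite /ph sr scaleNr.
  by rewrite -Aphi sumrN -Bpsi addrA addrAC addrK.
exists (\det (pert_mx ph v)); last by exists T; split=> //; exact: pert_has_det.
apply: det_pert_neq0 => // x; rewrite -TE => Tx0; apply: (corrector_inj cA).
have lT := rel_transfer_linear lL cA cB HT.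
by rewrite -!HT Tx0 (linear_fun0 lT).
Qed.

Lemma rel_det_comp L A B C d d' : linear L -> corrector L A -> corrector L B -> corrector L C ->
  rel_det L A B d -> rel_det L B C d' -> rel_det L A C (d' * d).
Proof.
move=> lL cA cB cC [T [HT hT]] [T' [HT' hT']]; exists (T' \o T); split.
  by move=> x; rewrite /= HT' HT.
apply: has_det_comp => //; first exact: rel_transfer_linear HT'.
exact: rel_transfer_linear HT.
Qed.

Lemma rel_det_uniq L A B d d' : linear L -> corrector L A -> corrector L B ->
  rel_det L A B d -> rel_det L A B d' -> d = d'.
Proof.
move=> lL cA cB [T [HT hT]] [T' [HT' hT']].
have TT : T = T' by apply/funext => x; apply: (corrector_inj cB); rewrite HT HT'.
have lT := rel_transfer_linear lL cA cB HT; rewrite -TT in hT'.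
have [n [phi [b [lphi Hphi ->]]]] := has_det_pert lT hT.
exact/esym/(has_det_uniq lphi Hphi).
Qed.

Lemma orientation_rel L (o : set (E -> F)) A B d : linear L ->
  operator_orientation L o -> corrector L A -> corrector L B -> d != 0 ->
  rel_det L A B d -> (o B <-> (if 0 < d then o A else ~ o A)).
Proof.
move=> lL [A0 cA0 ->] cA cB d0 dAB.
have [d1 d10 dA0] := rel_det_ex lL cA0 cA.
have memo C e : corrector L C -> rel_det L A0 C e ->
    ([set B | corrector L B /\ corrector_equiv L A0 B] C <-> 0 < e).
  move=> cC eC; split=> [[_ [T [HT [e' [e'0 he']]]]]|e0].
    by rewrite (rel_det_uniq lL cA0 cC eC (ex_intro _ T (conj HT he'))).
  by split=> //; have [T [HT he]] := eC; exists T; split=> //; exists e.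
have mA := memo A d1 cA dA0; have mB := memo B _ cB (rel_det_comp lL cA0 cA cB dA0 dAB).
rewrite mB; case: ifP => dp; first by rewrite mA pmulr_rgt0.
have dn : d < 0 by rewrite lt_neqAle d0 leNgt dp.
rewrite mA nmulr_rgt0//; split; first by move=> h1 h2; have := lt_trans h1 h2; rewrite ltxx.
by move=> h; rewrite lt_neqAle d10 leNgt; exact/negP.
Qed.

End Correctors.

Section Orientation.
Variables (R : realType) (E F : completeNormedModType R) (X : elliptic E F).
Local Notation emb := (emb X).
Local Notation lap := (lap X).
Local Notation ip := (ip X).
Local Notation mul := (mul X).
Local Notation one := (one X).
Local Notation ex := (ex X).
Local Notation opr := (opr X).
Local Notation potential := (potential X).
Local Notation proj := (proj X).
Implicit Types (f g : F) (u w h : E) (c : F -> F).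

Definition nrm f : R := Num.sqrt (ip f f).

Lemma nrm_ge0 f : 0 <= nrm f. Proof. exact: sqrtr_ge0. Qed.
Lemma nrm_sqr f : nrm f ^+ 2 = ip f f. Proof. by rewrite sqr_sqrtr// ip_ge0. Qed.

Lemma ip_le_nrm f g : `|ip f g| <= nrm f * nrm g.
Proof.
apply: le_of_sqr; first by rewrite mulr_ge0 ?nrm_ge0.
by rewrite real_normK ?num_real// exprMn !nrm_sqr ip_CS.
Qed.

Lemma nrmD f g : nrm (f + g) <= nrm f + nrm g.
Proof.
apply: le_of_sqr; first by rewrite addr_ge0 ?nrm_ge0.
rewrite nrm_sqr sqrrD !nrm_sqr ipDl !ipDr (ip_sym X g f).
have := le_trans (ler_norm _) (ip_le_nrm f g); rewrite mulr2n; lra.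
Qed.

Lemma nrmZ (a : R) f : nrm (a *: f) = `|a| * nrm f.
Proof. by rewrite /nrm ipZl ipZr mulrA -expr2 sqrtrM ?sqr_ge0// sqrtr_sqr. Qed.

Lemma nrm_eq0 f : nrm f = 0 -> f = 0.
Proof. by move=> f0; apply: (@ip_eq0 _ _ _ X); rewrite -nrm_sqr f0 expr0n. Qed.

Lemma nrm0 : nrm 0 = 0. Proof. by rewrite /nrm ip0l sqrtr0. Qed.

Lemma nrm_sum n (G : 'I_n -> F) : nrm (\sum_i G i) <= \sum_i nrm (G i).
Proof.
elim: n G => [|n IH] G; first by rewrite !big_ord0 nrm0.
by rewrite !big_ord_recl (le_trans (nrmD _ _))// lerD.
Qed.

Lemma nrm_bnd : exists2 k, 0 < k & forall f, nrm f <= k * `|f|.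
Proof.
have [k k0 kip] := ip_bnd X; exists (k + 1); first by rewrite addr_gt0.
move=> f; apply: le_of_sqr; first by rewrite mulr_ge0// ltW// addr_gt0.
rewrite nrm_sqr (le_trans (ler_norm _))// (le_trans (kip f f))// exprMn -expr2.
rewrite ler_wpM2r ?sqr_ge0// sqrrD expr1n mulr1 -addrA addrC -addrA.
by rewrite (_ : k *+ 2 + _ = k + (k + 1 + k ^+ 2)) ?lerDl ?addr_ge0 ?sqr_ge0 ?ltW//; ring.
Qed.

Lemma positive_nrm c kappa u : positive X c kappa ->
  kappa * nrm (emb u) <= nrm (opr c u).
Proof.
move=> [k0 pos]; have [->|u0] := eqVneq (nrm (emb u)) 0; first by rewrite mulr0 nrm_ge0.
have up : 0 < nrm (emb u) by rewrite lt_neqAle eq_sym u0 nrm_ge0.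
rewrite -(ler_pM2r up) -mulrA -expr2 nrm_sqr (le_trans (pos u))//.
exact: le_trans (ler_norm _) (ip_le_nrm _ _).
Qed.

(** [dens u] is the density [K e^{2u}], where [K] is the curvature of the metric of [u], and [wt u]
    is [e^{-2u}]. The differential [dpi u] of the curvature map is the symmetric operator
    [- Delta - 2 dens u] followed by this weight. *)
Definition dens u : F := one - lap u.
Definition pot u g : F := (-2) *: mul (dens u) g.
Definition wt u : F := ex (- emb u).
Definition dpi u h : F := mul (wt u) (opr (pot u) h).

Definition posfam u n (e : 'I_n -> F) kappa :=
  positive X (fun g => pot u g + proj e g) kappa.
Definition corr u n (e : 'I_n -> F) h : F := mul (wt u) (proj e (emb h)).

Lemma potential_pot u : potential (pot u).
Proof. exact: potential_mul. Qed.

Lemma potential_posfam u n (e : 'I_n -> F) : potential (fun g => pot u g + proj e g).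
Proof. by apply: potentialD; [exact: potential_pot|exact: potential_proj]. Qed.

Lemma opr_add c c' u : opr (fun g => c g + c' g) u = opr c u + c' (emb u).
Proof. by rewrite /EllipticPair.opr addrA. Qed.

(* Lifting the eigenvalues in the finite negative part makes the form positive. *)
Lemma eigen_family_positive c (P : R -> Prop) n (e : 'I_n -> E) l :
  potential c -> (forall m, 0 <= m -> P m) -> eigen_family X c P e l -> (forall i, 0 <= l i) ->
  (forall m u, P m -> opr c u = - m *: emb u -> u = \sum_i ip (emb (e i)) (emb u) *: e i) ->
  exists kappa, positive X
    (fun g => c g + proj (fun i => Num.sqrt (1 + l i) *: emb (e i)) g) kappa.
Proof.
move=> pc P0 [on eig] l0 span; apply: positive_of_spectrum.
  by apply: potentialD => //; exact: potential_proj.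
move=> m u m0; rewrite opr_add => um.
have pj g : proj (fun i => Num.sqrt (1 + l i) *: emb (e i)) g =
    \sum_i ((1 + l i) * ip (emb (e i)) g) *: emb (e i).
  apply: eq_bigr => i _; rewrite ipZl scalerA mulrAC -expr2 sqr_sqrtr//.
  by rewrite addr_ge0.
(* The added term raises the eigenvalue [- l k] to 1, so pairing with [e k] leaves
   [(1 + m) <e k, u> = 0]. *)
have a0 k : ip (emb (e k)) (emb u) = 0.
  have := congr1 (ip (emb (e k))) um; rewrite ipDr ipZr pj ip_sumr -opr_sym//.
  rewrite (proj2 (eig k)) ipZl (bigD1 k)//= big1 ?addr0 => [|i ik]; last first.
    by rewrite ipZr on eq_sym (negPf ik) mulr0.
  rewrite ipZr on eqxx mulr1 => h.
  have : (1 + m) * ip (emb (e k)) (emb u) = 0.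
    by rewrite mulrDl mul1r; move: h; rewrite mulrDl mulNr mul1r; lra.
  move/eqP; rewrite mulf_eq0 => /orP[/eqP m1|/eqP//].
  by move: m0; lra.
have um' : opr c u = - m *: emb u.
  by rewrite -um pj big1 ?addr0// => i _; rewrite a0 mulr0 scale0r.
rewrite (span m u (P0 m m0) um') big1// => i _; by rewrite a0 scale0r.
Qed.

Lemma posfam_ex u : exists n (e : 'I_n -> F) kappa, posfam u e kappa.
Proof.
have [n [e [l [fam span]]]] := @eigen_family_span _ _ _ X (pot u) (fun m => 0 <= m)
  (potential_pot u) (fun m hm => hm).
have l0 i : 0 <= l i by have [_ /(_ i)[]] := fam.
have [kappa Hk] := eigen_family_positive (potential_pot u) (fun m hm => hm) fam l0 span.
by exists n, (fun i => Num.sqrt (1 + l i) *: emb (e i)), kappa.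
Qed.

Lemma wtK u g : mul (wt u) (mul (ex (emb u)) g) = g.
Proof. by rewrite mulA exN mul1. Qed.

Lemma wtK' u g : mul (ex (emb u)) (mul (wt u) g) = g.
Proof. by rewrite mulA (mulC X (ex _)) exN mul1. Qed.

Lemma mul_cont f : continuous (mul f).
Proof.
have [k k0 km] := mul_bnd X.
apply: (bounded_linear_continuous (k := k * `|f|) (mul_lin X f)) => g.
by rewrite (le_trans (km _ _))// mulrA.
Qed.

Lemma dpi_lin u : linear (dpi u).
Proof.
have [lc _ _ _] := potential_pot u.
by move=> a h w; rewrite /dpi (opr_lin X lc) (mul_lin X).
Qed.

Lemma dpi_corr u n (e : 'I_n -> F) h :
  dpi u h + corr u e h = mul (wt u) (opr (fun g => pot u g + proj e g) h).
Proof. by rewrite opr_add (linear_funD (mul_lin X (wt u))). Qed.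

Lemma finite_rank_has_dim (A : E -> F) n (phi : 'I_n -> E -> R) (b : 'I_n -> F) :
  linear A -> (forall x, A x = \sum_i phi i x *: b i) -> exists m, has_dim (range A) m.
Proof.
move=> lA HA; apply: (@has_dim_subspace R F n b).
- by exists 0 => //; exact: linear_fun0.
- by move=> c _ _ [x _ <-] [y _ <-]; exists (c *: x + y) => //; rewrite lA.
- by move=> _ [x _ <-]; exists (phi^~ x).
Qed.

Lemma corr_corrector u n (e : 'I_n -> F) kappa : posfam u e kappa ->
  corrector (dpi u) (corr u e).
Proof.
move=> pos; have [lp [k k0 kp] _ _] := potential_proj X e.
have lc : linear (corr u e).
  by move=> a h w; rewrite /corr (emb_lin X) lp (mul_lin X).
split=> //.
- move=> h; apply: (@continuous_comp _ _ _ (fun h => proj e (emb h)) (mul (wt u)));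
    last exact: mul_cont.
  apply: (@continuous_comp _ _ _ emb (proj e)); first exact: emb_cont.
  exact: (bounded_linear_continuous lp kp).
- apply: (@finite_rank_has_dim _ n (fun i h => ip (e i) (emb h)) (fun i => mul (wt u) (e i))) => //.
  move=> h; rewrite /corr /proj (linear_fun_sum (mul_lin X (wt u))).
  by apply: eq_bigr => i _; rewrite (linear_funZ (mul_lin X (wt u))).
- have [G [lG GK KG _]] := opr_inverse (potential_posfam u e) (positive_inj pos).
  exists (fun f => G (mul (ex (emb u)) f)).
    by move=> h; rewrite dpi_corr wtK' KG.
  by move=> f; rewrite dpi_corr GK wtK.
Qed.

Lemma ip_emb_functional f : functional (fun h => ip f (emb h)).
Proof. by move=> a u w; rewrite (emb_lin X) ipDr ipZr. Qed.

End Orientation.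

End Corrector.
Import Corrector.

(** * Comparison of an orientation with the positive correctors *)

Section OrientationSign.
Variables (R : realType) (E F : completeNormedModType R) (X : elliptic E F).
Local Notation emb := (emb X).
Local Notation lap := (lap X).
Local Notation ip := (ip X).
Local Notation mul := (mul X).
Local Notation one := (one X).
Local Notation ex := (ex X).
Local Notation opr := (opr X).
Local Notation potential := (potential X).
Local Notation proj := (proj X).
Local Notation nrm := (nrm X).
Local Notation dpi := (dpi X).
Local Notation corr := (corr X).
Local Notation posfam := (posfam X).
Local Notation pot := (pot X).
Local Notation wt := (wt X).
Implicit Types (f g : F) (u w h : E) (c : F -> F).

Lemma pert_mx_scale (V : normedModType R) n (phi : 'I_n -> V -> R) (b : 'I_n -> V) (s : R) :
  pert_mx (fun i x => s * phi i x) b = 1%:M + s *: (\matrix_(i, j) phi j (b i)).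
Proof. by rewrite /pert_mx; congr (_ + _); apply/matrixP => i j; rewrite !mxE. Qed.

(** Along the segment between the two correctors the operator stays positive, hence injective, so
    the determinant of [1 + s M] never vanishes and keeps the sign it has at the identity. *)
Lemma posfam_rel u n (e : 'I_n -> F) kappa n' (e' : 'I_n' -> F) kappa' :
  posfam u e kappa -> posfam u e' kappa' ->
  exists2 d, 0 < d & rel_det (dpi u) (corr u e) (corr u e') d.
Proof.
move=> pe pe'; have [k0 He] := pe; have [k0' He'] := pe'.
have [lc' _ _ _] := potential_posfam X u e'.
have [G [lG GK KG _]] := opr_inverse (potential_posfam X u e') (positive_inj pe').
pose ph (i : 'I_(n + n')) x := match fintype.split i with
  inl i => ip (e i) (emb x) | inr i => - ip (e' i) (emb x) end.
pose v (i : 'I_(n + n')) := G (match fintype.split i with inl i => e i | inr i => e' i end).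
have lph i : functional (ph i).
  move=> a x y; rewrite /ph; case: (fintype.split i) => k; rewrite ip_emb_functional//.
  by rewrite opprD mulrN.
have sl i : fintype.split (lshift n' i) = inl i :> 'I_n + 'I_n'.
  by case: split_ordP => k /eqP; rewrite ?eq_shift// => /eqP ->.
have sr i : fintype.split (rshift n i) = inr i :> 'I_n + 'I_n'.
  by case: split_ordP => k /eqP; rewrite ?eq_shift// => /eqP ->.
have sumE x : \sum_i ph i x *: v i = G (proj e (emb x) - proj e' (emb x)).
  rewrite big_split_ord /=; under eq_bigr do rewrite /ph /v sl.
  under [X in _ + X]eq_bigr do rewrite /ph /v sr scaleNr.
  rewrite sumrN (linear_funB lG) !(linear_fun_sum lG); congr (_ - _);
    by apply: eq_bigr => i _; rewrite (linear_funZ lG).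
have SG s x : opr (fun g => pot u g + proj e' g) (pert (fun i x => s * ph i x) v x) =
    opr (pot u) x + (1 - s) *: proj e' (emb x) + s *: proj e (emb x).
  rewrite /pert; under eq_bigr do rewrite -scalerA.
  rewrite -scaler_sumr sumE (linear_funD (opr_lin X lc')) (linear_funZ (opr_lin X lc')) GK.
  rewrite opr_add scalerBr scalerBl scale1r -!addrA; congr (_ + (_ + _)).
  by congr (_ + _); rewrite addrC.
have inj s x : 0 <= s <= 1 -> pert (fun i x => s * ph i x) v x = 0 -> x = 0.
  move=> /andP[s0 s1] x0; have := SG s x; rewrite x0 (linear_fun0 (opr_lin X lc')) => /esym S0.
  apply/eqP; apply: contraT => /(emb_ip_gt0 X) ix.
  have h1 := He x; have h2 := He' x; rewrite opr_add ipDl in h1; rewrite opr_add ipDl in h2.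
  have := congr1 (fun f => ip f (emb x)) S0; rewrite ipDl ipDl !ipZl ip0l => h3.
  have k1 : 0 < kappa * ip (emb x) (emb x) by rewrite mulr_gt0.
  have k2 : 0 < kappa' * ip (emb x) (emb x) by rewrite mulr_gt0.
  have [s0'|s0'] := ltP 0 s.
    have m1 := ler_wpM2l s0 h1; have m2 : (1 - s) * (kappa' * ip (emb x) (emb x)) <=
      (1 - s) * (ip (opr (pot u) x) (emb x) + ip (proj e' (emb x)) (emb x)).
      by rewrite ler_wpM2l ?subr_ge0.
    have m3 : 0 < s * (kappa * ip (emb x) (emb x)) by rewrite mulr_gt0.
    have m4 : 0 <= (1 - s) * (kappa' * ip (emb x) (emb x)) by rewrite mulr_ge0 ?subr_ge0// ltW.
    by move: m1 m2 m3 m4 h3; rewrite !mulrDr !mulrBl !mul1r; lra.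
  have s00 : s = 0 by apply/eqP; rewrite eq_le s0' s0.
  by move: h3 h2 k2; rewrite s00 subr0 mul1r mul0r addr0; lra.
pose M := \matrix_(i, j) ph j (v i).
have := @det_affine_sign R _ 1%:M M; rewrite det1 mul1r => dM.
exists (\det (1%:M + M)).
  apply: dM => s s01; rewrite -pert_mx_scale; apply: det_pert_neq0.
    by move=> i a x y; rewrite lph mulrDr mulrCA.
  by move=> x; exact: inj.
have HT x : pert ph v x = pert (fun i x => 1 * ph i x) v x.
  by rewrite /pert; congr (_ + _); apply: eq_bigr => i _; rewrite mul1r.
exists (pert ph v); split; last exact: pert_has_det.
move=> x; rewrite !dpi_corr HT SG subrr scale0r addr0 scale1r opr_add//.
Qed.

Section Local.
Variables (u0 : E) (n : nat) (e : 'I_n -> F) (kappa : R).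
Hypothesis pos0 : posfam u0 e kappa.
Let v := cst1 X.
Let S y := opr (fun g => pot y g + proj e g).
(** Multiplication by the quotient of the weights at [u0] and at [y]. It is close to the identity on
    fixed vectors for [y] near [u0] and absorbs the motion of the factor [e^{-2y}]. *)
Let q y g := mul (ex (emb y)) (mul (wt u0) g).

Lemma near_q g (eta : R) : 0 < eta -> \forall y \near u0, nrm (q y g - g) < eta.
Proof.
move=> eta0; have [kn kn0 Hkn] := nrm_bnd X; have [km km0 Hkm] := mul_bnd X.
have [k k0 Hk] := linear_continuous_bounded (emb_lin X) (@emb_cont _ _ _ X).
have E1 y : q y g - g = mul (ex (emb y) - ex (emb u0)) (mul (wt u0) g).
  rewrite (mulC X _ (mul _ _)) (linear_funB (mul_lin X _)) !(mulC X (mul (wt u0) g)).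
  by rewrite wtK'.
pose C := kn * km * (`|mul (wt u0) g| + 1); have C0 : 0 < C by rewrite !mulr_gt0// ltr_wpDl.
have ce : {for emb u0, continuous ex}.
  apply/cvgrPdist_lt => d d0.
  have := ex_diff X (emb u0) ltr01; move=> /nbhs_normP[r /= r0 Hr].
  pose K := 1 + 2 * (km * `|ex (emb u0)|); have K0 : 0 < K by rewrite ltr_pwDl// !mulr_ge0// ltW.
  apply/nbhs_normP; exists (Num.min r (d / K)); first by rewrite /= lt_min r0 divr_gt0.
  move=> f /=; rewrite lt_min => /andP[fr fd].
  have := Hr (f - emb u0); rewrite /= sub0r normrN distrC fr => /(_ isT).
  rewrite [emb u0 + _]addrC subrK mul1r => h.
  rewrite distrC (@le_lt_trans _ _ (K * `|emb u0 - f|))//; last by rewrite mulrC -ltr_pdivlMr.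
  rewrite -(subrK (2 *: mul (ex (emb u0)) (f - emb u0)) (ex f - ex (emb u0))).
  rewrite (le_trans (ler_normD _ _))// /K mulrDl mul1r distrC lerD//; last first.
    by rewrite normrZ ger0_norm// -!mulrA ler_pM2l// (le_trans (Hkm _ _))// distrC.
  by rewrite distrC.
have := @continuous_comp _ _ _ emb ex u0 (@emb_cont _ _ _ X u0) ce.
move=> /cvgrPdist_lt/(_ _ (divr_gt0 eta0 C0)); apply: filterS => y /= hy.
rewrite E1 (le_lt_trans (Hkn _))// (@le_lt_trans _ _ (C * `|ex (emb u0) - ex (emb y)|))//.
  rewrite /C -!mulrA ler_pM2l// (le_trans (Hkm _ _))// ler_pM2l// distrC mulrC.
  by rewrite ler_wpM2r// lerDl.
by rewrite mulrC -ltr_pdivlMr.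
Qed.

Lemma pot_diff y g : pot y g - pot u0 g = 2 *: mul (lap (y - u0)) g.
Proof.
rewrite /pot /dens -scalerBr -!(mulC X g) -(linear_funB (mul_lin X g)).
rewrite opprB [X in mul g X]addrC addrA subrK -(linear_funB (lap_lin X)).
rewrite -[u0 - y]opprB (linear_funN (lap_lin X)).
by rewrite (linear_funN (mul_lin X g)) scalerN scaleNr opprK.
Qed.

Lemma near_lap (eta : R) : 0 < eta -> \forall y \near u0, `|lap (y - u0)| < eta.
Proof.
move=> eta0; have [k k0 Hk] := linear_continuous_bounded (lap_lin X) (@lap_cont _ _ _ X).
apply/nbhs_normP; exists (eta / k); first by rewrite /= divr_gt0.
by move=> y /= uy; rewrite (le_lt_trans (Hk _))// distrC mulrC -ltr_pdivlMr.
Qed.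

Lemma near_S w (eta : R) : 0 < eta -> \forall y \near u0, nrm (S y w - S u0 w) < eta.
Proof.
move=> eta0; have [kn kn0 Hkn] := nrm_bnd X; have [km km0 Hkm] := mul_bnd X.
pose C := kn * (2 * km * (`|emb w| + 1)); have C0 : 0 < C by rewrite !mulr_gt0// ltr_wpDl.
apply: filterS (near_lap (divr_gt0 eta0 C0)) => y hy.
have -> : S y w - S u0 w = pot y (emb w) - pot u0 (emb w).
  by rewrite /S !opr_add /EllipticPair.opr opprD addrACA subrr addr0 opprD addrACA subrr add0r.
rewrite pot_diff (le_lt_trans (Hkn _))// (@le_lt_trans _ _ (C * `|lap (y - u0)|))//.
  rewrite /C -!mulrA ler_pM2l// normrZ ger0_norm// ler_pM2l// (le_trans (Hkm _ _))//.
  by rewrite ler_pM2l// [leRHS]mulrC ler_wpM2l// lerDl.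
by rewrite mulrC -ltr_pdivlMr.
Qed.

(** Moving [u0] changes the form by a multiplication, which [ip_mul_bnd] bounds by a small multiple
    of [<w, w>]; half of [kappa] survives. *)
Lemma near_posfam : \forall y \near u0, posfam y e (kappa / 2).
Proof.
have [k k0 Hk] := ip_mul_bnd X; have [kap0 Hpos] := pos0.
have k20 : 0 < kappa / 2 / (2 * k) by rewrite !divr_gt0// mulr_gt0.
apply: filterS (near_lap k20) => y hy; split; first by rewrite divr_gt0.
move=> w; have h0 := Hpos w.
have -> : opr (fun g => pot y g + proj e g) w = opr (fun g => pot u0 g + proj e g) w +
    2 *: mul (lap (y - u0)) (emb w).
  rewrite -pot_diff !opr_add /EllipticPair.opr [RHS]addrAC; congr (_ + _).
  by rewrite [RHS]addrACA subrr addr0.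
rewrite [leRHS]ipDl [X in _ + X]ipZl.
have := Hk (lap (y - u0)) (emb w); have i0 := ip_ge0 X (emb w).
have : 2 * (k * `|lap (y - u0)|) * ip (emb w) (emb w) <= kappa / 2 * ip (emb w) (emb w).
  by rewrite ler_wpM2r// mulrA mulrC -ler_pdivlMr ?mulr_gt0// ltW.
move=> h1; rewrite ler_norml => /andP[h2 _]; move: h0 h1 h2.
move: (ip (opr _ _) _) (ip (emb w) _) (ip (mul _ _) _) (k * _) => a1 a2 a3 a4 h0 h1 h2; lra.
Qed.

(* [tau = 0] gives the positive corrector itself, [tau = 2] its composite with
   the reflection [h - 2 <1, h> 1], which reverses the orientation. *)
Definition refl (tau : R) h : E := h - (tau * ip one (emb h)) *: v.
Definition acorr (tau : R) h : F := mul (wt u0) (S u0 (refl tau h) - opr (pot u0) h).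

Lemma emb_refl tau h : emb (refl tau h) = emb h - (tau * ip one (emb h)) *: one.
Proof. by rewrite (linear_funB (emb_lin X)) (linear_funZ (emb_lin X)) emb_cst1. Qed.

Lemma reflK tau : tau = 0 \/ tau = 2 -> involutive (refl tau).
Proof.
move=> [->|->] h; rewrite /refl; first by rewrite !mul0r scale0r !subr0.
rewrite -/(refl 2 h) emb_refl ipBr ipZr ip_one mulr1 /refl -addrA -opprD -scalerDl.
rewrite (_ : 2 * ip one (emb h) + _ = 0) ?scale0r ?subr0//; ring.
Qed.

Lemma refl_lin tau : linear (refl tau).
Proof.
move=> a h w; rewrite /refl ip_emb_functional mulrDr scalerDl mulrCA.
by rewrite [X in _ = X + _]scalerBr opprD addrACA scalerA.
Qed.

Lemma nrm_refl tau h : tau = 0 \/ tau = 2 -> nrm (emb (refl tau h)) = nrm (emb h).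
Proof.
move=> t; congr Num.sqrt; rewrite emb_refl ipBl !ipBr !ipZl !ipZr ip_one.
rewrite (ip_sym X (emb h) one); case: t => ->; ring.
Qed.

Lemma S_lin y : linear (S y).
Proof. by have [lc _ _ _] := potential_posfam X y e; exact: opr_lin. Qed.

Lemma acorrE tau h : acorr tau h = mul (wt u0) (proj e (emb h)) -
  (tau * ip one (emb h)) *: mul (wt u0) (S u0 v).
Proof.
rewrite /acorr /refl (linear_funB (S_lin u0)) (linear_funZ (S_lin u0)).
rewrite {1}/S opr_add addrAC [opr _ _ + _]addrC addrK (linear_funB (mul_lin X _)).
by rewrite (linear_funZ (mul_lin X _)).
Qed.

Lemma acorr_corrector tau : tau = 0 \/ tau = 2 -> corrector (dpi u0) (acorr tau).
Proof.
move=> t; have [lc [k k0 kp] _ _] := potential_pot X u0.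
have lo := opr_lin X lc.
have la : linear (acorr tau).
  move=> a h w; rewrite /acorr refl_lin (S_lin u0) lo opprD addrACA -scalerBr.
  by rewrite (mul_lin X).
have cS y : continuous (S y) by exact: (opr_cont (potential_posfam X y e)).
have [G [lG GK KG _]] := opr_inverse (potential_posfam X u0 e) (positive_inj pos0).
have eq h : dpi u0 h + acorr tau h = mul (wt u0) (S u0 (refl tau h)).
  by rewrite -(linear_funD (mul_lin X _)) addrC subrK.
split=> //.
- have cr : continuous (refl tau).
    move=> h; apply: (@continuousB _ _ _ id (fun h => (tau * ip one (emb h)) *: v)).
      exact: cvg_id.
    apply: (@continuousZr_tmp _ _ _ (fun h => tau * ip one (emb h)) v).
    apply: (@continuousM _ _ (fun=> tau) (fun h => ip one (emb h))); first exact: cst_continuous.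
    by apply: (@continuous_comp _ _ _ emb (ip one)); [exact: emb_cont|exact: ip_cont].
  move=> h; apply: (@continuous_comp _ _ _
    (fun h => S u0 (refl tau h) - opr (pot u0) h) (mul (wt u0))); last exact: mul_cont.
  apply: (@continuousB _ _ _ (fun h => S u0 (refl tau h)) (opr (pot u0))).
    by apply: (@continuous_comp _ _ _ (refl tau) (S u0)); [exact: cr|exact: cS].
  exact: (opr_cont (potential_pot X u0)).
- pose ph (i : 'I_n.+1) h := if unlift ord0 i is Some k then ip (e k) (emb h)
    else - (tau * ip one (emb h)).
  pose b (i : 'I_n.+1) := mul (wt u0) (if unlift ord0 i is Some k then e k else S u0 v).
  apply: (@finite_rank_has_dim _ _ _ _ n.+1 ph b) => // h.
  rewrite acorrE big_ord_recl /ph /b unlift_none scaleNr addrC; congr (_ + _).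
  rewrite /proj (linear_fun_sum (mul_lin X _)); apply: eq_bigr => i _.
  by rewrite liftK (linear_funZ (mul_lin X _)).
- exists (fun f => refl tau (G (mul (ex (emb u0)) f))).
    by move=> h; rewrite eq wtK' KG reflK.
  by move=> f; rewrite eq reflK// [S u0 _]GK wtK.
Qed.

(** Relative to [corr y e], the fixed operator [acorr tau] is the reflection plus a term of [L^2]
    norm at most 1/2. The reflection is an [L^2] isometry, so the segment between the two stays
    injective and the determinant keeps the sign of [1 - tau]. *)
Lemma acorr_rel tau : tau = 0 \/ tau = 2 -> \forall y \near u0,
  corrector (dpi y) (acorr tau) ->
  exists2 d, 0 < (1 - tau) * d & rel_det (dpi y) (acorr tau) (corr y e) d.
Proof.
move=> t; have [kap0 _] := pos0.
(* Bounds the sum of the rank-one errors, with [2 / kappa] for the inverse at [y] and 2 for [tau];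
   each error vector is then taken below [1 / (2 * Cn)]. *)
pose Cn := \sum_i nrm (e i) * (2 / kappa) + 2 * (2 / kappa) + 1.
have Cn0 : 0 < Cn.
  have k2 : 0 <= 2 / kappa by rewrite divr_ge0// ltW.
  rewrite ltr_wpDl//; apply: addr_ge0; last by rewrite mulr_ge0.
  by apply: sumr_ge0 => i _; rewrite mulr_ge0 ?nrm_ge0.
have eta0 : 0 < (2 * Cn)^-1 by rewrite invr_gt0 mulr_gt0.
have eta20 : 0 < (2 * Cn)^-1 / 2 by rewrite divr_gt0.
have n1 : \forall y \near u0, forall i, nrm (q y (e i) - e i) < (2 * Cn)^-1.
  by apply: filter_forall => i; exact: near_q.
have n2 := near_q (S u0 v) eta20; have n3 := near_S v eta20.
near=> y => cA.
have py : posfam y e (kappa / 2) by near: y; exact: near_posfam.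
have h1 : forall i, nrm (q y (e i) - e i) < (2 * Cn)^-1 by near: y.
have h2 : nrm (q y (S u0 v) - S y v) < (2 * Cn)^-1.
  have a1 : nrm (q y (S u0 v) - S u0 v) < (2 * Cn)^-1 / 2 by near: y.
  have a2 : nrm (S y v - S u0 v) < (2 * Cn)^-1 / 2 by near: y.
  rewrite -(subrK (S u0 v) (q y (S u0 v))) -addrA (le_lt_trans (nrmD _ _ _))//.
  have -> : S u0 v - S y v = (-1) *: (S y v - S u0 v) by rewrite scaleN1r opprB.
  by rewrite nrmZ normrN1 mul1r; lra.
have [G [lG GK KG _]] := opr_inverse (potential_posfam X y e) (positive_inj py).
have Gn f : nrm (emb (G f)) <= 2 / kappa * nrm f.
  have := positive_nrm (G f) py; rewrite GK => hf.
  have -> : 2 / kappa = (kappa / 2)^-1 by rewrite invf_div.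
  by rewrite ler_pdivlMl// divr_gt0.
pose ph (i : 'I_n.+1) h := if unlift ord0 i is Some k then ip (e k) (emb h)
  else - (tau * ip one (emb h)).
pose b0 (i : 'I_n.+1) : E := if unlift ord0 i is Some k then 0 else v.
pose db (i : 'I_n.+1) : E := if unlift ord0 i is Some k then G (q y (e k) - e k)
  else G (q y (S u0 v)) - v.
pose b s i := b0 i + s *: db i.
have lph i : functional (ph i).
  move=> a h w; rewrite /ph; case: unlift => [k|]; rewrite ip_emb_functional//.
  by rewrite mulrDr opprD mulrCA mulrN.
pose N h := \sum_i ph i h *: db i.
have pertE s h : pert ph (b s) h = refl tau h + s *: N h.
  rewrite /pert /b; under eq_bigr do rewrite scalerDr scalerA mulrC -scalerA.
  rewrite big_split /= -scaler_sumr addrA; congr (_ + _).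
  rewrite big_ord_recl /ph /b0 unlift_none big1 ?addr0 => [|i _].
    by rewrite scaleNr.
  by rewrite liftK scaler0.
have Nn h : nrm (emb (N h)) <= 2^-1 * nrm (emb h).
  rewrite /N (linear_fun_sum (emb_lin X)) (le_trans (nrm_sum _ _))//.
  rewrite big_ord_recl /ph /db unlift_none.
  have -> : G (q y (S u0 v)) - v = G (q y (S u0 v) - S y v).
    by rewrite (linear_funB lG) KG.
  have t2 : `|tau| <= 2 by case: t => ->; rewrite ?normr0 ?ger0_norm.
  have one1 : nrm one = 1 by rewrite /Corrector.nrm ip_one sqrtr1.
  have c1 : nrm (emb (- (tau * ip one (emb h)) *: G (q y (S u0 v) - S y v))) <=
      nrm (emb h) * (2 * (2 / kappa) * (2 * Cn)^-1).
    rewrite (linear_funZ (emb_lin X)) nrmZ normrN normrM.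
    have := ip_le_nrm X one (emb h); rewrite one1 mul1r => hi.
    have := le_trans (Gn _) (ler_wpM2l (ltac:(by rewrite divr_ge0// ltW) : 0 <= 2 / kappa) (ltW h2)) => hG.
    rewrite [leRHS](_ : _ = (2 * nrm (emb h)) * (2 / kappa * (2 * Cn)^-1)); last by ring.
    by apply: ler_pM; rewrite ?mulr_ge0 ?nrm_ge0// ler_pM.
  have c2 i : nrm (emb (ip (e i) (emb h) *: G (q y (e i) - e i))) <=
      nrm (emb h) * (nrm (e i) * (2 / kappa) * (2 * Cn)^-1).
    rewrite (linear_funZ (emb_lin X)) nrmZ.
    have hi := ip_le_nrm X (e i) (emb h).
    have := le_trans (Gn _) (ler_wpM2l (ltac:(by rewrite divr_ge0// ltW) : 0 <= 2 / kappa) (ltW (h1 i))) => hG.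
    rewrite [leRHS](_ : _ = (nrm (e i) * nrm (emb h)) * (2 / kappa * (2 * Cn)^-1)); last by ring.
    by apply: ler_pM; rewrite ?nrm_ge0.
  under eq_bigr do rewrite liftK.
  rewrite (le_trans (lerD c1 (ler_sum _ (fun i _ => c2 i))))//.
  rewrite -mulr_sumr -mulrDr mulrC ler_wpM2r ?nrm_ge0//.
  rewrite -mulr_suml -mulrDl ler_pdivrMr ?mulr_gt0// [leRHS]mulrA mulVf// mul1r addrC.
  by rewrite /Cn lerDl.
have inj s h : 0 <= s <= 1 -> pert ph (b s) h = 0 -> h = 0.
  move=> /andP[s0 s1]; rewrite pertE => h0.
  have hn : nrm (emb (refl tau h)) = s * nrm (emb (N h)).
    have -> : refl tau h = (- s) *: N h by apply/eqP; rewrite scaleNr -addr_eq0 h0.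
    by rewrite (linear_funZ (emb_lin X)) nrmZ normrN ger0_norm.
  rewrite nrm_refl// in hn.
  apply: (@emb_inj _ _ _ X); apply: (@nrm_eq0 _ _ _ X).
  have a1 : s * nrm (emb (N h)) <= 1 * nrm (emb (N h)) by rewrite ler_wpM2r ?nrm_ge0.
  by have := Nn h; have := nrm_ge0 X (emb h); lra.
pose M0 := pert_mx ph b0; pose M1 := \matrix_(i, j) ph j (db i).
have ME s : pert_mx ph (b s) = M0 + s *: M1.
  rewrite /M0 /pert_mx -addrA; congr (_ + _); apply/matrixP => i j; rewrite !mxE.
  by rewrite /b (addrC (b0 i)) lph addrC.
have detM0 : \det M0 = 1 - tau.
  have -> : \det M0 = \det (pert_mx (fun (_ : 'I_1) h => - (tau * ip one (emb h))) (fun=> v)).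
    apply: det_pert_uniq => [//|i a h w|h].
      by rewrite ip_emb_functional mulrDr opprD mulrCA mulrN.
    rewrite /pert big_ord_recl big_ord1 /ph /b0 unlift_none big1 ?addr0// => i _.
    by rewrite liftK scaler0.
  by rewrite det_mx11 !mxE eqxx emb_cst1 ip_one mulr1.
have sgn := @det_affine_sign R _ M0 M1; rewrite detM0 in sgn.
exists (\det (M0 + M1)).
  apply: sgn => s s01; rewrite -ME; apply: det_pert_neq0 => // h; exact: inj.
have -> : M0 + M1 = pert_mx ph (b 1) by rewrite ME scale1r.
exists (pert ph (b 1)); split; last exact: pert_has_det.
move=> h; rewrite dpi_corr -/(S y) pertE scale1r (linear_funD (S_lin y)).
have -> : S y (N h) = q y (proj e (emb h)) - proj e (emb h) -
    (tau * ip one (emb h)) *: (q y (S u0 v) - S y v).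
  rewrite /N (linear_fun_sum (S_lin y)) big_ord_recl /ph /db unlift_none.
  rewrite (linear_funZ (S_lin y)) (linear_funB (S_lin y)) [S y (G _)]GK scaleNr addrC; congr (_ - _).
  have qlin : linear (q y) by move=> a f g; rewrite /q !(mul_lin X).
  rewrite /proj (linear_fun_sum qlin) -sumrB; apply: eq_bigr => i _.
  by rewrite liftK (linear_funZ (S_lin y)) [S y (G _)]GK (linear_funZ qlin) scalerBr.
rewrite /refl (linear_funB (S_lin y)) (linear_funZ (S_lin y)) acorrE /dpi.
rewrite -(wtK X y (mul (wt u0) (proj e (emb h)))) -/(q y _).
rewrite -(wtK X y (mul (wt u0) (S u0 v))) -/(q y _).
rewrite -(linear_funZ (mul_lin X _)) -(linear_funB (mul_lin X _)) -(linear_funD (mul_lin X _)).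
congr (mul _ _); rewrite {1}/S opr_add scalerBr opprB.
set x1 := opr _ _; set x2 := proj _ _; set x3 := q y _; set x4 := _ *: S y v; set x5 := _ *: _.
by rewrite [LHS]addrACA addKr [X in X - _]addrACA subrr addr0 -addrA.
Unshelve. all: by end_near. Qed.

End Local.

Section Global.
Variable o : E -> set (E -> F).
Hypothesis oo : forall u, operator_orientation (dpi u) (o u).
Hypothesis oc : forall u A, o u A -> \forall y \near u, o y A.

Definition pos_side u := exists n (e : 'I_n -> F) kappa, posfam u e kappa /\ o u (corr u e).

Lemma oriented_corrector u A : o u A -> corrector (dpi u) A.
Proof. by have [A0 _ ->] := oo u; case. Qed.

Lemma pos_sideP u n (e : 'I_n -> F) kappa : posfam u e kappa ->
  (pos_side u <-> o u (corr u e)).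
Proof.
move=> pe; split; last by exists n, e, kappa.
move=> [n' [e' [k' [pe' oe']]]]; have [d d0 rd] := posfam_rel pe' pe.
have := orientation_rel (dpi_lin X u) (oo u) (corr_corrector pe') (corr_corrector pe).
by move=> /(_ d (lt0r_neq0 d0) rd); rewrite d0 => ->.
Qed.

(** Continuity of an orientation transports only members of [o u]. If the positive correctors are
    not in [o u], the reflected operator is; it is carried to nearby [y], where it excludes the
    positive ones. *)
Lemma pos_side_near u : \forall y \near u, pos_side y <-> pos_side u.
Proof.
have [n [e [kappa pe]]] := posfam_ex X u.
have side tau y d : corrector (dpi y) (acorr u e tau) -> posfam y e (kappa / 2) ->
    0 < (1 - tau) * d -> rel_det (dpi y) (acorr u e tau) (corr y e) d ->
    (pos_side y <-> if 0 < d then o y (acorr u e tau) else ~ o y (acorr u e tau)).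
  move=> cA py d0 rd; rewrite (pos_sideP py).
  have dn0 : d != 0 by apply: contraTneq d0 => ->; rewrite mulr0 ltxx.
  exact: (orientation_rel (dpi_lin X y) (oo y) cA (corr_corrector py) dn0 rd).
have [ps|ns] := pselect (pos_side u).
- have t0 : (0 : R) = 0 \/ (0 : R) = 2 by left.
  have r0 := acorr_rel pe t0; have pn := near_posfam pe.
  have [d d0 rd] := nbhs_singleton r0 (acorr_corrector pe t0).
  have d0' : 0 < d by move: d0; rewrite subr0 mul1r.
  have ou : o u (acorr u e 0).
    by have := side _ _ _ (acorr_corrector pe t0) (nbhs_singleton pn) d0 rd; rewrite d0' => <-.
  near=> y; have oy : o y (acorr u e 0) by near: y; exact: oc.
  have [d' e0 re] : exists2 d, 0 < (1 - 0) * d & rel_det (dpi y) (acorr u e 0) (corr y e) d.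
    have : corrector (dpi y) (acorr u e 0) -> exists2 d, 0 < (1 - 0) * d &
      rel_det (dpi y) (acorr u e 0) (corr y e) d by near: y.
    by apply; exact: oriented_corrector.
  have py : posfam y e (kappa / 2) by near: y.
  have := side _ _ _ (oriented_corrector oy) py e0 re.
  by move: e0; rewrite subr0 mul1r => -> h; split=> // _; exact/h.
- have t0 : (2 : R) = 0 \/ (2 : R) = 2 by right.
  have r0 := acorr_rel pe t0; have pn := near_posfam pe.
  have neg d : 0 < (1 - 2 : R) * d -> (0 < d) = false.
    by move=> dn; apply/negbTE; rewrite -leNgt; move: dn; lra.
  have [d d0 rd] := nbhs_singleton r0 (acorr_corrector pe t0).
  have ou : o u (acorr u e 2).
    have := side _ _ _ (acorr_corrector pe t0) (nbhs_singleton pn) d0 rd; rewrite neg// => h.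
    by apply: contrapT => no; exact/ns/h.
  near=> y; have oy : o y (acorr u e 2) by near: y; exact: oc.
  have [d' e0 re] : exists2 d, 0 < (1 - 2) * d & rel_det (dpi y) (acorr u e 2) (corr y e) d.
    have : corrector (dpi y) (acorr u e 2) -> exists2 d, 0 < (1 - 2) * d &
      rel_det (dpi y) (acorr u e 2) (corr y e) d by near: y.
    by apply; exact: oriented_corrector.
  have py : posfam y e (kappa / 2) by near: y.
  have := side _ _ _ (oriented_corrector oy) py e0 re; rewrite neg// => h.
  by split=> [/h//|/ns].
Unshelve. all: by end_near. Qed.

(** Along a segment of [E] the indicator of the side is locally constant, hence continuous, and the
    intermediate value theorem forbids a jump. *)
Lemma pos_side_const u w : pos_side u <-> pos_side w.
Proof.
pose x (t : R) : E := u + t *: (w - u).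
have cx : continuous x.
  move=> t; apply: (@continuousD R E R (fun=> u) (fun t => t *: (w - u)) t).
    exact: cst_continuous.
  by apply: (@continuousZr_tmp _ _ _ (fun t : R => t) (w - u)); exact: cvg_id.
pose ind (t : R) : R := if `[< pos_side (x t) >] then 1 else 0.
have ci : continuous ind.
  move=> t; apply/cvgrPdist_lt => eps eps0.
  have := cx t _ (pos_side_near (x t)).
  apply: (@filterS _ (nbhs t)) => s /= hs.
  by rewrite /ind (asbool_equiv_eq hs) subrr normr0.
have x0 : x 0 = u by rewrite /x scale0r addr0.
have x1 : x 1 = w by rewrite /x scale1r addrC subrK.
have half : forall t, ind t <> 2^-1 by move=> t; rewrite /ind; case: ifP => _; lra.
have cw : {within `[0, 1], continuous ind} by apply: continuous_subspaceT.
have b01 : (0 : R) <= 1 by [].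
have ivt := IVT b01 cw.
rewrite -{1}x0 -{1}x1; have [p0|p0] := pselect (pos_side (x 0));
  have [p1|p1] := pselect (pos_side (x 1)) => //.
  have : exists2 c, c \in `[0 : R, 1] & ind c = 2^-1.
    apply: ivt; rewrite /ind asboolT// asboolF//; apply/andP; split.
      by rewrite ge_min; apply/orP; right; rewrite invr_ge0.
    by rewrite le_max; apply/orP; left; lra.
  by case=> c _ /half.
have : exists2 c, c \in `[0 : R, 1] & ind c = 2^-1.
  apply: ivt; rewrite /ind asboolF// asboolT//; apply/andP; split.
    by rewrite ge_min; apply/orP; left; rewrite invr_ge0.
  by rewrite le_max; apply/orP; right; lra.
by case=> c _ /half.
Qed.

(** The determinant of [(dpi u + corr u e)^-1 (dpi u)]: the identity minus [G] applied to the added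
    finite-rank term. *)
Definition eps_det n (e : 'I_n -> F) (G : F -> E) : R :=
  \det (pert_mx (fun i h => - ip (e i) (emb h)) (fun i => G (e i))).

(** The zero corrector and [corr u e] lie in the same class exactly when [eps_det] is positive; the
    constant [s] records the class of the positive correctors, the same at every [u]. *)
Lemma sign_eps : exists s : int, (s = 1 \/ s = -1) /\
  forall u n (e : 'I_n -> F) kappa (G : F -> E),
    (forall h, dpi u h = 0 -> h = 0) -> posfam u e kappa ->
    linear G -> cancel G (opr (fun g => pot u g + proj e g)) ->
    sign o u = s * sgz (eps_det e G).
Proof.
pose s : int := if `[< pos_side 0 >] then 1 else -1.
exists s; split; first by rewrite /s; case: ifP; [left|right].
move=> u n e kappa G inj pe lG GK.
have cE := corr_corrector pe.
have [lc _ _ _] := potential_posfam X u e.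
have lS := opr_lin X lc.
have [G' [_ G'K KG' _]] := opr_inverse (potential_posfam X u e) (positive_inj pe).
have KG : cancel (opr (fun g => pot u g + proj e g)) G.
  by move=> h; rewrite -[RHS]KG' -(GK (opr _ h)) KG' GK.
have opr_inj h : opr (pot u) h = 0 -> h = 0.
  by move=> h0; apply: inj; rewrite /Corrector.dpi h0 (linear_fun0 (mul_lin X _)).
have [H [lH HK KH _]] := opr_inverse (potential_pot X u) opr_inj.
have c0 : corrector (dpi u) (cst 0).
  split.
  - by move=> a x y; rewrite /= scaler0 addr0.
  - exact: cst_continuous.
  - apply: (@finite_rank_has_dim _ _ _ _ 0 (fun _ _ => 0) (fun=> 0)).
      by move=> a x y; rewrite /= scaler0 addr0.
    by move=> x; rewrite big_ord0.
  - exists (fun f => H (mul (ex (emb u)) f)).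
      by move=> h; rewrite addr0 /Corrector.dpi wtK' KH.
    by move=> f; rewrite addr0 /Corrector.dpi HK wtK.
have rd : rel_det (dpi u) (cst 0) (corr u e) (eps_det e G).
  exists (pert (fun i h => - ip (e i) (emb h)) (fun i => G (e i))); split; last first.
    by apply: pert_has_det => // i a x y; rewrite ip_emb_functional opprD mulrN.
  move=> h; rewrite dpi_corr addr0 /Corrector.dpi; congr (mul _ _).
  rewrite /pert (linear_funD lS) (linear_fun_sum lS) opr_add.
  under eq_bigr do rewrite (linear_funZ lS) GK scaleNr.
  by rewrite sumrN addrK.
have d0 : eps_det e G != 0.
  have [d dn0 rd'] := rel_det_ex (dpi_lin X u) c0 cE.
  by rewrite (rel_det_uniq (dpi_lin X u) c0 cE rd rd').
have := orientation_rel (dpi_lin X u) (oo u) c0 cE d0 rd.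
rewrite -(pos_sideP pe) (pos_side_const u 0) /sign /s => h.
have [dp|dn] := ltP 0 (eps_det e G).
  by rewrite dp in h; rewrite gtr0_sgz// mulr1 (asbool_equiv_eq h).
have dn' : eps_det e G < 0 by rewrite lt_neqAle d0.
rewrite ltNge dn in h; rewrite ltr0_sgz//.
case: asboolP => h1; case: asboolP => h2; rewrite ?mulrN1 ?opprK//.
  by have := (iffLR h) h2.
by exfalso; apply/h2/h.
Qed.

End Global.
End OrientationSign.

(** * The Morse index *)

Definition fcons (T : Type) n (x : T) (f : 'I_n -> T) (i : 'I_n.+1) : T :=
  if unlift ord0 i is Some k then f k else x.

Lemma fcons0 (T : Type) n (x : T) (f : 'I_n -> T) : fcons x f ord0 = x.
Proof. by rewrite /fcons unlift_none. Qed.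

Lemma fconsS (T : Type) n (x : T) (f : 'I_n -> T) i : fcons x f (lift ord0 i) = f i.
Proof. by rewrite /fcons liftK. Qed.

Section PertPath.
Variables (R : realType) (V : normedModType R).

(** The matrix is bilinear in forms and vectors, so its path is affine only if one of the two moves
    at a time; hence a lemma for the vectors and another for the forms. *)
Lemma pert_path_vec n (phi : 'I_n -> V -> R) (b b' : 'I_n -> V) :
  (forall i, functional (phi i)) ->
  (forall s x, 0 <= s <= 1 -> pert phi (fun i => (1 - s) *: b i + s *: b' i) x = 0 -> x = 0) ->
  0 < \det (pert_mx phi b) * \det (pert_mx phi b').
Proof.
move=> lphi inj; pose M1 := pert_mx phi b' - pert_mx phi b.
have ME s : pert_mx phi (fun i => (1 - s) *: b i + s *: b' i) = pert_mx phi b + s *: M1.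
  rewrite /M1 /pert_mx; apply/matrixP => i j; rewrite !mxE.
  rewrite lphi -[s *: b' i]addr0 lphi (_ : phi j 0 = 0) ?addr0; first by ring.
  by have := lphi j (-1) 0 0; rewrite scaler0 addr0 mulN1r addNr.
have := @det_affine_sign R _ (pert_mx phi b) M1; rewrite addrC subrK; apply.
by move=> s s01; rewrite -ME; apply: det_pert_neq0 => // x; exact: inj.
Qed.

Lemma pert_path_form n (phi phi' : 'I_n -> V -> R) (b : 'I_n -> V) :
  (forall i, functional (phi i)) -> (forall i, functional (phi' i)) ->
  (forall s x, 0 <= s <= 1 ->
     pert (fun i x => (1 - s) * phi i x + s * phi' i x) b x = 0 -> x = 0) ->
  0 < \det (pert_mx phi b) * \det (pert_mx phi' b).
Proof.
move=> lphi lphi' inj; pose M1 := pert_mx phi' b - pert_mx phi b.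
have ME s : pert_mx (fun i x => (1 - s) * phi i x + s * phi' i x) b = pert_mx phi b + s *: M1.
  by rewrite /M1 /pert_mx; apply/matrixP => i j; rewrite !mxE; ring.
have := @det_affine_sign R _ (pert_mx phi b) M1; rewrite addrC subrK; apply.
move=> s s01; rewrite -ME; apply: det_pert_neq0 => [i a x y|x]; last exact: inj.
by rewrite lphi lphi'; ring.
Qed.

End PertPath.

Section MorseSign.
Variables (R : realType) (E F : completeNormedModType R) (X : elliptic E F).
Local Notation emb := (emb X).
Local Notation lap := (lap X).
Local Notation ip := (ip X).
Local Notation mul := (mul X).
Local Notation one := (one X).
Local Notation cst1 := (cst1 X).
Local Notation ex := (ex X).
Local Notation opr := (opr X).
Local Notation potential := (potential X).
Local Notation proj := (proj X).
Local Notation dpi := (dpi X).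
Local Notation posfam := (posfam X).
Local Notation pot := (pot X).
Local Notation dens := (dens X).
Implicit Types (f g : F) (u w h : E) (c : F -> F).

(** The image of [emb] is dense for the [L^2] product: with [G] the inverse of [- lap + 1], testing
    [f] on [G f] bounds the [L^2] norm of [G f] by 0. *)
Lemma ip_emb_eq0 f : (forall k, ip f (emb k) = 0) -> f = 0.
Proof.
move=> f0; have [G [_ GK _ _]] := opr_inverse (potential_id X) (positive_inj (positive_id X)).
have [_ /(_ (G f))] := positive_id X; rewrite GK f0 mul1r => h.
have /(@ip_eq0 _ _ _ X) e0 : ip (emb (G f)) (emb (G f)) = 0.
  by apply/eqP; rewrite eq_le h ip_ge0.
have l0 : linear (id : F -> F) by [].
by rewrite -(GK f) ((@emb_inj _ _ _ X) _ e0) (linear_fun0 (opr_lin X l0)).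
Qed.

(** Half of the Hessian of [J_K] at a solution is [- lap + hpot u]: the potential of the
    linearization plus the rank-one term produced by the logarithm. *)
Definition hpot u g : F := pot u g + (2 * ip (dens u) g) *: dens u.

Definition neg_space u : set E := [set v | exists (n : nat) (h : 'I_n -> E),
  (forall i, exists2 l : R, l < 0 & forall k,
     2 * ip (opr (hpot u) (h i)) (emb k) = l * ip (emb (h i)) (emb k)) /\
  v = \sum_i h i].

(** Gauss-Bonnet for the area normalized to 1: the Laplacian has mean zero. *)
Lemma ip_dens u : ip (dens u) one = 1.
Proof.
by rewrite ipBl ip_one -(emb_cst1 X) lap_sym lap_cst1 ip0r subr0.
Qed.

Lemma hpotE u g : hpot u g = pot u g + proj (fun _ : 'I_1 => Num.sqrt 2 *: dens u) g.
Proof.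
rewrite /hpot /EllipticPair.proj big_ord1 ipZl scalerA mulrAC -expr2 sqr_sqrtr//.
Qed.

Lemma potential_hpot u : potential (hpot u).
Proof.
rewrite (_ : hpot u = fun g => pot u g + proj (fun _ : 'I_1 => Num.sqrt 2 *: dens u) g).
  by apply: potentialD; [exact: potential_pot|exact: potential_proj].
by apply/funext => g; exact: hpotE.
Qed.

Lemma opr_hpot u h : opr (hpot u) h = opr (pot u) h + (2 * ip (dens u) (emb h)) *: dens u.
Proof. by rewrite /EllipticPair.opr addrA. Qed.

Lemma opr_pot_cst1 u : opr (pot u) cst1 = (-2) *: dens u.
Proof. by rewrite /EllipticPair.opr lap_cst1 oppr0 add0r /Corrector.pot emb_cst1 mulC mul1. Qed.

Lemma hess_cst1 u : opr (hpot u) cst1 = 0.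
Proof.
by rewrite opr_hpot opr_pot_cst1 emb_cst1 ip_dens mulr1 scaleNr addNr.
Qed.

Lemma ip_hess_one u h : ip (opr (hpot u) h) one = 0.
Proof. by rewrite -(emb_cst1 X) (opr_sym _ _ (potential_hpot u)) hess_cst1 ip0r. Qed.

Section Regular.
Variable u : E.
Hypothesis inj : forall h, dpi u h = 0 -> h = 0.

(** The Hessian differs from the injective operator [opr (pot u)] by a rank-one term whose direction
    [dens u] is, up to the factor -2, the image of the constants. *)
Lemma hess_ker h : opr (hpot u) h = 0 -> h = ip (dens u) (emb h) *: cst1.
Proof.
have [lc _ _ _] := potential_pot X u; have lo := opr_lin X lc.
move=> h0; apply/eqP; rewrite -subr_eq0; apply/eqP/inj.
rewrite /Corrector.dpi (linear_funB lo) (linear_funZ lo) opr_pot_cst1 scalerA mulrN scaleNr opprK.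
by rewrite mulrC -opr_hpot h0 (linear_fun0 (mul_lin X _)).
Qed.

Section Family.
Variables (n : nat) (e : 'I_n -> E) (l : 'I_n -> R).
Hypothesis fam : eigen_family X (hpot u) (fun m => 0 < m) e l.
Hypothesis span : forall m h, 0 < m -> opr (hpot u) h = - m *: emb h ->
  h = \sum_i ip (emb (e i)) (emb h) *: e i.

Lemma neg_space_dim : has_dim (neg_space u) n.
Proof.
have [on eig] := fam.
have lh := opr_lin X (let: And4 h _ _ _ := potential_hpot u in h).
exists e; split=> [c c0 i|].
  have := congr1 (fun h => ip (emb (e i)) (emb h)) c0.
  rewrite (linear_fun_sum (emb_lin X)) (linear_fun0 (emb_lin X)) ip0r ip_sumr.
  rewrite (bigD1 i)//= big1 ?addr0 => [|j ji]; rewrite (linear_funZ (emb_lin X)) ipZr on.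
    by rewrite eqxx mulr1.
  by rewrite eq_sym (negPf ji) mulr0.
apply/seteqP; split=> v.
  move=> [m [h [hh ->]]].
  suff /choice[c Hc] : forall i, spanned e (h i).
    have := @spanned_sum R E n e m h (fun=> 1) (fun i => ex_intro _ (c i) (Hc i)).
    by under eq_bigr do rewrite scale1r.
  move=> i; have [k k0 Hk] := hh i; exists (fun j => ip (emb (e j)) (emb (h i))).
  (* The Hessian is twice [opr (hpot u)], so its eigenvalue [k] is halved. *)
  apply: (span (m := - (k / 2))); first by rewrite oppr_gt0 pmulr_llt0.
  apply/eqP; rewrite -subr_eq0 opprK; apply/eqP/ip_emb_eq0 => w.
  by have := Hk w; rewrite ipBl ipZl; lra.
move=> [c ->]; exists n, (fun i => c i *: e i); split=> // i.
have [l0 ei] := eig i; exists (- (2 * l i)); first by rewrite oppr_lt0 mulr_gt0.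
move=> k; rewrite (linear_funZ lh) ei (linear_funZ (emb_lin X)) !ipZl; ring.
Qed.

(** The constants, a null direction of the Hessian, are put in front of the negative eigenvectors;
    together they span the nonpositive part. *)
Let e' := fcons cst1 e.
Let l' := fcons 0 l.

Lemma fam_cons : eigen_family X (hpot u) (fun m => 0 <= m) e' l'.
Proof.
have [on eig] := fam.
have e1 i : ip (emb (e i)) one = 0.
  have := ip_hess_one u (e i); rewrite (proj2 (eig i)) ipZl => /eqP.
  by rewrite mulf_eq0 oppr_eq0 gt_eqF ?(proj1 (eig i))//= => /eqP.
split=> [i j|i].
  case: (unliftP ord0 i) => [i'|] ->; case: (unliftP ord0 j) => [j'|] ->;
    rewrite /e' ?fcons0 ?fconsS ?emb_cst1.
  - by rewrite on (inj_eq lift_inj).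
  - by rewrite e1 eq_sym (negPf (neq_lift _ _)).
  - by rewrite ip_sym e1 (negPf (neq_lift _ _)).
  - by rewrite ip_one eqxx.
case: (unliftP ord0 i) => [i'|] ->; rewrite /e' /l' ?fcons0 ?fconsS.
  by have [l0 ->] := eig i'; split=> //; exact: ltW.
by rewrite hess_cst1 oppr0 scale0r.
Qed.

Lemma span_cons m h : 0 <= m -> opr (hpot u) h = - m *: emb h ->
  h = \sum_i ip (emb (e' i)) (emb h) *: e' i.
Proof.
have [on _] := fam_cons; rewrite le_eqVlt => /orP[/eqP <-|m0] hm.
  rewrite oppr0 scale0r in hm; have := hess_ker hm; set t := ip _ _ => ->.
  rewrite (bigD1 ord0)//= big1 ?addr0 => [|i i0];
    rewrite (linear_funZ (emb_lin X)) ipZr.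
    by have := on ord0 ord0; rewrite eqxx /e' fcons0 => ->; rewrite mulr1.
  by have := on i ord0; rewrite /e' fcons0 (negPf i0) => ->; rewrite mulr0 scale0r.
have h1 : ip one (emb h) = 0.
  have := ip_hess_one u h; rewrite hm ipZl ip_sym => /eqP.
  by rewrite mulf_eq0 oppr_eq0 gt_eqF//= => /eqP.
rewrite big_ord_recl /e' fcons0 emb_cst1 h1 scale0r add0r.
by under eq_bigr do rewrite fconsS; exact: span hm.
Qed.

Let q i := Num.sqrt (1 + l' i) *: emb (e' i).
(** The first vector turns [pot u] into [hpot u]; the others lift the nonpositive eigenvalues of the
    Hessian operator to 1. *)
Let p := fcons (Num.sqrt 2 *: dens u) q.

Lemma l'_ge0 i : 0 <= l' i.
Proof. by have [_ /(_ i)[]] := fam_cons. Qed.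

Lemma proj_p g : proj p g = (2 * ip (dens u) g) *: dens u +
  \sum_i ((1 + l' i) * ip (emb (e' i)) g) *: emb (e' i).
Proof.
rewrite /EllipticPair.proj big_ord_recl /p fcons0 ipZl scalerA mulrAC -expr2 sqr_sqrtr//.
congr (_ + _); apply: eq_bigr => i _; rewrite fconsS /q ipZl scalerA mulrAC -expr2.
by rewrite sqr_sqrtr// addr_ge0// l'_ge0.
Qed.

Lemma morse_posfam : exists kappa, posfam u p kappa.
Proof.
have [k Hk] := eigen_family_positive (potential_hpot u) (fun m hm => hm) fam_cons
  l'_ge0 span_cons.
exists k; rewrite /Corrector.posfam (_ : (fun g => _) = (fun g => hpot u g + proj q g))//.
apply/funext => g; rewrite /EllipticPair.proj big_ord_recl /p fcons0 addrA; congr (_ + _).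
  by rewrite /hpot ipZl scalerA mulrAC -expr2 sqr_sqrtr.
by apply: eq_bigr => i _; rewrite fconsS.
Qed.

Variable G : F -> E.
Hypothesis lG : linear G.
Hypothesis GK : cancel G (opr (fun g => pot u g + proj p g)).
Hypothesis KG : cancel (opr (fun g => pot u g + proj p g)) G.
Let S := opr (fun g => pot u g + proj p g).

Lemma SE h : S h = opr (hpot u) h + \sum_i ((1 + l' i) * ip (emb (e' i)) (emb h)) *: emb (e' i).
Proof. by rewrite /S opr_add proj_p addrA -opr_hpot. Qed.

Lemma S_eigen i : S (e' i) = emb (e' i).
Proof.
have [on eig] := fam_cons; rewrite SE (proj2 (eig i)) (bigD1 i)//= big1 ?addr0.
  by rewrite on eqxx mulr1 -scalerDl addrC addrK scale1r.
by move=> j ji; rewrite on (negPf ji) mulr0 scale0r.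
Qed.

Lemma G_eigen i : G (emb (e' i)) = e' i.
Proof. by rewrite -{1}S_eigen KG. Qed.

(** For [g = g' = dens u] the pair of [phi g] and [vec g'] represents [S^-1 (opr (pot u))]. The two
    copies of the rank-one direction are separated so that each can be moved on its own. *)
Let phi g : 'I_n.+2 -> E -> R :=
  fcons (fun h => - (2 * ip g (emb h))) (fun i h => - ((1 + l' i) * ip (emb (e' i)) (emb h))).
Let vec g : 'I_n.+2 -> E := fcons (G g) e'.

Lemma phi_functional g i : functional (phi g i).
Proof.
move=> a h w; rewrite /phi /fcons; case: unlift => [k|]; rewrite ip_emb_functional; ring.
Qed.

Lemma S_pert g g' h : S (pert (phi g) (vec g') h) =
  opr (hpot u) h - (2 * ip g (emb h)) *: g'.
Proof.
have [lc _ _ _] := potential_posfam X u p; have lS : linear S := opr_lin X lc.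
rewrite /pert (linear_funD lS) (linear_fun_sum lS) SE [X in _ + X]big_ord_recl.
rewrite (linear_funZ lS) /phi /vec !fcons0 [S (G g')]GK scaleNr.
under [X in _ + (_ + X)]eq_bigr do rewrite !fconsS (linear_funZ lS) S_eigen scaleNr.
by rewrite sumrN [- _ - _]addrC addrA addrK.
Qed.

(** The range of the Hessian is orthogonal to the constants, so pairing with 1 gives [<g, h> = 0];
    then [h] is a constant, and [<g, 1> = 1] makes it 0. *)
Lemma pert_inj g g' h : ip g one = 1 -> ip g' one = 1 ->
  pert (phi g) (vec g') h = 0 -> h = 0.
Proof.
move=> g1 g1' h0; have [lc _ _ _] := potential_posfam X u p.
have := S_pert g g' h; rewrite h0 [S 0](linear_fun0 (opr_lin X lc)) => /esym hE.
have := congr1 (ip^~ one) hE; rewrite ipBl ip_hess_one ipZl g1' ip0l => gh.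
have gh0 : ip g (emb h) = 0 by lra.
move: hE; rewrite gh0 mulr0 scale0r subr0 => /hess_ker; set t := ip _ _ => ht.
by move: gh0; rewrite ht (linear_funZ (emb_lin X)) emb_cst1 ipZr g1 mulr1 => ->; rewrite scale0r.
Qed.

(** Both factors of the rank-one term are moved from [dens u] to the constant function, their
    pairing with 1 staying equal to 1. The final matrix is diagonal, with [- 2] on the constants and
    [- l i] on the negative eigenvectors, whence the extra sign. *)
Lemma eps_det_morse : sgz (eps_det X p G) = - (-1) ^+ n.
Proof.
have d1 := ip_dens u; have o1 := ip_one X.
have conv g g' s : ip g one = 1 -> ip g' one = 1 -> ip ((1 - s) *: g + s *: g') one = 1.
  by move=> h h'; rewrite ipDl !ipZl h h'; ring.
have E0 : eps_det X p G = \det (pert_mx (phi (dens u)) (vec (dens u))).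
  apply: det_pert_uniq => [i a h w|i|h]; first by rewrite ip_emb_functional; ring.
    exact: phi_functional.
  rewrite /pert [in LHS]big_ord_recl [in RHS]big_ord_recl /p /phi /vec !fcons0; congr (_ + (_ + _)).
    by rewrite ipZl (linear_funZ lG) scalerA mulrC mulrN mulrA -expr2 sqr_sqrtr.
  under [RHS]eq_bigr do rewrite !fconsS; apply: eq_bigr => i _; rewrite fconsS /q ipZl.
  rewrite (linear_funZ lG) G_eigen scalerA mulrC mulrN mulrA -expr2 sqr_sqrtr//.
  by rewrite addr_ge0// l'_ge0.
have E1 : 0 < \det (pert_mx (phi (dens u)) (vec (dens u))) *
    \det (pert_mx (phi (dens u)) (vec one)).
  apply: pert_path_vec => [i|s x _ x0]; first exact: phi_functional.
  apply: (@pert_inj (dens u) ((1 - s) *: dens u + s *: one)) => //; first exact: conv.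
  rewrite -[RHS]x0 /pert; congr (_ + _); apply: eq_bigr => i _; congr (_ *: _).
  rewrite /vec /fcons; case: unlift => [k|]; first by rewrite -scalerDl subrK scale1r.
  by rewrite (linear_funD lG) !(linear_funZ lG).
have E2 : 0 < \det (pert_mx (phi (dens u)) (vec one)) * \det (pert_mx (phi one) (vec one)).
  apply: pert_path_form => [i|i|s x _ x0]; try exact: phi_functional.
  apply: (@pert_inj ((1 - s) *: dens u + s *: one) one) => //; first exact: conv.
  rewrite -[RHS]x0 /pert; congr (_ + _); apply: eq_bigr => i _; congr (_ *: _).
  by rewrite /phi /fcons; case: unlift => [k|]; [ring|rewrite ipDl !ipZl; ring].
have [on _] := fam_cons.
have E3 : \det (pert_mx (phi one) (vec one)) = - 2 * \prod_i (- l i).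
  (* [3 = 2 + 1]: once [g] is the constant function, the rank-one term and the lift of the null
     direction act on the same vector. *)
  pose mu := fcons 3 (fun i => 1 + l i).
  have -> : \det (pert_mx (phi one) (vec one)) =
      \det (pert_mx (fun i h => - (mu i * ip (emb (e' i)) (emb h))) e').
    apply: det_pert_uniq => [i|i a h w|h]; first exact: phi_functional.
      by rewrite ip_emb_functional; ring.
    rewrite /pert [in LHS]big_ord_recl [in RHS]big_ord_recl /vec /phi !fcons0.
    rewrite big_ord_recl !fconsS /mu !fcons0 /l' fcons0 addr0.
    have -> : G one = e' ord0 by rewrite -(emb_cst1 X) -(fcons0 cst1 e) G_eigen.
    have -> : emb (e' ord0) = one by rewrite /e' fcons0 emb_cst1.
    congr (_ + _); rewrite addrA -scalerDl; congr (_ + _); first by congr (_ *: _); ring.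
    by apply: eq_bigr => i _; rewrite !fconsS.
  have -> : pert_mx (fun i h => - (mu i * ip (emb (e' i)) (emb h))) e' =
      diag_mx (\row_i (1 - mu i)).
    apply/matrixP => i j; rewrite !mxE on [j == i]eq_sym.
    by case: eqVneq => [->|_]; rewrite ?mulr1 ?mulr1n ?mulr0 ?mulr0n ?subr0.
  rewrite det_diag big_ord_recl !mxE /mu fcons0; congr (_ * _); first by ring.
  by apply: eq_bigr => i _; rewrite !mxE fconsS; ring.
have l0 i : 0 < l i by have [_ /(_ i)[]] := fam.
have E4 : sgz (- 2 * \prod_i (- l i)) = - (-1) ^+ n.
  rewrite sgzM sgzN (_ : sgz 2 = 1) ?mulN1r; last by rewrite gtr0_sgz.
  congr (- _); rewrite -[in RHS](card_ord n) -prodr_const.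
  rewrite (big_morph (fun x : R => sgz x) (@sgzM R) (@sgz1 R)).
  by apply: eq_bigr => i _; rewrite sgzN gtr0_sgz.
have pos_sg (x y : R) : 0 < x * y -> sgz x = sgz y.
  move=> xy; have [x0|x0|x0] := ltgtP x 0; last by move: xy; rewrite x0 mul0r ltxx.
    by move: xy; rewrite nmulr_rgt0// => y0; rewrite !ltr0_sgz.
  by move: xy; rewrite pmulr_rgt0// => y0; rewrite !gtr0_sgz.
by rewrite E0 (pos_sg _ _ E1) (pos_sg _ _ E2) E3 E4.
Qed.

End Family.

Lemma morse_sign : exists n m (p : 'I_m -> F) kappa (G : F -> E),
  [/\ has_dim (neg_space u) n, posfam u p kappa, linear G,
      cancel G (opr (fun g => pot u g + proj p g)) & sgz (eps_det X p G) = - (-1) ^+ n].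
Proof.
have [n [e [l [fam span]]]] := @eigen_family_span _ _ _ X (hpot u) (fun m => 0 < m)
  (potential_hpot u) (fun m hm => ltW hm).
have [kappa pk] := morse_posfam fam span.
have [G [lG GK KG _]] := opr_inverse (potential_posfam X u _) (positive_inj pk).
exists n, n.+2, (fcons (Num.sqrt 2 *: dens u)
  (fun i => Num.sqrt (1 + fcons 0 l i) *: emb (fcons cst1 e i))), kappa, G; split; first exact: neg_space_dim fam span.
- exact: pk.
- exact: lG.
- exact: GK.
- exact: (eps_det_morse fam lG GK KG).
Qed.

End Regular.
End MorseSign.

(** * Invariance of the signed count *)

Section NetsClosure.
Variables (R : realType) (E : completeNormedModType R).

Lemma has_nets_compact_closure (A : set E) : has_nets A -> compact (closure A).
Proof.
move=> nA; have nc : has_nets (closure A).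
  move=> e e0; have e20 : 0 < e / 2 by rewrite divr_gt0.
  have [s Hs] := nA _ e20; exists s => x cx.
  have [y [Ay xy]] := cx _ (nbhsx_ballx x (e / 2) e20).
  have [v vs yv] := Hs y Ay; exists v => //; rewrite -ball_normE /= in xy.
  by rewrite (le_lt_trans (ler_distD y _ _))// (splitr e) ltrD.
rewrite compact_ultra => G UG Gc.
have [x Gx] := has_nets_ultra (c := id) nc UG Gc.
exists x; split=> //; apply: (closed_cvg _ (@closed_closure _ A) Gc).
exact: Gx.
Qed.

Lemma has_nets_image (G : normedModType R) (f : R * E -> G) (A : set E) :
  has_nets A -> continuous f ->
  has_nets [set f (s, x) | s in [set s | 0 <= s <= 1] & x in A].
Proof.
move=> nA cf; have cA := has_nets_compact_closure nA.
have c01 : compact [set s : R | 0 <= s <= 1].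
  have -> : [set s : R | 0 <= s <= 1] = `[0, 1]%classic.
    by apply/seteqP; split=> s; rewrite /= in_itv.
  exact: segment_compact.
have := compact_has_nets (continuous_compact (continuous_subspaceT cf)
  (compact_setX c01 cA)).
apply: has_netsS => _ [s s01 [x Ax <-]]; exists (s, x) => //; split=> //=.
exact: subset_closure.
Qed.

Lemma compact_isolated_finite (A : set E) : compact A ->
  (forall x, A x -> exists2 r, 0 < r & forall y, A y -> `|y - x| < r -> y = x) ->
  finite_set A.
Proof.
move=> cA iso.
have H x : exists rx : R, A x -> 0 < rx /\ forall y, A y -> `|y - x| < rx -> y = x.
  have [/iso[rx rx0 H]|nA] := pselect (A x); last by exists 0.
  by exists rx.
have [r Hr] := choice H.
move: cA; rewrite compact_cover => /(_ E A (fun x => ball x (r x))) [].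
- by move=> x Ax; apply: ball_open; case: (Hr x Ax).
- by move=> x Ax; exists x => //; apply: ballxx; case: (Hr x Ax).
move=> D DA AD. apply: (sub_finite_set _ (finite_fset D)).
move=> x Ax; have [y yD] := AD x Ax; rewrite -ball_normE /= distrC => xy.
by have := DA y yD; rewrite inE => /Hr[_ /(_ x Ax xy) ->].
Qed.

End NetsClosure.

Section FibreSum.
Variables (R : realType) (E F : completeNormedModType R) (X : elliptic E F).
Local Notation emb := (emb X).
Local Notation lap := (lap X).
Local Notation ip := (ip X).
Local Notation mul := (mul X).
Local Notation one := (one X).
Local Notation ex := (ex X).
Local Notation opr := (opr X).
Local Notation potential := (potential X).
Local Notation proj := (proj X).
Local Notation dpi := (dpi X).
Local Notation posfam := (posfam X).
Local Notation pot := (pot X).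
Local Notation dens := (dens X).
Local Notation wt := (wt X).
Implicit Types (f g : F) (u w h : E) (c : F -> F).

(** The retraction of the line onto [[0, 1]]: it extends homotopies to all times, as continuity on
    the whole of [R] requires. *)
Definition clamp (s : R) : R := Num.max 0 (Num.min s 1).

Lemma clamp_cont : continuous clamp.
Proof.
move=> s; apply: (@continuous_max R R (fun=> 0) (fun s => Num.min s 1) s).
  exact: cst_continuous.
by apply: (@continuous_min R R (fun s => s) (fun=> 1) s); [exact: cvg_id|exact: cst_continuous].
Qed.

Lemma clamp01 s : 0 <= clamp s <= 1.
Proof. by rewrite /clamp le_max lexx ge_max ler01 ge_min lexx orbT. Qed.

Lemma clamp_id s : 0 <= s <= 1 -> clamp s = s.
Proof. by move=> /andP[s0 s1]; rewrite /clamp (min_idPl s1) (max_idPr s0). Qed.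

Lemma mul_cvg (T : Type) (Q : set_system T) {FQ : Filter Q} (a b : T -> F) f g :
  a @ Q --> f -> b @ Q --> g -> (fun t => mul (a t) (b t)) @ Q --> mul f g.
Proof.
move=> af bg; have [k k0 km] := mul_bnd X; apply/cvgrPdist_lt => e e0.
have E1 t : mul f g - mul (a t) (b t) = mul (f - a t) g + mul (a t) (g - b t).
  rewrite (linear_funB (mul_lin X _)) (mulC X (f - a t)) (linear_funB (mul_lin X _)).
  by rewrite !(mulC X g) addrA subrK.
pose M := `|f| + 1; pose N := `|g| + 1.
have M0 : 0 < M by rewrite ltr_wpDl. have N0 : 0 < N by rewrite ltr_wpDl.
have d1 : 0 < e / 2 / (k * N) by rewrite !divr_gt0// mulr_gt0.
have d2 : 0 < e / 2 / (k * M) by rewrite !divr_gt0// mulr_gt0.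
have h1 := (iffLR (@cvgrPdist_lt _ _ _ _ _ a f) af) _ d1.
have h2 := (iffLR (@cvgrPdist_lt _ _ _ _ _ b g) bg) _ d2.
have h3 := (iffLR (@cvgrPdist_lt _ _ _ _ _ a f) af) _ ltr01.
near=> t.
have a1 : `|f - a t| < e / 2 / (k * N) by near: t; exact: h1.
have a2 : `|g - b t| < e / 2 / (k * M) by near: t; exact: h2.
have a3 : `|f - a t| < 1 by near: t; exact: h3.
rewrite E1 (le_lt_trans (ler_normD _ _))// (splitr e) ltr_leD//.
  rewrite (le_lt_trans (km _ _))// (@le_lt_trans _ _ (k * N * `|f - a t|))//.
    by rewrite -mulrA ler_pM2l// mulrC ler_wpM2r// lerDl.
  by rewrite mulrC -ltr_pdivlMr ?mulr_gt0.
rewrite (le_trans (km _ _))// (@le_trans _ _ (k * M * `|g - b t|))//.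
  rewrite -mulrA ler_pM2l// ler_wpM2r//.
  by have := ler_normD (a t - f) f; rewrite subrK distrC /M; lra.
by rewrite mulrC -ler_pdivlMr ?mulr_gt0// ltW.
Unshelve. all: by end_near. Qed.

Lemma ex_cont : continuous ex.
Proof.
move=> f; have [km km0 Hkm] := mul_bnd X; apply/cvgrPdist_lt => d d0.
have := ex_diff X f ltr01; move=> /nbhs_normP[r /= r0 Hr].
pose K := 1 + 2 * (km * `|ex f|); have K0 : 0 < K by rewrite ltr_pwDl// !mulr_ge0// ltW.
apply/nbhs_normP; exists (Num.min r (d / K)); first by rewrite /= lt_min r0 divr_gt0.
move=> g /=; rewrite lt_min => /andP[fr fd].
have := Hr (g - f); rewrite /= sub0r normrN distrC fr => /(_ isT).
rewrite [f + _]addrC subrK mul1r => h.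
rewrite distrC (@le_lt_trans _ _ (K * `|f - g|))//; last by rewrite mulrC -ltr_pdivlMr.
rewrite -(subrK (2 *: mul (ex f) (g - f)) (ex g - ex f)).
rewrite (le_trans (ler_normD _ _))// /K mulrDl mul1r lerD//.
by rewrite normrZ ger0_norm// -!mulrA ler_pM2l// (le_trans (Hkm _ _))// distrC.
Qed.

(** Nearby operators of the segment differ by a small multiple of a bounded one, so the bound on the
    inverses is locally uniform in [s]. Compactness of [[0, 1]] makes it uniform, and joint
    continuity follows. *)
Lemma opr_segment_inverse c0 c1 k0 k1 : potential c0 -> potential c1 ->
  positive X c0 k0 -> positive X c1 k1 ->
  exists G : R -> F -> E, [/\ continuous (fun p : R * F => G p.1 p.2),
    forall s f, 0 <= s <= 1 -> (1 - s) *: opr c0 (G s f) + s *: opr c1 (G s f) = f &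
    forall s h, 0 <= s <= 1 -> G s ((1 - s) *: opr c0 h + s *: opr c1 h) = h].
Proof.
move=> p0 p1 [k00 pos0] [k10 pos1].
pose c s g := (1 - s) *: c0 g + s *: c1 g.
have pZ (a : R) d : potential d -> 0 <= a -> potential (fun g => a *: d g).
  move=> [ld [k kp Hk] sd [C C0 HC]] a0; split.
  - by move=> b f g; rewrite ld scalerDr !scalerA mulrC.
  - exists (a * k + 1); first by rewrite ltr_wpDl// mulr_ge0// ltW.
    move=> f; rewrite normrZ ger0_norm// mulrDl mul1r ler_wpDr// -mulrA ler_wpM2l//.
  - by move=> f g; rewrite ipZl ipZr sd.
  - exists (a * C); first by rewrite mulr_ge0.
    by move=> f; rewrite ipZl -mulrA -mulrN ler_wpM2l.
have pc s : 0 <= s <= 1 -> potential (c s).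
  by move=> /andP[s0 s1]; apply: potentialD; apply: pZ => //; rewrite subr_ge0.
have oc s h : opr (c s) h = (1 - s) *: opr c0 h + s *: opr c1 h.
  rewrite /EllipticPair.opr /c !scalerDr [RHS]addrACA; congr (_ + _).
  by rewrite -scalerDl subrK scale1r.
have posc s : 0 <= s <= 1 -> positive X (c s) (Num.min k0 k1).
  move=> /andP[s0 s1]; split; first by rewrite lt_min k00.
  move=> h; rewrite oc [leRHS]ipDl [X in X + _]ipZl [X in _ + X]ipZl.
  have i0 := ip_ge0 X (emb h).
  rewrite (_ : Num.min k0 k1 = (1 - s) * Num.min k0 k1 + s * Num.min k0 k1); last by ring.
  rewrite mulrDl -!mulrA lerD// ler_wpM2l ?subr_ge0//.
    by rewrite (le_trans _ (pos0 h))// ler_wpM2r// ge_min lexx.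
  by rewrite (le_trans _ (pos1 h))// ler_wpM2r// ge_min lexx orbT.
have [G0 HG0] := choice (fun s => (opr_inverse (pc _ (clamp01 s)) (positive_inj (posc _ (clamp01 s))))).
have [D D0 HD] : exists2 D, 0 < D & forall h, `|opr c0 h - opr c1 h| <= D * `|h|.
  have [d0 d00 Hd0] := linear_continuous_bounded (opr_lin X (let: And4 l _ _ _ := p0 in l)) (opr_cont p0).
  have [d1 d10 Hd1] := linear_continuous_bounded (opr_lin X (let: And4 l _ _ _ := p1 in l)) (opr_cont p1).
  exists (d0 + d1); first by rewrite addr_gt0.
  by move=> h; rewrite (le_trans (ler_normB _ _))// mulrDl lerD.
have dc s s' h : opr (c s) h - opr (c s') h = (s' - s) *: (opr c0 h - opr c1 h).
  rewrite !oc opprD addrACA -!scalerBl scalerBr; congr (_ + _).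
    by congr (_ *: _); ring.
  by rewrite -scaleNr; congr (_ *: _); ring.
have [k k_gt0 Hk] : exists2 k, 0 < k & forall s h, 0 <= s <= 1 -> `|h| <= k * `|opr (c s) h|.
  have c01 : compact [set s : R | 0 <= s <= 1].
    have -> : [set s : R | 0 <= s <= 1] = `[0, 1]%classic.
      by apply/seteqP; split=> s; rewrite /= in_itv.
    exact: segment_compact.
  have := iffLR (compact_near_coveringP _) c01 R (pinfty_nbhs R)
    (fun k s => forall h, `|h| <= k * `|opr (c s) h|) _.
  move=> /(_ _)[s s01|M [_ HM]]; last first.
    exists (`|M| + 1); first by rewrite ltr_wpDl.
    move=> s h s01; apply: (HM (`|M| + 1) _ s s01 h).
    by rewrite (le_lt_trans (ler_norm M))// ltrDl.
  have [_ _ GK [ks ks0 Hks]] := HG0 s; rewrite clamp_id// in GK.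
  have hs h : `|h| <= ks * `|opr (c s) h| by rewrite -{1}(GK h).
  near=> s' k => h.
  have s's : `|s - s'| * (ks * D) <= 2^-1.
    rewrite -ler_pdivlMr ?mulr_gt0// ltW//; near: s'.
    have d0 : 0 < 2^-1 / (ks * D) by rewrite divr_gt0// mulr_gt0.
    by apply/nbhs_normP; exists (2^-1 / (ks * D)).
  have kk : 2 * ks <= k by near: k; exact: nbhs_pinfty_ge (num_real _).
  have : `|h| <= ks * `|opr (c s') h| + 2^-1 * `|h|.
    rewrite (le_trans (hs h))// -(subrK (opr (c s') h) (opr (c s) h)).
    rewrite (le_trans (ler_wpM2l (ltW ks0) (ler_normD _ _)))// mulrDr addrC lerD2l.
    rewrite dc normrZ distrC mulrCA.
    rewrite (le_trans (ler_wpM2l (normr_ge0 _) (ler_wpM2l (ltW ks0) (HD h))))//.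
    by rewrite !mulrA -[`|s - s'| * ks * D]mulrA ler_wpM2r.
  have : 2 * ks * `|opr (c s') h| <= k * `|opr (c s') h| by rewrite ler_wpM2r.
  rewrite -mulrA; move: (`|h|) (ks * _) (k * _) => x y z; lra.
have lc s : 0 <= s <= 1 -> linear (c s) by move=> /pc[].
exists G0; split.
- move=> [s f]; apply/cvgrPdist_lt => e e0.
  have [lG GK KG _] := HG0 s.
  pose N := `|opr c0 (G0 s f) - opr c1 (G0 s f)| + 1.
  have N0 : 0 < N by rewrite ltr_wpDl.
  have ce : 0 < e / 2 / (k * N) by rewrite !divr_gt0// mulr_gt0.
  have fe : 0 < e / 2 / k by rewrite !divr_gt0.
  near=> p => /=.
  have a1 : `|clamp s - clamp p.1| < e / 2 / (k * N).
    near: p; have h1 : (fun p : R * F => p.1) @ (s, f) --> s by exact: cvg_fst.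
    have := @continuous_comp _ _ _ (fun p : R * F => p.1) clamp (s, f) h1 (@clamp_cont s).
    by move=> /cvgrPdist_lt/(_ _ ce).
  have a2 : `|f - p.2| < e / 2 / k.
    near: p; have : (fun p : R * F => p.2) @ (s, f) --> f by exact: cvg_snd.
    by move=> /cvgrPdist_lt/(_ _ fe).
  have [lG' GK' KG' _] := HG0 p.1.
  have h0 := Hk (clamp p.1) (G0 s f - G0 p.1 p.2) (clamp01 _).
  rewrite (linear_funB (opr_lin X (lc _ (clamp01 _)))) GK' in h0.
  rewrite -{1}(GK f) in a2.
  rewrite -(subrK (opr (c (clamp s)) (G0 s f)) (opr (c (clamp p.1)) (G0 s f))) -addrA in h0.
  rewrite (le_lt_trans h0)// mulrC -ltr_pdivlMr// (le_lt_trans (ler_normD _ _))//.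
  rewrite dc normrZ (splitr e) mulrDl ltrD// (@le_lt_trans _ _ (`|clamp s - clamp p.1| * N))//.
    by rewrite ler_wpM2l// lerDl.
  by rewrite -ltr_pdivlMr// -[ltRHS]mulrA -invfM.
- by move=> s f s01; rewrite -oc; have [_ GK _ _] := HG0 s; rewrite clamp_id// in GK.
- by move=> s h s01; rewrite -oc; have [_ _ KG _] := HG0 s; rewrite clamp_id// in KG.
Unshelve. all: by end_near. Qed.

End FibreSum.

Section FibreSum2.
Variables (R : realType) (E F : completeNormedModType R) (X : elliptic E F).
Local Notation emb := (emb X).
Local Notation lap := (lap X).
Local Notation ip := (ip X).
Local Notation mul := (mul X).
Local Notation one := (one X).
Local Notation ex := (ex X).
Local Notation opr := (opr X).
Local Notation potential := (potential X).
Local Notation proj := (proj X).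
Local Notation dpi := (dpi X).
Local Notation posfam := (posfam X).
Local Notation pot := (pot X).
Local Notation dens := (dens X).
Local Notation wt := (wt X).
Implicit Types (f g K : F) (u w h z : E) (c : F -> F).

Definition curv u : F := mul (wt u) (dens u).

Lemma curvE u K : curv u = K <-> dens u = mul K (ex (emb u)).
Proof.
split=> [<-|du]; first by rewrite mulC /curv wtK'.
by rewrite /curv du (mulC X K) wtK.
Qed.

Variable G0 : F -> E.
Hypothesis lG0 : linear G0.
Hypothesis GK0 : cancel G0 (opr id).
Hypothesis KG0 : cancel (opr id) G0.
Hypothesis cG0 : continuous G0.

(** The equation [1 - lap u = K e^{2u}] is rewritten as [(- lap + 1) u = u - 1 + K e^{2u}] and
    solved by [G0]; compactness comes from the embedding. *)
Definition lsmap K u : E := G0 (emb u - one + mul K (ex (emb u))).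

Lemma lsmap_fix K u : lsmap K u = u <-> curv u = K.
Proof.
rewrite curvE; split=> [Cu|du].
  have := congr1 (opr id) Cu; rewrite GK0 => h.
  rewrite -[RHS](addKr (emb u - one)) h opprB addrC /EllipticPair.opr [RHS]addrACA subrr addr0.
  by rewrite addrC.
rewrite /lsmap -du /Corrector.dens addrA subrK -[RHS]KG0; congr G0.
by rewrite /EllipticPair.opr addrC.
Qed.

Section Datum.
Variables (K : F) (z : E).
Hypothesis zK : curv z = K.
Hypothesis inj : forall h, dpi z h = 0 -> h = 0.
Variables (n : nat) (e : 'I_n -> F) (kappa : R) (G : F -> E).
Hypothesis pe : posfam z e kappa.
Hypothesis lG : linear G.
Hypothesis GK : cancel G (opr (fun g => pot z g + proj e g)).

Let L := opr (pot z).
Let rem u := - mul K (ex (emb u) - ex (emb z) - 2 *: mul (ex (emb z)) (emb (u - z))).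
(** Right-hand side of the homotopy from the nonlinear map at [s = 0] to the affine finite-rank one
    at [s = 1]. The inverse applied to it moves along the same segment, so that the fixed points are
    the zeros of [L (u - z) + (1 - s) *: rem u]. *)
Let kk (s : R) (g : F) : F :=
  (1 - s) *: (g - emb z + mul K (ex g) - dens z) + s *: proj e (g - emb z).

Lemma opr_pot_inj h : L h = 0 -> h = 0.
Proof. by move=> h0; apply: inj; rewrite /Corrector.dpi -/(L h) h0 (linear_fun0 (mul_lin X _)). Qed.

Lemma remE u : L (u - z) + rem u = - lap (u - z) - mul K (ex (emb u)) + dens z.
Proof.
rewrite /L /EllipticPair.opr /rem /Corrector.pot (iffLR (curvE z K) zK).
rewrite -(mulA X K) !(linear_funB (mul_lin X K)) (linear_funZ (mul_lin X K)) -!addrA.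
by congr (_ + _); rewrite scaleNr !opprD !opprK addrC !addrA addrK.
Qed.

Lemma S_kk s u : (1 - s) *: opr id (u - z) + s *: opr (fun g => pot z g + proj e g) (u - z) -
  kk s (emb u) = L (u - z) + (1 - s) *: rem u.
Proof.
have ez : emb (u - z) = emb u - emb z by exact: (linear_funB (emb_lin X)).
rewrite /kk opprD addrACA -!scalerBr opr_add ez addrK -/(L _).
have -> : opr id (u - z) - (emb u - emb z + mul K (ex (emb u)) - dens z) = L (u - z) + rem u.
  rewrite remE /EllipticPair.opr ez -!addrA; congr (_ + _).
  by rewrite !opprD !opprK !addrA [emb u - emb z - _]addrAC subrr sub0r addNr add0r.
by rewrite scalerDr addrAC -scalerDl subrK scale1r.
Qed.

(** The linear part is bounded below and the remainder is of smaller order, so one neighbourhood of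
    [z] contains no other zero at any time; [eta] limits the remainder to half of the lower
    bound. *)
Lemma rem_small : exists2 r, 0 < r & forall u (s : R), 0 <= s <= 1 -> `|u - z| <= r ->
  L (u - z) + (1 - s) *: rem u = 0 -> u = z.
Proof.
have [[k k0 Hk] _] := opr_alternative (potential_pot X z) opr_pot_inj.
have [km km0 Hm] := mul_bnd X.
have [ke ke0 He] := linear_continuous_bounded (emb_lin X) (@emb_cont _ _ _ X).
pose eta := (2 * k * (km * (`|K| + 1)) * ke)^-1.
have eta0 : 0 < eta by rewrite invr_gt0 !mulr_gt0// ltr_wpDl.
have /nbhs_normP[r /= r0 Hr] := ex_diff X (emb z) eta0.
exists (r / (2 * ke)); first by rewrite divr_gt0// mulr_gt0.
move=> u s /andP[s0 s1] uz Lr.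
have hr : `|emb (u - z)| < r.
  rewrite (le_lt_trans (He _))// mulrC -ltr_pdivlMr// (le_lt_trans uz)//.
  by rewrite ltr_pM2l// ltf_pV2 ?posrE ?mulr_gt0//; lra.
have ez : emb z + emb (u - z) = emb u.
  by rewrite (linear_funB (emb_lin X)) addrC subrK.
have := Hr (emb (u - z)); rewrite /= sub0r normrN ez => /(_ hr) hex.
apply/eqP; rewrite -subr_eq0 -normr_le0.
have h1 := Hk (u - z).
have h2 : `|L (u - z)| <= `|rem u|.
  have -> : L (u - z) = - ((1 - s) *: rem u) by apply/eqP; rewrite -addr_eq0 Lr.
  rewrite normrN normrZ ger0_norm ?subr_ge0// ler_piMl//; lra.
have h3 : `|rem u| <= km * (`|K| + 1) * (eta * (ke * `|u - z|)).
  rewrite /rem normrN (le_trans (Hm _ _))// -mulrA ler_pM2l// ler_pM// ?lerDl//.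
  by rewrite (le_trans hex)// ler_pM2l.
have h4 : k * (km * (`|K| + 1) * (eta * (ke * `|u - z|))) = 2^-1 * `|u - z|.
  have K1 : `|K| + 1 != 0 by rewrite lt0r_neq0// ltr_wpDl.
  by rewrite /eta; field; rewrite K1 !lt0r_neq0.
have := ler_wpM2l (ltW k0) (le_trans h2 h3); rewrite h4 => h5.
move: h1 h5; rewrite -/L; move: (`|u - z|) (k * _) => x y; lra.
Qed.

(** The nonlinear term and the inverted operator are deformed together, the latter from [- lap + 1]
    to the positive operator of the family [e]. The index is thus computed with the same [G] as the
    orientation sign. *)
Lemma lsmap_index : ls_index (lsmap K) z (sgz (eps_det X e G)).
Proof.
have [GG [cGG GGK KGG]] := opr_segment_inverse (potential_id X) (potential_posfam X z e)
  (positive_id X) pe.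
have [r r0 Hr] := rem_small.
have s01 : (0 <= (0 : R) <= 1) by rewrite lexx ler01.
have s11 : (0 <= (1 : R) <= 1) by rewrite lexx ler01.
have [lc1 _ _ _] := potential_posfam X z e.
pose f (p : R * F) := z + GG p.1 (kk p.1 p.2).
have [lpr [kp kp0 Hkp] _ _] := potential_proj X e.
have cf : continuous f.
  have h1 (p : R * F) : (fun p : R * F => p.1) @ p --> p.1 by exact: cvg_fst.
  have h2 (p : R * F) : (fun p : R * F => p.2) @ p --> p.2 by exact: cvg_snd.
  have h3 (p : R * F) : (fun p : R * F => p.2 - emb z) @ p --> p.2 - emb z.
    by apply: (@continuousB _ _ _ (fun p : R * F => p.2) (fun=> emb z));
      [exact: h2|exact: cst_continuous].
  have ck (p : R * F) : (fun p => kk p.1 p.2) @ p --> kk p.1 p.2.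
    apply: (@continuousD _ _ _ (fun p : R * F => (1 - p.1) *: (p.2 - emb z + mul K (ex p.2) - dens z))
      (fun p => p.1 *: proj e (p.2 - emb z))).
    - have h4 : (fun p : R * F => 1 - p.1) @ p --> 1 - p.1.
        by apply: (@continuousB R R _ (fun=> 1) (fun p : R * F => p.1) p);
          [exact: cst_continuous|exact: h1].
      have h5 : (fun p : R * F => mul K (ex p.2)) @ p --> mul K (ex p.2).
        apply: (@mul_cvg _ _ _ X _ _ _ (fun=> K)); first exact: cvg_cst.
        by apply: (@continuous_comp _ _ _ (fun p : R * F => p.2) ex p); [exact: h2|exact: ex_cont].
      have h6 : (fun p : R * F => p.2 - emb z + mul K (ex p.2) - dens z) @ p -->
          p.2 - emb z + mul K (ex p.2) - dens z.
        apply: (@continuousB _ _ _ (fun p : R * F => p.2 - emb z + mul K (ex p.2))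
          (fun=> dens z)); last exact: cst_continuous.
        by apply: (@continuousD _ _ _ (fun p : R * F => p.2 - emb z)
          (fun p => mul K (ex p.2))); [exact: h3|exact: h5].
      exact: (cvgZ h4 h6).
    - have h7 : (fun p : R * F => proj e (p.2 - emb z)) @ p --> proj e (p.2 - emb z).
        apply: (@continuous_comp _ _ _ (fun p : R * F => p.2 - emb z) (proj e) p).
          exact: h3.
        exact: (bounded_linear_continuous lpr Hkp).
      exact: (cvgZ (h1 p) h7).
  move=> p; apply: (@continuousD _ _ _ (fun=> z) (fun p : R * F => GG p.1 (kk p.1 p.2))).
    exact: cst_continuous.
  apply: (@continuous_comp _ _ _ (fun p : R * F => (p.1, kk p.1 p.2))
    (fun p : R * F => GG p.1 p.2) p); last exact: cGG.
  exact: (cvg_pair (h1 p) (ck p)).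
pose Q (s : R) u := f (s, emb u).
pose D := LsDatum (fun i w => ip (e i) (emb w)) (fun i => G (e i)) Q r.
have DE : ls_mx D = pert_mx (fun i h => - ip (e i) (emb h)) (fun i => G (e i)).
  by rewrite /ls_mx /pert_mx /=; congr (_ + _); apply/matrixP => i j; rewrite !mxE.
exists D; split; last by rewrite DE.
split=> //=.
- move=> p; apply: (@continuous_comp _ _ _ (fun p : R * E => (p.1, emb p.2)) f p); last exact: cf.
  have h1 : (fun p : R * E => p.1) @ p --> p.1 by exact: cvg_fst.
  have h2 : (fun p : R * E => p.2) @ p --> p.2 by exact: cvg_snd.
  have h3 : (fun p : R * E => emb p.2) @ p --> emb p.2.
    by apply: (@continuous_comp _ _ _ (fun p : R * E => p.2) emb p); [exact: h2|exact: emb_cont].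
  exact: (cvg_pair h1 h3).
- have nA := emb_cpt X (r + `|z|).
  apply: has_netsS (has_nets_image nA cf) => _ [s hs [u /= ur <-]]; exists s => //.
  exists (emb u) => //; exists u => //=.
  by rewrite -{1}(subrK z u) (le_trans (ler_normD _ _))// lerD2r.
- move=> s u hs uz; rewrite /Q /f /= => fu; apply: (Hr u s) => //.
  have uz' : u - z = GG s (kk s (emb u)) by rewrite -{1}fu addrAC subrr add0r.
  by rewrite -S_kk uz' GGK// subrr.
have GG0 g : GG 0 g = G0 g.
  by rewrite -[LHS]KG0; congr G0; have := GGK 0 g s01; rewrite subr0 scale1r scale0r addr0.
have GG1 g : GG 1 g = G g.
  have [G1 [_ _ K1 _]] := opr_inverse (potential_posfam X z e) (positive_inj pe).
  rewrite -[LHS]K1 -[RHS]K1; congr G1; have := GGK 1 g s11.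
  by rewrite subrr scale1r scale0r add0r GK.
split=> //.
- move=> u; rewrite /Q /f /= GG0 /kk subr0 scale1r scale0r addr0 /lsmap.
  rewrite -{1}(KG0 z) -(linear_funD lG0); congr G0.
  have -> : opr id z = emb z + dens z - one.
    by rewrite /EllipticPair.opr /Corrector.dens addrC -addrA [one - _]addrC addrK.
  by rewrite [emb u - _ + _]addrAC -[X in _ + X]addrA -opprD [LHS]addrC addrA subrK addrAC.
- move=> u; rewrite /Q /f /= GG1 /kk subrr scale0r add0r scale1r.
  rewrite -(linear_funB (emb_lin X)) /EllipticPair.proj (linear_fun_sum lG); congr (_ + _).
  by apply: eq_bigr => i _; rewrite (linear_funZ lG).
- by move=> i; exact: ip_emb_functional.
- move=> i; have [k k0 Hk] := ip_bnd X.
  have [ke ke0 He] := linear_continuous_bounded (emb_lin X) (@emb_cont _ _ _ X).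
  exists (k * `|e i| * ke) => u; rewrite (le_trans (Hk _ _))// -!mulrA ler_pM2l// ler_wpM2l//.
rewrite DE; apply: det_pert_neq0 => [i a x y|h h0]; first by rewrite ip_emb_functional; ring.
apply: opr_pot_inj; have lS := opr_lin X lc1.
have := congr1 (opr (fun g => pot z g + proj e g)) h0.
rewrite /pert (linear_funD lS) (linear_fun_sum lS) opr_add (linear_fun0 lS).
under eq_bigr do rewrite (linear_funZ lS) GK scaleNr.
by rewrite sumrN addrK.
Qed.

End Datum.

End FibreSum2.

Section FibreSum3.
Variables (R : realType) (E F : completeNormedModType R) (X : elliptic E F).
Local Notation emb := (emb X).
Local Notation mul := (mul X).
Local Notation ex := (ex X).
Local Notation one := (one X).

(** Compactness of the solutions along the path is the a priori bound that confines the fixed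
    points. At the two regular ends solutions are isolated, hence finite in number, with index
    [eps]. *)
Theorem fibre_sum (g : R -> F) (eps : E -> int) :
  continuous g ->
  compact [set u | exists2 s, 0 <= s <= 1 & curv X u = g s] ->
  (forall (t : bool) u, curv X u = g (t : nat)%:R -> forall h, dpi X u h = 0 -> h = 0) ->
  (forall u, (forall h, dpi X u h = 0 -> h = 0) ->
     exists n (e : 'I_n -> F) kappa (G : F -> E), [/\ posfam X u e kappa, linear G,
       cancel G (opr X (fun g => pot X u g + proj X e g)) & eps u = sgz (eps_det X e G)]) ->
  \sum_(u \in [set u | curv X u = g 0]) eps u = \sum_(u \in [set u | curv X u = g 1]) eps u.
Proof.
move=> cg cpt reg Heps.
have [G0 [lG0 GK0 KG0 [k0 k00 Hk0]]] :=
  opr_inverse (potential_id X) (positive_inj (positive_id X)).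
have cG0 := bounded_linear_continuous lG0 Hk0.
pose f (p : R * F) := G0 (p.2 - one + mul (g p.1) (ex p.2)).
have cf : continuous f.
  move=> p; apply: (@continuous_comp _ _ _ (fun p : R * F => p.2 - one + mul (g p.1) (ex p.2)) G0 p);
    last exact: cG0.
  have h1 : (fun p : R * F => p.1) @ p --> p.1 by exact: cvg_fst.
  have h2 : (fun p : R * F => p.2) @ p --> p.2 by exact: cvg_snd.
  apply: (@continuousD _ _ _ (fun p : R * F => p.2 - one) (fun p => mul (g p.1) (ex p.2))).
    by apply: (@continuousB _ _ _ (fun p : R * F => p.2) (fun=> one));
      [exact: h2|exact: cst_continuous].
  apply: (@mul_cvg _ _ _ X _ _ _ (fun p : R * F => g p.1) (fun p : R * F => ex p.2)).
    by apply: (@continuous_comp _ _ _ (fun p : R * F => p.1) g p); [exact: h1|exact: cg].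
  by apply: (@continuous_comp _ _ _ (fun p : R * F => p.2) ex p); [exact: h2|exact: ex_cont].
pose C (s : R) (u : E) := f (s, emb u).
have CE s u : C s u = lsmap X G0 (g s) u by [].
have cC : continuous (fun p : R * E => C p.1 p.2).
  move=> p; apply: (@continuous_comp _ _ _ (fun p : R * E => (p.1, emb p.2)) f p); last exact: cf.
  have h1 : (fun p : R * E => p.1) @ p --> p.1 by exact: cvg_fst.
  have h2 : (fun p : R * E => p.2) @ p --> p.2 by exact: cvg_snd.
  have h3 : (fun p : R * E => emb p.2) @ p --> emb p.2.
    by apply: (@continuous_comp _ _ _ (fun p : R * E => p.2) emb p); [exact: h2|exact: emb_cont].
  exact: (cvg_pair h1 h3).
have [M [_ /(_ (`|M| + 1))]] := compact_bounded cpt.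
rewrite (le_lt_trans (ler_norm M)) ?ltrDl// => /(_ isT) HM.
pose rho := `|M| + 2.
pose fib (t : bool) := [set u : E | curv X u = g (t : nat)%:R].
have t01 (t : bool) : 0 <= ((t : nat)%:R : R) <= 1 by case: t => /=; rewrite lexx ler01.
have fibE t u : fib t u <-> C (t : nat)%:R u = u by rewrite CE (lsmap_fix GK0 KG0).
have ind (t : bool) u : fib t u -> ls_index (C (t : nat)%:R) u (eps u).
  move=> fu; have iu := reg t u fu; have [n [e [kappa [G [pe lG GK ->]]]]] := Heps u iu.
  exact: (lsmap_index lG0 KG0 fu iu pe lG GK).
have fin t : finite_set (fib t).
  apply: compact_isolated_finite.
    apply: (subclosed_compact _ cpt) => [|u fu]; last by exists (t : nat)%:R.
    have -> : fib t = (fun u => C (t : nat)%:R u - u) @^-1` [set 0].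
      apply/seteqP; split=> u /=; first by move=> /fibE ->; rewrite subrr.
      by move=> /eqP; rewrite subr_eq0 => /eqP /fibE.
    apply: preimage_closed => [u _|]; last exact: (compact_closed (@norm_hausdorff _ E) (@compact_set1 _ 0)).
    apply: (@continuousB _ _ _ (C (t : nat)%:R) id); last exact: cvg_id.
    apply: (@continuous_comp _ _ _ (fun u => ((t : nat)%:R : R, u)) (fun p : R * E => C p.1 p.2) u);
      last exact: cC.
    have h1 : (fun u : E => ((t : nat)%:R : R)) @ u --> ((t : nat)%:R : R) by exact: cvg_cst.
    exact: (cvg_pair h1 (@cvg_id _ (nbhs u))).
  move=> u /ind[D [[r0 _ _ uniq [Q0 _ _ _ _]] _]]; exists (ls_radius D) => // w fw wu.
  by apply: (uniq 0 w); rewrite ?lexx ?ler01 ?ltW// Q0; exact/fibE.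
pose r t : seq E := finmap.enum_fset (fset_set (fib t)).
have rP t u : fib t u <-> u \in r t 
  by have /(congr1 (fun A => A u)) <- := fset_setK (fin t).
have sumE t : \sum_(u \in fib t) eps u = \sum_(i < size (r t)) eps (nth 0 (r t) i).
  by rewrite fsbig_finite//= (big_nth 0) big_mkord.
rewrite -[LHS]/(\sum_(u \in fib false) eps u) -[RHS]/(\sum_(u \in fib true) eps u) !sumE.
apply: (@ls_invariance R E C rho (fun t => 'I_(size (r t)))
  (fun t i => nth 0 (r t) i) (fun t i => eps (nth 0 (r t) i))) => //.
- have := has_nets_image (emb_cpt X (rho + 1)) cf; apply: has_netsS.
  by move=> _ [s s01 [u ur <-]]; exists s => //; exists (emb u) => //; exists u.
- move=> s u s01; rewrite CE (lsmap_fix GK0 KG0) => us.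
  by have := HM u (ex_intro2 _ _ s s01 us); rewrite /= /rho; lra.
- move=> t i j /eqP; rewrite nth_uniq//; first by move=> /eqP/val_inj.
  exact: finmap.fset_uniq.
- move=> t u; rewrite -fibE rP; split=> [ur|[i ->]]; last exact: mem_nth.
  by exists (Ordinal (ltac:(by rewrite index_mem) : (index u (r t) < size (r t))%N)); rewrite /= nth_index.
- by move=> t i; apply: ind; apply/rP; exact: mem_nth.
Qed.

End FibreSum3.

(** * Differential of the curvature map and Hessian of the functional *)

Lemma is_derive_small (R : realType) (n : R -> R) (x d : R) :
  (forall e, 0 < e -> \forall t \near (0 : R), `|n (x + t) - n x - t * d| <= e * `|t|) ->
  is_derive x 1 n d.
Proof.
move=> H; have cv : (fun h => h^-1 *: ((n \o shift x) (h *: 1) - n x)) @ 0^' --> d.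
  apply/cvgrPdist_le => e e0; have := H e e0; rewrite near_withinE; apply: filterS => t Ht t0.
  rewrite /= /shift /= [t *: 1]mulr1 distrC -[X in _ - X](mulKf t0) -mulrBr normrM normfV.
  by rewrite ler_pdivrMl ?normr_gt0// [leRHS]mulrC [t + x]addrC.
apply: DeriveDef; first by apply/cvg_ex; exists d.
by apply/cvg_lim => //; exact: Rhausdorff.
Qed.

Lemma is_derive_affine (R : realType) (a b x : R) : is_derive x 1 (fun t => a * t + b) a.
Proof.
apply: is_derive_small => e e0; apply/nbhs_normP; exists 1 => //= t _.
by rewrite [X in `|X|](_ : _ = 0) ?normr0 ?mulr_ge0 ?(ltW e0)//; ring.
Qed.

Lemma is_derive_quot (R : realType) (W : normedModType R) (F : W -> R) (w v : W) (c : R) :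
  is_derive (0 : R) 1 (fun t => F (w + t *: v)) c <-> is_derive w v F c.
Proof.
have eq : (fun h => h^-1 *: ((F \o shift w) (h *: v) - F w)) =
    (fun h => h^-1 *: (((fun t => F (w + t *: v)) \o shift 0) (h *: 1) -
       (fun t => F (w + t *: v)) (0 : R))).
  by apply/funext => h; rewrite /= /shift /= addr0 scale0r addr0 [h *: 1]mulr1 [_ + w]addrC.
by split=> -[d1 d2]; apply: DeriveDef; move: d1 d2; rewrite /derivable /derive eq.
Qed.

Lemma diff_eq (R : realType) (E F : normedModType R) (f df : E -> F) (x : E) :
  linear df -> continuous df ->
  (forall e, 0 < e -> \forall h \near (0 : E), `|f (x + h) - f x - df h| <= e * `|h|) ->
  'd f x = df :> (E -> F).
Proof.
move=> ldf cdf H.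
pose dl : {linear E -> F} := HB.pack_for {linear E -> F} df
  (GRing.isLinear.Build R E F *:%R df ldf).
have := @diff_unique R E F f dl x cdf; apply; apply/eqaddoP => e e0.
have := H e e0; apply: filterS => h; rewrite /= !fctE /shift /= [h + x]addrC.
by rewrite opprD addrA.
Qed.

Section CurvatureDifferential.
Variables (R : realType) (E F : normedModType R).
Variables (emb lap : E -> F) (mul : F -> F -> F) (ex : F -> F) (one : F).
Hypotheses (emb_lin : linear emb) (emb_cont : continuous emb).
Hypotheses (lap_lin : linear lap) (lap_cont : continuous lap).
Hypotheses (mul_lin : forall f, linear (mul f)) (mulC : forall f g, mul f g = mul g f).
Hypothesis mul_bnd : exists2 k, 0 < k & forall f g, `|mul f g| <= k * (`|f| * `|g|).
Hypothesis ex_diff : forall f e, 0 < e -> \forall g \near (0 : F),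
  `|ex (f + g) - ex f - 2 *: mul (ex f) g| <= e * `|g|.

(** Product rule for the weight and the density. The error is the product of the two increments plus
    the remainder of the exponential, each given half of [e], through [B] and [eta] respectively. *)
Lemma curv_diff u : 'd (fun u => mul (ex (- emb u)) (one - lap u)) u =
  (fun h => - mul (ex (- emb u)) (lap h) - 2 *: mul (mul (ex (- emb u)) (emb h)) (one - lap u))
  :> (E -> F).
Proof.
have [km km0 Hm] := mul_bnd.
have [ke ke0 He] := linear_continuous_bounded emb_lin emb_cont.
have [kl kl0 Hl] := linear_continuous_bounded lap_lin lap_cont.
set w := ex (- emb u); set d := one - lap u.
have mulBr f g h : mul f (g - h) = mul f g - mul f h by rewrite (linear_funB (mul_lin f)).
have mulDl f g h : mul (f + g) h = mul f h + mul g h.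
  by rewrite mulC (linear_funD (mul_lin h)) !(mulC h).
have mulZl (a : R) f g : mul (a *: f) g = a *: mul f g.
  by rewrite mulC (linear_funZ (mul_lin g)) mulC.
have mulNr f g : mul f (- g) = - mul f g by rewrite (linear_funN (mul_lin f)).
have ldf : linear (fun h => - mul w (lap h) - 2 *: mul (mul w (emb h)) d).
  move=> a h k; rewrite lap_lin emb_lin !mul_lin !(mulC _ d) mul_lin scalerDr !scalerA.
  by rewrite [2 * a]mulrC -scalerA !opprD addrACA -!scalerN -scalerDr scalerN.
apply: diff_eq => //.
  apply: (bounded_linear_continuous (k := km * (`|w| * kl) + 2 * (km * (km * (`|w| * ke) * `|d|))) ldf).
  move=> h; rewrite (le_trans (ler_normD _ _))// !normrN mulrDl normrZ ger0_norm//.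
  rewrite lerD//; first by rewrite (le_trans (Hm _ _))// -!mulrA ler_pM2l// ler_wpM2l.
  rewrite -!mulrA ler_pM2l// (le_trans (Hm _ _))// ler_pM2l// [leRHS](_ : _ =
    (km * (`|w| * (ke * `|h|))) * `|d|); last by ring.
  by rewrite ler_wpM2r// (le_trans (Hm _ _))// ler_pM2l// ler_wpM2l.
move=> e e0.
pose eta := e / 2 / (km * ke * (`|d| + kl)).
have dk0 : 0 < `|d| + kl by rewrite ltr_wpDl.
have eta0 : 0 < eta by rewrite !divr_gt0// !mulr_gt0.
pose B := 2 * km * km * (`|w| + 1) * ke * kl.
have B0 : 0 < B by rewrite !mulr_gt0// ltr_wpDl.
have /nbhs_normP[r /= r0 Hr] := ex_diff (- emb u) eta0.
apply/nbhs_normP; exists (Num.min 1 (Num.min (r / ke) (e / 2 / B))).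
  by rewrite /= !lt_min ltr01 !divr_gt0.
move=> h; rewrite /= sub0r normrN !lt_min => /and3P[h1 hr hB].
pose g := - emb h.
have gh : `|g| <= ke * `|h| by rewrite normrN.
have gr : `|g| < r by rewrite (le_lt_trans gh)// mulrC -ltr_pdivlMr.
have := Hr g; rewrite /= sub0r normrN => /(_ gr); rewrite -/w.
set rr := _ - _ - _ => Hrr.
have exE : ex (- emb u + g) = w + 2 *: mul w g + rr.
  by rewrite /rr -[X in _ = _ + X]addrA -(opprD w) [RHS]addrC subrK.
have -> : mul (ex (- emb (u + h))) (one - lap (u + h)) - mul w d -
    (- mul w (lap h) - 2 *: mul (mul w (emb h)) d) =
    - (2 *: mul (mul w g) (lap h)) + mul rr (d - lap h).
  have -> : - emb (u + h) = - emb u + g by rewrite (linear_funD emb_lin) opprD.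
  have -> : one - lap (u + h) = d - lap h by rewrite (linear_funD lap_lin) opprD addrA.
  have -> : emb h = - g by rewrite opprK.
  clearbody rr d w g; rewrite exE (mulDl _ rr) (mulDl w) mulZl !mulBr scalerBr.
  rewrite mulNr (mulC (- _) d) mulNr (mulC d) scalerN.
  set a := mul w d; set b := mul w (lap h); set c := 2 *: mul (mul w g) d.
  set q := 2 *: _; set m1 := mul rr d; set m2 := mul rr (lap h).
  rewrite opprK (_ : a - b + (c - q) = a + (c - b) - q); last first.
    by rewrite [LHS]addrA [a - b + c]addrAC [a + (c - b)]addrA.
  rewrite [- b + c]addrC -[LHS]addrA -(opprD a) [LHS]addrC.
  by rewrite -[a + (c - b) - q + _]addrA addKr.
rewrite (le_trans (ler_normD _ _))// normrN normrZ (@ger0_norm _ 2)// [X in _ <= X * _](splitr e) [leRHS]mulrDl.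
apply: lerD.
  rewrite (@le_trans _ _ (B * `|h| * `|h|))//; last first.
    by rewrite ler_wpM2r// mulrC -ler_pdivlMr// ltW.
  rewrite /B [leRHS](_ : _ = 2 * (km * ((km * ((`|w| + 1) * (ke * `|h|))) * (kl * `|h|)))); last by ring.
  rewrite ler_pM2l// (le_trans (Hm _ _))// ler_pM2l// ler_pM// (le_trans (Hm _ _))// ler_pM2l//.
  by rewrite ler_pM// lerDl.
rewrite (le_trans (Hm _ _))// (@le_trans _ _ (km * (eta * (ke * `|h|) * (`|d| + kl))))//.
  rewrite ler_pM2l// ler_pM//.
    by rewrite (le_trans Hrr)// ler_pM2l.
  rewrite (le_trans (ler_normB _ _))// lerD2l (le_trans (Hl _))// -[leRHS]mulr1 ler_pM2l// ltW//.
rewrite /eta [leLHS](_ : _ = e / 2 * `|h|)//; field.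
by rewrite !lt0r_neq0.
Qed.

End CurvatureDifferential.

Section Hessian.
Variables (R : realType) (E F : completeNormedModType R) (X : elliptic E F).
Local Notation emb := (emb X).
Local Notation lap := (lap X).
Local Notation ip := (ip X).
Local Notation mul := (mul X).
Local Notation one := (one X).
Local Notation ex := (ex X).

(** By Green's formula the Dirichlet integral is [- <lap u, u>]. *)
Definition Jfun (K : F) (u : E) : R :=
  - ip (lap u) (emb u) + 2 * ip one (emb u) - ln (ip K (ex (emb u))).

Lemma ip_ex_derive (K : F) (f g : F) :
  is_derive (0 : R) 1 (fun t => ip K (ex (f + t *: g))) (2 * ip K (mul (ex f) g)).
Proof.
apply: is_derive_small => e e0; have [k k0 Hk] := ip_bnd X.
pose eta := e / (k * (`|K| + 1) * (`|g| + 1)).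
have g1 : 0 < `|g| + 1 by rewrite ltr_wpDl.
have K1 : 0 < `|K| + 1 by rewrite ltr_wpDl.
have eta0 : 0 < eta by rewrite divr_gt0// !mulr_gt0.
have /nbhs_normP[r /= r0 Hr] := ex_diff X f eta0.
apply/nbhs_normP; exists (r / (`|g| + 1)); first by rewrite /= divr_gt0.
move=> t; rewrite /= sub0r normrN => tr.
have tg : `|t *: g| <= `|t| * (`|g| + 1) by rewrite normrZ ler_wpM2l// lerDl.
have := Hr (t *: g); rewrite /= sub0r normrN (le_lt_trans tg) -?ltr_pdivlMr// => /(_ isT) h.
rewrite add0r scale0r addr0.
have -> : ip K (ex (f + t *: g)) - ip K (ex f) - t * (2 * ip K (mul (ex f) g)) =
    ip K (ex (f + t *: g) - ex f - 2 *: mul (ex f) (t *: g)).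
  by rewrite (linear_funZ (mul_lin X _)) !ipBr !ipZr; ring.
rewrite (le_trans (Hk _ _))//.
rewrite (@le_trans _ _ (k * ((`|K| + 1) * (eta * (`|t| * (`|g| + 1))))))//.
  rewrite ler_pM2l// ler_pM// ?lerDl// (le_trans h)// ler_pM2l//.
rewrite /eta [leLHS](_ : _ = e * `|t|)//; field.
by rewrite !lt0r_neq0.
Qed.

Lemma J_derive (K : F) (v k : E) : 0 < ip K (ex (emb v)) ->
  is_derive v k (Jfun K) (- 2 * ip (lap v) (emb k) + 2 * ip one (emb k) -
    2 * ip K (mul (ex (emb v)) (emb k)) / ip K (ex (emb v))).
Proof.
move=> n0; apply/is_derive_quot.
pose n t := ip K (ex (emb v + t *: emb k)).
have -> : (fun t => Jfun K (v + t *: k)) =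
    (fun t => (- ip (lap v) (emb v) + 2 * ip one (emb v)) +
      t * (- 2 * ip (lap v) (emb k) + 2 * ip one (emb k)) + t ^+ 2 * (- ip (lap k) (emb k)) -
      (@ln R \o n) t).
  apply/funext => t; rewrite /Jfun /n /= addrC [v + _]addrC (lap_lin X) (emb_lin X).
  rewrite [t *: emb k + _]addrC !ipDl !ipDr !ipZl !ipZr (lap_sym X k v) (ip_sym X (emb k)); ring.
have dn := ip_ex_derive K (emb v) (emb k).
have n00 : n 0 = ip K (ex (emb v)) by rewrite /n scale0r addr0.
have dl : is_derive (0 : R) 1 (@ln R \o n) ((n 0)^-1 * (2 * ip K (mul (ex (emb v)) (emb k)))).
  by apply: is_derive1_comp; apply: is_derive1_ln; rewrite n00.
set c0 := _ + 2 * ip one (emb v); set c1 := _ + 2 * ip one (emb k); set c2 := - ip (lap k) _.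
have dq : is_derive (0 : R) 1 (fun t => c0 + t * c1 + t ^+ 2 * c2) c1.
  apply: is_derive_small => e e0; have c20 : 0 < `|c2| + 1 by rewrite ltr_wpDl.
  apply/nbhs_normP; exists (e / (`|c2| + 1)); first by rewrite /= divr_gt0.
  move=> t; rewrite /= sub0r normrN ltr_pdivlMr// => tr.
  rewrite add0r [X in `|X|](_ : _ = (t * c2) * t); last by ring.
  rewrite normrM ler_wpM2r// (le_trans _ (ltW tr))// normrM ler_wpM2l// lerDl//.
apply: (is_derive_eq (is_deriveB dq dl)).
by rewrite n00 [in RHS]mulrC.
Qed.

(** At a solution [<K, e^{2u}> = 1] by Gauss-Bonnet. The derivative of the quotient coming from the
    logarithm then gives a zero-order term and a product of two means, which is the rank-one term of
    [hpot]. *)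
Lemma J_hessian (K : F) (u h k : E) : curv X u = K ->
  'D_h ('D_k (Jfun K)) u = 2 * ip (opr X (hpot X u) h) (emb k).
Proof.
move=> /curvE uK.
have one_ex : ip K (ex (emb u)) = 1.
  by have := ip_dens X u; rewrite uK ip_mul (mulC X K) mul1 ip_sym.
pose n (v : E) := ip K (ex (emb v)).
have cn : continuous n.
  move=> v; apply: (@continuous_comp _ _ _ (fun v => ex (emb v)) (ip K)); last exact: ip_cont.
  by apply: (@continuous_comp _ _ _ emb ex); [exact: emb_cont|exact: ex_cont].
pose D (v : E) := - 2 * ip (lap v) (emb k) + 2 * ip one (emb k) -
    2 * ip K (mul (ex (emb v)) (emb k)) / n v.
have nD : \near u, D u = 'D_k (Jfun K) u.
  have : \forall v \near u, 0 < n v.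
    by apply: (cvgr_gt (n u)); [exact: cn|rewrite /n one_ex].
  by apply: filterS => v /J_derive H; rewrite derive_val.
suff HD : is_derive u h D (2 * ip (opr X (hpot X u) h) (emb k)).
  by rewrite -(near_eq_derive _ nD) derive_val.
apply/is_derive_quot.
have sw f : ip K (mul f (emb k)) = ip (mul K (emb k)) f.
  by rewrite (mulC X f) -ip_mul (mulC X K).
pose a t := ip (mul K (emb k)) (ex (emb u + t *: emb h)).
pose b t := ip K (ex (emb u + t *: emb h)).
have da : is_derive (0 : R) 1 a _ := ip_ex_derive (mul K (emb k)) (emb u) (emb h).
have db : is_derive (0 : R) 1 b _ := ip_ex_derive K (emb u) (emb h).
have b0 : b 0 = 1 by rewrite /b scale0r addr0.
have bn0 : b 0 != 0 by rewrite b0 oner_neq0.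
have dV := is_deriveV bn0 db.
have dM := is_deriveM da dV.
set c0 := - 2 * ip (lap u) (emb k) + 2 * ip one (emb k).
set c1 := - 2 * ip (lap h) (emb k).
have -> : (fun t => D (u + t *: h)) = (fun t => c0 + t * c1) - 2 *: (a * (fun t => (b t)^-1)).
  apply/funext => t; rewrite !fctE /D /n /a /b [u + _]addrC (lap_lin X) (emb_lin X).
  rewrite [t *: emb h + _]addrC ipDl ipZl sw /c0 /c1 -[2 *: _]/(2 * _); ring.
have dq : is_derive (0 : R) 1 (fun t => c0 + t * c1) c1.
  apply: is_derive_small => e e0; apply/nbhs_normP; exists 1 => //= t _; rewrite add0r mul0r addr0.
  by rewrite [X in `|X|](_ : _ = 0) ?normr0 ?mulr_ge0 ?(ltW e0)//; ring.
apply: (is_derive_eq (is_deriveB dq (is_deriveZ 2 dM))).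
rewrite b0 /a scale0r addr0 expr1n invr1 -![_ *: _ : R^o]/(_ * _).
rewrite opr_hpot /opr /pot ipDl ipZl ipDl ipNl ipZl.
have dE g : ip K (mul (ex (emb u)) g) = ip (dens X u) g by rewrite uK (mulC X K) ip_mul.
rewrite -!sw -(mulA X (ex _)) !dE (mulC X (dens X u)) ip_mul /c1; ring.
Qed.

End Hessian.

Lemma within_clamp (R : realType) (F : normedModType R) (g : R -> F) :
  {within `[0, 1], continuous g} -> continuous (g \o @clamp R).
Proof.
move=> /subspace_continuousP cg s P Ps.
have c01 : `[0, 1]%classic (clamp s) by rewrite /= in_itv /= clamp01.
have H := @clamp_cont R s _ (cg _ c01 P Ps).
apply: (@filterS _ (nbhs s) (nbhs_filter s) _ _ _ H) => t Ht.
by apply: Ht; rewrite /= in_itv /= clamp01.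
Qed.

(** * The degree formula for an abstract elliptic pair *)

Section DegreeFormula.
Variables (R : realType) (E F : completeNormedModType R) (X : elliptic E F).
Variables (f : E -> F) (o : E -> set (E -> F)) (mi : F -> E -> nat).
Hypothesis fE : forall u, f u = curv X u.
Hypothesis df : forall u, 'd f u = dpi X u :> (E -> F).
Hypothesis ho : orientation f o.
Hypothesis miE : forall K u n, f u = K -> has_dim (neg_space X u) n -> mi K u = n.

(** The operator [opr (pot u)] is symmetric, so its kernel is orthogonal to its range; when the
    range is everything, the kernel is zero. *)
Lemma dpi_surj_inj u : range (dpi X u) = setT -> forall h, dpi X u h = 0 -> h = 0.
Proof.
move=> sur h h0; apply: (@emb_inj _ _ _ X); apply: (@ip_eq0 _ _ _ X).
have [w _ wE] : range (dpi X u) (mul X (wt X u) (emb X h)) by rewrite sur.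
have Lh : opr X (pot X u) h = 0 by rewrite -(wtK' X u (opr _ _ _)) -/(dpi X u h) h0
  (linear_fun0 (mul_lin X _)).
have Lw : opr X (pot X u) w = emb X h by rewrite -(wtK' X u (opr _ _ _)) -/(dpi X u w) wE wtK'.
by rewrite -{1}Lw (opr_sym _ _ (potential_pot X u)) Lh ip0r.
Qed.

(** A component consists of endpoints of paths from [x]. Reversing one path and following the other
    is written as a sum minus [x]: at each time one of the two clamped arguments is 0, where its
    path sits at [x]. *)
Lemma path_between (A Ki : set F) (x y z : F) : Ki = path_component A x -> Ki y -> Ki z ->
  exists g : R -> F, [/\ continuous g, g 0 = y, g 1 = z & forall s, 0 <= s <= 1 -> Ki (g s)].
Proof.
move=> -> [gy [cy y0 y1 Ay]] [gz [cz z0 z1 Az]].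
pose h (g : R -> F) (q : R -> R) s := g (clamp (q s)).
have ch (g : R -> F) (q : R -> R) : {within `[0, 1], continuous g} -> continuous q ->
    continuous (h g q).
  by move=> cg cq s; apply: (@continuous_comp _ _ _ q (g \o @clamp R)); [exact: cq|exact: within_clamp].
have c0 : clamp 0 = 0 :> R by rewrite clamp_id// lexx ler01.
have c1 : clamp 1 = 1 :> R by rewrite clamp_id// lexx ler01.
have inK (g : R -> F) t : {within `[0, 1], continuous g} -> g 0 = x ->
    (forall s, 0 <= s <= 1 -> A (g s)) -> path_component A x (g (clamp t)).
  move=> cg g0 Ag; exists (h g (fun s => clamp t * s)); split.
  - apply: continuous_subspaceT; apply: ch => // s.
    by apply: (@continuousM _ _ (fun=> clamp t) (fun s : R => s)); [exact: cst_continuous|exact: cvg_id].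
  - by rewrite /h mulr0 c0.
  - by rewrite /h mulr1 clamp_id// clamp01.
  - by move=> s _; apply: Ag; exact: clamp01.
have cl (a b : R) : continuous (fun s : R => a * s + b).
  move=> s; apply: (@continuousD R R _ (fun s => a * s) (fun=> b) s); last exact: cst_continuous.
  by apply: (@continuousM _ _ (fun=> a) (fun s : R => s)); [exact: cst_continuous|exact: cvg_id].
exists (fun s => h gy (fun s => - 2 * s + 1) s + h gz (fun s => 2 * s + -1) s - x); split.
- move=> s; apply: (@continuousB _ _ _ (fun s => h gy (fun s => - 2 * s + 1) s +
    h gz (fun s => 2 * s + -1) s) (fun=> x)); last exact: cst_continuous.
  by apply: (@continuousD R F _ (h gy (fun s => - 2 * s + 1)) (h gz (fun s => 2 * s + -1)) s);
    apply: ch.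
- rewrite /h !mulr0 !add0r c1 y1 (_ : clamp (-1) = 0) ?z0 ?addrK//.
  by rewrite /clamp (min_idPl _) ?(max_idPl _)//; lra.
- rewrite /h !mulr1 (_ : clamp (2 + -1) = 1); last by rewrite (_ : 2 + -1 = 1)//; ring.
  rewrite (_ : clamp (- 2 + 1) = 0); first by rewrite y0 z1 addrAC subrr add0r.
  by rewrite /clamp (min_idPl _) ?(max_idPl _)//; lra.
- move=> s s01; have [s2|s2] := leP (2 * s) 1.
    rewrite /h (_ : clamp (2 * s + -1) = 0) ?z0 ?addrK; first exact: inK.
    by rewrite /clamp (min_idPl _) ?(max_idPl _)//; lra.
  rewrite /h (_ : clamp (- 2 * s + 1) = 0) ?y0; first by rewrite addrAC subrr add0r; exact: inK.
  by rewrite /clamp (min_idPl _) ?(max_idPl _)//; lra.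
Qed.

Theorem degree_formula : exists s : int, (s = 1 \/ s = -1) /\
  forall (A Ki : set F) (Ui : set E), is_path_component A Ki -> Ui = f @^-1` Ki ->
    proper_map Ui Ki f -> forall K, regular_value Ui Ki f K ->
    degree o Ui Ki f = s * \sum_(u \in Ui `&` f @^-1` [set K]) ((-1) ^+ mi K u : int).
Proof.
have [oo oc] := ho.
have oo' u : operator_orientation (dpi X u) (o u) by rewrite -df; exact: oo.
have [s [s1 Hs]] := sign_eps oo' oc.
(* The orientation sign is [s] times [eps], and [eps] is minus the Morse parity. *)
exists (- s); split; first by case: s1 => ->; [right|left; rewrite opprK].
move=> A Ki Ui [x _ KiE] UiE prop K regK.
pose eps u : int := - (-1) ^+ mi (f u) u.
have Heps u : (forall h, dpi X u h = 0 -> h = 0) ->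
    exists n (e : 'I_n -> F) kappa (G : F -> E), [/\ posfam X u e kappa, linear G,
      cancel G (opr X (fun g => pot X u g + proj X e g)) & eps u = sgz (eps_det X e G)].
  move=> iu; have [n [m [p [kappa [G [dn pk lG GK sg]]]]]] := morse_sign iu.
  by exists m, p, kappa, G; split=> //; rewrite sg /eps (miE erefl dn).
have fibE (y : F) : Ki y -> Ui `&` f @^-1` [set y] = [set u | curv X u = y].
  move=> Ky; apply/seteqP; split=> u /=; first by move=> [_ <-]; rewrite fE.
  by rewrite -fE UiE /= => uy; rewrite uy.
have reginj y u : regular_value Ui Ki f y -> curv X u = y -> forall h, dpi X u h = 0 -> h = 0.
  move=> [Ky Hy] uy; apply: dpi_surj_inj; rewrite -df; apply: Hy; last by rewrite fE.
  by rewrite UiE /= fE uy.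
(* The degree is summed over the fibre of a chosen value [y], which is regular since [K] shows that
   regular values exist. Both lie in the component, and the signed counts are compared along a path
   from [y] to [K]. *)
rewrite /degree; set y := xget _ _.
have regy : regular_value Ui Ki f y.
  have : [set y | regular_value Ui Ki f y] !=set0 by exists K.
  by move=> [y0 Hy0]; exact: (xgetPex 0 (ex_intro _ y0 Hy0)).
have [[Ky _] [KK _]] := (regy, regK).
have [g [cg g0 g1 Kg]] := path_between KiE Ky KK.
have cpt : compact [set u | exists2 s, 0 <= s <= 1 & curv X u = g s].
  have cI : compact (g @` [set s | 0 <= s <= 1]).
    apply: continuous_compact; first exact: continuous_subspaceT.
    have -> : [set s : R | 0 <= s <= 1] = `[0, 1]%classic.
      by apply/seteqP; split=> t; rewrite /= in_itv.
    exact: segment_compact.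
  have := prop _ _ cI; rewrite (_ : Ui `&` _ = [set u | exists2 s, 0 <= s <= 1 & curv X u = g s]).
    by apply; move=> _ [t t01 <-]; exact: Kg.
  apply/seteqP; split=> u /=; first by move=> [_ [t t01 tu]]; exists t => //; rewrite -fE.
  move=> [t t01 tu]; rewrite UiE /= fE tu; split; first exact: Kg.
  by exists t.
have := fibre_sum cg cpt (eps := eps) _ Heps.
rewrite g0 g1 -(fibE _ Ky) -(fibE _ KK) => sumE.
have {sumE}/sumE : forall (t : bool) u, curv X u = g (t : nat)%:R -> forall h, dpi X u h = 0 -> h = 0.
  by move=> [] u; rewrite ?g0 ?g1; exact: reginj.
move=> sumE.
have -> : \sum_(u \in Ui `&` f @^-1` [set y]) sign o u =
    \sum_(u \in Ui `&` f @^-1` [set y]) s * eps u.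
  apply: eq_fsbigr => u; rewrite inE => -[_ uy].
  have iu := reginj y u regy; rewrite -fE in iu.
  have [n [e [kappa [G [pe lG GK ->]]]]] := Heps u (iu uy).
  exact: (Hs u n e kappa G (iu uy) pe lG GK).
rewrite -mulr_fsumr sumE mulNr -mulrN; congr (_ * _).
rewrite -[RHS]mulN1r mulr_fsumr; apply: eq_fsbigr => u; rewrite inE => -[_ /= uK].
by rewrite /eps uK mulN1r.
Qed.

End DegreeFormula.

(** * Calculus on the sphere *)

Section SphereCalculus.
Variable R : realType.
Local Notation S2 := (S2 R).
Local Notation V := 'rV[R]_3.
Implicit Types (p q : S2) (x y z d : V) (f g : S2 -> R).

(** Euclidean norm; the norm of a row vector as a matrix is the maximum norm. *)
Definition nr x : R := Num.sqrt (dot x x).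

Lemma sphere_dot p : dot (val p) (val p) = 1.
Proof. by case: p => x /= /set_mem. Qed.

Lemma dot_ge0 x : 0 <= dot x x.
Proof. by rewrite /dot sumr_ge0// => i _; rewrite -expr2 sqr_ge0. Qed.

Lemma coord_le_nr x i : `|x 0 i| <= nr x.
Proof.
rewrite /nr -sqrtr_sqr ler_wsqrtr// /dot (bigD1 i)//= expr2 lerDl sumr_ge0// => j _.
by rewrite -expr2 sqr_ge0.
Qed.

Lemma nr_gt0 x : x != 0 -> 0 < nr x.
Proof.
move=> /eqP x0; rewrite lt_neqAle sqrtr_ge0 andbT eq_sym; apply/eqP => n0; apply: x0.
apply/rowP => i; rewrite mxE; apply/eqP; rewrite -normr_le0 -n0; exact: coord_le_nr.
Qed.

Lemma dotZ (c : R) x : dot (c *: x) (c *: x) = c ^+ 2 * dot x x.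
Proof. by rewrite /dot mulr_sumr; apply: eq_bigr => i _; rewrite !mxE; ring. Qed.

Lemma nrZ (c : R) x : 0 <= c -> nr (c *: x) = c * nr x.
Proof. by move=> c0; rewrite /nr dotZ sqrtrM ?sqr_ge0// sqrtr_sqr ger0_norm. Qed.

Lemma val_radial x : x != 0 -> val (radial x) = (nr x)^-1 *: x.
Proof.
move=> x0; rewrite /radial val_insubd ifT// inE /unit_sphere /= dotZ.
have n0 := nr_gt0 x0; rewrite exprVn -/(nr x) /nr sqr_sqrtr ?dot_ge0// mulVf//.
by apply: contraTneq n0 => d0; rewrite /nr d0 sqrtr0 ltxx.
Qed.

Lemma radialZ (c : R) x : 0 < c -> radial (c *: x) = radial x.
Proof.
move=> c0; have [->|x0] := eqVneq x 0; first by rewrite scaler0.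
have cx0 : c *: x != 0 by rewrite scaler_eq0 negb_or gt_eqF.
apply: val_inj; rewrite !val_radial// nrZ ?(ltW c0)// scalerA; congr (_ *: _).
by rewrite invfM mulrAC mulVf ?mul1r ?gt_eqF.
Qed.

Lemma val_neq0 p : val p != 0.
Proof.
apply/eqP => p0; have := sphere_dot p; rewrite p0 /dot big1 ?mxE => [/esym/eqP|i _].
  by rewrite oner_eq0.
by rewrite !mxE mulr0.
Qed.

Lemma S2_contP f p : {for p, continuous f} <->
  forall e, 0 < e -> exists2 r, 0 < r & forall q, `|val p - val q| < r -> `|f p - f q| < e.
Proof.
split=> [/cvgrPdist_lt cf e e0|H].
  have /nbhs_ballP[r /= r0 Hr] := cf e e0; exists r => // q pq; apply: Hr.
  by rewrite -initial_ballE /= -ball_normE.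
apply/(@cvgrPdist_lt _ _ S2 (nbhs p) _ f (f p)) => e e0; have [r r0 Hr] := H e e0.
apply/nbhs_ballP; exists r => //= q; rewrite -initial_ballE /= -ball_normE /= => pq.
exact: Hr.
Qed.

Lemma S2_comp_cont (T : topologicalType) (h : T -> S2) f t :
  continuous f -> {for t, continuous (fun t => val (h t))} -> {for t, continuous (f \o h)}.
Proof.
move=> cf ch; apply/cvgrPdist_lt => e e0.
have [r r0 Hr] := iffLR (S2_contP f (h t)) (cf (h t)) e e0.
have /cvgrPdist_lt/(_ _ r0) := ch; apply: filterS => s /= hs; exact: Hr.
Qed.

Lemma cvg_row (T : Type) (Q : set_system T) {FQ : Filter Q} (h : T -> V) x :
  (forall i, (fun t => h t 0 i) @ Q --> x 0 i) -> h @ Q --> x.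
Proof.
move=> H; apply/cvgrPdist_le => e e0.
have : \forall t \near Q, forall i, `|x 0 i - h t 0 i| <= e.
  by apply: filter_forall => i; have /cvgrPdist_le/(_ _ e0) := H i.
apply: filterS => t ht; apply: row_norm_le; first exact: ltW.
by move=> i; rewrite !mxE.
Qed.

Lemma continuous_nr : continuous nr.
Proof.
move=> x; apply: (@continuous_comp _ _ _ (fun x : V => dot x x) Num.sqrt); last exact: sqrt_continuous.
exact: continuous_dot.
Qed.

Lemma val_radial_cont x : x != 0 -> {for x, continuous (fun x => val (radial x))}.
Proof.
move=> x0; have n0 : nr x != 0 by rewrite gt_eqF// nr_gt0.
have near0 : \forall y \near x, y != 0.
  have xn : 0 < `|x| by rewrite normr_gt0.
  apply/nbhs_normP; exists `|x| => //= y /=; apply: contraTneq => ->.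
  by rewrite subr0 ltxx.
have cv : (fun y : V => (nr y)^-1 *: y) @ x --> (nr x)^-1 *: x.
  have h1 : (fun y : V => (nr y)^-1) @ x --> (nr x)^-1.
    exact: (continuousV n0 (@continuous_nr x)).
  exact: (cvgZ h1 (@cvg_id _ (nbhs x))).
suff : (fun x => val (radial x)) @ x --> val (radial x) by [].
rewrite val_radial//; apply: cvg_trans cv.
have ne : \forall y \near x, (nr y)^-1 *: y = val (radial y).
  by near=> y; rewrite val_radial//; near: y.
exact: near_eq_cvg ne.
Unshelve. all: by end_near.
Qed.

Definition dg (i : 'I_3) f x : R := (nr x)^-1 * tder i f (radial x).

Lemma dg_cont i f x : continuous (tder i f) -> x != 0 -> {for x, continuous (dg i f)}.
Proof.
move=> cf x0; apply: (@continuousM _ _ (fun x : V => (nr x)^-1) (fun x => tder i f (radial x))).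
  have n0 : nr x != 0 by rewrite gt_eqF// nr_gt0.
  exact: (continuousV n0 (@continuous_nr x)).
exact: (@S2_comp_cont V (@radial R) (tder i f) x cf (val_radial_cont x0)).
Qed.

Lemma dg_val i f p : dg i f (val p) = tder i f p.
Proof. by rewrite /dg radial_val /nr sphere_dot sqrtr1 invr1 mul1r. Qed.

(* The extension of [f] is homogeneous of degree 0, so its derivatives are
   homogeneous of degree -1. *)
Lemma radial_derive i f x : tderivable f -> x != 0 ->
  is_derive x 'e_i (f \o @radial R) (dg i f x).
Proof.
move=> df x0; have n0 := nr_gt0 x0; apply/is_derive_quot.
have /derivableP/is_derive_quot d1 := df i (radial x).
have d2 : is_derive (0 : R) 1 (fun t : R => (nr x)^-1 * t) ((nr x)^-1).
  have := is_derive_affine (nr x)^-1 0 0.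
  by rewrite (_ : (fun t => _ + 0) = fun t : R => (nr x)^-1 * t)//; apply/funext => t; rewrite addr0.
pose psi (t : R) := (f \o @radial R) (val (radial x) + t *: 'e_i).
have d1' : is_derive ((nr x)^-1 * 0) 1 psi (tder i f (radial x)) by rewrite mulr0.
have := is_derive1_comp d1' d2; rewrite mulrC.
rewrite (_ : psi \o _ = fun t : R => (f \o @radial R) (x + t *: 'e_i))//.
apply/funext => t; rewrite /psi /= val_radial// -scalerA -scalerDr radialZ//.
by rewrite invr_gt0.
Qed.

Lemma line_derive i f x (t : R) : tderivable f -> x + t *: 'e_i != 0 ->
  is_derive t 1 (fun t => f (radial (x + t *: 'e_i))) (dg i f (x + t *: 'e_i)).
Proof.
move=> df xt; have /is_derive_quot H := radial_derive i df xt.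
have := is_derive1_comp (f := fun s => f (radial (x + t *: 'e_i + s *: 'e_i)))
  (g := fun s => s - t) (x := t) (a := dg i f (x + t *: 'e_i)) (b := 1).
rewrite mulr1 (_ : _ \o _ = fun t => f (radial (x + t *: 'e_i))); last first.
  by apply/funext => s /=; rewrite -addrA -scalerDl [t + _]addrC subrK.
apply; first by rewrite subrr.
have := is_derive_affine 1 (- t) t.
by rewrite (_ : (fun s => 1 * s - t) = fun s : R => s - t)//; apply/funext => s; rewrite mul1r.
Qed.

Lemma MVT_sym (phi dphi : R -> R) (h : R) :
  (forall t : R, `|t| <= `|h| -> is_derive t 1 phi (dphi t)) ->
  exists2 t : R, `|t| <= `|h| & phi h - phi 0 = h * dphi t.
Proof.
move=> H; have cont a b : (forall t, a <= t <= b -> `|t| <= `|h|) -> {within `[a, b], continuous phi}.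
  move=> ab; apply: continuous_in_subspaceT => t; rewrite inE /= in_itv /= => /ab th.
  apply: differentiable_continuous; apply/derivable1_diffP.
  by have [] := H t th.
have [h0|h0] := leP 0 h.
  have sub t : 0 <= t <= h -> `|t| <= `|h| by move=> /andP[t0 th]; rewrite !ger0_norm.
  have [|c] := MVT_segment h0 _ (cont _ _ sub) (df := dphi).
    by move=> t; rewrite in_itv /= => /andP[/ltW t0 /ltW th]; apply: H; apply: sub; rewrite t0.
  by rewrite in_itv /= subr0 => ch ->; exists c; [exact: sub|rewrite mulrC].
have sub t : h <= t <= 0 -> `|t| <= `|h|.
  by move=> /andP[th t0]; rewrite !ler0_norm ?lerN2// ltW.
have [|c] := MVT_segment (ltW h0) _ (cont _ _ sub) (df := dphi).
  by move=> t; rewrite in_itv /= => /andP[/ltW t0 /ltW th]; apply: H; apply: sub; rewrite t0.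
rewrite in_itv /= sub0r => ch E; exists c; first exact: sub.
by rewrite -opprB E; ring.
Qed.

(** Points of a broken line from [x] to [x + d] parallel to the axes, along which partial
    derivatives suffice. *)
Definition mix x d (k : nat) (s : R) : V :=
  \row_j (x 0 j + (if (j < k)%N then d 0 j else if j == k :> nat then s else 0)).

Lemma mix_line x d (k : 'I_3) s : mix x d k s = mix x d k 0 + s *: 'e_k.
Proof.
apply/rowP => j; rewrite !mxE eqxx /= -[j == k]val_eqE /=.
by case: (ltngtP j k) => _ /=; ring.
Qed.

Lemma mixS x d (k : 'I_3) : mix x d k (d 0 k) = mix x d k.+1 0.
Proof.
apply/rowP => j; rewrite !mxE ltnS; case: (ltngtP j k) => [jk|jk|/val_inj ->]//=.
by case: ifP.
Qed.

(** [tderivable] provides only partial derivatives; the mean value theorem on each piece of the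
    broken line takes the place of a total differential. *)
Lemma increments f x d : tderivable f -> (forall z, `|z - x| <= `|d| -> z != 0) ->
  exists xi : 'I_3 -> V, (forall i, `|xi i - x| <= `|d|) /\
    f (radial (x + d)) - f (radial x) = \sum_i d 0 i * dg i f (xi i).
Proof.
move=> df H; have mixb (k : 'I_3) s : `|s| <= `|d 0 k| -> `|mix x d k s - x| <= `|d|.
  move=> sk; apply: row_norm_le => // j; rewrite !mxE addrAC subrr add0r.
  case: ifP => _; first exact: coord_le_norm.
  case: ifP => _; last by rewrite normr0.
  exact: le_trans sk (coord_le_norm _ _).
have step (k : 'I_3) : exists xi, `|xi - x| <= `|d| /\
    f (radial (mix x d k.+1 0)) - f (radial (mix x d k 0)) = d 0 k * dg k f xi.
  have Hd (t : R) : `|t| <= `|d 0 k| -> is_derive t 1 (fun t => f (radial (mix x d k 0 + t *: 'e_k)))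
      (dg k f (mix x d k 0 + t *: 'e_k)).
    move=> td; apply: line_derive => //; rewrite -(mix_line x d k t); apply: H; exact: mixb.
  have [t th] := MVT_sym Hd; rewrite -(mix_line x d k (d 0 k)) (mixS x d k) scale0r addr0 => E.
  exists (mix x d k t); split; first exact: mixb.
  by rewrite (mix_line x d k t); exact: E.
have [xi Hxi] := choice step; exists xi; split=> [i|]; first by case: (Hxi i).
rewrite -(eq_bigr _ (fun i _ => proj2 (Hxi i))).
rewrite -(big_mkord xpredT (fun k => f (radial (mix x d k.+1 0)) - f (radial (mix x d k 0)))).
rewrite telescope_sumr//; congr (f (radial _) - f (radial _)); apply/rowP => j; rewrite !mxE.
  by rewrite ltn_ord.
by rewrite ltn0; case: ifP => _; rewrite addr0.
Qed.

Lemma far_from_0 p z : `|z - val p| < 4^-1 -> 4^-1 <= nr z.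
Proof.
move=> zp; have [i pi] : exists i, 2^-1 <= `|val p 0 i|.
  apply: contrapT => /forallNP H; have := sphere_dot p; rewrite /dot.
  have b i : val p 0 i * val p 0 i < 4^-1.
    have /negP := H i; rewrite -ltNge => h; rewrite -expr2 -real_normK ?num_real//.
    by rewrite (_ : 4^-1 = 2^-1 ^+ 2 :> R) ?ltr_pXn2r ?nnegrE//; field.
  by rewrite !big_ord_recl big_ord0; have := b ord0; have := b (lift ord0 ord0);
    have := b (lift ord0 (lift ord0 ord0)); lra.
apply: le_trans (coord_le_nr z i).
have := coord_le_norm (z - val p) i; rewrite !mxE => h.
have := ler_normB (z 0 i) (z 0 i - val p 0 i); rewrite opprB addrC subrK; lra.
Qed.

Lemma nr_neq0 z : 4^-1 <= nr z -> z != 0.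
Proof.
move=> h; apply: contraTneq h => ->; rewrite -ltNge /nr /dot big1 ?sqrtr0 ?invr_gt0//.
by move=> i _; rewrite mxE mulr0.
Qed.

(** [12 = 3 * 4]: three partial derivatives, each multiplied by at most 4, since points near the
    sphere have Euclidean norm at least 1/4. At distance at least 1/4 the trivial bound [2 * M0]
    becomes [8 * M0] times the distance. *)
Lemma C1_lipschitz f (M0 M : R) p q : tderivable f -> 0 <= M0 -> 0 <= M ->
  (forall p, `|f p| <= M0) -> (forall i p, `|tder i f p| <= M) ->
  `|f p - f q| <= (8 * M0 + 12 * M) * `|val p - val q|.
Proof.
move=> df M00 M_0 fM dM; set d := val p - val q.
have [dl|dl] := ltP `|d| 4^-1; last first.
  have := ler_normB (f p) (f q); have := fM p; have := fM q; have := ler_wpM2l M00 dl.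
  have : 0 <= M * `|d| by rewrite mulr_ge0.
  rewrite !mulrDl; lra.
have [z zd|xi [xid E]] := @increments f (val q) d df.
  by apply: nr_neq0; apply: (@far_from_0 q); exact: le_lt_trans zd dl.
have qd : val q + d = val p by rewrite addrC subrK.
rewrite qd !radial_val in E; rewrite E.
rewrite (le_trans (ler_norm_sum _ _ _))// (@le_trans _ _ (\sum_(i < 3) 4 * M * `|d|))//.
  apply: ler_sum => i _; rewrite normrM mulrC ler_pM ?coord_le_norm// normrM.
  have n4 := @far_from_0 q _ (le_lt_trans (xid i) dl).
  have n0 : 0 < nr (xi i) by apply: lt_le_trans n4; rewrite invr_gt0.
  rewrite ler_pM// normfV gtr0_norm// -[leRHS]invrK lef_pV2 ?posrE ?invr_gt0//.
rewrite sumr_const card_ord -mulr_natl mulrDl.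
have : 0 <= M0 * `|d| by rewrite mulr_ge0.
lra.
Qed.

(** The intermediate points of [increments] tend to the base point, so continuous partial
    derivatives give the total derivative along the curve. *)
Lemma chain_rule f (ga : R -> V) (dga : 'I_3 -> R) (t0 : R) :
  tderivable f -> (forall i, continuous (tder i f)) ->
  (forall i, is_derive t0 1 (fun t => ga t 0 i) (dga i)) -> ga t0 != 0 ->
  is_derive t0 1 (fun t => f (radial (ga t))) (\sum_i dga i * dg i f (ga t0)).
Proof.
move=> df cf dga_ ga0; set x := ga t0.
pose d s : V := ga (s + t0) - x.
have cd : d @ (0 : R) --> (0 : V).
  apply: cvg_row => i; rewrite mxE.
  have ci : {for t0, continuous (fun t => ga t 0 i)}.
    by apply: differentiable_continuous; apply/derivable1_diffP; case: (dga_ i).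
  have c0 : (fun s : R => s + t0) @ (0 : R) --> t0.
    rewrite -[X in _ --> X]add0r; apply: (@continuousD R R _ id (fun=> t0) 0); first exact: cvg_id.
    exact: cst_continuous.
  have c1 : (fun s => ga (s + t0) 0 i) @ (0 : R) --> x 0 i 
    by exact: (@cvg_comp R R R (fun s => s + t0) (fun t => ga t 0 i) (nbhs (0 : R)) (nbhs t0)
      (nbhs (x 0 i)) c0 ci).
  have -> : (fun s => d s 0 i) = (fun s => ga (s + t0) 0 i - x 0 i) by apply/funext => s; rewrite !mxE.
  rewrite -[X in _ --> X](subrr (x 0 i)).
  apply: (@cvgB _ _ _ _ _ (fun s => ga (s + t0) 0 i) (fun=> x 0 i)); [exact: c1|exact: cvg_cst].
have xn : 0 < `|x| by rewrite normr_gt0.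
have ok : \forall s \near (0 : R), exists xi : 'I_3 -> V, (forall i, `|xi i - x| <= `|d s|) /\
    f (radial (ga (s + t0))) - f (radial x) = \sum_i d s 0 i * dg i f (xi i).
  have H0 : \forall s \near (0 : R), `|0 - d s| < `|x|.
    by exact: (iffLR (cvgrPdist_lt d 0) cd _ xn).
  apply: (@filterS _ (nbhs (0 : R)) (nbhs_filter _) _ _ _ H0) => s; rewrite sub0r normrN => ds.
  have [z zd|xi H] := @increments f x (d s) df.
    apply: contraTneq (le_lt_trans zd ds) => ->; by rewrite sub0r normrN ltxx.
  by exists xi; rewrite [x + _]addrC subrK in H.
have tot (s : R) : exists xi : 'I_3 -> V, (forall i, `|xi i - x| <= `|d s|) /\
    ((exists xi : 'I_3 -> V, (forall i, `|xi i - x| <= `|d s|) /\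
    f (radial (ga (s + t0))) - f (radial x) = \sum_i d s 0 i * dg i f (xi i)) ->
    f (radial (ga (s + t0))) - f (radial x) = \sum_i d s 0 i * dg i f (xi i)).
  have [[xi [H1 H2]]|n] := pselect (exists xi : 'I_3 -> V, (forall i, `|xi i - x| <= `|d s|) /\
    f (radial (ga (s + t0))) - f (radial x) = \sum_i d s 0 i * dg i f (xi i)); first by exists xi.
  by exists (fun=> x); split=> // i; rewrite subrr normr0.
have [xi Hxi] := choice tot.
have cxi i : (fun s => xi s i) @ (0 : R) --> x.
  apply/cvgrPdist_lt => e e0; have H0 : \forall s \near (0 : R), `|0 - d s| < e.
    by exact: (iffLR (cvgrPdist_lt d 0) cd _ e0).
  apply: (@filterS _ (nbhs (0 : R)) (nbhs_filter _) _ _ _ H0) => s; rewrite sub0r normrN => ds; rewrite distrC.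
  exact: le_lt_trans (proj1 (Hxi s) i) ds.
have quot : (fun h => h^-1 *: (((fun t => f (radial (ga t))) \o shift t0) (h *: 1) - f (radial (ga t0))))
    @ 0^' --> \sum_i dga i * dg i f x.
  have cs : (fun h : R => \sum_i (h^-1 * d h 0 i) * dg i f (xi h i)) @ 0^' -->
      \sum_i dga i * dg i f x.
    apply: cvg_big => [|i _]; first exact: add_continuous.
    have c1 : (fun h : R => h^-1 * d h 0 i) @ 0^' --> dga i.
      have [ed <-] := dga_ i; move: ed; rewrite /derivable /derive.
      rewrite (_ : (fun h : R => h^-1 * d h 0 i) = (fun h => h^-1 *: (((fun t => ga t 0 i) \o
        shift t0) (h *: 1) - ga t0 0 i)))//.
      by apply/funext => h; rewrite /d !mxE /= /shift /= [h *: 1]mulr1.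
    have cxi' : (fun s => xi s i) @ 0^' --> x.
      by apply: cvg_trans (cxi i); apply: cvg_app; exact: cvg_within.
    have c2 : (fun h : R => dg i f (xi h i)) @ 0^' --> dg i f x.
      apply: (@cvg_comp R V R (fun h => xi h i) (dg i f) 0^' (nbhs x) (nbhs (dg i f x))).
        exact: cxi'.
      exact: (dg_cont (cf i) ga0).
    exact: cvgM c1 c2.
  apply: cvg_trans cs; apply: near_eq_cvg; rewrite near_withinE.
  apply: (@filterS _ (nbhs (0 : R)) (nbhs_filter _) _ _ _ ok) => h Hh h0.
  rewrite /= /shift /= [h *: 1]mulr1 (proj2 (Hxi h) Hh) scaler_sumr.
  by apply: eq_bigr => i _; rewrite -mulrA.
apply: DeriveDef; first by apply/cvg_ex; eexists; exact: quot.
by apply/cvg_lim => //; exact: Rhausdorff.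
Qed.

(** The extension of [f] is constant along rays. *)
Lemma euler f p : tderivable f -> (forall i, continuous (tder i f)) ->
  \sum_i val p 0 i * tder i f p = 0.
Proof.
move=> df cf; pose ga (t : R) : V := (1 + t) *: val p.
have g0 : ga 0 = val p by rewrite /ga addr0 scale1r.
have dgi i : is_derive (0 : R) 1 (fun t => ga t 0 i) (val p 0 i).
  have -> : (fun t => ga t 0 i) = (fun t : R => val p 0 i * t + val p 0 i).
    by apply/funext => t; rewrite !mxE; ring.
  exact: is_derive_affine.
have gn : ga 0 != 0 by rewrite g0 val_neq0.
have H := chain_rule df cf dgi gn.
have n0 : \forall t \near (0 : R), f p = f (radial (ga t)).
  apply/nbhs_normP; exists 1; first by rewrite /=.
  move=> t; rewrite /= sub0r normrN => t1.
  by rewrite /ga radialZ ?radial_val//; move: t1; rewrite ltr_norml => /andP[]; lra.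
have := near_eq_is_derive n0 (is_derive_cst (f p) (0 : R) 1).
move=> [_ E1]; have [_ E2] := H; move: E2; rewrite E1 g0 => E2.
by rewrite [RHS]E2; apply: eq_bigr => i _; rewrite dg_val.
Qed.

End SphereCalculus.

(** * Integrals over an interval and iterated integrals *)

Section Integrals.
Variable R : realType.
Local Notation mu := (@lebesgue_measure R).

Definition intg (a b : R) (h : R -> R) : R := \int[mu]_(x in `[a, b]) h x.

Lemma intg_integrable a b (h : R -> R) : continuous h -> mu.-integrable `[a, b] (EFin \o h).
Proof.
move=> ch; apply: continuous_compact_integrable; first exact: segment_compact.
exact: continuous_subspaceT.
Qed.

Lemma intgD a b (h k : R -> R) : continuous h -> continuous k ->
  intg a b (fun x => h x + k x) = intg a b h + intg a b k.
Proof. by move=> ch ck; rewrite /intg RintegralD//; exact: intg_integrable. Qed.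

Lemma intgZ a b (c : R) (h : R -> R) : continuous h ->
  intg a b (fun x => c * h x) = c * intg a b h.
Proof. by move=> ch; rewrite /intg RintegralZl//; exact: intg_integrable. Qed.

Lemma le_intg a b (h k : R -> R) : continuous h -> continuous k ->
  (forall x, a <= x <= b -> h x <= k x) -> intg a b h <= intg a b k.
Proof.
by move=> ch ck hk; apply: le_Rintegral => //; exact: intg_integrable.
Qed.

Lemma intg_FTC a b (G h : R -> R) : a < b -> continuous h ->
  (forall x : R, is_derive x 1 G (h x)) -> intg a b h = G b - G a.
Proof.
move=> ab ch dG; have cG : continuous G.
  by move=> x; apply: differentiable_continuous; apply/derivable1_diffP; case: (dG x).
rewrite /intg /Rintegral (@continuous_FTC2 _ h G)//.
- exact: continuous_subspaceT.
- split; first by move=> x _; case: (dG x).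
    by apply: cvg_at_right_filter; exact: cG.
  by apply: cvg_at_left_filter; exact: cG.
- by move=> x _; rewrite derive1E; case: (dG x).
Qed.

Lemma intg_cst a b (c : R) : a <= b -> intg a b (fun=> c) = c * (b - a).
Proof.
rewrite le_eqVlt => /orP[/eqP <-|ab].
  by rewrite /intg set_itv1 Rintegral_set1 subrr mulr0.
have dc x := is_derive_affine c 0 x.
by rewrite (intg_FTC ab (@cst_continuous _ _ c) dc); ring.
Qed.

Lemma intg_norm a b (h : R -> R) (M : R) : a <= b -> continuous h ->
  (forall x, a <= x <= b -> `|h x| <= M) -> `|intg a b h| <= M * (b - a).
Proof.
move=> ab ch hM; have cM (c : R) : continuous (fun _ : R => c) by exact: cst_continuous.
rewrite ler_norml -(intg_cst M ab) -(mulN1r (intg _ _ _)) -intgZ//; apply/andP; split.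
  apply: le_intg => // x xab; rewrite mulN1r; have := hM x xab; rewrite ler_norml => /andP[]//.
by apply: le_intg => // x xab; have := hM x xab; rewrite ler_norml => /andP[].
Qed.

Lemma intg_gt0 a b (h : R -> R) x0 : a < b -> continuous h ->
  (forall x, a <= x <= b -> 0 <= h x) -> a <= x0 <= b -> 0 < h x0 -> 0 < intg a b h.
Proof.
move=> ab ch h0 /andP[ax xb] hx0.
have h20 : h x0 / 2 < h x0 by rewrite ltr_pdivrMr// mulr_natr mulr2n ltrDl.
have /nbhs_normP[r /= r0 Hr] : \forall x \near x0, h x0 / 2 < h x by exact: (cvgr_gt _ (ch x0)).
pose c := Num.max a (x0 - r / 2); pose d := Num.min b (x0 + r / 2).
have r20 : 0 < r / 2 by rewrite divr_gt0.
have cd : c < d.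
  by rewrite /c /d lt_min !gt_max ab /=; apply/andP; split; [lra|apply/andP; split; lra].
have ac : a <= c by rewrite le_max lexx. have db : d <= b by rewrite ge_min lexx.
have Hcd x : c <= x <= d -> h x0 / 2 <= h x.
  rewrite /c /d ge_max le_min => /andP[/andP[_ x1] /andP[_ x2]]; apply/ltW/Hr.
  by rewrite /= ltr_norml; apply/andP; split; lra.
apply: (@lt_le_trans _ _ (intg c d h)).
  apply: (@lt_le_trans _ _ (intg c d (fun=> h x0 / 2))); last first.
    by apply: le_intg => //; exact: cst_continuous.
  by rewrite intg_cst ?ltW// mulr_gt0// ?subr_gt0// divr_gt0.
have Icd := intg_integrable c d ch; have Iab := intg_integrable a b ch.
rewrite /intg /Rintegral; apply: fine_le; try exact: integrable_fin_num.
apply: ge0_subset_integral => //; first by case/integrableP : Iab.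
by apply: subset_itv; rewrite bnd_simp.
Qed.

Definition cont2 (H : R -> R -> R) := continuous (fun p : R * R => H p.1 p.2).

Lemma cont2_fst H s : cont2 H -> continuous (fun t => H t s).
Proof.
move=> cH t; apply: (@continuous_comp _ _ _ (fun t : R => (t, s)) (fun p : R * R => H p.1 p.2) t);
  last exact: cH.
have h : (fun _ : R => s) @ t --> s by exact: cvg_cst.
exact: (cvg_pair (@cvg_id _ (nbhs t)) h).
Qed.

Lemma cont2_snd H t : cont2 H -> continuous (H t).
Proof.
move=> cH s; apply: (@continuous_comp _ _ _ (fun s : R => (t, s)) (fun p : R * R => H p.1 p.2) s);
  last exact: cH.
have h : (fun _ : R => t) @ s --> t by exact: cvg_cst.
exact: (cvg_pair h (@cvg_id _ (nbhs s))).
Qed.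

Lemma cont2D H K : cont2 H -> cont2 K -> cont2 (fun t s => H t s + K t s).
Proof. by move=> cH cK p; exact: (@continuousD _ _ _ _ _ p (cH p) (cK p)). Qed.

Lemma cont2M H K : cont2 H -> cont2 K -> cont2 (fun t s => H t s * K t s).
Proof. by move=> cH cK p; exact: (@continuousM _ _ _ _ p (cH p) (cK p)). Qed.

Lemma cont2_c (c : R) : cont2 (fun _ _ => c).
Proof. by move=> p; exact: cst_continuous. Qed.

Lemma cont2_t (h : R -> R) : continuous h -> cont2 (fun t _ => h t).
Proof.
move=> ch p; apply: (@continuous_comp _ _ _ (fun p : R * R => p.1) h p); last exact: ch.
exact: cvg_fst.
Qed.

Lemma cont2_s (h : R -> R) : continuous h -> cont2 (fun _ s => h s).
Proof.
move=> ch p; apply: (@continuous_comp _ _ _ (fun p : R * R => p.2) h p); last exact: ch.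
exact: cvg_snd.
Qed.

Lemma cont2_unif H t a b e : cont2 H -> 0 < e ->
  \forall t' \near t, forall s, a <= s <= b -> `|H t' s - H t s| <= e.
Proof.
move=> cH e0; have cI : compact `[a, b] by exact: segment_compact.
suff NC s0 : `[a, b]%classic s0 -> \forall s \near s0 & t' \near t, `|H t' s - H t s| <= e.
  have H0 : \forall t' \near t, `[a, b]%classic `<=` (fun s => `|H t' s - H t s| <= e).
    exact: (iffLR (compact_near_coveringP _) cI R (nbhs t)
      (fun t' s => `|H t' s - H t s| <= e) (nbhs_filter t) NC).
  apply: (@filterS _ (nbhs t) (nbhs_filter t) _ _ _ H0) => t' Ht' s sab.
  by apply: Ht'; rewrite /= in_itv.
move=> _; have e20 : 0 < e / 2 by rewrite divr_gt0.
have c1 := iffLR (cvgrPdist_lt _ _) (cH (t, s0)) _ e20.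
have c2 : \forall s \near s0, `|H t s0 - H t s| < e / 2.
  by exact: (iffLR (cvgrPdist_lt (H t) (H t s0)) (@cont2_snd H t cH s0) _ e20).
case: c1 => -[A B] /= [A1 B1] AB.
exists (B `&` [set s | `|H t s0 - H t s| < e / 2], A) => //=.
  by split=> //; apply: filterI.
move=> [s t'] /= [[Bs s2] At']; have := AB (t', s) (conj At' Bs) => /= h.
have := ler_distD (H t s0) (H t' s) (H t s); rewrite distrC in h.
move: h s2; set x := `|_|; set y := `|_| => h s2 /le_trans; apply.
by rewrite (splitr e) lerD// ltW// distrC.
Qed.

Lemma intg_cont H a b : a <= b -> cont2 H -> continuous (fun t => intg a b (H t)).
Proof.
move=> ab cH t; apply/cvgrPdist_le => e e0.
have b1 : 0 < b - a + 1 by rewrite ltr_wpDl// subr_ge0.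
have e1 : 0 < e / (b - a + 1) by rewrite divr_gt0.
have := cont2_unif t a b cH e1; apply: filterS => t' Ht'.
have cs x := @cont2_snd H x cH.
have cN : continuous (fun s => -1 * H t' s).
  by move=> s; apply: (@continuousM _ _ (fun=> -1) (H t')); [exact: cst_continuous|exact: cs].
have -> : intg a b (H t) - intg a b (H t') = intg a b (fun s => H t s + -1 * H t' s).
  by rewrite intgD// intgZ// mulN1r.
have c3 : continuous (fun s => H t s + -1 * H t' s).
  by move=> s; apply: (@continuousD R R _ (H t) (fun s => -1 * H t' s) s); [exact: cs|exact: cN].
rewrite (le_trans (intg_norm (M := e / (b - a + 1)) ab c3 _))//.
  by move=> s /Ht'; rewrite mulN1r distrC.
by rewrite -mulrA ler_piMr ?(ltW e0)// ler_pdivrMl// mulr1 lerDl.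
Qed.

Lemma intg_derive A A' (a b t : R) : a <= b -> cont2 A -> cont2 A' ->
  (forall t s, is_derive (t : R) 1 (fun t => A t s) (A' t s)) ->
  is_derive t 1 (fun t => intg a b (A t)) (intg a b (A' t)).
Proof.
move=> ab cA cA' dA; apply: is_derive_small => e e0.
have b1 : 0 < b - a + 1 by rewrite ltr_wpDl// subr_ge0.
have e1 : 0 < e / (b - a + 1) by rewrite divr_gt0.
have /nbhs_normP[r /= r0 Hr] := cont2_unif t a b cA' e1.
apply/nbhs_normP; exists r => // h; rewrite /= sub0r normrN => hr.
have cs x := @cont2_snd A x cA; have cs' x := @cont2_snd A' x cA'.
have cZ (c : R) (k : R -> R) : continuous k -> continuous (fun s => c * k s).
  by move=> ck s; apply: (@continuousM _ _ (fun=> c) k); [exact: cst_continuous|exact: ck].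
have cD (k l : R -> R) : continuous k -> continuous l -> continuous (fun s => k s + l s).
  by move=> ck cl s; apply: (@continuousD R R _ k l s); [exact: ck|exact: cl].
have -> : intg a b (A (t + h)) - intg a b (A t) - h * intg a b (A' t) =
    intg a b (fun s => (A (t + h) s + -1 * A t s) + - h * A' t s).
  by rewrite !(intgD, intgZ)//; [ring|exact: cZ|apply: cD => //; exact: cZ|exact: cZ].
have M0 s : a <= s <= b -> `|A (t + h) s + -1 * A t s + - h * A' t s| <= e / (b - a + 1) * `|h|.
  move=> sab; have dl (u : R) : `|u| <= `|h| -> is_derive u 1 (fun u => A (u + t) s) (A' (u + t) s).
    move=> _; have d1 := is_derive_affine 1 t u.
    have d2 : is_derive (1 * u + t) 1 (fun t => A t s) (A' (1 * u + t) s) by exact: dA.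
    have := @is_derive1_comp R (fun t => A t s) (fun v => 1 * v + t) u _ _ d2 d1.
    rewrite mulr1 mul1r.
    by rewrite (_ : _ \o _ = (fun u => A (u + t) s))//; apply/funext => v /=; rewrite mul1r.
  have [u uh] := MVT_sym dl; rewrite add0r [h + t]addrC => E.
  have -> : A (t + h) s + -1 * A t s + - h * A' t s = h * (A' (u + t) s - A' t s).
    by rewrite mulrBr -E; ring.
  rewrite normrM mulrC ler_wpM2r// Hr//= opprD addrCA subrr addr0 normrN.
  exact: le_lt_trans uh hr.
rewrite (le_trans (intg_norm ab _ M0))//.
  exact: (cD _ _ (cD _ _ (cs _) (cZ _ _ (cs _))) (cZ _ _ (cs' _))).
rewrite mulrAC ler_wpM2r// -mulrA ler_piMr ?(ltW e0)// ler_pdivrMl// mulr1 lerDl//.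
Qed.

Definition dint H : R := intg 0 pi (fun t => intg 0 (2 * pi) (H t)).

Lemma pi0 : 0 <= pi :> R. Proof. exact: pi_ge0. Qed.
Lemma pi20 : 0 <= 2 * pi :> R. Proof. by rewrite mulr_ge0 ?pi_ge0. Qed.
Lemma pi2gt0 : 0 < 2 * pi :> R. Proof. by rewrite mulr_gt0 ?pi_gt0. Qed.

Lemma dintD H K : cont2 H -> cont2 K -> dint (fun t s => H t s + K t s) = dint H + dint K.
Proof.
move=> cH cK; rewrite /dint -intgD; try exact: (intg_cont pi20).
congr intg; apply/funext => t; rewrite intgD//; exact: cont2_snd.
Qed.

Lemma dintZ (c : R) H : cont2 H -> dint (fun t s => c * H t s) = c * dint H.
Proof.
move=> cH; rewrite /dint -intgZ; last exact: (intg_cont pi20).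
congr intg; apply/funext => t; rewrite intgZ//; exact: cont2_snd.
Qed.

Lemma le_dint H K : cont2 H -> cont2 K ->
  (forall t s, 0 <= t <= pi -> H t s <= K t s) -> dint H <= dint K.
Proof.
move=> cH cK HK; apply: le_intg; try exact: (intg_cont pi20).
move=> t t0; apply: le_intg; try exact: cont2_snd.
by move=> s _; exact: HK.
Qed.

Lemma dint_gt0 H t0 s0 : cont2 H -> (forall t s, 0 <= t <= pi -> 0 <= H t s) ->
  0 <= t0 <= pi -> 0 <= s0 <= 2 * pi -> 0 < H t0 s0 -> 0 < dint H.
Proof.
move=> cH H0 t0b s0b H1; apply: (@intg_gt0 0 pi _ t0) => //; first exact: pi_gt0.
- exact: (intg_cont pi20).
- move=> t tb; rewrite (le_trans _ (@le_intg 0 (2 * pi) (fun=> 0) (H t) _ _ _))//.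
  + by rewrite intg_cst ?pi20// mul0r.
  + exact: cst_continuous.
  + exact: cont2_snd.
  + by move=> s _; exact: H0.
- apply: (@intg_gt0 0 (2 * pi) _ s0) => //; first exact: pi2gt0.
    exact: cont2_snd.
  by move=> s _; exact: H0.
Qed.

(** The derivative is first taken out of the inner integral, then the outer one is evaluated at its
    ends; the order of integration is not exchanged. *)
Lemma dint_dt A A' : cont2 A -> cont2 A' ->
  (forall t s, is_derive (t : R) 1 (fun t => A t s) (A' t s)) ->
  (forall s, A 0 s = 0) -> (forall s, A pi s = 0) -> dint A' = 0.
Proof.
move=> cA cA' dA A0 Api.
have dI t := intg_derive t pi20 cA cA' dA.
rewrite /dint (intg_FTC (@pi_gt0 R) (intg_cont pi20 cA') dI).
have -> : A pi = fun=> 0 by apply/funext.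
by have -> : A 0 = fun=> 0; [apply/funext|rewrite subrr].
Qed.

Lemma dint_ds B B' : cont2 B' ->
  (forall t s, is_derive (s : R) 1 (B t) (B' t s)) ->
  (forall t, B t 0 = B t (2 * pi)) -> dint B' = 0.
Proof.
move=> cB' dB B0.
have E t : intg 0 (2 * pi) (B' t) = 0.
  by rewrite (@intg_FTC 0 (2 * pi) (B t)) ?pi2gt0 ?B0 ?subrr//; exact: cont2_snd.
rewrite /dint (_ : (fun t => _) = fun=> 0); first by rewrite intg_cst ?pi0// mul0r.
exact/funext.
Qed.

End Integrals.

(** * The mean over the sphere *)

Section Mean.
Variable R : realType.
Local Notation S2 := (S2 R).
Local Notation V := 'rV[R]_3.
Implicit Types (p q : S2) (f g : S2 -> R).

Definition sphv (t s : R) : V := \row_(i < 3) [:: sin t * cos s; sin t * sin s; cos t]`_i.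

Lemma dot_sphv t s : dot (sphv t s) (sphv t s) = 1.
Proof.
rewrite /dot !big_ord_recl big_ord0 !mxE /=.
rewrite (_ : _ + _ = sin t ^+ 2 * (cos s ^+ 2 + sin s ^+ 2) + cos t ^+ 2); last by ring.
by rewrite cos2Dsin2 mulr1 addrC cos2Dsin2.
Qed.

Lemma val_sph t s : val (sph t s) = sphv t s.
Proof.
have /= E := radial_val (exist _ (sphv t s) (mem_set (dot_sphv t s)) : S2).
by rewrite /sph -/(sphv t s) E.
Qed.

Lemma cont2_sph f : continuous f -> cont2 (fun t s => f (sph t s)).
Proof.
move=> cf p; suff H : {for p, continuous (f \o (fun p : R * R => sph p.1 p.2))} by exact: H.
apply: (@S2_comp_cont R (R * R)%type (fun w => sph w.1 w.2) f p cf).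
suff : (fun p : R * R => val (sph p.1 p.2)) @ p --> val (sph p.1 p.2) by [].
have st := cont2_t (@continuous_sin R); have ct := cont2_t (@continuous_cos R).
have ss := cont2_s (@continuous_sin R); have cs := cont2_s (@continuous_cos R).
apply: cvg_row => i.
have -> : (fun w : R * R => val (sph w.1 w.2) 0 i) = (fun w : R * R => sphv w.1 w.2 0 i).
  by apply/funext => u; rewrite val_sph.
rewrite val_sph; case: i => -[|[|[|//]]] i3.
- have -> : (fun w : R * R => sphv w.1 w.2 0 (Ordinal i3)) = (fun w : R * R => sin w.1 * cos w.2).
    by apply/funext => u; rewrite mxE.
  by rewrite mxE; exact: (cont2M st cs).
- have -> : (fun w : R * R => sphv w.1 w.2 0 (Ordinal i3)) = (fun w : R * R => sin w.1 * sin w.2).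
    by apply/funext => u; rewrite mxE.
  by rewrite mxE; exact: (cont2M st ss).
- have -> : (fun w : R * R => sphv w.1 w.2 0 (Ordinal i3)) = (fun w : R * R => cos w.1).
    by apply/funext => u; rewrite mxE.
  by rewrite mxE; exact: ct.
Qed.

Lemma cont2_msin f : continuous f -> cont2 (fun t s => f (sph t s) * sin t).
Proof. by move=> cf; apply: cont2M; [exact: cont2_sph|exact: (cont2_t (@continuous_sin R))]. Qed.

Lemma meanE f : mean f = (4 * pi)^-1 * dint (fun t s => f (sph t s) * sin t).
Proof. by []. Qed.

Lemma pi4_gt0 : 0 < 4 * pi :> R. Proof. by rewrite mulr_gt0// pi_gt0. Qed.

Lemma meanD f g : continuous f -> continuous g -> mean (fun p => f p + g p) = mean f + mean g.
Proof.
move=> cf cg; rewrite !meanE -mulrDr -dintD; [|exact: cont2_msin..].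
by congr (_ * dint _); apply/funext => t; apply/funext => s; rewrite mulrDl.
Qed.

Lemma meanZ (c : R) f : continuous f -> mean (fun p => c * f p) = c * mean f.
Proof.
move=> cf; rewrite !meanE mulrCA -(dintZ c (cont2_msin cf)).
by congr (_ * dint _); apply/funext => t; apply/funext => s; rewrite mulrA.
Qed.

Lemma sin_itv t : 0 <= t <= pi -> 0 <= sin t :> R.
Proof. by move=> /andP[t0 tp]; apply: sin_ge0_pi; rewrite t0. Qed.

Lemma le_mean f g : continuous f -> continuous g -> (forall p, f p <= g p) -> mean f <= mean g.
Proof.
move=> cf cg fg; rewrite !meanE ler_pM2l ?invr_gt0 ?pi4_gt0//.
apply: le_dint; [exact: cont2_msin..|].
by move=> t s /sin_itv t0; rewrite ler_wpM2r.
Qed.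

Lemma mean_cst (c : R) : mean (fun=> c) = c.
Proof.
rewrite meanE /dint.
have -> : (fun t : R => intg 0 (2 * pi) (fun=> c * sin t)) = (fun t => (c * (2 * pi)) * sin t).
  by apply/funext => t; rewrite intg_cst ?pi20// subr0; ring.
rewrite intgZ; last exact: continuous_sin.
have dc (x : R) : is_derive x 1 (fun x => - cos x) (sin x).
  have := is_deriveN (is_derive_cos x); rewrite opprK; exact.
rewrite (intg_FTC (@pi_gt0 R) (@continuous_sin R) dc) cospi cos0 opprK.
rewrite (_ : c * (2 * pi) * (1 + 1) = c * (4 * pi)); last by ring.
by rewrite mulrC mulfK// gt_eqF// pi4_gt0.
Qed.

Lemma mean_norm f (M : R) : continuous f -> (forall p, `|f p| <= M) -> `|mean f| <= M.
Proof.
move=> cf fM; have cc (c : R) : continuous (fun _ : S2 => c) by exact: cst_continuous.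
rewrite ler_norml -{1}(mean_cst (- M)) -{2}(mean_cst M); apply/andP; split; apply: le_mean => // p;
  by have := fM p; rewrite ler_norml => /andP[].
Qed.

Lemma cos2pi : cos (2 * pi) = 1 :> R.
Proof. by rewrite mulr_natl mulr2n cosD cospi sinpi; ring. Qed.
Lemma sin2pi : sin (2 * pi) = 0 :> R.
Proof. by rewrite mulr_natl mulr2n sinD cospi sinpi; ring. Qed.

Lemma sph_surj p : exists t s, [/\ 0 <= t <= pi, 0 <= s <= 2 * pi & sph t s = p].
Proof.
have := sphere_dot p; rewrite /dot !big_ord_recl big_ord0.
set x := val p 0 ord0; set y := val p 0 (lift ord0 ord0); set z := val p 0 _ => xyz.
have pE t s : sin t * cos s = x -> sin t * sin s = y -> cos t = z -> sph t s = p.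
  move=> ex ey ez; apply: val_inj; rewrite val_sph; apply/rowP => i; rewrite mxE.
  case: i => -[|[|[|//]]] i3 /=; rewrite ?ex ?ey ?ez;
    by congr (val p 0 _); apply: val_inj.
have x2 := sqr_ge0 x; have y2 := sqr_ge0 y; have z2 := sqr_ge0 z; rewrite !expr2 in x2 y2 z2.
have z1 : -1 <= z <= 1 by rewrite -ler_norml -(@expr_le1 _ 2)// real_normK ?num_real// expr2; lra.
have t0 : 0 <= acos z <= pi by rewrite acos_ge0//= acos_lepi.
have ct : cos (acos z) = z by apply: acosK; rewrite in_itv.
have st2 : sin (acos z) ^+ 2 = x * x + y * y by rewrite sin2cos2 ct expr2; lra.
have pi_g := @pi_gt0 R.
have [s0|sn0] := eqVneq (sin (acos z)) 0.
  move: st2; rewrite s0 expr0n /= => xy0.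
  have /eqP : x * x = 0 by lra. rewrite mulf_eq0 orbb => /eqP x0.
  have /eqP : y * y = 0 by lra. rewrite mulf_eq0 orbb => /eqP y0.
  exists (acos z), 0; split=> //; first by rewrite lexx pi20.
  by apply: pE => //; rewrite s0 mul0r.
set r := sin (acos z) in st2 sn0 *.
have r2 : r * r != 0 by rewrite mulf_neq0.
have xy1 : (x / r) ^+ 2 + (y / r) ^+ 2 = 1.
  by rewrite !exprMn exprVn -mulrDl !expr2 -st2 expr2 mulfV.
have xr2 := sqr_ge0 (x / r); have yr2 := sqr_ge0 (y / r).
have x1 : -1 <= x / r <= 1 by rewrite -ler_norml -(@expr_le1 _ 2)// real_normK ?num_real//; lra.
have s1b : 0 <= acos (x / r) <= pi by rewrite acos_ge0//= acos_lepi.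
have cs1 : cos (acos (x / r)) = x / r by apply: acosK; rewrite in_itv.
have ss1 : sin (acos (x / r)) = `|y / r|.
  by rewrite sin_acos// -sqrtr_sqr; congr Num.sqrt; lra.
have /andP[s1a s1c] := s1b.
have rx : r * (x / r) = x by rewrite mulrC divfK.
have ry : r * (y / r) = y by rewrite mulrC divfK.
(* [acos] determines the longitude up to reflection; the sign of [y / r] decides between it and
   [2 * pi] minus it. *)
have [yr|yr] := leP 0 (y / r).
  exists (acos z), (acos (x / r)); split=> //; first by rewrite s1a/=; lra.
  by apply: pE; rewrite // ?cs1 // ss1 ger0_norm.
exists (acos z), (2 * pi - acos (x / r)); split=> //; first by apply/andP; split; lra.
apply: pE => //; rewrite ?cosB ?sinB cos2pi sin2pi ?cs1 ss1 ltr0_norm//.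
  by rewrite mul0r addr0 mul1r.
by rewrite mul0r sub0r mul1r opprK.
Qed.

(** The weight [sin t] vanishes at the poles, so a point where [f] is positive is first moved
    slightly along its meridian towards the equator. *)
Lemma mean_eq0 f : continuous f -> (forall p, 0 <= f p) -> mean f = 0 -> forall p, f p = 0.
Proof.
move=> cf f0 m0 p; apply/eqP; rewrite eq_le f0 andbT leNgt; apply/negP => fp.
have [t [s [/andP[t0 tp] sb tsp]]] := sph_surj p.
have pi_g := @pi_gt0 R.
pose th (x : R) := (pi / 2 - t) * x + t.
have cth : continuous th.
  by move=> x; apply: differentiable_continuous; apply/derivable1_diffP; case: (is_derive_affine (pi / 2 - t) t x).
pose h x := f (sph (th x) s).
have ch : continuous h.
  move=> x; apply: (@continuous_comp _ _ _ th (fun t => f (sph t s))); first exact: cth.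
  exact: (@cont2_fst R _ s (cont2_sph cf) (th x)).
have h0 : 0 < h 0 by rewrite /h /th mulr0 add0r tsp.
have /nbhs_normP[r /= r0 Hr] : \forall x \near (0 : R), 0 < h x by exact: (cvgr_gt _ (ch 0)).
pose x := Num.min 2^-1 (r / 2).
have x0 : 0 < x by rewrite lt_min invr_gt0 ltr0n divr_gt0.
have x1 : x <= 2^-1 by rewrite ge_min lexx.
have xr : x <= r / 2 by rewrite ge_min lexx orbT.
have hx : 0 < h x by apply: Hr; rewrite /= sub0r normrN gtr0_norm//; lra.
have a1 : 0 <= (1 - x) * t by rewrite mulr_ge0//; lra.
have a2 : (1 - x) * t <= (1 - x) * pi by rewrite ler_wpM2l//; lra.
have a3 : 0 < x * pi by rewrite mulr_gt0.
have thb : 0 < th x < pi by rewrite /th; apply/andP; split; move: a1 a2 a3; rewrite !mulrBl !mul1r ![x * _]mulrC; lra.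
have stx : 0 < sin (th x) by apply: sin_gt0_pi.
have : 0 < mean f.
  rewrite meanE mulr_gt0 ?invr_gt0 ?pi4_gt0//.
  apply: (@dint_gt0 R _ (th x) s (cont2_msin cf)) => //.
  - by move=> t' s' /sin_itv st'; rewrite mulr_ge0.
  - by have /andP[/ltW -> /ltW ->] := thb.
  - by rewrite mulr_gt0.
by rewrite m0 ltxx.
Qed.

Lemma is_derive_mul (h k : R -> R) (h' k' x : R) : is_derive x 1 h h' -> is_derive x 1 k k' ->
  is_derive x 1 (fun t => h t * k t) (h' * k x + h x * k').
Proof.
move=> dh dk; apply: (is_derive_eq (is_deriveM dh dk)).
by rewrite -![_ *: _]/(_ * _); ring.
Qed.

Lemma is_derive_mulr (h : R -> R) (h' x c : R) : is_derive x 1 h h' ->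
  is_derive x 1 (fun t => h t * c) (h' * c).
Proof.
move=> dh; have := is_derive_mul dh (is_derive_cst c x 1); rewrite mulr0 addr0; exact.
Qed.

Section IBP.
Variable f : S2 -> R.
Hypothesis cf0 : continuous f.
Hypothesis df : tderivable f.
Hypothesis cf : forall i, continuous (tder i f).
Let F t s := f (sph t s).
Let D i t s := tder i f (sph t s).
Let i0 : 'I_3 := ord0.
Let i1 : 'I_3 := lift ord0 ord0.
Let i2 : 'I_3 := lift ord0 (lift ord0 ord0).

Definition Ft t s := cos t * cos s * D i0 t s + cos t * sin s * D i1 t s + - sin t * D i2 t s.
Definition Fs t s := - (sin t * sin s) * D i0 t s + sin t * cos s * D i1 t s.

Lemma sum3 (G : 'I_3 -> R) : \sum_i G i = G i0 + G i1 + G i2.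
Proof. by rewrite !big_ord_recl big_ord0 addr0 addrA. Qed.

Lemma sphv_neq0 t s : sphv t s != 0.
Proof. by rewrite -val_sph val_neq0. Qed.

Lemma dg_sph i t s : dg i f (sphv t s) = D i t s.
Proof. by rewrite -val_sph dg_val. Qed.

Lemma dFt (t s : R) : is_derive t 1 (fun t => F t s) (Ft t s).
Proof.
pose dga := [:: cos t * cos s; cos t * sin s; - sin t].
have dc (i : 'I_3) : is_derive t 1 (fun t => sphv t s 0 i) (dga`_i).
  case: i => -[|[|[|//]]] i3.
  - rewrite (_ : (fun t => _) = (fun t => sin t * cos s)); last by apply/funext => u; rewrite mxE.
    exact: is_derive_mulr.
  - rewrite (_ : (fun t => _) = (fun t => sin t * sin s)); last by apply/funext => u; rewrite mxE.
    exact: is_derive_mulr.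
  - rewrite (_ : (fun t => _) = @cos R); last by apply/funext => u; rewrite mxE.
    exact: is_derive_cos.
apply: (is_derive_eq (chain_rule df cf dc (sphv_neq0 t s))).
by rewrite sum3 (dg_sph i0 t s) (dg_sph i1 t s) (dg_sph i2 t s).
Qed.

Lemma dFs (t s : R) : is_derive s 1 (F t) (Fs t s).
Proof.
pose dga := [:: - (sin t * sin s); sin t * cos s; 0].
have dc (i : 'I_3) : is_derive s 1 (fun s => sphv t s 0 i) (dga`_i).
  case: i => -[|[|[|//]]] i3.
  - rewrite (_ : (fun s => _) = (fun s => cos s * sin t)); last by apply/funext => u; rewrite mxE mulrC.
    by apply: (is_derive_eq (is_derive_mulr (sin t) (is_derive_cos s))); rewrite /=; ring.
  - rewrite (_ : (fun s => _) = (fun s => sin s * sin t)); last by apply/funext => u; rewrite mxE /= mulrC.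
    by apply: (is_derive_eq (is_derive_mulr (sin t) (is_derive_sin s))); rewrite /=; ring.
  - rewrite (_ : (fun s => _) = cst (cos t)); last by apply/funext => u; rewrite mxE.
    exact: is_derive_cst.
apply: (is_derive_eq (chain_rule df cf dc (sphv_neq0 t s))).
rewrite sum3 (dg_sph i0 t s) (dg_sph i1 t s) [X in _ + X](_ : _ = 0) ?addr0//.
exact: mul0r.
Qed.

Lemma euler_sph t s : sin t * cos s * D i0 t s + sin t * sin s * D i1 t s + cos t * D i2 t s = 0.
Proof.
by have := euler (sph t s) df cf; rewrite sum3 val_sph !mxE.
Qed.

(** Divergence theorem for [f] times the tangential part of the constant field ['e_i], whose
    divergence is [tder i f] minus twice the coordinate times [f]. *)
Lemma mean_tder i : mean (tder i f) = 2 * mean (fun p => val p 0 i * f p).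
Proof.
have cD j : cont2 (D j) by exact: cont2_sph.
have cF : cont2 F by exact: cont2_sph.
have st := cont2_t (@continuous_sin R); have ct := cont2_t (@continuous_cos R).
have ss := cont2_s (@continuous_sin R); have cs := cont2_s (@continuous_cos R).
have cc (c : R) := @cont2_c R c.
have cnst : cont2 (fun t _ : R => - sin t).
  by have := cont2M (cc (-1)) st; rewrite (_ : (fun t s => -1 * sin t) = fun t _ => - sin t)//;
    apply/funext => t; apply/funext => s; rewrite mulN1r.
have cFt : cont2 Ft by rewrite /Ft; do !apply: cont2D; do !apply: cont2M => //.
have cnss : cont2 (fun t s : R => - (sin t * sin s)).
  by have := cont2M (cc (-1)) (cont2M st ss); rewrite (_ : (fun t s => -1 * (sin t * sin s)) =
    fun t s => - (sin t * sin s))//; apply/funext => t; apply/funext => s; rewrite mulN1r.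
have cFs : cont2 Fs by rewrite /Fs; do !apply: cont2D; do !apply: cont2M => //.
(* [A] and [B] are the components of a vector field whose divergence is the integrand *)
suff [A [A' [B [B' [cA cA' cB' [dA dB A0 Api B0] E]]]]] : exists A A' B B' : R -> R -> R,
    [/\ cont2 A, cont2 A', cont2 B', [/\ forall t s, is_derive (t : R) 1 (fun t => A t s) (A' t s),
      forall t s, is_derive (s : R) 1 (B t) (B' t s), forall s, A 0 s = 0, forall s, A pi s = 0 &
      forall t, B t 0 = B t (2 * pi)] &
      forall t s, D i t s * sin t = A' t s + B' t s + 2 * (val (sph t s) 0 i * F t s * sin t)].
  have cx : continuous (fun p : S2 => val p 0 i * f p).
    move=> p; apply: (@continuousM _ _ (fun p : S2 => val p 0 i) f); last exact: cf0.
    apply: (@continuous_comp _ _ _ (fun p : S2 => val p) (fun v : V => v 0 i)).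
      exact: (@initial_continuous _ _ set_val p).
    exact: coord_continuous.
  rewrite !meanE mulrCA; congr (_ * _).
  have cX := cont2_msin cx; rewrite -(dintZ 2 cX).
  have := dintD (cont2D cA' cB') (cont2M (cc 2) cX).
  rewrite (dintD cA' cB') (dint_dt cA cA' dA A0 Api) (dint_ds cB' dB B0) !add0r => <-.
  by congr dint; apply/funext => t; apply/funext => s; exact: E.
have T t : sin t ^+ 2 + cos t ^+ 2 = 1 :> R by rewrite addrC cos2Dsin2.
have cZ (c : R) H : cont2 H -> cont2 (fun t s => c * H t s) by move=> cH; exact: (cont2M (cc c) cH).
case: i => -[|[|[|//]]] i3.
- have -> : Ordinal i3 = i0 by apply: val_inj.
  exists (fun t s => sin t * (cos t * (F t s * cos s))),
    (fun t s => cos t * (cos t * (F t s * cos s)) + sin t * (- sin t * (F t s * cos s) +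
      cos t * (Ft t s * cos s))),
    (fun t s => (-1) * (sin s * F t s)), (fun t s => (-1) * (cos s * F t s + sin s * Fs t s)).
  split.
  + by do !apply: cont2M.
  + by apply: cont2D; apply: cont2M => //; [do !apply: cont2M|apply: cont2D; do !apply: cont2M].
  + by apply: cZ; apply: cont2D; apply: cont2M.
  + split.
    * move=> t s; exact: (is_derive_mul (is_derive_sin t) (is_derive_mul (is_derive_cos t)
        (is_derive_mulr (cos s) (dFt t s)))).
    * move=> t s; have := is_derive_mulr (-1) (is_derive_mul (is_derive_sin s) (dFs t s)).
      rewrite (_ : (fun s => sin s * F t s * -1) = (fun s => -1 * (sin s * F t s))); last first.
        by apply/funext => u; rewrite mulrC.
      by rewrite mulrC.
    * by move=> s; rewrite sin0 mul0r.
    * by move=> s; rewrite sinpi mul0r.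
    * by move=> t; rewrite sin0 sin2pi !mul0r.
  + move=> t s; rewrite val_sph mxE /= /Ft /Fs -/(F t s).
    have E := euler_sph t s; have Tt := T t; have Ts := T s.
    move: E Tt Ts; move: (sin t) (cos t) (sin s) (cos s) (D i0 t s) (D i1 t s) (D i2 t s) (F t s).
    move=> a b c d f0 f1 f2 ff E Tt Ts.
    apply/eqP; rewrite -subr_eq0; apply/eqP.
    (* The difference is a combination of Euler's relation and of [sin^2 + cos^2 = 1] in the two
       angles. *)
    rewrite (_ : _ - _ = a ^+ 2 * d * (a * d * f0 + a * c * f1 + b * f2)
      + (1 - (a ^+ 2 + b ^+ 2)) * (a * d ^+ 2 * f0 + a * c * d * f1 + d * ff)
      + (1 - (c ^+ 2 + d ^+ 2)) * a * f0); last by ring.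
    by rewrite E Tt Ts; ring.
- have -> : Ordinal i3 = i1 by apply: val_inj.
  exists (fun t s => sin t * (cos t * (F t s * sin s))),
    (fun t s => cos t * (cos t * (F t s * sin s)) + sin t * (- sin t * (F t s * sin s) +
      cos t * (Ft t s * sin s))),
    (fun t s => cos s * F t s), (fun t s => - sin s * F t s + cos s * Fs t s).
  have cns : cont2 (fun _ s : R => - sin s).
    by have := cont2M (cc (-1)) ss; rewrite (_ : (fun t s => -1 * sin s) = fun _ s => - sin s)//;
      apply/funext => t; apply/funext => s; rewrite mulN1r.
  split.
  + by do !apply: cont2M.
  + by apply: cont2D; apply: cont2M => //; [do !apply: cont2M|apply: cont2D; do !apply: cont2M].
  + by apply: cont2D; apply: cont2M.
  + split.
    * move=> t s; exact: (is_derive_mul (is_derive_sin t) (is_derive_mul (is_derive_cos t)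
        (is_derive_mulr (sin s) (dFt t s)))).
    * by move=> t s; exact: (is_derive_mul (is_derive_cos s) (dFs t s)).
    * by move=> s; rewrite sin0 mul0r.
    * by move=> s; rewrite sinpi mul0r.
    * move=> t; rewrite cos0 cos2pi /F; congr (1 * f _); apply: val_inj; rewrite !val_sph.
      by rewrite /sphv cos0 cos2pi sin0 sin2pi.
  + move=> t s; rewrite val_sph mxE /= /Ft /Fs -/(F t s).
    have E := euler_sph t s; have Tt := T t; have Ts := T s.
    move: E Tt Ts; move: (sin t) (cos t) (sin s) (cos s) (D i0 t s) (D i1 t s) (D i2 t s) (F t s).
    move=> a b c d f0 f1 f2 ff E Tt Ts.
    apply/eqP; rewrite -subr_eq0; apply/eqP.
    rewrite (_ : _ - _ = a ^+ 2 * c * (a * d * f0 + a * c * f1 + b * f2)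
      + (1 - (a ^+ 2 + b ^+ 2)) * (a * c ^+ 2 * f1 + a * c * d * f0 + c * ff)
      + (1 - (c ^+ 2 + d ^+ 2)) * a * f1); last by ring.
    by rewrite E Tt Ts; ring.
- have -> : Ordinal i3 = i2 by apply: val_inj.
  exists (fun t s => sin t * (- sin t * F t s)),
    (fun t s => cos t * (- sin t * F t s) + sin t * (- cos t * F t s + - sin t * Ft t s)),
    (fun _ _ => 0), (fun _ _ => 0).
  have cnc : cont2 (fun t _ : R => - cos t).
    by have := cont2M (cc (-1)) ct; rewrite (_ : (fun t s => -1 * cos t) = fun t _ => - cos t)//;
      apply/funext => t; apply/funext => s; rewrite mulN1r.
  split.
  + by do !apply: cont2M.
  + by apply: cont2D; apply: cont2M => //; [do !apply: cont2M|apply: cont2D; do !apply: cont2M].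
  + exact: cc.
  + split.
    * move=> t s; exact: (is_derive_mul (is_derive_sin t)
        (is_derive_mul (is_deriveN (is_derive_sin t)) (dFt t s))).
    * by move=> t s; exact: is_derive_cst.
    * by move=> s; rewrite sin0 mul0r.
    * by move=> s; rewrite sinpi mul0r.
    * by [].
  + move=> t s; rewrite val_sph mxE /= /Ft -/(F t s).
    have E := euler_sph t s; have Tt := T t.
    move: E Tt; move: (sin t) (cos t) (sin s) (cos s) (D i0 t s) (D i1 t s) (D i2 t s) (F t s).
    move=> a b c d f0 f1 f2 ff E Tt.
    apply/eqP; rewrite -subr_eq0; apply/eqP.
    rewrite (_ : _ - _ = a * b * (a * d * f0 + a * c * f1 + b * f2)
      + (1 - (a ^+ 2 + b ^+ 2)) * a * f2); last by ring.
    by rewrite E Tt; ring.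
Qed.

End IBP.
End Mean.

(** * Hölder spaces *)

Section HolderAlgebra.
Variables (R : realType) (a : R).
Hypothesis ha : 0 < a < 1.
Local Notation S2 := (S2 R).
Local Notation V := 'rV[R]_3.
Implicit Types (p q : S2) (f g : S2 -> R).

Lemma a_gt0 : 0 < a. Proof. by have /andP[] := ha. Qed.
Lemma a_lt1 : 0 < 1 - a. Proof. by rewrite subr_gt0; have /andP[] := ha. Qed.

Lemma dist2E p q : \sum_i (val p 0 i - val q 0 i) ^+ 2 = 2 - 2 * dot (val p) (val q).
Proof.
have := sphere_dot p; have := sphere_dot q; rewrite /dot => q1 p1.
have -> : \sum_i (val p 0 i - val q 0 i) ^+ 2 = \sum_i val p 0 i * val p 0 i +
    \sum_i val q 0 i * val q 0 i - 2 * \sum_i val p 0 i * val q 0 i.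
  by rewrite mulr_sumr -big_split /= -sumrB; apply: eq_bigr => i _; ring.
by rewrite p1 q1.
Qed.

Lemma dot_itv p q : -1 <= dot (val p) (val q) <= 1.
Proof.
have h1 : 0 <= \sum_i (val p 0 i - val q 0 i) ^+ 2 by apply: sumr_ge0 => i _; exact: sqr_ge0.
have h2 : 0 <= \sum_i (val p 0 i + val q 0 i) ^+ 2 by apply: sumr_ge0 => i _; exact: sqr_ge0.
have E2 : \sum_i (val p 0 i + val q 0 i) ^+ 2 = 2 + 2 * dot (val p) (val q).
  have := sphere_dot p; have := sphere_dot q; rewrite /dot => q1 p1.
  have -> : \sum_i (val p 0 i + val q 0 i) ^+ 2 = \sum_i val p 0 i * val p 0 i +
      \sum_i val q 0 i * val q 0 i + 2 * \sum_i val p 0 i * val q 0 i.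
    by rewrite mulr_sumr -!big_split /=; apply: eq_bigr => i _; ring.
  by rewrite p1 q1.
move: h1 h2; rewrite dist2E E2 => h1 h2; apply/andP; split; lra.
Qed.

Lemma sdist_ge0 p q : 0 <= sdist p q. Proof. exact: acos_ge0 (dot_itv p q). Qed.
Lemma sdist_lepi p q : sdist p q <= pi. Proof. exact: acos_lepi (dot_itv p q). Qed.

Lemma sin_norm_le (x : R) : `|sin x| <= `|x|.
Proof.
have [t _] := @MVT_sym R sin cos x (fun t _ => is_derive_sin t); rewrite sin0 subr0 => ->.
by rewrite normrM ler_piMr// cos_max.
Qed.

(** The Euclidean chord is [2 sin (d / 2)], at most [d], and the maximum norm is below the Euclidean
    one. *)
Lemma chord_le p q : `|val p - val q| <= sdist p q.
Proof.
apply: row_norm_le => [|i]; first exact: sdist_ge0.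
rewrite !mxE -(@ler_sqr _ `|_|) ?nnegrE ?sdist_ge0// real_normK ?num_real//.
apply: (@le_trans _ _ (\sum_i (val p 0 i - val q 0 i) ^+ 2)).
  by rewrite (bigD1 i)//= lerDl sumr_ge0// => j _; exact: sqr_ge0.
have cd : cos (sdist p q) = dot (val p) (val q) by apply: acosK; rewrite in_itv /= dot_itv.
rewrite dist2E -cd.
have dE : sdist p q = (sdist p q / 2) *+ 2 by rewrite -mulr_natr divfK.
have -> : 2 - 2 * cos (sdist p q) = 4 * sin (sdist p q / 2) ^+ 2.
  by rewrite {1}dE cos_mulr2n cos2sin2; ring.
have := sin_norm_le (sdist p q / 2).
rewrite -(@ler_sqr _ `|_|) ?nnegrE// !real_normK ?num_real// => h.
rewrite [leRHS](_ : _ = 4 * (sdist p q / 2) ^+ 2); last by field.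
by rewrite ler_pM2l.
Qed.

Lemma sdist_eq0 p q : sdist p q = 0 -> p = q.
Proof.
move=> d0; apply: val_inj; apply/eqP; rewrite -subr_eq0 -normr_le0 -d0; exact: chord_le.
Qed.

Lemma le_powR_dist (x d : R) : 0 <= x <= d -> x <= d `^ (1 - a) * x `^ a.
Proof.
move=> /andP[x0 xd]; have [->|xn] := eqVneq x 0; first by rewrite mulr_ge0 ?powR_ge0.
have xp : 0 < x by rewrite lt_neqAle eq_sym xn.
have {1}-> : x = x `^ (1 - a) * x `^ a.
  by rewrite -powRD ?subrK ?powRr1// (gt_eqF xp) implybT.
rewrite ler_wpM2r ?powR_ge0// ge0_ler_powR ?nnegrE//; first by rewrite ltW// a_lt1.
exact: le_trans xd.
Qed.

Definition Cpi : R := pi `^ (1 - a).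
Lemma Cpi_ge0 : 0 <= Cpi. Proof. exact: powR_ge0. Qed.

Lemma chord_powR p q : `|val p - val q| <= Cpi * sdist p q `^ a.
Proof.
by apply: le_trans (chord_le p q) (le_powR_dist _); rewrite sdist_ge0 sdist_lepi.
Qed.

Lemma sup_norm_le f (M : R) : (forall p, `|f p| <= M) -> sup_norm f <= M.
Proof. exact: (sup_range_le (@north R)). Qed.

Lemma le_sup_norm f p : continuous f -> `|f p| <= sup_norm f.
Proof. by move=> /continuous_bounded[M fM]; exact: (le_sup_range p fM). Qed.

Lemma semi_le f (M : R) : 0 <= M -> (forall p q, `|f p - f q| <= M * sdist p q `^ a) ->
  holder_seminorm a f <= M.
Proof.
move=> M0 fM; apply: (sup_range_le (@north R, @north R)) => -[p q] /=.
have := powR_ge0 (sdist p q) a; rewrite le_eqVlt => /orP[/eqP <-|d0].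
  by rewrite invr0 mulr0.
by rewrite ler_pdivrMr.
Qed.

Lemma le_semi f p q : holder_at a f -> `|f p - f q| <= holder_seminorm a f * sdist p q `^ a.
Proof.
move=> hf; have [M fM] := holder_atP hf; have [->|pq] := eqVneq p q.
  by rewrite subrr normr0 mulr_ge0 ?holder_seminorm_ge0 ?powR_ge0.
have d0 : 0 < sdist p q.
  by rewrite lt_neqAle sdist_ge0 andbT eq_sym; apply: contraNneq pq => /sdist_eq0 ->.
rewrite -ler_pdivrMr ?powR_gt0//.
exact: (@le_sup_range _ _ (fun pq : S2 * S2 => `|f pq.1 - f pq.2| / sdist pq.1 pq.2 `^ a) M (p, q)).
Qed.

Lemma sup_le_norm k f : sup_norm f <= holder_norm a k f.
Proof.
case: k => [|k]; rewrite /= lerDl ?holder_seminorm_ge0//.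
by apply: sumr_ge0 => i _; exact: holder_norm_ge0.
Qed.

Lemma tder_le_norm k f i : holder_norm a k (tder i f) <= holder_norm a k.+1 f.
Proof.
rewrite /= (bigD1 i)//= addrCA lerDl addr_ge0 ?sup_norm_ge0//.
by apply: sumr_ge0 => j _; exact: holder_norm_ge0.
Qed.

Lemma le_holder_norm k f p : is_holder a k f -> `|f p| <= holder_norm a k f.
Proof.
by move=> /is_holder_continuous cf; exact: le_trans (le_sup_norm p cf) (sup_le_norm k f).
Qed.

(** [20 = 8 + 12] comes from [C1_lipschitz], and [Cpi] converts chords to powers of the distance;
    one constant serves all orders. *)
Definition Ce : R := 1 + 20 * Cpi.
Lemma Ce_ge1 : 1 <= Ce. Proof. by rewrite lerDl mulr_ge0// Cpi_ge0. Qed.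
Lemma Ce_ge0 : 0 <= Ce. Proof. exact: le_trans ler01 Ce_ge1. Qed.

Lemma is_holder_lip k f p q : is_holder a k.+1 f ->
  `|f p - f q| <= 20 * holder_norm a k.+1 f * `|val p - val q|.
Proof.
move=> [cf [df hf]]; set N := holder_norm a k.+1 f.
have N0 : 0 <= N by exact: holder_norm_ge0.
have fN r : `|f r| <= N by exact: le_trans (le_sup_norm r cf) (sup_le_norm k.+1 f).
have dN i r : `|tder i f r| <= N.
  exact: le_trans (@le_holder_norm k _ r (hf i)) (tder_le_norm k f i).
by have := C1_lipschitz p q df N0 N0 fN dN; rewrite -mulrDl -natrD.
Qed.

Lemma is_holder_emb k f : is_holder a k.+1 f ->
  is_holder a k f /\ holder_norm a k f <= Ce * holder_norm a k.+1 f.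
Proof.
elim: k f => [|k IH] f hf.
  have N0 := holder_norm_ge0 a 1 f; have [cf _] := hf.
  have lip p q : `|f p - f q| <= 20 * Cpi * holder_norm a 1 f * sdist p q `^ a.
    rewrite (le_trans (is_holder_lip p q hf))// [leRHS](_ : _ =
      20 * holder_norm a 1 f * (Cpi * sdist p q `^ a)); last by ring.
    by rewrite ler_wpM2l ?mulr_ge0// chord_powR.
  split; first by split=> //; exists (20 * Cpi * holder_norm a 1 f).
  rewrite /Ce mulrDl mul1r lerD//; first exact: sup_le_norm.
  by apply: semi_le => //; rewrite !mulr_ge0// Cpi_ge0.
have [cf [df hdf]] := hf; split.
  by split=> //; split=> // i; exact: (proj1 (IH _ (hdf i))).
rewrite -[holder_norm a k.+1 f]/(sup_norm f + \sum_i holder_norm a k (tder i f)).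
rewrite -[holder_norm a k.+2 f]/(sup_norm f + \sum_i holder_norm a k.+1 (tder i f)) mulrDr lerD//.
  by rewrite ler_peMl ?sup_norm_ge0// Ce_ge1.
by rewrite mulr_sumr ler_sum// => i _; exact: (proj2 (IH _ (hdf i))).
Qed.

Lemma tderivableM f g : tderivable f -> tderivable g -> tderivable (fun p => f p * g p).
Proof. by move=> df dg i p; exact: (derivableM (df i p) (dg i p)). Qed.

Lemma tderM f g i p : tderivable f -> tderivable g ->
  tder i (fun p => f p * g p) p = f p * tder i g p + g p * tder i f p.
Proof.
move=> df dg; rewrite /tder; have := deriveM (df i p) (dg i p) => /= E.
by rewrite -[LHS]/('D_('e_i) ((f \o @radial R) * (g \o @radial R)) (val p)) E /= radial_val.
Qed.

Lemma is_holderM k : exists2 C, 0 <= C & forall f g, is_holder a k f -> is_holder a k g ->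
  is_holder a k (fun p => f p * g p) /\
  holder_norm a k (fun p => f p * g p) <= C * (holder_norm a k f * holder_norm a k g).
Proof.
have cM f g : continuous f -> continuous g -> continuous (fun p => f p * g p).
  by move=> cf cg p; exact: (continuousM (cf p) (cg p)).
have supM f g k' : is_holder a k' f -> is_holder a k' g ->
    sup_norm (fun p => f p * g p) <= holder_norm a k' f * holder_norm a k' g.
  by move=> hf hg; apply: sup_norm_le => p; rewrite normrM ler_pM// le_holder_norm.
elim: k => [|k [C C0 IH]].
  exists 1 => // f g [cf hf] [cg hg]; rewrite mul1r.
  have lip p q : `|f p * g p - f q * g q| <= (sup_norm f * holder_seminorm a g +
      sup_norm g * holder_seminorm a f) * sdist p q `^ a.
    have -> : f p * g p - f q * g q = f p * (g p - g q) + g q * (f p - f q) by ring.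
    rewrite (le_trans (ler_normD _ _))// !normrM mulrDl -!mulrA lerD// ler_pM// ?le_sup_norm//;
      exact: le_semi.
  have s0 := holder_seminorm_ge0 a f; have s1 := holder_seminorm_ge0 a g.
  have n0 := sup_norm_ge0 f; have n1 := sup_norm_ge0 g.
  have L0 : 0 <= sup_norm f * holder_seminorm a g + sup_norm g * holder_seminorm a f.
    by rewrite addr_ge0// mulr_ge0.
  split; first by split; [exact: cM|exists (sup_norm f * holder_seminorm a g +
      sup_norm g * holder_seminorm a f)].
  have h1 := semi_le L0 lip.
  have h2 : sup_norm (fun p => f p * g p) <= sup_norm f * sup_norm g.
    by apply: sup_norm_le => p; rewrite normrM ler_pM// le_sup_norm.
  rewrite /= (le_trans (lerD h2 h1))//.
  have : 0 <= holder_seminorm a f * holder_seminorm a g by rewrite mulr_ge0.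
  by rewrite mulrDl !mulrDr; lra.
exists (1 + 2 * (C * Ce)); first by rewrite addr_ge0// !mulr_ge0// Ce_ge0.
move=> f g hf hg; have [cf [df hdf]] := hf; have [cg [dg hdg]] := hg.
have [hfk nf] := is_holder_emb hf; have [hgk ng] := is_holder_emb hg.
have dE i : tder i (fun p => f p * g p) =
    (fun p => f p * tder i g p) + (fun p => g p * tder i f p).
  by apply/funext => p; rewrite tderM.
have [h1 b1] := all_and2 (fun i => IH _ _ hfk (hdg i)).
have [h2 b2] := all_and2 (fun i => IH _ _ hgk (hdf i)).
split.
  split; first exact: cM.
  split; first exact: tderivableM.
  by move=> i; rewrite dE; exact: is_holderD.
set nF := holder_norm a k.+1 f; set nG := holder_norm a k.+1 g.
have nF0 : 0 <= nF by exact: holder_norm_ge0. have nG0 : 0 <= nG by exact: holder_norm_ge0.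
rewrite -[leLHS]/(sup_norm (fun p => f p * g p) + \sum_i holder_norm a k (tder i (fun p => f p * g p))).
rewrite mulrDl mul1r lerD//; first exact: supM.
have sumF : \sum_i holder_norm a k (tder i f) <= nF by rewrite lerDr sup_norm_ge0.
have sumG : \sum_i holder_norm a k (tder i g) <= nG by rewrite lerDr sup_norm_ge0.
apply: (@le_trans _ _ (\sum_i (C * Ce * (nF * holder_norm a k (tder i g) + nG * holder_norm a k (tder i f))))).
  apply: ler_sum => i _; rewrite dE (le_trans (holder_normD (h1 i) (h2 i)))// mulrDr lerD//.
    rewrite (le_trans (b1 i))// -!mulrA ler_wpM2l// mulrA ler_wpM2r ?holder_norm_ge0//.
  rewrite (le_trans (b2 i))// -!mulrA ler_wpM2l// mulrA ler_wpM2r ?holder_norm_ge0//.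
rewrite -mulr_sumr big_split /= -!mulr_sumr -!mulrA [leRHS]mulrCA ler_wpM2l// [leRHS]mulrCA.
rewrite ler_wpM2l ?Ce_ge0// mulr_natl mulr2n lerD// ?ler_wpM2l// [leRHS]mulrC ler_wpM2l//.
Qed.

Lemma cst_tder (c : R) i : tder i (fun=> c) = 0.
Proof.
by apply/funext => p; have [_ E] := @is_derive_cst R V R c (val p) 'e_i; exact: E.
Qed.

Lemma is_holder_cst k (c : R) : is_holder a k (fun=> c).
Proof.
case: k => [|k]; (split; first exact: cst_continuous).
  by exists 0 => p q; rewrite subrr normr0 mul0r.
split=> [i p|i]; last by rewrite cst_tder; exact: is_holder0.
exact: (derivable_cst c).
Qed.

Lemma exp_lip (M x y : R) : `|x| <= M -> `|y| <= M -> `|expR x - expR y| <= expR M * `|x - y|.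
Proof.
move=> xM yM.
have dl (t : R) : `|t| <= `|x - y| -> is_derive t 1 (fun t => expR (1 * t + y)) (expR (1 * t + y) * 1).
  by move=> _; exact: (@is_derive1_comp R expR (fun v => 1 * v + y) t _ _ (is_derive_expR _) (is_derive_affine _ _ _)).
have dl' (t : R) : 0 <= t <= 1 -> is_derive t 1 (fun t => expR ((x - y) * t + y)) (expR ((x - y) * t + y) * (x - y)).
  by move=> _; exact: (@is_derive1_comp R expR (fun v => (x - y) * v + y) t _ _ (is_derive_expR _) (is_derive_affine _ _ _)).
have c01 : {within `[0, 1], continuous (fun t => expR ((x - y) * t + y))}.
  apply: continuous_in_subspaceT => t; rewrite inE /= in_itv /= => /dl' [d _].
  by apply: differentiable_continuous; apply/derivable1_diffP.
have [|c] := @MVT_segment R _ (fun t => expR ((x - y) * t + y) * (x - y)) 0 1 ler01 _ c01.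
  by move=> t; rewrite in_itv /= => /andP[/ltW t0 /ltW t1]; apply: dl'; rewrite t0.
rewrite in_itv /= mulr1 mulr0 add0r subrK subr0 mulr1 => /andP[c0 c1] ->.
rewrite normrM ler_wpM2r// ger0_norm ?expR_ge0// ler_expR.
move: xM yM; rewrite !ler_norml => /andP[x1 x2] /andP[y1 y2].
have : c * (x - M) <= 0 by rewrite mulr_ge0_le0// subr_le0.
have : (1 - c) * (y - M) <= 0 by rewrite mulr_ge0_le0 ?subr_ge0// subr_le0.
by rewrite !mulrBl !mulrBr; lra.
Qed.

Lemma exp_taylor_lip (N x y : R) : `|x| <= N -> `|y| <= N ->
  `|(expR x - 1 - x) - (expR y - 1 - y)| <= expR N * N * `|x - y|.
Proof.
move=> xN yN; pose h (t : R) := expR ((x - y) * t + y) - 1 - ((x - y) * t + y).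
have dh (t : R) : is_derive t 1 h ((expR ((x - y) * t + y) - 1) * (x - y)).
  have d1 := @is_derive1_comp R expR (fun v => (x - y) * v + y) t _ _ (is_derive_expR _) (is_derive_affine _ _ _).
  have := is_deriveB (is_deriveB d1 (is_derive_cst (1 : R) t 1)) (is_derive_affine (x - y) y t).
  by rewrite subr0 => H; apply: (is_derive_eq H); ring.
have c01 : {within `[0, 1], continuous h}.
  apply: continuous_subspaceT => t; apply: differentiable_continuous; apply/derivable1_diffP.
  by case: (dh t).
have [c] := @MVT_segment R h (fun t => (expR ((x - y) * t + y) - 1) * (x - y)) 0 1 ler01
  (fun t _ => dh t) c01.
rewrite in_itv /= /h mulr1 mulr0 add0r subrK subr0 mulr1 => /andP[c0 c1] ->.
rewrite normrM ler_wpM2r//; set z := _ * c + y.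
have zN : `|z| <= N.
  move: xN yN; rewrite /z !ler_norml => /andP[x1 x2] /andP[y1 y2].
  have a1 : c * (x - N) <= 0 by rewrite mulr_ge0_le0// subr_le0.
  have a2 : (1 - c) * (y - N) <= 0 by rewrite mulr_ge0_le0 ?subr_ge0// subr_le0.
  have a3 : 0 <= c * (x + N) by rewrite mulr_ge0//; lra.
  have a4 : 0 <= (1 - c) * (y + N) by rewrite mulr_ge0 ?subr_ge0//; lra.
  by move: a1 a2 a3 a4; rewrite !mulrBl !mulrBr !mulrDr; move=> *; apply/andP; split; lra.
have N0 : `|0 : R| <= N by rewrite normr0 (le_trans _ zN).
have := exp_lip zN N0; rewrite expR0 subr0 => h1; rewrite (le_trans h1)// ler_wpM2l ?expR_ge0//.
Qed.

Lemma tder_exp g i p : tderivable g ->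
  derivable ((fun p => expR (g p)) \o @radial R) (val p) 'e_i /\
  tder i (fun p => expR (g p)) p = expR (g p) * tder i g p.
Proof.
move=> dg; have /derivableP/is_derive_quot d1 := dg i p.
pose G (t : R) := (g \o @radial R) (val p + t *: 'e_i).
have G0 : G 0 = g p by rewrite /G scale0r addr0 /= radial_val.
have := @is_derive1_comp R expR G 0 _ _ (is_derive_expR _) d1; rewrite G0 => d2.
have /is_derive_quot [d3 d4] : is_derive (0 : R) 1
    (fun t => ((fun p => expR (g p)) \o @radial R) (val p + t *: 'e_i)) (expR (g p) * tder i g p).
  exact: d2.
by split.
Qed.

(** The exponential without its Taylor terms of order 0, and then of order 1, so that norms are
    bounded linearly and quadratically in [g]. *)
Definition expm1 g p := expR (g p) - 1.
Definition expm2 g p := expR (g p) - 1 - g p.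

Lemma expm1_cont g : continuous g -> continuous (expm1 g).
Proof.
move=> cg p; apply: (@continuousB _ _ _ (fun p => expR (g p)) (fun=> 1)); last exact: cst_continuous.
by apply: (@continuous_comp _ _ _ g expR); [exact: cg|exact: continuous_expR].
Qed.

Lemma expm1_tder g i : tderivable g -> tderivable (expm1 g) /\
  tder i (expm1 g) = (fun p => expm1 g p * tder i g p) + tder i g.
Proof.
move=> dg; have H j p := tder_exp j p dg.
have de : tderivable (fun p => expR (g p)) by move=> j p; case: (H j p).
have d1 : tderivable (fun _ : S2 => (-1 : R)) by move=> j p; exact: (derivable_cst (-1 : R)).
have eq : expm1 g = (fun p => expR (g p)) + (fun=> -1) by apply/funext => p.
split; first by rewrite eq; exact: tderivableD.
rewrite eq tderD// cst_tder addr0; apply/funext => p; rewrite (proj2 (H i p)) !fctE.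
by ring.
Qed.

Lemma expm1_holder k (M : R) : 0 <= M -> exists2 C, 0 <= C & forall g, is_holder a k g ->
  holder_norm a k g <= M ->
  is_holder a k (expm1 g) /\ holder_norm a k (expm1 g) <= C * holder_norm a k g.
Proof.
elim: k M => [|k IH] M M0.
  exists (expR M); first exact: expR_ge0.
  move=> g hg gM; have [cg hg0] := hg.
  have gb p : `|g p| <= M by exact: le_trans (le_holder_norm p hg) gM.
  have lip p q : `|expm1 g p - expm1 g q| <= (expR M * holder_seminorm a g) * sdist p q `^ a.
    have -> : expm1 g p - expm1 g q = expR (g p) - expR (g q) by rewrite /expm1; ring.
    rewrite (le_trans (exp_lip (gb p) (gb q)))//.
    by rewrite -mulrA ler_wpM2l ?expR_ge0// le_semi.
  have L0 : 0 <= expR M * holder_seminorm a g by rewrite mulr_ge0 ?expR_ge0 ?holder_seminorm_ge0.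
  split; first by split; [exact: expm1_cont|exists (expR M * holder_seminorm a g)].
  rewrite /= mulrDr lerD//; last exact: semi_le.
  apply: sup_norm_le => p; rewrite /expm1 -{1}expR0.
  have M00 : `|0 : R| <= M by rewrite normr0.
  rewrite (le_trans (exp_lip (gb p) M00))// subr0 ler_wpM2l ?expR_ge0// le_sup_norm//.
have [Cm Cm0 HM] := is_holderM k; have CM0 : 0 <= Ce * M by rewrite mulr_ge0// Ce_ge0.
have [C C0 HC] := IH _ CM0.
exists (expR M + (Cm * (C * (Ce * M)) + 1)).
  by rewrite addr_ge0 ?expR_ge0// addr_ge0// !mulr_ge0// Ce_ge0.
move=> g hg gM; have [cg [dg hdg]] := hg; have [hgk ngk] := is_holder_emb hg.
have gkM : holder_norm a k g <= Ce * M by rewrite (le_trans ngk)// ler_wpM2l// Ce_ge0.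
have [he ne] := HC g hgk gkM.
have [hm nm] := all_and2 (fun i => HM _ _ he (hdg i)).
have dE i := proj2 (expm1_tder i dg); have dd := proj1 (expm1_tder ord0 dg).
split.
  split; first exact: expm1_cont.
  split; first exact: dd.
  by move=> i; rewrite dE; exact: (is_holderD (hm i) (hdg i)).
rewrite -[leLHS]/(sup_norm (expm1 g) + \sum_i holder_norm a k (tder i (expm1 g))) mulrDl lerD//.
  apply: sup_norm_le => p; have gb : `|g p| <= M by exact: le_trans (le_holder_norm p hg) gM.
  have M00 : `|0 : R| <= M by rewrite normr0.
  rewrite /expm1 -{1}expR0 (le_trans (exp_lip gb M00))// subr0 ler_wpM2l ?expR_ge0//.
  exact: le_holder_norm.
apply: (@le_trans _ _ (\sum_i (Cm * (C * (Ce * M)) + 1) * holder_norm a k (tder i g))).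
  apply: ler_sum => i _; rewrite dE (le_trans (holder_normD (hm i) (hdg i)))// mulrDl mul1r lerD2r.
  rewrite (le_trans (nm i))// -[leRHS]mulrA ler_wpM2l// ler_wpM2r ?holder_norm_ge0//.
  by rewrite (le_trans ne)// ler_wpM2l.
rewrite -mulr_sumr ler_wpM2l ?addr_ge0 ?mulr_ge0 ?Ce_ge0//.
by rewrite /= lerDr sup_norm_ge0.
Qed.

(** One derivative turns [e^g - 1 - g] into [(e^g - 1) dg], so the quadratic bound at order [k.+1]
    follows from the linear one at order [k]. *)
Lemma expm2_holder k (M : R) : 0 <= M -> exists2 C, 0 <= C & forall g, is_holder a k g ->
  holder_norm a k g <= M ->
  is_holder a k (expm2 g) /\ holder_norm a k (expm2 g) <= C * holder_norm a k g ^+ 2.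
Proof.
have sup0 k' g : is_holder a k' g -> holder_norm a k' g <= M -> 0 <= M ->
    sup_norm (expm2 g) <= expR M * holder_norm a k' g ^+ 2.
  move=> hg gM M0; apply: sup_norm_le => p; have gb := le_holder_norm p hg.
  have n0 : `|0 : R| <= holder_norm a k' g by rewrite normr0 holder_norm_ge0.
  have := exp_taylor_lip gb n0; rewrite expR0 !subr0 subrr subr0 /expm2 => h1.
  rewrite (le_trans h1)// expr2 mulrA ler_pM ?mulr_ge0 ?expR_ge0 ?holder_norm_ge0//.
  by rewrite ler_wpM2r ?holder_norm_ge0// ler_expR.
have c2 g : continuous g -> continuous (expm2 g).
  by move=> cg p; apply: (@continuousB _ _ _ (expm1 g) g); [exact: expm1_cont|exact: cg].
case: k => [|k] M0.
  exists (2 * expR M); first by rewrite mulr_ge0 ?expR_ge0.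
  move=> g hg gM; have [cg hg0] := hg; have s0 := sup0 0%N g hg gM M0.
  have gb p := le_holder_norm p hg.
  have nn := holder_norm_ge0 a 0 g.
  have lip p q : `|expm2 g p - expm2 g q| <= (expR M * holder_norm a 0 g ^+ 2) * sdist p q `^ a.
    rewrite (le_trans (exp_taylor_lip (gb p) (gb q)))//.
    rewrite (@le_trans _ _ (expR M * holder_norm a 0 g * `|g p - g q|))//.
      by rewrite ler_wpM2r// ler_wpM2r// ler_expR.
    rewrite expr2 -!mulrA ler_wpM2l ?expR_ge0// ler_wpM2l// (le_trans (le_semi p q hg0))//.
    by rewrite ler_wpM2r ?powR_ge0//= lerDr sup_norm_ge0.
  have L0 : 0 <= expR M * holder_norm a 0 g ^+ 2 by rewrite mulr_ge0 ?expR_ge0 ?sqr_ge0.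
  split; first by split; [exact: c2|exists (expR M * holder_norm a 0 g ^+ 2)].
  rewrite -[leLHS]/(sup_norm (expm2 g) + holder_seminorm a (expm2 g)).
  by have := semi_le L0 lip; rewrite -mulrA; lra.
have [Cm Cm0 HM] := is_holderM k; have CM0 : 0 <= Ce * M by rewrite mulr_ge0// Ce_ge0.
have [C C0 HC] := expm1_holder k CM0.
exists (expR M + Cm * (C * Ce)); first by rewrite addr_ge0 ?expR_ge0// !mulr_ge0// Ce_ge0.
move=> g hg gM; have [cg [dg hdg]] := hg; have [hgk ngk] := is_holder_emb hg.
have gkM : holder_norm a k g <= Ce * M by rewrite (le_trans ngk)// ler_wpM2l// Ce_ge0.
have [he ne] := HC g hgk gkM.
have [hm nm] := all_and2 (fun i => HM _ _ he (hdg i)).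
have d1 := proj1 (expm1_tder ord0 dg).
have dng : tderivable (-1 *: g) by exact: tderivableZ.
have eq : expm2 g = expm1 g + (-1 *: g) by apply/funext => p; rewrite !fctE scaleN1r.
have dE i : tder i (expm2 g) = (fun p => expm1 g p * tder i g p).
  rewrite eq tderD// (proj2 (expm1_tder i dg)) tderZ//; apply/funext => p; rewrite !fctE.
  by rewrite scaleN1r addrK.
split.
  split; first exact: c2.
  by split=> [|i]; [rewrite eq; exact: tderivableD|rewrite dE].
rewrite -[leLHS]/(sup_norm (expm2 g) + \sum_i holder_norm a k (tder i (expm2 g))) mulrDl lerD//.
  exact: sup0.
set n := holder_norm a k.+1 g.
apply: (@le_trans _ _ (\sum_i (Cm * (C * Ce) * n) * holder_norm a k (tder i g))).
  apply: ler_sum => i _; rewrite dE (le_trans (nm i))//.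
  rewrite [leRHS](_ : _ = Cm * ((C * (Ce * n)) * holder_norm a k (tder i g))); last by ring.
  by rewrite ler_wpM2l// ler_wpM2r ?holder_norm_ge0// (le_trans ne)// ler_wpM2l.
have n0 : 0 <= n by exact: holder_norm_ge0.
rewrite -mulr_sumr expr2 [leRHS]mulrA ler_wpM2l ?mulr_ge0 ?Ce_ge0//.
by rewrite lerDr sup_norm_ge0.
Qed.

End HolderAlgebra.

(** * Completeness of the Hölder spaces *)

Section HolderLimits.
Variables (R : realType) (a : R).
Local Notation S2 := (S2 R).
Local Notation V := 'rV[R]_3.
Implicit Types (p q : S2) (f g : S2 -> R).
Local Notation sub f g := (f + (-1 *: g)).

Lemma subE f g p : (sub f g) p = f p - g p.
Proof. by rewrite !fctE scaleN1r. Qed.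

Lemma is_holderB k f g : is_holder a k f -> is_holder a k g -> is_holder a k (sub f g).
Proof. by move=> hf hg; apply: is_holderD => //; exact: is_holderZ. Qed.

Lemma tderB f g i : tderivable f -> tderivable g -> tder i (sub f g) = sub (tder i f) (tder i g).
Proof.
move=> df dg; have dg' : tderivable (-1 *: g) := @tderivableZ R (-1) g dg.
by rewrite (tderD i df dg') (tderZ (-1) i dg).
Qed.

Lemma uniform_limit (u : nat -> S2 -> R) :
  (forall e, 0 < e -> exists N, forall m n p, (N <= m)%N -> (N <= n)%N -> `|u m p - u n p| <= e) ->
  exists f, forall e, 0 < e -> exists N, forall n p, (N <= n)%N -> `|u n p - f p| <= e.
Proof.
move=> H; have lim p : exists l : R, (fun n => u n p) @ \oo --> l.
  suff cv : cvg ((fun n => u n p) @ \oo) by exists (lim ((fun n => u n p) @ \oo)).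
  apply/cauchy_cvgP; apply/cauchy_exP => e e0.
  have e20 : 0 < e / 2 by rewrite divr_gt0.
  have [N HN] := H _ e20; exists (u N p); exists N => // n /= Nn; rewrite -ball_normE /=.
  rewrite (le_lt_trans (HN N n p (leqnn N) Nn))//.
  by rewrite ltr_pdivrMr// mulr_natr mulr2n ltrDl.
have [f Hf] := choice lim; exists f => e e0; have e20 : 0 < e / 2 by rewrite divr_gt0.
have [N HN] := H _ e20; exists N => n p Nn.
have [M _ HM] : \forall n \near \oo, `|f p - u n p| <= e / 2.
  by exact: (iffLR (cvgrPdist_le (fun n => u n p) (f p)) (Hf p) _ e20).
 have := HM (maxn M N) (leq_maxl _ _); have := HN n (maxn M N) p Nn (leq_maxr _ _).
move=> h1 h2; rewrite (le_trans (ler_distD (u (maxn M N) p) _ _))// (splitr e) lerD// distrC.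
exact: h2.
Qed.

Lemma uniform_limit_cont (u : nat -> S2 -> R) f : (forall n, continuous (u n)) ->
  (forall e, 0 < e -> exists N, forall n p, (N <= n)%N -> `|u n p - f p| <= e) -> continuous f.
Proof.
move=> cu H p; apply/S2_contP => e e0; have e40 : 0 < e / 4 by rewrite divr_gt0.
have [N HN] := H _ e40; have [r r0 Hr] := iffLR (S2_contP (u N) p) (cu N p) _ e40.
exists r => // q pq; have h1 := HN N p (leqnn N); have h2 := HN N q (leqnn N).
have h3 := Hr q pq; have := ler_distD (u N p) (f p) (f q); have := ler_distD (u N q) (u N p) (f q).
rewrite (distrC (f p) (u N p)); lra.
Qed.

(** The mean value bound for [u m - u n] is uniform in [m] and proportional to the step, so the
    limit in [m] can be taken before the step tends to 0. *)
Lemma uniform_limit_derive (u du : nat -> S2 -> R) f g i p : (forall n, tderivable (u n)) ->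
  (forall n, tder i (u n) = du n) ->
  (forall e, 0 < e -> exists N, forall n p, (N <= n)%N -> `|u n p - f p| <= e) ->
  (forall e, 0 < e -> exists N, forall n p, (N <= n)%N -> `|du n p - g p| <= e) ->
  is_derive (val p) 'e_i (f \o @radial R) (g p).
Proof.
move=> dn dE Hf Hg; apply/is_derive_quot; apply: is_derive_small => e e0.
have e90 : 0 < e / 10 by rewrite divr_gt0.
have [N HN] := Hg _ e90; pose x t : V := val p + t *: 'e_i.
have x0 : radial (x 0) = p by rewrite /x scale0r addr0 radial_val.
have xn (t : R) : `|t| < 4^-1 -> 4^-1 <= nr (x t).
  move=> t4; apply: (@far_from_0 R p); rewrite /x addrAC subrr add0r normrZ.
  rewrite (le_lt_trans _ t4)// ler_piMr// row_norm_le// => j; rewrite !mxE eqxx /=.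
  by case: (j == i); rewrite ?normr0 ?normr1.
(* [8 = 4 * 2]: derivatives off the sphere carry a factor at most 4, and two errors [e / 10] are
   added. With the two further errors [e / 10] below, the total is [e]. *)
have step m n (t : R) : (N <= m)%N -> (N <= n)%N -> `|t| < 4^-1 ->
    `|(u m (radial (x t)) - u m p) - (u n (radial (x t)) - u n p)| <= 8 * (e / 10) * `|t|.
  move=> Nm Nn t4; have dmn : tderivable (sub (u m) (u n)).
    by apply: tderivableD => //; exact: tderivableZ.
  have dl (s : R) : `|s| <= `|t| -> is_derive s 1 (fun s => (sub (u m) (u n)) (radial (x s)))
      (dg i (sub (u m) (u n)) (x s)).
    by move=> st; apply: line_derive => //; apply: nr_neq0; apply: xn; exact: le_lt_trans st t4.
  have [s st] := MVT_sym dl; rewrite x0 !subE => E.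
  rewrite [X in `|X|](_ : _ = t * dg i (sub (u m) (u n)) (x s)); last by rewrite -E; ring.
  rewrite normrM mulrC ler_wpM2r// /dg normrM tderB// subE !dE.
  have n4 := xn s (le_lt_trans st t4); have np : 0 < nr (x s) by apply: lt_le_trans n4; rewrite invr_gt0.
  rewrite (_ : 8 * (e / 10) = 4 * (2 * (e / 10))); last by ring.
  apply: ler_pM => //.
    by rewrite normfV gtr0_norm// -[leRHS]invrK lef_pV2 ?posrE ?invr_gt0.
  have := ler_distD (g (radial (x s))) (du m (radial (x s))) (du n (radial (x s))).
  have := HN m (radial (x s)) Nm; have := HN n (radial (x s)) Nn.
  by rewrite (distrC (g _)); lra.
have lim (t : R) : `|t| < 4^-1 ->
    `|(f (radial (x t)) - f p) - (u N (radial (x t)) - u N p)| <= 8 * (e / 10) * `|t|.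
  move=> t4; apply/ler_addgt0Pr => d d0; have d40 : 0 < d / 4 by rewrite divr_gt0.
  have [M HM] := Hf _ d40; have := step (maxn M N) N t (leq_maxr _ _) (leqnn N) t4.
  have h1 := HM (maxn M N) p (leq_maxl _ _); have h2 := HM (maxn M N) (radial (x t)) (leq_maxl _ _).
  move: h1 h2; set A := u (maxn M N) (radial (x t)); set B := u (maxn M N) p.
  set C := f (radial (x t)); set D := f p; set U := u N _ - u N p => h1 h2 h3.
  have -> : C - D - U = (A - B - U) - (A - C) + (B - D) by ring.
  have := ler_normD ((A - B - U) - (A - C)) (B - D); have := ler_normB (A - B - U) (A - C).
  lra.
have /is_derive_quot [dN vN] : is_derive (val p) 'e_i (u N \o @radial R) (du N p).
  by rewrite -dE; apply: derivableP; exact: dn.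
have c1 : (fun h => h^-1 *: (((fun t => u N (radial (x t))) \o shift 0) (h *: 1) - u N (radial (x 0)))) @ (0 : R)^' --> du N p.
  by rewrite -vN; exact: dN.
have n1 : \forall h \near (0 : R)^', `|du N p - h^-1 *: (((fun t => u N (radial (x t))) \o shift 0) (h *: 1) -
    u N (radial (x 0)))| <= e / 10.
  by exact: (iffLR (cvgrPdist_le _ _) c1 _ e90).
rewrite near_withinE in n1.
have r4 : (0 : R) < 4^-1 by rewrite invr_gt0.
have n2 : \forall t \near (0 : R), `|t| < 4^-1.
  by apply/nbhs_normP; exists 4^-1 => // t; rewrite /= sub0r normrN.
near=> t.
have t4 : `|t| < 4^-1 by near: t.
rewrite add0r -/(x t) -/(x 0) [X in _ - X - _]/= x0.
have b1 := lim t t4; have b2 := HN N p (leqnn N).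
have b3 : `|u N (radial (x t)) - u N p - t * du N p| <= e / 10 * `|t|.
  have [->|t0] := eqVneq t 0; first by rewrite x0 subrr mul0r subr0 normr0 mulr0.
  have : t != 0 -> `|du N p - t^-1 *: (((fun t => u N (radial (x t))) \o shift 0) (t *: 1) - u N (radial (x 0)))| <= e / 10.
    by near: t; exact: n1.
  move=> /(_ t0); rewrite /= /shift /= addr0 [t *: 1]mulr1 x0 distrC => h.
  rewrite [leRHS]mulrC (_ : u N _ - u N p - t * _ = t * (t^-1 * (u N (radial (x t)) - u N p) - du N p)).
    by rewrite normrM ler_wpM2l.
  by rewrite mulrBr mulrA mulfV// mul1r.
rewrite -[(f \o @radial R) _]/(f (radial (x t))).
have b4 : `|t * (du N p - g p)| <= e / 10 * `|t| by rewrite normrM mulrC ler_wpM2r.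
have -> : f (radial (x t)) - f p - t * g p = (f (radial (x t)) - f p - (u N (radial (x t)) - u N p))
    + (u N (radial (x t)) - u N p - t * du N p) + t * (du N p - g p) by ring.
move: b1 b3 b4; set A := _ - _ - _; set B := _ - _ - _; set C := t * _ => b1 b3 b4.
have := ler_normD (A + B) C; have := ler_normD A B.
have : 0 <= e / 10 * `|t| by rewrite mulr_ge0// ltW.
by move: (`|t|) b1 b3 b4 => tt b1 b3 b4; lra.
Unshelve. all: by end_near. Qed.

Lemma holder_cauchy k (u : nat -> S2 -> R) : (forall n, is_holder a k (u n)) ->
  (forall e, 0 < e -> exists N, forall m n, (N <= m)%N -> (N <= n)%N ->
     holder_norm a k (sub (u m) (u n)) <= e) ->
  exists2 f, is_holder a k f & forall e, 0 < e -> exists N, forall n, (N <= n)%N ->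
     holder_norm a k (sub (u n) f) <= e.
Proof.
elim: k u => [|k IH] u hu cu.
  have cun n : continuous (u n) := is_holder_continuous (hu n).
  have [|f Hf] := @uniform_limit u.
    move=> e /cu[N HN]; exists N => m n p Nm Nn; rewrite -subE.
    apply: le_trans (le_holder_norm p _) (HN m n Nm Nn); exact: is_holderB.
  have cf := uniform_limit_cont cun Hf.
  (* The Hölder bound on [u n - u m] passes to the limit in [m] for each pair of points
     separately. *)
  have lim e N : (forall m n, (N <= m)%N -> (N <= n)%N -> holder_norm a 0 (sub (u m) (u n)) <= e) ->
      forall n p q, (N <= n)%N -> `|(sub (u n) f) p - (sub (u n) f) q| <= e * sdist p q `^ a.
    move=> HN n p q Nn; apply/ler_addgt0Pr => d d0; have d40 : 0 < d / 4 by rewrite divr_gt0.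
    have [M HM] := Hf _ d40; set m := maxn M N.
    have hmn : is_holder a 0 (sub (u n) (u m)) by exact: is_holderB.
    have h0 := le_semi p q (proj2 hmn).
    have h1 : holder_seminorm a (sub (u n) (u m)) <= e.
      by apply: le_trans (HN n m Nn (leq_maxr _ _)); rewrite /= lerDr sup_norm_ge0.
    have h2 := le_trans h0 (ler_wpM2r (powR_ge0 _ _) h1).
    have h3 := HM m p (leq_maxl _ _); have h4 := HM m q (leq_maxl _ _).
    move: h2; rewrite !subE; move: h3 h4.
    set A := u m p; set B := u m q; set P := u n p; set Q := u n q => h3 h4 h2.
    have -> : P - f p - (Q - f q) = (P - A - (Q - B)) + (A - f p) - (B - f q) by ring.
    have := ler_normB ((P - A - (Q - B)) + (A - f p)) (B - f q).
    have := ler_normD (P - A - (Q - B)) (A - f p); lra.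
  have hf : is_holder a 0 f.
    split=> //; have [N HN] := cu 1 ltr01.
    have [C HC] := proj2 (hu N); exists (1 + C) => p q.
    have := lim _ _ HN N p q (leqnn N); rewrite !subE mulrDl => h1; have h2 := HC p q.
    have -> : f p - f q = (u N p - u N q) - ((u N p - f p) - (u N q - f q)) by ring.
    by rewrite (le_trans (ler_normB _ _))// addrC lerD.
  exists f => // e e0; have e20 : 0 < e / 2 by rewrite divr_gt0.
  have [N HN] := cu _ e20; have [M HM] := Hf _ e20; exists (maxn M N) => n nMN.
  rewrite /= (splitr e) lerD//.
    by apply: sup_norm_le => p; rewrite subE; apply: HM; exact: leq_trans (leq_maxl _ _) nMN.
  apply: semi_le; first exact: ltW.
  by move=> p q; apply: (lim _ N) => //; exact: leq_trans (leq_maxr _ _) nMN.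
have cun n : continuous (u n) := is_holder_continuous (hu n).
have dun n : tderivable (u n) by have [_ []] := hu n.
have hdu i n : is_holder a k (tder i (u n)) by have [_ [_ h]] := hu n; exact: h.
have [|f Hf] := @uniform_limit u.
  move=> e /cu[N HN]; exists N => m n p Nm Nn; rewrite -subE.
  apply: le_trans (@le_holder_norm _ a k.+1 _ p _) (HN m n Nm Nn); exact: is_holderB.
have cf := uniform_limit_cont cun Hf.
have IHi i : exists g, is_holder a k g /\ forall e, 0 < e -> exists N, forall n, (N <= n)%N ->
     holder_norm a k (sub (tder i (u n)) g) <= e.
  have [|g hg Hg] := IH (fun n => tder i (u n)) (hdu i); last by exists g.
  move=> e /cu[N HN]; exists N => m n Nm Nn; rewrite -tderB//.
  exact: le_trans (tder_le_norm a k _ i) (HN m n Nm Nn).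
have [g Hg] := choice IHi.
have df i p : is_derive (val p) 'e_i (f \o @radial R) (g i p).
  apply: (@uniform_limit_derive u (fun n => tder i (u n)) f (g i) i p) => //.
  move=> e /(proj2 (Hg i))[N HN]; exists N => n q Nn; rewrite -subE.
  apply: le_trans (le_holder_norm q _) (HN n Nn); apply: is_holderB => //.
  exact: (proj1 (Hg i)).
have dff : tderivable f by move=> i p; case: (df i p).
have dfE i : tder i f = g i by apply/funext => p; case: (df i p).
exists f; first by split=> //; split=> // i; rewrite dfE; exact: (proj1 (Hg i)).
move=> e e0; have e40 : 0 < e / 4 by rewrite divr_gt0.
have [M HM] := Hf _ e40; have [N HN] := choice (fun i => proj2 (Hg i) _ e40).
exists (maxn M (\max_i N i)) => n; rewrite geq_max => /andP[Mn Nn].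
rewrite -[leLHS]/(sup_norm (sub (u n) f) + \sum_i holder_norm a k (tder i (sub (u n) f))).
have h1 : sup_norm (sub (u n) f) <= e / 4.
  by apply: sup_norm_le => p; rewrite subE; exact: HM.
have h2 : \sum_i holder_norm a k (tder i (sub (u n) f)) <= \sum_(i < 3) e / 4.
  apply: ler_sum => i _; rewrite tderB// dfE; apply: HN.
  by apply: leq_trans Nn; exact: leq_bigmax.
rewrite (le_trans (lerD h1 h2))// sumr_const card_ord -mulr_natl.
rewrite [leLHS](_ : _ = e)//; by field.
Qed.

End HolderLimits.

Section HolderComplete.
Variables (R : realType) (a : R) (k : nat).

Definition mkh (f : S2 R -> R) (hf : is_holder a k f) : holder a k := Holder (asboolT hf).

Lemma holder_normE (u : holder a k) : `|u| = holder_norm a k u.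
Proof. by []. Qed.

Lemma holder_subE (u w : holder a k) :
  holder_fun (u - w) = holder_fun u + (-1) *: holder_fun w.
Proof. by rewrite -scaleN1r. Qed.

Lemma holder_complete (F : set_system (holder a k)) : ProperFilter F -> cauchy F -> cvg F.
Proof.
move=> PF cF0; have cF : cauchy_ex F by apply/cauchyP.
have ex n : exists x : holder a k, F (ball x n.+1%:R^-1) by apply: cF; rewrite invr_gt0.
have [x Hx] := choice ex.
have dx m n : `|x m - x n| <= m.+1%:R^-1 + n.+1%:R^-1.
  have [y [ym yn]] := filter_ex (filterI (Hx m) (Hx n)).
  rewrite -!ball_normE /= in ym yn.
  by rewrite (le_trans (ler_distD y _ _))// lerD// ltW// distrC.
have small (e : R) : 0 < e -> exists N, forall n, (N <= n)%N -> n.+1%:R^-1 <= e.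
  move=> e0; exists (Num.truncn e^-1) => n Nn.
  rewrite -[leRHS]invrK lef_pV2 ?posrE ?invr_gt0//.
  by apply: ltW; rewrite (lt_le_trans (truncnS_gt _))// ler_nat ltnS.
have [|e e0|f hf Hf] := @holder_cauchy R a k (fun n => x n : S2 R -> R).
- by move=> n; exact: holderP.
- have e20 : 0 < e / 2 by rewrite divr_gt0.
  have [N HN] := small _ e20; exists N => m n Nm Nn; rewrite -holder_subE -holder_normE.
  by rewrite (le_trans (dx m n))// (splitr e) lerD// HN.
suff Fl : F --> (mkh hf) by apply/cvg_ex; exists (mkh hf).
apply/cvg_ballP => e e0; have e20 : 0 < e / 3 by rewrite divr_gt0.
have [N HN] := small _ e20; have [M HM] := Hf _ e20; set n := maxn N M.
apply: filterS (Hx n) => y; rewrite -!ball_normE /= => yn.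
have h1 := HN n (leq_maxl _ _).
have h2 : `|x n - mkh hf| <= e / 3 by rewrite holder_normE holder_subE; exact: HM (leq_maxr _ _).
rewrite (le_lt_trans (ler_distD (x n) _ _))// distrC.
by rewrite (le_lt_trans (lerD h2 (le_trans (ltW yn) h1)))//; lra.
Qed.

HB.instance Definition _ := Uniform_isComplete.Build (holder a k) holder_complete.

End HolderComplete.

(** * Compactness of the embedding of Hölder spaces *)

Section HolderNets.
Variables (R : realType) (a : R).
Hypothesis ha : 0 < a < 1.
Local Notation S2 := (S2 R).
Implicit Types (p q : S2) (f g : S2 -> R).
Local Notation sub f g := (f + (-1 *: g)).

Lemma sphere_net (d : R) : 0 < d ->
  exists s : seq S2, forall p, exists2 q, q \in s & `|val p - val q| < d.
Proof.
move=> d0; have := @compact_sphere R.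
rewrite compact_cover => /(_ S2 setT (fun q => ball (val q) d)) [].
- by move=> q _; exact: ball_open.
- by move=> x Sx; exists (exist _ x (mem_set Sx)) => //; exact: ballxx.
move=> D _ HD; exists (finmap.enum_fset D) => p.
have [q qD] := HD (val p) (sphere_dot p); rewrite -ball_normE /= => h.
by exists q => //; rewrite distrC.
Qed.

(* Sampling on a net and rounding sorts bounded Lipschitz functions into finitely
   many classes of small diameter. *)
Lemma class_sup (M e : R) : 0 <= M -> 0 < e ->
  exists (T : finType) (cl : (S2 -> R) -> T), forall f g,
    (forall p, `|f p| <= M) -> (forall p, `|g p| <= M) ->
    (forall p q, `|f p - f q| <= M * `|val p - val q|) ->
    (forall p q, `|g p - g q| <= M * `|val p - val q|) ->
    cl f = cl g -> forall p, `|f p - g p| <= e.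
Proof.
move=> M0 e0; have M1 : 0 < M + 1 by rewrite ltr_wpDl.
have [s Hs] := @sphere_net (e / (4 * (M + 1))) (divr_gt0 e0 (mulr_gt0 (ltr0Sn _ 3) M1)).
pose eta := e / 2; have eta0 : 0 < eta by rewrite divr_gt0.
pose N := (Num.truncn (2 * M / eta)).+1.
pose v f q := Num.truncn ((f q + M) / eta).
exists {ffun 'I_(size s) -> 'I_N.+1}, (fun f => [ffun i : 'I_(size s) => inord (v f (nth (@north R) s i))]).
move=> f g fM gM lf lg clE p.
have pos h q : (forall p, `|h p| <= M) -> 0 <= (h q + M) / eta.
  by move=> hM; rewrite divr_ge0 ?(ltW eta0)//; have := hM q; rewrite ler_norml => /andP[]; lra.
have vN h q : (forall p, `|h p| <= M) -> (v h q < N.+1)%N.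
  move=> hM; have /andP[t1 _] := truncn_itv (pos h q hM).
  have p2 : 0 <= 2 * M / eta by rewrite divr_ge0 ?mulr_ge0// ltW.
  have /andP[_ t2] := truncn_itv p2.
  have : (h q + M) / eta <= 2 * M / eta.
    by rewrite ler_wpM2r ?invr_ge0 ?(ltW eta0)//; have := hM q; rewrite ler_norml => /andP[]; lra.
  move=> t3.
  have : ((v h q)%:R : R) < N%:R by exact: le_lt_trans (le_trans t1 t3) t2.
  by rewrite ltr_nat => /ltnW.
have [q qs pq] := Hs p; have iq : (index q s < size s)%N by rewrite index_mem.
have vE : v f q = v g q.
  have := congr1 (fun F : {ffun 'I_(size s) -> 'I_N.+1} => val (F (Ordinal iq))) clE.
  by rewrite !ffunE /= nth_index// !inordK// vN.
have fg : `|f q - g q| <= eta.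
  have /andP[f1 f2] := truncn_itv (pos f q fM); have /andP[g1 g2] := truncn_itv (pos g q gM).
  rewrite -/(v f q) vE in f1 f2; rewrite -/(v g q) in g1 g2.
  rewrite ler_pdivlMr// in f1; rewrite ler_pdivlMr// in g1.
  rewrite ltr_pdivrMr// -natr1 mulrDl mul1r in f2; rewrite ltr_pdivrMr// -natr1 mulrDl mul1r in g2.
  by rewrite ler_norml; apply/andP; split; lra.
have h1 := lf p q; have h2 := lg q p.
have Md : M * `|val p - val q| <= e / 4.
  apply: (@le_trans _ _ ((M + 1) * (e / (4 * (M + 1))))).
    by apply: ler_pM => //; [rewrite lerDl|exact: ltW].
  rewrite [leLHS](_ : _ = e / 4)//; field; by rewrite lt0r_neq0.
rewrite distrC in h2; rewrite (distrC (val q)) in h2.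
have := ler_distD (f q) (f p) (g p); have := ler_distD (g q) (f q) (g p).
by rewrite (distrC (g q)); move: fg; rewrite /eta; lra.
Qed.

(** Functions of one class are uniformly close. Pairs of points farther apart than [d] are then
    controlled by the sup norm, closer pairs by the Lipschitz bound, [d] being chosen with
    [d^(1 - a)] a small multiple of [e]. Derivatives are classified separately. *)
Lemma class_holder k (M e : R) : 0 <= M -> 0 < e ->
  exists (T : finType) (cl : (S2 -> R) -> T), forall f g,
    is_holder a k.+1 f -> is_holder a k.+1 g ->
    holder_norm a k.+1 f <= M -> holder_norm a k.+1 g <= M ->
    cl f = cl g -> holder_norm a k (sub f g) <= e.
Proof.
have key (k' : nat) (M' : R) f : 0 <= M' -> is_holder a k'.+1 f -> holder_norm a k'.+1 f <= M' ->
    (forall p, `|f p| <= 20 * M') /\ (forall p q, `|f p - f q| <= 20 * M' * `|val p - val q|).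
  move=> M0 hf fM; split=> [p|p q].
    by rewrite (le_trans (le_holder_norm p hf))// (le_trans fM)// ler_peMl// ler1n.
  by rewrite (le_trans (is_holder_lip p q hf))// ler_wpM2r// ler_wpM2l.
elim: k M e => [|k IH] M e M0 e0; have M20 : 0 <= 20 * M by rewrite mulr_ge0.
  have a1 := a_lt1 ha; have a0 := a_gt0 ha.
  pose y := e / (2 * (40 * M + 1)).
  have m1 : 0 < 40 * M + 1 by rewrite ltr_wpDl// mulr_ge0.
  have y0 : 0 < y by rewrite divr_gt0// mulr_gt0.
  pose d := y `^ (1 - a)^-1; have d0 : 0 < d by rewrite powR_gt0.
  have dy : d `^ (1 - a) = y by rewrite /d -powRrM mulVf ?gt_eqF// powRr1// ltW.
  have da0 : 0 < d `^ a by rewrite powR_gt0.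
  pose e' := Num.min (e / 2) (e / 4 * d `^ a).
  have e'0 : 0 < e' by rewrite lt_min divr_gt0//= mulr_gt0// divr_gt0.
  have [T [cl Hcl]] := class_sup M20 e'0.
  exists T, cl => f g hf hg fM gM fg.
  have [fb fl] := key 0%N M f M0 hf fM; have [gb gl] := key 0%N M g M0 hg gM.
  have H := Hcl f g fb gb fl gl fg.
  have e'1 : e' <= e / 2 by rewrite ge_min lexx.
  have e'2 : e' <= e / 4 * d `^ a by rewrite ge_min lexx orbT.
  rewrite /= (splitr e) lerD//.
    by apply: sup_norm_le => p; rewrite subE (le_trans (H p)).
  apply: semi_le => [|p q]; first by rewrite divr_ge0// ltW.
  rewrite !subE; have [dl|dl] := leP d (sdist p q).
    have : d `^ a <= sdist p q `^ a.
      by rewrite ge0_ler_powR ?nnegrE ?(ltW a0) ?(ltW d0) ?sdist_ge0.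
    move=> dd; have := ler_normB (f p - g p) (f q - g q); have := H p; have := H q.
    have : e / 2 * d `^ a <= e / 2 * sdist p q `^ a by rewrite ler_pM2l// divr_gt0.
    move: e'2; move: (d `^ a) (sdist p q `^ a) => x1 x2; lra.
  have h1 := fl p q; have h2 := gl p q.
  have ch := chord_le p q.
  have dp : sdist p q <= y * sdist p q `^ a.
    by rewrite -dy; apply: (le_powR_dist ha); rewrite sdist_ge0 ltW.
  have h3 : 40 * M * (y * sdist p q `^ a) <= e / 2 * sdist p q `^ a.
    rewrite mulrA ler_wpM2r ?powR_ge0// /y mulrCA ler_wpM2l ?(ltW e0)//.
    by rewrite ler_pdivrMr ?mulr_gt0// mulrA mulVf// mul1r lerDl.
  have h4 : 40 * M * `|val p - val q| <= 40 * M * (y * sdist p q `^ a).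
    by rewrite ler_wpM2l ?mulr_ge0// (le_trans ch).
  have -> : f p - g p - (f q - g q) = (f p - f q) - (g p - g q) by ring.
  have := ler_normB (f p - f q) (g p - g q).
  have E40 : 40 * M * `|val p - val q| = 20 * M * `|val p - val q| + 20 * M * `|val p - val q| by ring.
  by move: h1 h2 h3 h4; rewrite E40; lra.
have e40 : 0 < e / 4 by rewrite divr_gt0.
have [T0 [cl0 H0]] := class_sup M20 e40; have [T1 [cl1 H1]] := IH M (e / 4) M0 e40.
exists (T0 * {ffun 'I_3 -> T1})%type, (fun f => (cl0 f, [ffun i => cl1 (tder i f)])).
move=> f g hf hg fM gM [fg0 fg1].
have [fb fl] := key k.+1 M f M0 hf fM; have [gb gl] := key k.+1 M g M0 hg gM.
have [cf [df hdf]] := hf; have [cg [dg hdg]] := hg.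
rewrite -[leLHS]/(sup_norm (sub f g) + \sum_i holder_norm a k (tder i (sub f g))).
have h1 : sup_norm (sub f g) <= e / 4.
  by apply: sup_norm_le => p; rewrite subE; exact: (H0 f g).
have h2 : \sum_i holder_norm a k (tder i (sub f g)) <= \sum_(i < 3) e / 4.
  apply: ler_sum => i _; rewrite tderB//; apply: H1 => //.
  - exact: le_trans (tder_le_norm a k.+1 f i) fM.
  - exact: le_trans (tder_le_norm a k.+1 g i) gM.
  - by have := congr1 (fun F : {ffun 'I_3 -> T1} => F i) fg1; rewrite !ffunE.
rewrite (le_trans (lerD h1 h2))// sumr_const card_ord -mulr_natl.
rewrite [leLHS](_ : _ = e)//; by field.
Qed.

End HolderNets.

Section HolderEmbedding.
Variables (R : realType) (a : R) (k : nat).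
Hypothesis ha : 0 < a < 1.

Definition embh (u : holder a k.+2) : holder a k :=
  mkh (proj1 (is_holder_emb ha (proj1 (is_holder_emb ha (holderP u))))).

Lemma embh_lin : linear embh.
Proof. by move=> c u w; apply: val_inj. Qed.

Lemma embh_bnd (u : holder a k.+2) : `|embh u| <= Ce a * Ce a * `|u|.
Proof.
have [h1 b1] := is_holder_emb ha (holderP u); have [h2 b2] := is_holder_emb ha h1.
by rewrite (le_trans b2)// -mulrA ler_wpM2l ?Ce_ge0.
Qed.

Lemma embh_cont : continuous embh.
Proof. exact: (bounded_linear_continuous embh_lin embh_bnd). Qed.

(** One of the two lost derivatives is spent on a bounded embedding, the other on compactness. The
    net consists of one representative for each class met by the ball, so its centres are images of
    elements of the space. *)
Lemma embh_compact : compact_map embh.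
Proof.
move=> r e e0; have e20 : 0 < e / 2 by rewrite divr_gt0.
have M0 : 0 <= Ce a * `|r| by rewrite mulr_ge0 ?Ce_ge0.
have [T [cl Hcl]] := class_holder ha k M0 e20.
have rep (t : T) : exists w : holder a k.+2,
    (exists u : holder a k.+2, `|u| <= r /\ cl u = t) -> `|w| <= r /\ cl w = t.
  have [[u Hu]|n] := pselect (exists u : holder a k.+2, `|u| <= r /\ cl u = t); first by exists u.
  by exists 0.
have [w Hw] := choice rep.
exists [seq embh (w t) | t : T] => _ [u /= ur <-].
have [wr wc] := Hw (cl u) (ex_intro _ u (conj ur erefl)).
exists (embh (w (cl u))); first by apply/mapP; exists (cl u) => //; rewrite mem_enum.
rewrite (@le_lt_trans _ _ (e / 2))//; last by rewrite ltr_pdivrMr// mulr_natr mulr2n ltrDl.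
have [h1 b1] := is_holder_emb ha (holderP u).
have [h2 b2] := is_holder_emb ha (holderP (w (cl u))).
have bd (x : holder a k.+2) : `|x| <= r -> Ce a * `|x| <= Ce a * `|r|.
  by move=> xr; rewrite ler_wpM2l ?Ce_ge0// (le_trans xr)// ler_norm.
rewrite holder_normE holder_subE; apply: (Hcl u (w (cl u))) => //.
- exact: le_trans b1 (bd u ur).
- exact: le_trans b2 (bd _ wr).
Qed.

End HolderEmbedding.

(** * The curvature map *)

Section Instance.
Variables (R : realType) (a : R) (k : nat).
Hypothesis ha : 0 < a < 1.
Local Notation S2 := (S2 R).
Local Notation E := (holder a k.+2).
Local Notation F := (holder a k).
Implicit Types (u w : E) (f g : F).

Lemma hcont j (f : holder a j) : continuous f.
Proof. exact: (is_holder_continuous (holderP f)). Qed.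

Lemma hmul_cont (f g : S2 -> R) : continuous f -> continuous g -> continuous (fun p => f p * g p).
Proof. by move=> cf cg p; exact: (continuousM (cf p) (cg p)). Qed.

Lemma tder_hold u i : is_holder a k.+1 (tder i u).
Proof. by have [_ [_ h]] := holderP u; exact: h. Qed.

Lemma tder2_hold u i : is_holder a k (tder i (tder i u)).
Proof. by have [_ [_ h]] := tder_hold u i; exact: h. Qed.

Lemma tderivable_hold u : tderivable u.
Proof. by have [_ []] := holderP u. Qed.

Lemma tderivable_tder u i : tderivable (tder i u).
Proof. by have [_ []] := tder_hold u i. Qed.

Lemma sum3fun (G : 'I_3 -> S2 -> R) : (fun p => \sum_i G i p) =
  G ord0 + (G (lift ord0 ord0) + G (lift ord0 (lift ord0 ord0))).
Proof. by apply/funext => p; rewrite !big_ord_recl big_ord0 addr0. Qed.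

Lemma mean_sum3 (G : 'I_3 -> S2 -> R) : (forall i, continuous (G i)) ->
  mean (fun p => \sum_i G i p) = \sum_i mean (G i).
Proof.
move=> cG.
have c12 : continuous (G (lift ord0 ord0) + G (lift ord0 (lift ord0 ord0))).
  move=> p; exact: (continuousD (cG (lift ord0 ord0) p) (cG (lift ord0 (lift ord0 ord0)) p)).
rewrite sum3fun (meanD (cG ord0) c12) !big_ord_recl big_ord0 addr0; congr (_ + _).
exact: (meanD (cG (lift ord0 ord0)) (cG (lift ord0 (lift ord0 ord0)))).
Qed.

Lemma laplacianE (f : S2 -> R) : laplacian f = tder ord0 (tder ord0 f) +
  (tder (lift ord0 ord0) (tder (lift ord0 ord0) f) +
   tder (lift ord0 (lift ord0 ord0)) (tder (lift ord0 (lift ord0 ord0)) f)).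
Proof. exact: (sum3fun (fun i => tder i (tder i f))). Qed.

Lemma laplacian_holder u : is_holder a k (laplacian u).
Proof.
rewrite laplacianE; by apply: is_holderD; [|apply: is_holderD]; exact: tder2_hold.
Qed.

Definition laph u : F := mkh (laplacian_holder u).
Definition iph f g : R := mean (fun p => f p * g p).

Lemma mulh_holder f g : is_holder a k (fun p => f p * g p).
Proof. by have [C _ H] := is_holderM ha k; have [] := H _ _ (holderP f) (holderP g). Qed.

Definition mulh f g : F := mkh (mulh_holder f g).
Definition oneh : F := mkh (is_holder_cst a k 1).
Definition cst1h : E := mkh (is_holder_cst a k.+2 1).

Lemma expm1_hold f : is_holder a k (expm1 (2 *: (f : S2 -> R))).
Proof.
have hf : is_holder a k (2 *: (f : S2 -> R)) := is_holderZ 2 (holderP f).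
have [C _ H] := expm1_holder ha k (holder_norm_ge0 a k (2 *: (f : S2 -> R))).
by have [] := H _ hf (lexx _).
Qed.

Lemma exh_holder f : is_holder a k (fun p => expR (2 * f p)).
Proof.
rewrite (_ : (fun p => _) = expm1 (2 *: (f : S2 -> R)) + (fun=> 1)).
  by apply: is_holderD; [exact: expm1_hold|exact: is_holder_cst].
by apply/funext => p; rewrite !fctE /expm1 subrK.
Qed.

Definition exh f : F := mkh (exh_holder f).

Lemma laph_lin : linear laph.
Proof.
move=> c u w; apply: val_inj; apply/funext => p.
rewrite -[LHS]/(laplacian (c *: (u : S2 -> R) + w) p) -[RHS]/(c * laplacian u p + laplacian w p).
rewrite /laplacian mulr_sumr -big_split; apply: eq_bigr => i _ /=.
have du := @tderivable_hold u; have dw := @tderivable_hold w.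
have dcu : tderivable (c *: (u : S2 -> R)) := tderivableZ (c := c) du.
have d2u := @tderivable_tder u i; have d2w := @tderivable_tder w i.
have dc2u : tderivable (c *: tder i u) := tderivableZ (c := c) d2u.
by rewrite (tderD i dcu dw) (tderZ c i du) (tderD i dc2u d2w) (tderZ c i d2u).
Qed.

Lemma laph_bnd u : `|laph u| <= 3 * `|u|.
Proof.
have b i : holder_norm a k (tder i (tder i u)) <= `|u|.
  exact: le_trans (tder_le_norm a k _ i) (tder_le_norm a k.+1 u i).
rewrite holder_normE -[holder_fun _]/(laplacian u) laplacianE.
have h1 := holder_normD (tder2_hold u (lift ord0 ord0)) (tder2_hold u (lift ord0 (lift ord0 ord0))).
have h2 := holder_normD (tder2_hold u ord0) (is_holderD (tder2_hold u (lift ord0 ord0))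
  (tder2_hold u (lift ord0 (lift ord0 ord0)))).
apply: (le_trans h2); apply: (le_trans (lerD (b ord0) (le_trans h1 (lerD (b _) (b _))))).
by rewrite le_eqVlt; apply/orP; left; apply/eqP; ring.
Qed.

(** [mean_tder] is applied to the products [tder i u * w] and summed over [i]; the terms containing
    the coordinates add up to 0 by Euler's relation. *)
Lemma green u w : iph (laph u) (embh ha w) = - \sum_i mean (fun p => tder i u p * tder i w p).
Proof.
have cu i : continuous (tder i u) := is_holder_continuous (tder_hold u i).
have cw i : continuous (tder i w) := is_holder_continuous (tder_hold w i).
have cuu i : continuous (tder i (tder i u)) := is_holder_continuous (tder2_hold u i).
have cw0 := @hcont _ w; have cu0 := @hcont _ u.
have cuj i j : continuous (tder j (tder i u)).
  by have [_ [_ h]] := tder_hold u i; exact: (is_holder_continuous (h j)).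
have step i : mean (fun p => tder i (tder i u) p * w p) =
    2 * mean (fun p => val p 0 i * (tder i u p * w p)) - mean (fun p => tder i u p * tder i w p).
  have d1 : tderivable (fun p => tder i u p * w p).
    exact: (tderivableM (@tderivable_tder u i) (@tderivable_hold w)).
  have dE j : tder j (fun p => tder i u p * w p) =
      (fun p => tder i u p * tder j w p + w p * tder j (tder i u) p).
    by apply/funext => p; exact: (tderM j p (@tderivable_tder u i) (@tderivable_hold w)).
  have cd j : continuous (tder j (fun p => tder i u p * w p)).
    rewrite dE => p; apply: (@continuousD _ _ _ (fun p => tder i u p * tder j w p)
      (fun p => w p * tder j (tder i u) p)); exact: hmul_cont.
  have := mean_tder (hmul_cont (cu i) cw0) d1 cd i.
  rewrite dE meanD; [|exact: hmul_cont..] => <-.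
  rewrite addrC addKr; congr mean; apply/funext => p; exact: mulrC.
have coord i : continuous (fun p : S2 => val p 0 i).
  move=> p; apply: (@continuous_comp _ _ _ (fun p : S2 => val p) (fun v : 'rV[R]_3 => v 0 i)).
    exact: (@initial_continuous _ _ set_val p).
  exact: coord_continuous.
rewrite /iph.
have -> : (fun p => laph u p * embh ha w p) = (fun p => \sum_i tder i (tder i u) p * w p).
  by apply/funext => p; rewrite -mulr_suml.
rewrite (mean_sum3 (fun i => hmul_cont (cuu i) cw0)).
rewrite (eq_bigr _ (fun i _ => step i)) sumrB -mulr_sumr.
rewrite -(mean_sum3 (fun i => hmul_cont (coord i) (hmul_cont (cu i) cw0))).
have -> : (fun p : S2 => \sum_i val p 0 i * (tder i u p * w p)) = (fun=> 0).
  apply/funext => p; under eq_bigr do rewrite mulrA.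
  rewrite -mulr_suml (euler p (@tderivable_hold u) cu); exact: mul0r.
by rewrite mean_cst mulr0 sub0r.
Qed.

Lemma iphC f g : iph f g = iph g f.
Proof. by congr mean; apply/funext => p; exact: mulrC. Qed.

Lemma green_sym u w : iph (laph u) (embh ha w) = iph (embh ha u) (laph w).
Proof.
rewrite [RHS]iphC (green u w) (green w u).
have E i : (fun p => tder i u p * tder i w p) = (fun p => tder i w p * tder i u p).
  by apply/funext => p; exact: mulrC.
apply: (congr1 (fun x : R => - x)); exact: (eq_bigr _ (fun i _ => congr1 (@mean R) (E i))).
Qed.

Lemma green_le0 u : iph (laph u) (embh ha u) <= 0.
Proof.
rewrite (green u u) oppr_le0; apply: sumr_ge0 => i _.
have cu : continuous (tder i u) := is_holder_continuous (tder_hold u i).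
rewrite -(mean_cst (0 : R)); apply: (le_mean (@cst_continuous _ _ 0) (hmul_cont cu cu)) => p.
by rewrite -expr2 sqr_ge0.
Qed.

Lemma iph_lin g c f f' : iph (c *: f + f') g = c * iph f g + iph f' g.
Proof.
have cfg (h h' : F) : continuous (fun p => h p * h' p) := hmul_cont (@hcont _ h) (@hcont _ h').
have ccfg : continuous (fun p => c * (f p * g p)).
  exact: (hmul_cont (@cst_continuous _ _ c) (cfg f g)).
have E : (fun p => (c *: f + f') p * g p) = (fun p => c * (f p * g p) + f' p * g p).
  apply/funext => p; rewrite -[(c *: f + f') p]/(c * f p + f' p); ring.
by rewrite /iph E (meanD ccfg (cfg f' g)) (meanZ c (cfg f g)).
Qed.

Lemma iph_bnd f g : `|iph f g| <= 1 * (`|f| * `|g|).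
Proof.
rewrite mul1r; apply: mean_norm => [|p]; first by apply: hmul_cont; exact: hcont.
by rewrite normrM ler_pM// le_holder_norm//; exact: holderP.
Qed.

Lemma iph_mul_bnd f g : `|iph (mulh f g) g| <= 1 * `|f| * iph g g.
Proof.
have cg2 : continuous (fun p => g p * g p) by apply: hmul_cont; exact: hcont.
have c3 : continuous (fun p => mulh f g p * g p) by apply: hmul_cont; exact: hcont.
have b p : `|mulh f g p * g p| <= `|f| * (g p * g p).
  rewrite -[mulh f g p]/(f p * g p) -mulrA normrM [`|g p * g p|]ger0_norm -?expr2 ?sqr_ge0//.
  by rewrite ler_wpM2r ?sqr_ge0// le_holder_norm//; exact: holderP.
have cz (c : R) : continuous (fun p => c * (g p * g p)).
  by apply: hmul_cont => //; exact: cst_continuous.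
rewrite mul1r /iph ler_norml -mulNr -!(meanZ _ cg2); apply/andP; split; apply: le_mean => // p;
  by have := b p; rewrite ler_norml ?mulNr => /andP[].
Qed.

Lemma mulh_bnd : exists2 C, 0 < C & forall f g, `|mulh f g| <= C * (`|f| * `|g|).
Proof.
have [C C0 H] := is_holderM ha k; exists (C + 1); first by rewrite ltr_wpDl.
move=> f g; have [_ b] := H _ _ (holderP f) (holderP g).
by apply: (le_trans b); apply: ler_wpM2r; [rewrite mulr_ge0 ?holder_norm_ge0|rewrite lerDl].
Qed.

(** The remainder is exactly [e^{2f}] times [expm2] of [2 g], quadratic in [g] as long as [2 g] has
    norm at most 2. *)
Lemma exh_diff f e : 0 < e -> \forall g \near (0 : F),
  `|exh (f + g) - exh f - 2 *: mulh (exh f) g| <= e * `|g|.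
Proof.
move=> e0; have [Cm Cm0 Hm] := mulh_bnd.
have [C C0 HC] := expm2_holder ha k (ler0n R 2).
pose B := Cm * (`|exh f| + 1) * (C * 4) + 1.
have B0 : 0 < B by rewrite ltr_wpDl// !mulr_ge0// ?addr_ge0// ltW.
apply/nbhs_normP; exists (Num.min 1 (e / B)); first by rewrite /= lt_min ltr01 divr_gt0.
move=> g; rewrite /= sub0r normrN lt_min => /andP[g1 ge].
have hg : is_holder a k (2 *: (g : S2 -> R)) := is_holderZ 2 (holderP g).
have ng : holder_norm a k (2 *: (g : S2 -> R)) = 2 * `|g|.
  by rewrite holder_normZ ?ger0_norm//; exact: holderP.
have [h2 b2] : is_holder a k (expm2 (2 *: (g : S2 -> R))) /\
    holder_norm a k (expm2 (2 *: (g : S2 -> R))) <= C * (2 * `|g|) ^+ 2.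
  have := HC _ hg; rewrite ng; apply; by rewrite ler_piMr// ltW.
have -> : exh (f + g) - exh f - 2 *: mulh (exh f) g = mulh (exh f) (mkh h2).
  apply: val_inj; apply/funext => p.
  rewrite -[LHS]/(expR (2 * (f p + g p)) - expR (2 * f p) - 2 * (expR (2 * f p) * g p)).
  rewrite -[RHS]/(expR (2 * f p) * (expR (2 * g p) - 1 - 2 * g p)) mulrDr expRD; ring.
rewrite (le_trans (Hm _ _))// (@le_trans _ _ (B * `|g| * `|g|))//; last first.
  by rewrite ler_wpM2r// mulrC -ler_pdivlMr// ltW.
rewrite (@le_trans _ _ (Cm * ((`|exh f| + 1) * (C * (2 * `|g|) ^+ 2))))//.
  by rewrite ler_pM2l// ler_pM// lerDl.
rewrite [leLHS](_ : _ = Cm * (`|exh f| + 1) * (C * 4) * (`|g| * `|g|)); last by ring.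
by rewrite -[leRHS]mulrA ler_wpM2r ?mulr_ge0// lerDl.
Qed.

Hypothesis ellh : exists A : E -> F, [/\ linear A, continuous A, exists n, has_dim (range A) n &
    bijective (fun u => - laph u - 2 *: embh ha u + A u)].

(** Kept transparent: the operations of the pair are later identified with those of the sphere by
    conversion. *)
Definition sphere_elliptic : elliptic E F.
Proof.
refine (@Elliptic R E F (embh ha) laph iph mulh exh oneh cst1h (@embh_lin R a k ha) _ (@embh_cont R a k ha)
  (@embh_compact R a k ha) laph_lin _ _ _ _ _ _ _ _ _ _ _ _ _ _ _ _ _ _ _ exh_diff ellh).
- move=> u u0; apply: val_inj; exact: (congr1 (@holder_fun R a k) u0).
- exact: (bounded_linear_continuous laph_lin laph_bnd).
- exact: iph_lin.
- exact: iphC.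
- move=> f; rewrite -(mean_cst (0 : R)); apply: le_mean => [|p|p].
  + exact: cst_continuous.
  + by apply: hmul_cont; exact: hcont.
  + by rewrite -expr2 sqr_ge0.
- move=> f m0; apply: val_inj; apply/funext => p.
  have := @mean_eq0 R (fun p => f p * f p) _ _ m0 p => /(_ _ _)/eqP.
  rewrite mulf_eq0 orbb => H; apply/eqP/H; first by apply: hmul_cont; exact: hcont.
  by move=> q; rewrite -expr2 sqr_ge0.
- by exists 1 => //; exact: iph_bnd.
- exact: green_sym.
- exact: green_le0.
- move=> f c g g'; apply: val_inj; apply/funext => p.
  rewrite -[LHS]/(f p * (c * g p + g' p)) -[RHS]/(c * (f p * g p) + f p * g' p); ring.
- by move=> f g; apply: val_inj; apply/funext => p; exact: mulrC.
- by move=> f g h; apply: val_inj; apply/funext => p; exact: mulrA.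
- by move=> f; apply: val_inj; apply/funext => p; exact: mul1r.
- exact: mulh_bnd.
- move=> f g h; congr mean; apply/funext => p.
  by rewrite -[LHS]/(f p * g p * h p) -[RHS]/(g p * (f p * h p)); ring.
- by exists 1 => //; exact: iph_mul_bnd.
- exact: val_inj.
- apply: val_inj; apply/funext => p.
  rewrite -[LHS]/(\sum_i tder i (tder i (fun=> 1)) p) big1// => i _.
  by rewrite cst_tder (_ : 0 = fun=> 0)// cst_tder.
- rewrite /iph (_ : (fun p => _) = fun=> 1) ?mean_cst//.
  by apply/funext => p; rewrite -[LHS]/(1 * 1 : R) mulr1.
- move=> f; apply: val_inj; apply/funext => p.
  rewrite -[LHS]/(expR (2 * - f p) * expR (2 * f p)) -expRD mulrN addNr expR0//.
Defined.

End Instance.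

Section Curvature.
Variables (R : realType) (a : R) (k : nat).
Hypothesis ha : 0 < a < 1.
Local Notation E := (holder a k.+4).
Local Notation F := (holder a k.+2).

(** Products and exponentials stay in the Hölder space, so [insubd] returns the formula and not its
    default. *)
Lemma curvatureE (u : E) : curvature u =
  mulh ha (exh ha (- embh ha u)) (oneh a k.+2 - laph u).
Proof.
apply: val_inj; rewrite /curvature val_insubd.
have -> : (fun p => expR (- (2 * u p)) * (1 - laplacian u p)) =
    mulh ha (exh ha (- embh ha u)) (oneh a k.+2 - laph u).
  apply/funext => p; rewrite -[RHS]/(expR (2 * - u p) * (1 - laplacian u p)).
  by rewrite mulrN.
by rewrite ifT//; apply/asboolP; exact: holderP.
Qed.

Lemma curvature_diff (u : E) : 'd (@curvature R k.+4 a) u = (fun h =>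
  - mulh ha (exh ha (- embh ha u)) (laph h) -
  2 *: mulh ha (mulh ha (exh ha (- embh ha u)) (embh ha h)) (oneh a k.+2 - laph u)) :> (E -> F).
Proof.
have -> : @curvature R k.+4 a = fun u => mulh ha (exh ha (- embh ha u)) (oneh a k.+2 - laph u).
  by apply/funext => w; exact: curvatureE.
apply: curv_diff.
- exact: embh_lin.
- exact: embh_cont.
- exact: laph_lin.
- exact: (bounded_linear_continuous (@laph_lin R a k.+2) (@laph_bnd R a k.+2)).
- move=> f c g g'; apply: val_inj; apply/funext => p.
  rewrite -[LHS]/(f p * (c * g p + g' p)) -[RHS]/(c * (f p * g p) + f p * g' p); ring.
- by move=> f g; apply: val_inj; apply/funext => p; exact: mulrC.
- exact: mulh_bnd.
- exact: exh_diff.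
Qed.

(* The orientation at [u = 0] provides a finite rank perturbation of the
   linearization that is invertible: this is all the elliptic regularity needed. *)
Lemma orientation_ell (o : E -> set (E -> F)) : orientation (@curvature R k.+4 a) o ->
  exists A : E -> F, [/\ linear A, continuous A, exists n, has_dim (range A) n &
    bijective (fun u => - laph u - 2 *: embh ha u + A u)].
Proof.
move=> [/(_ 0)[A [lA cA dA bA] _] _]; exists A; split=> //.
rewrite (_ : (fun u => _) = (fun x => 'd (@curvature R k.+4 a) 0 x + A x))//.
apply/funext => u; congr (_ + _); rewrite curvature_diff.
have e0 : embh ha (0 : E) = 0 := linear_fun0 (@embh_lin R a k.+2 ha).
have l0 : laph (0 : E) = 0 := linear_fun0 (@laph_lin R a k.+2).
apply: val_inj; apply/funext => p; rewrite e0 l0 oppr0 addr0.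
rewrite -[LHS]/(- laplacian u p - 2 * u p).
rewrite -[RHS]/(- (expR (2 * 0) * laplacian u p) - 2 * (expR (2 * 0) * u p * 1)).
by rewrite mulr0 expR0 !mul1r mulr1.
Qed.

Variable ellh : exists A : E -> F, [/\ linear A, continuous A, exists n, has_dim (range A) n &
    bijective (fun u => - laph u - 2 *: embh ha u + A u)].
Let X := sphere_elliptic ellh.

Lemma curvature_dpi (u : E) : 'd (@curvature R k.+4 a) u = dpi X u :> (E -> F).
Proof.
rewrite curvature_diff; apply/funext => h.
transitivity (mulh ha (exh ha (- embh ha u))
    (- laph h + (-2) *: mulh ha (oneh a k.+2 - laph u) (embh ha h))); last by [].
apply: val_inj; apply/funext => p.
rewrite -[LHS]/(- (expR (2 * - u p) * laplacian h p) - 2 * (expR (2 * - u p) * h p * (1 - laplacian u p))).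
rewrite -[RHS]/(expR (2 * - u p) * (- laplacian h p + (-2) * ((1 - laplacian u p) * h p))).
move: (expR _) (laplacian h p) (laplacian u p) (h p) => x y z t; ring.
Qed.

Lemma J_Jfun (K : F) (u : E) : J K u = Jfun X K u.
Proof.
have cu i : continuous (tder i u) := is_holder_continuous (tder_hold u i).
have cu0 := @hcont _ _ _ u.
have cuu i : continuous (fun p => tder i u p * tder i u p) by exact: hmul_cont.
have c1u : continuous (fun p => 1 * u p) by apply: hmul_cont => //; exact: cst_continuous.
have c2u : continuous (fun p => 2 * (1 * u p)) by apply: hmul_cont => //; exact: cst_continuous.
have cs : continuous (fun p => \sum_i tder i u p * tder i u p).
  rewrite (sum3fun (fun i p => tder i u p * tder i u p)) => p.
  apply: (@continuousD _ _ _ (fun p => tder ord0 u p * tder ord0 u p)); first exact: cuu.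
  by apply: (@continuousD _ _ _ (fun p => tder (lift ord0 ord0) u p * tder (lift ord0 ord0) u p));
    exact: cuu.
transitivity (- iph (laph u) (embh ha u) + 2 * iph (oneh a k.+2) (embh ha u) -
  ln (iph K (exh ha (embh ha u)))); last by [].
rewrite green opprK /J; congr (_ - _).
rewrite -(mean_sum3 cuu) -[iph (oneh a k.+2) (embh ha u)]/(mean (fun p => 1 * u p)) -(meanZ 2 c1u).
rewrite -(meanD cs c2u).
congr mean; apply/funext => p; rewrite mul1r; congr (_ + _).
rewrite /grad_norm sqr_sqrtr; first by apply: eq_bigr => i _; rewrite expr2.
by apply: sumr_ge0 => i _; exact: sqr_ge0.
Qed.

(** On the fibre of [K] the Hessian of [J] is twice the form of [opr (hpot u)], so [neg_eigenspace]
    is the abstract [neg_space]; dimensions being unique, [xget] returns [n]. *)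
Lemma morse_indexE (K : F) (u : E) n : curvature u = K -> has_dim (neg_space X u) n ->
  morse_index K u = n.
Proof.
move=> uK dn.
have JE : @J R K k.+4 a = Jfun X K by apply/funext => w; exact: J_Jfun.
have hE (h l : E) : hessian K u h l = 2 * ip X (opr X (hpot X u) h) (emb X l).
  by rewrite /hessian JE; apply: J_hessian; rewrite -uK curvatureE.
have nE : neg_eigenspace K u = neg_space X u.
  have mE (h l : E) : mean (fun p => h p * l p) = ip X (emb X h) (emb X l) by [].
  apply/seteqP; split=> v [m [h [H vE]]]; exists m, h; (split; last exact: vE) => i;
    have [l l0 Hl] := H i; exists l; [exact: l0| |exact: l0|] => w.
    by rewrite -(hE (h i) w) (Hl w) mE.
  by rewrite (hE (h i) w) (Hl w) -mE.
have := xgetPex 0%N (ex_intro (fun n => has_dim (neg_eigenspace K u) n) n _).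
rewrite /morse_index nE => /(_ dn) H; exact: has_dim_uniq H dn.
Qed.

End Curvature.

Theorem theorem1p3 (R : realType) (m : nat) (a : R)
    (hm : (4 <= m)%N) (ha : 0 < a < 1)
    (o : holder a m -> set (holder a m -> holder a (m - 2)))
    (ho : orientation (@curvature R m a) o) :
  exists s : int, (s = 1 \/ s = -1) /\
    forall (Ki : set (holder a (m - 2))) (Ui : set (holder a m)),
      is_path_component (@calK R (m - 2) a) Ki ->
      Ui = @curvature R m a @^-1` Ki ->
      proper_map Ui Ki (@curvature R m a) ->
      fredholm0_map Ui (@curvature R m a) ->
      forall K : holder a (m - 2),
        regular_value Ui Ki (@curvature R m a) K ->
        degree o Ui Ki (@curvature R m a) =
        s * \sum_(u \in Ui `&` @curvature R m a @^-1` [set K])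
              ((-1) ^+ morse_index K u : int).
Proof.
(* With [m] in the form [k.+4], the order [m - 2] computes to [k.+2]. *)
move: m hm o ho => [|[|[|[|k]]]]// _ o ho.
have ell := orientation_ell ha ho.
have cE (u : holder a k.+4) : curvature u = curv (sphere_elliptic ell) u by exact: curvatureE.
have [s [s1 H]] := degree_formula cE (curvature_dpi ell) ho (morse_indexE (ellh := ell)).
exists s; split=> // Ki Ui hKi hUi hp _ K hK; exact: (H _ Ki Ui hKi hUi hp K hK).
Qed.
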